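(* Let $G$ be a triangulation of the projective plane $\mathbb{P}$. Then $G$ does not have a bipartite subgraph $H$ with $|E(H)|=\frac{2}{3}|E(G)|$ if and only if $G$ is constructed as follows. Let $T=K_6$ embedded on $\mathbb{P}$, and let $f_1,\ldots,f_{10}$ be its faces. For each $i\in\{1,\ldots,10\}$, let $T_i$ be either empty or a plane quasi-Eulerian triangulation with respect to one of its faces $f_i'$. Then $G$ is obtained from $T$ and the $T_i$ by pasting $f_i$ and $f_i'$ for every $i$ with $T_i\neq\emptyset$.
   Context: A triangulation of a surface is a graph without loops or multiple edges, 2-cell embedded on the surface such that every face is bounded by a closed walk of length 3 (the paper uses ''multitriangulation'' when multiple edges are allowed). $K_6$ has a unique embedding on $\mathbb{P}$, which is a triangulation with 10 faces. Pasting: if $T_1,T_2$ are triangulations with faces $f\in F(T_1)$ and $f'\in F(T_2)$, where $T_2$ is a plane triangulation, the triangulation constructed from $T_1$ and $T_2$ by pasting $f$ and $f'$ is obtained by placing $T_2$ (with $f'$ as outer face) inside the face $f$ and identifying the boundary 3-cycle of $f'$ with that of $f$ (via some bijection of their vertices). A 3-cycle of a triangulation is separating if both regions it bounds contain at least one vertex. Quasi-Eulerian triangulations. Let $E$ be a simple plane Eulerian triangulation (all degrees even) with no separating 3-cycle and let $f_0$ be a face of $E$; properly 2-color the faces of $E$ red and blue with $f_0$ red. The class $\mathcal{T}_1$ (w.r.t. $f_0$) consists of all triangulations obtained from such an $E$ by pasting, into each red face $r\neq f_0$ of $E$, an arbitrary plane triangulation (or nothing) along one of its faces. For $i\ge2$,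 $\mathcal{T}_i$ (w.r.t. $f_0$) consists of all triangulations obtained from such an $E$ by pasting into each red face $r\neq f_0$ an arbitrary plane triangulation (or nothing), and into each blue face $b$ a triangulation in $\mathcal{T}_{i-1}$ with respect to the face $b'$ along which it is pasted (or nothing). A simple plane triangulation $T$ with a face $f$ is quasi-Eulerian with respect to $f$ if it belongs to $\bigcup_{i\ge1}\mathcal{T}_i$ with respect to $f$. *)

(* Defs.v *)
From mathcomp Require Import all_boot all_order.
From mathcomp Require Import finmap.
Set Implicit Arguments. Unset Strict Implicit. Unset Printing Implicit Defensive.
Local Open Scope fset_scope.

(* A triangulation is represented combinatorially by its set of facial
   triangles; vertices are labelled by natural numbers.  Since the graph is
   simple, every face is a 3-set of vertices and (apart from the degenerate
   plane triangulation K3) distinct faces have distinct vertex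
   sets. *)
Definition tri := {fset {fset nat}}.

Definition verts (T : tri) : {fset nat} := \bigcup_(f <- T) f.

Definition edges (T : tri) : {fset {fset nat}} :=
  [fset e in fpowerset (verts T) | (#|` e| == 2) && has (fun f => e `<=` f) T].

Definition adj (T : tri) (x y : nat) : Prop := [fset x; y] \in edges T /\ x != y.

Definition degree (T : tri) (v : nat) : nat := #|` [fset e in edges T | v \in e] |.

(* closed combinatorial surface: faces are triangles, every edge lies in
   exactly two faces, the link of every vertex is connected (hence a single
   cycle), and the whole complex is connected *)
Definition closed_surface (T : tri) : Prop :=
  [/\ T != fset0,
      (forall f, f \in T -> #|` f| = 3),
      (forall e, e \in edges T -> #|` [fset f in T | e `<=` f] | = 2),
      (forall v, v \in verts T -> forall S : {fset nat},
          S != fset0 ->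
          (forall a, a \in S -> a != v /\ exists2 f, f \in T & (v \in f) && (a \in f)) ->
          (exists b, [/\ b != v, b \notin S & (exists2 f, f \in T & (v \in f) && (b \in f))]) ->
          exists2 f, f \in T & exists a b, [/\ [fset v; a; b] `<=` f, a \in S,
                                              b \notin S & b != v])
    & (forall S : {fset nat}, S != fset0 -> S `<=` verts T -> S != verts T ->
          exists2 f, f \in T & exists a b, [/\ a \in f, b \in f, a \in S & b \notin S])].

(* Euler characteristic V - E + F = 1: the projective plane *)
Definition proj_tri (T : tri) : Prop :=
  closed_surface T /\ (#|` verts T| + #|` T| = #|` edges T| + 1)%N.

(* Euler characteristic 2: the sphere, i.e. a plane triangulation *)
Definition plane_tri (T : tri) : Prop :=
  closed_surface T /\ (#|` verts T| + #|` T| = #|` edges T| + 2)%N.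

Definition eulerian (T : tri) : Prop := forall v, v \in verts T -> ~~ odd (degree T v).

(* Two faces lie in different regions of the cycle with edge set C if some
   set of faces containing f but not g is closed under crossing edges not in C *)
Definition sep_regions (T : tri) (C : {fset {fset nat}}) (f g : {fset nat}) : Prop :=
  exists S : {fset {fset nat}},
    [/\ f \in S, g \notin S &
        forall h h', h \in S -> h' \in T -> forall e, e \in edges T ->
          e `<=` h -> e `<=` h' -> e \notin C -> h' \in S].

Definition separating3 (T : tri) (a b c : nat) : Prop :=
  [/\ adj T a b, adj T b c, adj T c a &
    exists f g, [/\ f \in T, g \in T,
      (exists2 x, x \in f & x \notin [fset a; b; c]),
      (exists2 x, x \in g & x \notin [fset a; b; c]) &
      sep_regions T [fset [fset a; b]; [fset b; c]; [fset c; a]] f g]].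

Definition proper_face_colouring (T : tri) (red : {fset {fset nat}}) (f0 : {fset nat}) : Prop :=
  [/\ red `<=` T, f0 \in red &
      forall f g, f \in T -> g \in T -> f != g -> #|` (f `&` g)| = 2 ->
        (f \in red) != (g \in red)].

(* Pieces to paste: to a face g of E, either nothing (None) or a plane
   triangulation P together with one of its faces g'. *)
Definition pieces := {fset nat} -> option (tri * {fset nat}).

(* G is (isomorphic to) the triangulation obtained from E by pasting, for
   every face g of E with p g = Some (P, g'), the triangulation P along g'
   into g.  iE : labels of E -> labels of G. *)
Definition paste_into (E : tri) (p : pieces) (G : tri) (iE : nat -> nat) : Prop :=
  {in verts E &, injective iE} /\
  exists i : {fset nat} -> nat -> nat,
  [/\ (forall g, g \in E -> forall P g', p g = Some (P, g') ->
         {in verts P &, injective (i g)} /\ (i g) @` g' = iE @` g),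
      (forall g, g \in E -> forall P g', p g = Some (P, g') ->
         forall x v, x \in verts P -> v \in verts E -> i g x = iE v -> x \in g'),
      (forall g1 g2, g1 \in E -> g2 \in E -> g1 != g2 ->
         forall P1 g1' P2 g2', p g1 = Some (P1, g1') -> p g2 = Some (P2, g2') ->
         forall x y, x \in verts P1 -> y \in verts P2 -> i g1 x = i g2 y -> x \in g1') &
      (forall h, h \in G <->
         (exists2 g, g \in E & p g = None /\ h = iE @` g) \/
         (exists g P g' h0, [/\ g \in E, p g = Some (P, g'), h0 \in P, h0 != g' &
                                h = (i g) @` h0]))].

(* The class T_i (i = n.+1) of the paper, w.r.t. the face f of T. *)
Fixpoint qe_class (n : nat) (T : tri) (f : {fset nat}) : Prop :=
  match n with
  | 0 => False
  | k.+1 =>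
    exists (E : tri) (f0 : {fset nat}) (red : {fset {fset nat}}) (p : pieces) (iE : nat -> nat),
      [/\ plane_tri E /\ eulerian E,
          (forall a b c, ~ separating3 E a b c),
          f0 \in E /\ proper_face_colouring E red f0,
          (forall g, g \in E -> forall P g', p g = Some (P, g') ->
             (if g \in red then [/\ g != f0, plane_tri P & g' \in P]
              else qe_class k P g'))
          & [/\ paste_into E p T iE, plane_tri T & f = iE @` f0]]
  end.

Definition quasi_eulerian (T : tri) (f : {fset nat}) : Prop :=
  [/\ plane_tri T, f \in T & exists n, qe_class n T f].

Definition bipartite_subgraph (G : tri) (H : {fset {fset nat}}) : Prop :=
  H `<=` edges G /\
  exists A : {fset nat}, forall e, e \in H -> #|` (e `&` A)| = 1.

(* Main.v *)
Require Import Defs.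
From mathcomp Require Import all_boot all_order all_algebra finmap zify.
Set Implicit Arguments. Unset Strict Implicit. Unset Printing Implicit Defensive.

(** A face has at most two edges in a cut, so a bipartite subgraph with two thirds of the edges is the same as a vertex
    2-colouring without monochromatic face. Dually, the edges outside the cut form a perfect matching of the cubic dual
    graph that meets every cycle of the triangulation in as many edges, mod 2, as the cycle has.

    Let [G] be a triangulation of the projective plane without such a colouring. Cut the faces of [G] into as few discs
    bounded by 3-cycles as possible and regard each disc as one face: by the plane theory (Plesnik's theorem on matchings
    of bridgeless cubic graphs) a colouring of the quotient [Q] extends to [G], so [Q] has none either. If all 3-cycles of
    [Q] are facial, contracting suitable stars around one vertex or two adjacent odd vertices gives a smaller triangulation
    without colouring, which by induction has a noncontractible 3-cycle avoiding the centres, a contradiction. A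
    noncontractible 3-cycle consists of three edges that no perfect matching of the dual graph meets oddly; analysing the
    Tutte barriers that prevent matchings through exactly one of the three edges shows that the dual graph has ten
    vertices, so [Q] is the complete graph on six vertices. A 2-colouring of it splitting the vertices 3-3 has exactly one
    monochromatic face, which can be any given one; hence in the piece inside a face no colouring has exactly the
    outer face monochromatic. The minimal quotient of such a piece has a dual graph that is bipartite, again by Tutte's
    theorem, i.e. is Eulerian, and inside its blue faces the same holds by Hall's theorem and induction.

    Conversely, in a plane Eulerian triangulation there are as many monochromatic red faces as blue ones, so a colouring of
    a quasi-Eulerian piece in which the outer face is monochromatic has another monochromatic face; and ten, the number of
    faces of the complete graph on six vertices, is not the size of a cut of it. *)

(** * Tutte's and Hall's theorems *)

(** The surfaces are told apart by Euler characteristics alone: connectedness bounds the ranks of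
    the two incidence matrices over the field with two elements, and these bounds leave no
    nontrivial class of cocycles on the sphere and at most one on the projective plane. Without a
    colouring, the complement of every perfect matching of the dual graph therefore lies in the one
    nontrivial class and is odd on every noncontractible cycle. The induction on contractions meets
    an obstacle: a 3-cycle through a contracted vertex need not come from a 3-cycle. The claim is
    strengthened to a noncontractible 3-cycle avoiding any two prescribed vertices; two, because
    alternate edges at a vertex of odd degree do not close up, and a neighbouring star has to serve
    the gap. With ten faces the claim holds since four of the six vertices remain, whose 3-cycles
    cannot all be faces. The number ten arises as 3 * 2 + 4: the exceptional sets belonging to the
    three edges of the cycle have three exclusive cells, which shrink to two faces each, and four
    overlaps, which are single faces. *)

Section Tutte.
Variable T : finType.
Implicit Types (W S K A B X U : {set T}) (P : {set {set T}}) (r : rel T).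

(** A perfect matching is an involution along [r]. It ranges over finite functions, which makes the
    property boolean and open to case analysis. *)
Definition perfect W r :=
  [exists m : {ffun T -> T},
    [forall x in W, [&& m x \in W, m (m x) == x & r x (m x)]]].

Lemma perfectP W r :
  reflect (exists m : T -> T, forall x, x \in W -> [/\ m x \in W, m (m x) = x & r x (m x)])
          (perfect W r).
Proof.
apply: (iffP existsP) => [[m /forall_inP h]|[m h]].
  by exists m => x /h /and3P[? /eqP ? ?].
exists [ffun x => m x]; apply/forall_inP => x /h [h1 h2 h3].
by rewrite !ffunE h1 h2 eqxx h3.
Qed.

(** The members of [P] are odd unions of components of [W :\: S] rather than components, which
    leaves the freedom to enlarge a member by a leftover part. *)
Definition closed_odd W r S P :=
  forall K, K \in P -> [/\ K \subset W :\: S, odd #|K| &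
    forall x y, x \in K -> y \in W :\: S -> r x y -> y \in K].

Definition barrier W r S P :=
  [/\ S \subset W, closed_odd W r S P, trivIset P & #|S| < #|P|].

Lemma perfectU A B r : [disjoint A & B] -> perfect A r -> perfect B r -> perfect (A :|: B) r.
Proof.
move=> dAB /perfectP[m1 h1] /perfectP[m2 h2]; apply/perfectP.
exists (fun x => if x \in A then m1 x else m2 x) => x; rewrite inE.
case: ifPn => xA /=.
  by case: (h1 _ xA) => h3 h4 h5 _; rewrite h3 inE h3; split.
move=> /h2 [h3 h4 h5].
have /negbTE-> : m2 x \notin A by apply: contraTN h3 => h3; rewrite (disjointFr dAB h3).
by rewrite inE h3 orbT.
Qed.

Lemma perfect0 r : perfect set0 r.
Proof. by apply/perfectP; exists id => x; rewrite inE. Qed.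

Lemma perfect2 r x y : symmetric r -> x != y -> r x y -> perfect [set x; y] r.
Proof.
move=> rs nxy rxy; apply/perfectP; exists (fun z => if z == x then y else x) => z.
have nyx : (y == x) = false by rewrite eq_sym (negbTE nxy).
by rewrite !inE => /orP[] /eqP->; rewrite ?eqxx ?nyx ?eqxx ?orbT //=; split=> //; rewrite rs.
Qed.

Lemma perfect_clique r A : symmetric r ->
  (forall x y, x \in A -> y \in A -> x != y -> r x y) -> ~~ odd #|A| -> perfect A r.
Proof.
move=> rs; have [n] := ubnP #|A|; elim: n A => // n IH A leA clA evA.
have [->|[x xA]] := set_0Vmem A; first exact: perfect0.
have [A1|[y]] := set_0Vmem (A :\ x).
  by move: evA; rewrite (cardsD1 x) xA A1 cards0.
rewrite !inE => /andP[nyx yA].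
have cA : #|A| = #|A :\ x :\ y|.+2.
  by rewrite (cardsD1 x) xA (cardsD1 y (A :\ x)) !inE nyx yA.
have -> : A = [set x; y] :|: (A :\ x :\ y).
  apply/setP=> z; rewrite !inE; case: (eqVneq z x) => [->|_]; first by rewrite xA.
  by case: (eqVneq z y) => [->|_]; rewrite ?yA.
apply: perfectU.
- rewrite -setI_eq0; apply/eqP/setP=> z; rewrite !inE.
  by case: (z == x); case: (z == y).
- by apply: perfect2 => //; [rewrite eq_sym|apply: clA => //; rewrite eq_sym].
- apply: IH; first by rewrite cA in leA; lia.
  + by move=> u v; rewrite !inE => /and3P[_ _ uA] /and3P[_ _ vA]; apply: clA.
  + by rewrite cA /= negbK in evA.
Qed.

(** Every vertex of [X] is paired with one of [S], which is possible because [S] is joined to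
    everything; what remains of [S] is a clique of even order. *)
Lemma perfect_join r X S : symmetric r -> [disjoint X & S] ->
  (forall s y, s \in S -> y \in X :|: S -> s != y -> r s y) ->
  #|X| <= #|S| -> ~~ odd (#|X| + #|S|) -> perfect (X :|: S) r.
Proof.
move=> rs; have [n] := ubnP #|X|; elim: n X S => // n IH X S leX dXS uS leXS ev.
have [X0|[x xX]] := set_0Vmem X.
  rewrite X0 set0U; apply: perfect_clique => //.
    by move=> u v uS' vS; apply: uS => //; rewrite inE vS orbT.
  by move: ev; rewrite X0 cards0.
have [S0|[s sS]] := set_0Vmem S.
  by move: leXS; rewrite S0 cards0 leqn0 cards_eq0 => /eqP X0; rewrite X0 inE in xX.
have nxs : s != x by apply: contraTneq sS => ->; rewrite (disjointFr dXS xX).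
have cX : #|X| = #|X :\ x|.+1 by rewrite (cardsD1 x) xX.
have cS : #|S| = #|S :\ s|.+1 by rewrite (cardsD1 s) sS.
have -> : X :|: S = [set x; s] :|: ((X :\ x) :|: (S :\ s)).
  apply/setP=> z; rewrite !inE; case: eqVneq => [->|zx] //=; first by rewrite xX.
  by case: eqVneq => [->|] //=; rewrite sS orbT.
apply: perfectU.
- rewrite -setI_eq0; apply/eqP/setP=> z; rewrite !inE.
  case: eqVneq => [->|zx] //=; first by rewrite (disjointFr dXS xX) andbF.
  by case: eqVneq => [->|] //=; rewrite (disjointFl dXS sS).
- by apply: perfect2; rewrite 1?eq_sym // rs; apply: uS; rewrite ?inE ?xX.
- apply: IH.
  + by rewrite cX ltnS in leX.
  + apply: disjointWl (subsetDl _ _) _; apply: disjointWr (subsetDl _ _) _; exact: dXS.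
  + move=> u v; rewrite !inE => /andP[_ uS'] hv; apply: uS => //.
    by rewrite inE; case/orP: hv => /andP[_ ->]; rewrite ?orbT.
  + by rewrite cX cS in leXS.
  + by rewrite cX cS addSn addnS /= negbK in ev.
Qed.

(** Transitivity makes [U] a disjoint union of cliques: [P] consists of the odd ones, [X] has one
    vertex in each of them, and off [X] all cliques are even. *)
Lemma clique_decomp r U : symmetric r ->
  (forall x y z, x \in U -> y \in U -> z \in U -> r x y -> r y z -> x != z -> r x z) ->
  exists X P, [/\ X \subset U, perfect (U :\: X) r, closed_odd U r set0 P, trivIset P
               & #|P| = #|X|].
Proof.
move=> rs; have [n] := ubnP #|U|; elim: n U => // n IH U leU tr.
have [->|[x xU]] := set_0Vmem U.
  exists set0, set0; rewrite setD0 perfect0 !cards0; split=> //; first by move=> K; rewrite inE.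
  by apply/trivIsetP => A B; rewrite inE.
pose c := [set y in U | (y == x) || r x y].
have cE y : (y \in c) = (y \in U) && ((y == x) || r x y) by rewrite inE.
clearbody c.
have xc : x \in c by rewrite cE xU eqxx.
have clc u v : u \in c -> v \in c -> u != v -> r u v.
  rewrite !cE => /andP[uU /predU1P[->|xu]] /andP[vU /predU1P[->|xv]] nuv //.
  - by rewrite eqxx in nuv.
  - by rewrite rs.
  - by apply: (tr u x v) => //; rewrite rs.
have cc u v : u \in c -> v \in U -> r u v -> v \in c.
  rewrite !cE => /andP[uU /predU1P[->|xu]] vU ruv; rewrite vU /= ?ruv ?orbT //.
  by case: eqVneq => //= nvx; apply: (tr x u v) => //; rewrite eq_sym.
have cU : c \subset U by apply/subsetP=> y; rewrite cE => /andP[].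
have [||X [P [XU pX cP tP eP]]] := IH (U :\: c).
- rewrite cardsD (setIidPr cU); move: leU; rewrite ltnS; apply: leq_trans.
  have c0 : 0 < #|c| by rewrite card_gt0; apply/set0Pn; exists x.
  by rewrite ltn_subrL c0 (leq_trans c0) // subset_leq_card.
- by move=> u v w; rewrite !inE => /andP[_ ?] /andP[_ ?] /andP[_ ?]; apply: tr.
have XUc := subset_trans XU (subsetDl U c).
have dXc : [disjoint X & c].
  by rewrite -setI_eq0; apply/eqP/setP=> z; rewrite !inE; case: (boolP (z \in X)) => // /(subsetP XU);
     rewrite inE => /andP[/negbTE->].
have cP' : closed_odd U r set0 P.
  move=> K /cP [KU oK clK]; split => //.
    by apply: subset_trans KU _; rewrite !setD0 subsetDl.
  move=> u v uK; rewrite setD0 => vU ruv; apply: (clK u) => //; rewrite setD0 inE vU andbT.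
  have := subsetP KU _ uK; rewrite setD0 inE => /andP[uc uU].
  by apply: contra uc => vc; apply: (cc v) => //; rewrite rs.
case: (boolP (odd #|c|)) => oc.
- exists (x |: X), (c |: P).
  have cnP : c \notin P.
    apply/negP => /cP [cU' _ _]; have := subsetP cU' _ xc; by rewrite !inE xc.
  have xnX : x \notin X by rewrite (disjointFl dXc xc).
  split.
  + by rewrite subUset sub1set xU.
  + have -> : U :\: (x |: X) = (c :\ x) :|: (U :\: c :\: X).
      apply/setP=> z; rewrite !inE; case zc: (z \in c) => /=.
        by rewrite (subsetP cU _ zc) (disjointFl dXc zc) !andbT !andbF !orbF.
      rewrite andbF /= negb_or; case: eqVneq zc => [->|] /=; first by rewrite xc.
      by [].
    apply: perfectU => //.
      rewrite -setI_eq0; apply/eqP/setP=> z; rewrite !inE.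
      by case: (z \in c); rewrite ?andbF.
    apply: perfect_clique => //; last by move: oc; rewrite (cardsD1 x) xc /=.
    by move=> u v; rewrite !inE => /andP[_ uc] /andP[_ vc]; apply: clc.
  + move=> K; rewrite !inE => /predU1P[->|/cP'//]; split; rewrite ?setD0 //.
  + apply/trivIsetP => A B; rewrite !inE.
    have H D : D \in P -> [disjoint c & D].
      case/cP => DU _ _; rewrite -setI_eq0; apply/eqP/setP=> z; rewrite inE in_set0.
      case zD: (z \in D); rewrite ?andbF //.
      have := subsetP DU _ zD; by rewrite setD0 inE => /andP[/negbTE->].
    move=> /predU1P[->|AP] /predU1P[->|BP]; first by rewrite eqxx.
    * by move=> _; apply: H.
    * by move=> _; rewrite disjoint_sym; apply: H.
    * by apply: (trivIsetP tP).
  + by rewrite !cardsU1 cnP xnX eP.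
- exists X, P; split => //.
  have -> : U :\: X = c :|: (U :\: c :\: X).
    apply/setP=> z; rewrite !inE; case zc: (z \in c) => //=.
    by rewrite (subsetP cU _ zc) (disjointFl dXc zc).
  apply: perfectU => //.
    rewrite -setI_eq0; apply/eqP/setP=> z; rewrite !inE.
    by case: (z \in c); rewrite ?andbF.
  exact: perfect_clique.
Qed.

Definition add_edge r x y := [rel u v | [|| r u v, (u == x) && (v == y) | (u == y) && (v == x)]].

Lemma add_edge_sym r x y : symmetric r -> symmetric (add_edge r x y).
Proof. by move=> rs u v /=; rewrite rs; congr orb; rewrite orbC ![(v == _) && _]andbC. Qed.

(* The symmetric difference of the two matchings is followed from [y]; either its component avoids [x] and [z], or
   the part up to the first of [x], [z] is switched and closed up by an edge from [y]. *)
Lemma perfect_exchange r W x y z w : symmetric r -> irreflexive r ->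
  x \in W -> y \in W -> z \in W -> w \in W ->
  r x y -> r y z -> x != z -> y != w ->
  perfect W (add_edge r x z) -> perfect W (add_edge r y w) -> perfect W r.
Proof.
move=> rs ri xW yW zW wW rxy ryz nxz nyw /perfectP[m1' h1'] /perfectP[m2' h2'].
pose m1 u := if u \in W then m1' u else u.
pose m2 u := if u \in W then m2' u else u.
have m1W u : (m1 u \in W) = (u \in W).
  by rewrite /m1; case: ifPn => uW; [case: (h1' _ uW) => ->|apply: negbTE].
have m2W u : (m2 u \in W) = (u \in W).
  by rewrite /m2; case: ifPn => uW; [case: (h2' _ uW) => ->|apply: negbTE].
have m1K : involutive m1.
  move=> u; case uW: (u \in W); last by rewrite /m1 uW uW.
  by case: (h1' _ uW) => h e _; rewrite /m1 uW h.
have m2K : involutive m2.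
  move=> u; case uW: (u \in W); last by rewrite /m2 uW uW.
  by case: (h2' _ uW) => h e _; rewrite /m2 uW h.
have m1r u : u \in W -> add_edge r x z u (m1 u) by move=> uW; rewrite /m1 uW; case: (h1' _ uW).
have m2r u : u \in W -> add_edge r y w u (m2 u) by move=> uW; rewrite /m2 uW; case: (h2' _ uW).
have nyx : y != x by apply: contraTneq rxy => ->; rewrite ri.
have nyz : y != z by apply: contraTneq ryz => ->; rewrite ri.
have m1n u : u \in W -> m1 u != u.
  move=> /m1r /=; apply: contraTneq => ->; rewrite ri /=.
  by rewrite negb_or; case: (eqVneq u x) => [->|]; case: (eqVneq _ z) => // e; rewrite ?e ?eqxx // in nxz *.
have m2n u : u \in W -> m2 u != u.
  move=> /m2r /=; apply: contraTneq => ->; rewrite ri /=.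
  by rewrite negb_or; case: (eqVneq u y) => [->|]; case: (eqVneq _ w) => // e; rewrite ?e ?eqxx // in nyw *.
case: (eqVneq (m1 x) z) => [m1x|m1x]; last first.
  apply/perfectP; exists m1 => u uW; split; rewrite ?m1W //.
  have /or3P[//|/andP[/eqP e /eqP e']|/andP[/eqP e /eqP e']] := m1r _ uW.
    by rewrite -e e' eqxx in m1x.
  by move: m1x; rewrite -e' -[m1 (m1 u)]/(m1 (m1 u)) m1K e eqxx.
case: (eqVneq (m2 y) w) => [m2y|m2y]; last first.
  apply/perfectP; exists m2 => u uW; split; rewrite ?m2W //.
  have /or3P[//|/andP[/eqP e /eqP e']|/andP[/eqP e /eqP e']] := m2r _ uW.
    by rewrite -e e' eqxx in m2y.
  by move: m2y; rewrite -e' m2K e eqxx.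
have m1z : m1 z = x by rewrite -m1x m1K.
have m2w : m2 w = y by rewrite -m2y m2K.
have m1r' u : u \in W -> u != x -> u != z -> r u (m1 u).
  by move=> /m1r /= h /negbTE nx /negbTE nz; move: h; rewrite nx nz !orbF.
have m2r' u : u \in W -> u != y -> u != w -> r u (m2 u).
  by move=> /m2r /= h /negbTE ny /negbTE nw; move: h; rewrite ny nw !orbF.
pose s u := m2 (m1 u).
have sI : injective s by move=> u v /(can_inj m2K) /(can_inj m1K).
pose p i := iter i s y.
have pW i : p i \in W by elim: i => //= i IH; rewrite m2W m1W.
have pS i : p i.+1 = m2 (m1 (p i)) by [].
(* The orbit of [y] under [s] never meets its image under [m1]: a coincidence would move inwards
   from both ends until [m1] or [m2] has a fixed point. *)
have pM : forall n a b, b - a <= n -> a <= b -> p a != m1 (p b).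
  elim=> [|n IH] a b.
    rewrite leqn0 subn_eq0 => ba ab; have -> : a = b by apply/eqP; rewrite eqn_leq ab.
    by rewrite eq_sym m1n.
  move=> le_n ab; apply/eqP => e.
  case: b le_n ab e => [|b] le_n ab e.
    by move: ab; rewrite leqn0 => /eqP a0; move: (m1n _ (pW 0)); rewrite -e a0 eqxx.
  have e2 : p a.+1 = m1 (p b).
    by rewrite pS e m1K pS m2K.
  case: (eqVneq a b.+1) => [eab|nab1].
    by move: (m1n _ (pW a)); rewrite {2}e -eab eqxx.
  case: (eqVneq a b) => [eab|nab].
    by move: (m2n (m1 (p b))); rewrite -pS -eab e2 eab eqxx m1W pW => /(_ isT).
  have ab2 : a < b by lia.
  have : p a.+1 != m1 (p b).
    apply: IH => //; move: le_n.
    lia.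
  by rewrite e2 eqxx.
case: (boolP [exists i : 'I_#|T|.+1, (p i == x) || (p i == z)]) => hex.
- have exi : exists i, (p i == x) || (p i == z) by case/existsP: hex => i hi; exists i.
  case: (ex_minnP exi) => i hi mini.
  pose t := p i; pose t' := m1 t.
  have tt' : (t = x /\ t' = z) \/ (t = z /\ t' = x).
    by case/orP: hi => /eqP e; [left|right]; rewrite /t' /t e.
  have rt' : r y t' by case: tt' => -[_ ->] //; rewrite rs.
  have t'xz : (t' == x) || (t' == z) by case: tt' => -[_ ->]; rewrite eqxx ?orbT.
  have i0 : 0 < i.
    by case: i hi {mini t t' tt' rt' t'xz} => //=; rewrite (negbTE nyx) (negbTE nyz).
  (* [B] is the walk from [y] to [t] without [y]. It is a union of [m2]-edges, and the rest without
     [y] and [t'] is a union of [m1]-edges. *)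
  pose B := [set u | [exists j : 'I_i, (u == m1 (p j)) || (u == p j.+1)]].
  have BP u : reflect (exists2 j, j < i & u = m1 (p j) \/ u = p j.+1) (u \in B).
    rewrite inE; apply: (iffP existsP) => [[j /orP[]/eqP->]|[j lji [->|->]]].
    - by exists j => //; left.
    - by exists j => //; right.
    - by exists (Ordinal lji); rewrite eqxx.
    - by exists (Ordinal lji); rewrite eqxx orbT.
  have Bm2 u : u \in B -> m2 u \in B.
    case/BP => j lj [->|->]; apply/BP; exists j => //; first by right.
    by left; rewrite pS m2K.
  have yB : y \notin B.
    apply/BP => -[j lj [e|e]].
      by move: (pM j 0 j); rewrite subn0 leqnn -e /= eqxx => /(_ isT isT).
    have : p i = p (i - j.+1).
      have {1}-> : i = (i - j.+1) + j.+1 by rewrite subnK.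
      by rewrite /p iterD -/(p j.+1) -e.
    move=> e2; have := mini (i - j.+1); rewrite -e2 => /(_ hi).
    by rewrite leqNgt ltn_subrL i0.
  have t'B : t' \notin B.
    apply/BP => -[j lj [e|e]].
      have e2 : p j = t by rewrite -[p j]m1K -e /t' m1K.
      have := mini j; rewrite e2 hi => /(_ isT).
      by rewrite leqNgt lj.
    have hj : i <= j.+1 by apply: mini; rewrite -e.
    have ej : i = j.+1 by apply/eqP; rewrite eqn_leq hj lj.
    by move: (m1n _ (pW i)); rewrite -/t -/t' e -ej -/t eqxx.
  have yt' : y != t' by case: tt' => -[_ ->].
  have tB : t \in B by apply/BP; exists i.-1; rewrite ?prednK //; right.
  have m1yB : m1 y \in B by apply/BP; exists 0; rewrite ?i0 //; left.
  have out u : u \notin B -> u != y -> u != t' -> [/\ m1 u \notin B, m1 u != y & m1 u != t'].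
    move=> uB uy ut'; split.
    - apply/BP => -[j lj [e|e]].
        have eu : u = p j by rewrite -[u]m1K e m1K.
        case: j lj eu {e} => [|j] lj eu; first by rewrite eu eqxx in uy.
        by case/BP: uB; exists j; [apply: ltnW|right].
      have eu : u = m1 (p j.+1) by rewrite -e m1K.
      case: (ltnP j.+1 i) => hj; first by case/BP: uB; exists j.+1 => //; left.
      have ej : i = j.+1 by apply/eqP; rewrite eqn_leq hj lj.
      by move: ut'; rewrite eu -ej eqxx.
    - by apply: contraNneq uB => e; rewrite -[u]m1K e.
    - by apply: contraNneq uB => e; rewrite -[u]m1K e /t' m1K.
  apply/perfectP.
  exists (fun u => if u \in B then m2 u else if u == y then t' else if u == t' then y else m1 u).
  move=> u uW; case: ifPn => uB.
    rewrite m2W uW Bm2 // m2K; split=> //; apply: m2r' => //.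
      by apply: contraNneq yB => <-.
    by apply: contraNneq yB => e; rewrite -m2w -e Bm2.
  case: eqVneq => [->|uy].
    rewrite (negbTE t'B) eqxx [t' == y]eq_sym (negbTE yt') m1W pW; split=> //.
  case: eqVneq => [->|ut'].
    by rewrite (negbTE yB) eqxx yW rs.
  case: (out _ uB uy ut') => h1 h2 h3.
  rewrite (negbTE h1) (negbTE h2) (negbTE h3) m1K m1W uW; split=> //.
  case: tt' => -[e e']; apply: m1r' => //.
  + by rewrite -e; apply: contraNneq uB => ->.
  + by rewrite -e'.
  + by rewrite -e'.
  + by rewrite -e; apply: contraNneq uB => ->.
- pose O := [set u | fconnect s y u].
  have Oxz u : u \in O -> (u != x) && (u != z).
    rewrite inE => /iter_findex e; rewrite -negb_or; apply: contra hex => h.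
    apply/existsP; have lt : findex s y u < #|T|.+1.
      rewrite ltnS /findex; apply: leq_trans (index_size _ _) _.
      by rewrite size_orbit max_card.
    by exists (Ordinal lt); rewrite /= /p e.
  have Os u : u \in O -> s u \in O.
    by rewrite !inE => h; apply: connect_trans h _; apply: fconnect1.
  have Os' u : u \in O -> exists2 v, v \in O & u = s v.
    rewrite inE => h; exists (finv s u); last by rewrite f_finv.
    rewrite inE; apply: connect_trans h _; rewrite fconnect_sym //.
    by rewrite -{2}(f_finv sI u) fconnect1.
  pose A := O :|: [set m1 u | u in O].
  have Am1 u : u \in A -> m1 u \in A.
    rewrite !in_setU => /orP[uO|/imsetP[v vO ->]]; last by rewrite m1K vO.
    by apply/orP; right; apply: imset_f.
  have Am2 u : u \in A -> m2 u \in A.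
    rewrite !in_setU => /orP[/Os'[v vO ->]|/imsetP[v vO ->]].
      by rewrite /s m2K; apply/orP; right; apply: imset_f.
    by rewrite [m2 _ \in O]Os.
  have yA : y \in A by rewrite !inE connect0.
  have wA : w \in A by rewrite -m2y Am2.
  have Axz u : u \in A -> (u != x) && (u != z).
    rewrite in_setU => /orP[/Oxz//|/imsetP[v /Oxz/andP[h1 h2] ->]].
    apply/andP; split; [apply: contraNneq h2|apply: contraNneq h1] => e.
      by rewrite -[v]m1K e m1x.
    by rewrite -[v]m1K e m1z.
  (* On the component [A] of [y] and [w], which avoids [x] and [z], the first matching uses no added
     edge; off [A] the second uses none. *)
  apply/perfectP; exists (fun u => if u \in A then m1 u else m2 u) => u uW.
  case: ifPn => uA.
    rewrite m1W uW Am1 // m1K; split=> //.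
    by case/andP: (Axz _ uA) => ? ?; apply: m1r'.
  have mA : m2 u \notin A by apply: contra uA => /Am2; rewrite m2K.
  rewrite m2W uW (negbTE mA) m2K; split=> //; apply: m2r' => //.
    by apply: contraNneq uA => ->.
  by apply: contraNneq uA => ->.
Qed.

(** This is the proof by Lovasz: induction on the number of missing edges, so that in the main case
    every additional edge creates a perfect matching. *)
Lemma tutte_barrier r W : symmetric r -> irreflexive r -> ~~ perfect W r ->
  exists S P, barrier W r S P.
Proof.
pose mis r := [set q : T * T | [&& q.1 \in W, q.2 \in W, q.1 != q.2 & ~~ r q.1 q.2]].
have [n] := ubnP #|mis r|; elim: n r => // n IH r le_n rs ri npm.
case: (boolP (odd #|W|)) => oW.
  exists set0, [set W]; split; rewrite ?sub0set ?cards0 ?cards1 //.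
    by move=> K /set1P->; rewrite setD0; split.
  by apply/trivIsetP => A B /set1P-> /set1P->; rewrite eqxx.
(* A barrier survives the deletion of an edge, so a larger graph that still has no perfect matching
   settles this case by induction. *)
case: (boolP [exists q : T * T, (q \in mis r) && ~~ perfect W (add_edge r q.1 q.2)]).
  case/existsP=> -[x y] /= /andP[qm npm']; have := qm; rewrite inE /= => /and4P[xW yW nxy rxy].
  have [||S [P [SW cP tP lt]]] := IH (add_edge r x y) _ (add_edge_sym _ _ rs) _ npm'.
  - move: le_n; rewrite ltnS; apply: leq_trans; apply: proper_card; apply/properP; split.
      apply/subsetP=> -[u v]; rewrite !inE /= => /and4P[-> -> ->] /=.
      by rewrite !negb_or => /and3P[].
    by exists (x, y); rewrite inE /= ?xW ?yW ?nxy ?rxy //= !eqxx /= orbT.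
  - move=> u /=; rewrite ri /=; case: eqVneq => [->|] /=; rewrite ?(negbTE nxy) //.
    by rewrite andbF.
  exists S, P; split=> // K /cP[h1 h2 h3]; split=> // u v uK vW ruv.
  by apply: (h3 u) => //=; rewrite ruv.
rewrite negb_exists => /forallP hall.
have {}hall x y : x \in W -> y \in W -> x != y -> ~~ r x y -> perfect W (add_edge r x y).
  by move=> xW yW nxy rxy; have := hall (x, y); rewrite inE /= xW yW nxy rxy /= negbK.
(* [S] collects the vertices joined to all others. Off [S] the graph either is a union of cliques or
   has a path [x], [y], [z] without the edge [xz]; in the latter case [y] misses some [w], and
   [perfect_exchange] applies. *)
pose S := [set x in W | [forall y in W, (y != x) ==> r x y]].
have SW : S \subset W by apply/subsetP=> x; rewrite inE => /andP[].
have [tr|ntr] := boolP [forall x in W :\: S, forall y in W :\: S, forall z in W :\: S,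
   [==> r x y, r y z, x != z => r x z]].
- have [x y z xU yU zU rxy ryz nxz|X [P [XU pX cP tP eP]]] := @clique_decomp r (W :\: S) rs.
    move/forall_inP/(_ _ xU)/forall_inP/(_ _ yU)/forall_inP/(_ _ zU): tr.
    by rewrite rxy ryz nxz.
  case: (ltnP #|S| #|P|) => lt.
    exists S, P; split=> // K /cP[h1 h2 h3]; rewrite setD0 in h1; split=> //.
    by move=> u v uK vU; apply: h3 => //; rewrite setD0.
  have dXS : [disjoint X & S].
    rewrite -setI_eq0; apply/eqP/setP=> u; rewrite inE in_set0.
    by case uX: (u \in X) => //=; have := subsetP XU _ uX; rewrite inE => /andP[/negbTE->].
  have WE : W = (W :\: S :\: X) :|: (X :|: S).
    apply/setP=> u; rewrite !in_setU !in_setD.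
    case uX: (u \in X) => /=.
      by have := subsetP XU _ uX; rewrite in_setD => /andP[_ ->].
    by case uS: (u \in S) => /=; [rewrite (subsetP SW)|rewrite orbF].
  case/negP: npm; rewrite WE; apply: perfectU => //.
    rewrite -setI_eq0; apply/eqP/setP=> u; rewrite !in_setI !in_setU !in_setD in_set0.
    by case: (u \in X); case: (u \in S); rewrite ?andbF.
  apply: perfect_join => //.
  + move=> s y sS yXS nsy; have : s \in S by []. rewrite inE => /andP[sW /forall_inP h].
    have yW : y \in W by rewrite WE in_setU yXS orbT.
    by have := h _ yW; rewrite eq_sym nsy.
  + by rewrite -eP.
  + have -> : #|X| + #|S| = #|X :|: S|.
      by rewrite cardsU (_ : X :&: S = set0) ?cards0 ?subn0 //; apply/eqP; rewrite setI_eq0.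
    have ev : ~~ odd #|W :\: S :\: X|.
      case/perfectP: pX => m hm; rewrite -[X in odd X]/(#|W :\: S :\: X|).
      have [A] : exists A, A = W :\: S :\: X by exists (W :\: S :\: X).
      move=> eA; rewrite -eA in hm *; elim: {A eA}_.+1 {-2}A (ltnSn #|A|) hm => // k IHk A leA hm.
      have [->|[a aA]] := set_0Vmem A; first by rewrite cards0.
      case: (hm _ aA) => maA mma rma.
      have nma : m a != a by apply: contraTneq rma => ->; rewrite ri.
      have cA : #|A| = #|A :\ a :\ m a|.+2.
        by rewrite (cardsD1 a) aA (cardsD1 (m a) (A :\ a)) !inE nma maA.
      rewrite cA /= negbK; apply: IHk; first by rewrite cA in leA; lia.
      move=> u; rewrite !inE => /and3P[u1 u2 uA]; case: (hm _ uA) => h1 h2 h3; split=> //.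
      rewrite h1 andbT; apply/andP; split; [apply: contra u2 | apply: contra u1] => /eqP e.
        by rewrite -h2 e mma.
      by rewrite -h2 e.
    move: oW; rewrite {1}WE cardsU.
    rewrite (_ : (W :\: S :\: X) :&: (X :|: S) = set0).
      by rewrite cards0 subn0 oddD (negbTE ev).
    apply/setP=> u; rewrite !in_setI !in_setU !in_setD in_set0.
    by case: (u \in X); case: (u \in S); rewrite ?andbF.
- move: ntr; rewrite negb_forall => /existsP[x]; rewrite negb_imply => /andP[xU].
  rewrite negb_forall => /existsP[y]; rewrite negb_imply => /andP[yU].
  rewrite negb_forall => /existsP[z]; rewrite negb_imply => /andP[zU].
  rewrite !negb_imply => /and4P[rxy ryz nxz rxz].
  move: xU yU zU; rewrite !in_setD => /andP[_ xW] /andP[yS yW] /andP[_ zW].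
  move: yS; rewrite inE yW /= negb_forall => /existsP[w]; rewrite !negb_imply => /and3P[wW nwy ryw].
  case/negP: npm; apply: (@perfect_exchange r W x y z w) => //.
  + by rewrite eq_sym.
  + exact: hall.
  + by apply: hall => //; rewrite eq_sym.
Qed.

End Tutte.

Section TutteHall.
Variable T : finType.
Implicit Types (W S K A B X U L : {set T}) (P : {set {set T}}) (r : rel T).

Lemma odd_cover P : trivIset P -> (forall K, K \in P -> odd #|K|) -> odd #|cover P| = odd #|P|.
Proof.
move=> /eqP <- oP; rewrite -sum1_card !(big_morph odd oddD (erefl _)).
by apply: eq_bigr => K /oP ->.
Qed.

(** Parity raises the excess from one to two: [W] is even, so [#|S|] and [#|P|] agree modulo 2 once
    the leftover is even, and an odd leftover becomes one more block. *)
Lemma tutte r W : symmetric r -> irreflexive r -> ~~ odd #|W| -> ~~ perfect W r ->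
  exists S P, [/\ S \subset W, closed_odd W r S P, trivIset P, #|S|.+2 <= #|P|
    & ~~ odd #|W :\: S :\: cover P|].
Proof.
move=> rs ri eW np; have [S [P [SW cP tP lt]]] := tutte_barrier rs ri np.
have covW Q : closed_odd W r S Q -> cover Q \subset W :\: S.
  by move=> cQ; apply/bigcupsP => K /cQ[].
have fin Q : closed_odd W r S Q -> trivIset Q -> #|S| < #|Q| -> ~~ odd #|W :\: S :\: cover Q| ->
    #|S|.+2 <= #|Q|.
  move=> cQ tQ ltQ eL; rewrite ltn_neqAle ltQ andbT; apply/eqP => e.
  have oQ : odd #|cover Q| = odd #|Q| by apply: odd_cover => // K /cQ[].
  move: eW; rewrite -(cardsID S W) (setIidPr SW) -(cardsID (cover Q) (W :\: S)).
  by rewrite (setIidPr (covW _ cQ)) !oddD oQ (negbTE eL) -e /= addbF addbN addbb.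
case: (boolP (odd #|W :\: S :\: cover P|)) => oL; last by exists S, P; split=> //; apply: fin.
pose L := W :\: S :\: cover P.
have cQ : closed_odd W r S (L |: P).
  move=> K; rewrite !inE => /predU1P[->|/cP//]; split=> //; first exact: subsetDl.
  move=> x y; rewrite !in_setD => /and3P[xc xS xW] /andP[yS yW] rxy.
  rewrite yS yW /= andbT; apply: contra xc => /bigcupP[K' K'P yK']; apply/bigcupP; exists K' => //.
  by have [_ _ h] := cP _ K'P; apply: (h y); rewrite ?inE ?xS ?xW // rs.
have dL K : K \in P -> [disjoint L & K].
  move=> KP; rewrite -setI_eq0; apply/eqP/setP=> x; rewrite !in_setI !in_setD in_set0.
  by case xK: (x \in K); rewrite ?andbF // (_ : x \in cover P) //; apply/bigcupP; exists K.
have tQ : trivIset (L |: P).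
  apply/trivIsetP => A B; rewrite !inE => /predU1P[->|AP] /predU1P[->|BP]; rewrite ?eqxx // => nAB.
  - exact: dL.
  - by rewrite disjoint_sym; apply: dL.
  - exact: (trivIsetP tP).
have LP : L \notin P.
  apply/negP=> /dL; rewrite -setI_eq0 setIid => /eqP e; by move: oL; rewrite -/L e cards0.
have cL : cover (L |: P) = L :|: cover P by rewrite /cover bigcup_setU big_set1.
have eL : ~~ odd #|W :\: S :\: cover (L |: P)|.
  by rewrite cL [L :|: _]setUC -setDDl setDv cards0.
exists S, (L |: P); split=> //; apply: fin => //.
by rewrite cardsU1 LP; apply: leq_trans lt _.
Qed.

(** The even leftover is absorbed in one block, which stays odd and closed. The blocks then
    partition [W :\: S], as the edge counts below require. *)
Lemma tutte_cover r W : symmetric r -> irreflexive r -> ~~ odd #|W| -> ~~ perfect W r ->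
  exists S P, [/\ S \subset W, closed_odd W r S P, trivIset P, #|S|.+2 <= #|P|
    & cover P = W :\: S].
Proof.
move=> rs ri eW np; have [S [P [SW cP tP lt eL]]] := tutte rs ri eW np.
set L := W :\: S :\: cover P in eL.
have covP : cover P \subset W :\: S by apply/bigcupsP => K /cP[].
have [K0 K0P] : exists K, K \in P by apply/set0Pn; rewrite -card_gt0; apply: leq_trans lt.
have dL K : K \in P -> [disjoint L & K].
  move=> KP; rewrite -setI_eq0; apply/eqP/setP=> x; rewrite !in_setI !in_setD in_set0.
  by case xK: (x \in K); rewrite ?andbF // (_ : x \in cover P) //; apply/bigcupP; exists K.
have [K0W oK0 cK0] := cP _ K0P.
have LW : L \subset W :\: S by apply: subsetDl.
pose Q := (K0 :|: L) |: (P :\ K0).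
have dQ K : K \in P :\ K0 -> [disjoint K0 :|: L & K].
  rewrite !inE => /andP[nK KP]; rewrite -setI_eq0 setIUl setU_eq0 !setI_eq0 dL // andbT.
  by apply: (trivIsetP tP) => //; rewrite eq_sym.
have K0n : exists x, x \in K0 by apply/set0Pn; rewrite -card_gt0; case: #|K0| oK0.
have nQ : K0 :|: L \notin P :\ K0.
  apply/negP => /dQ; rewrite -setI_eq0 setIid => /eqP e0; case: K0n => x xK.
  have : x \in K0 :|: L by rewrite inE xK.
  by rewrite e0 inE.
exists S, Q; split=> //.
- move=> K; rewrite !inE => /orP[/eqP->|/andP[_ /cP//]]; split.
  + by rewrite subUset K0W.
  + rewrite cardsU (_ : K0 :&: L = set0) ?cards0 ?subn0 ?oddD ?oK0 ?(negbTE eL) //.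
    by apply/eqP; rewrite setI_eq0 disjoint_sym dL.
  + move=> x y; rewrite in_setU => /orP[xK|xL] yW rxy; rewrite in_setU.
      by rewrite (cK0 x).
    case: (boolP (y \in K0)) => //= yK0; rewrite in_setD yW andbT.
    apply/negP=> /bigcupP[K' K'P yK']; have [_ _ cK'] := cP _ K'P.
    have : x \in K' by apply: (cK' y); rewrite ?(subsetP LW) // rs.
    by rewrite (disjointFr (dL _ K'P) xL).
- apply/trivIsetP => A B; rewrite !in_setU1 => /predU1P[->|AP] /predU1P[->|BP] nAB.
  + by rewrite eqxx in nAB.
  + exact: dQ.
  + by rewrite disjoint_sym dQ.
  + by move: AP BP; rewrite !inE => /andP[_ AP] /andP[_ BP]; apply: (trivIsetP tP).
- by rewrite cardsU1 nQ; move: lt; rewrite (cardsD1 K0 P) K0P.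
- rewrite /cover bigcup_setU big_set1 -/(cover _); apply/setP=> x.
  rewrite !in_setU; apply/idP/idP.
    case/orP=> [/orP[/(subsetP K0W)//|/(subsetP LW)//]|/bigcupP[K]].
    by rewrite !inE => /andP[_ /cP[KW _ _]] /(subsetP KW); rewrite !inE.
  move=> xW; case: (boolP (x \in cover P)) => [/bigcupP[K KP xK]|xc].
    case: (eqVneq K K0) => [<-|nK]; first by rewrite xK.
    by apply/orP; right; apply/bigcupP; exists K; rewrite // !inE nK.
  by rewrite [x \in L]in_setD xW xc orbT.
Qed.

Definition nbrs r X B := [set y in B | [exists x in X, r x y]].

(* Hall's theorem is Tutte's theorem for the bipartite graph with one side completed to a clique. *)
Lemma hall r A B : symmetric r -> irreflexive r -> [disjoint A & B] -> #|A| = #|B| ->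
  (forall X, X \subset A -> #|X| <= #|nbrs r X B|) ->
  exists m : T -> T, (forall x, x \in A -> [/\ m x \in B, m (m x) = x & r x (m x)]) /\
    (forall x, x \in B -> [/\ m x \in A, m (m x) = x & r x (m x)]).
Proof.
move=> rs ri dAB eAB hallC.
pose r2 : rel T := fun u v => (u != v) && ((u \in B) && (v \in B) || r u v && ((u \in A) (+) (v \in A))).
have r2s : symmetric r2.
  by move=> u v; rewrite /r2 eq_sym rs [(v \in B) && _]andbC [(v \in A) (+) _]addbC.
have r2i : irreflexive r2 by move=> u; rewrite /r2 eqxx.
have AB x : x \in A -> x \in B = false by move=> xA; rewrite (disjointFr dAB xA).
case: (boolP (perfect (A :|: B) r2)) => [/perfectP[m hm]|np].
  have mA x : x \in A -> [/\ m x \in B, m (m x) = x & r x (m x)].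
    move=> xA; have := hm x; rewrite inE xA /= => /(_ isT)[h1 h2].
    rewrite /r2 (AB _ xA) xA /= => /and3P[_ h3 h4].
    by move: h1; rewrite inE (negbTE h4).
  have eB : m @: A = B.
    apply/eqP; rewrite eqEcard card_in_imset ?eAB ?leqnn ?andbT.
      by apply/subsetP=> y /imsetP[x xA ->]; case: (mA _ xA).
    by move=> x y xA yA e; case: (mA _ xA) => _ <- _; case: (mA _ yA) => _ <- _; rewrite e.
  exists m; split=> // y; rewrite -eB => /imsetP[x xA ->].
  by case: (mA _ xA) => h1 h2 h3; rewrite h2; split; rewrite // rs.
have [|S [P [SW cP tP lt _]]] := tutte r2s r2i _ np.
  rewrite cardsU (_ : A :&: B = set0) ?cards0 ?subn0; last by apply/eqP; rewrite setI_eq0.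
  by rewrite eAB oddD addbb.
pose P' := [set K in P | K \subset A].
have P'P K : K \in P' -> K \in P /\ K \subset A by rewrite inE => /andP[].
(* All blocks meeting [B] are adjacent through the clique on [B], so at most one block is not
   contained in [A]. *)
have ltP' : #|P| <= #|P'|.+1.
  rewrite -(cardsID P' P); have -> : P :&: P' = P' by apply/setIidPr/subsetP => K /P'P[].
  rewrite -addn1 leq_add2l; apply/card_le1_eqP => K1 K2.
  have H K : K \in P :\: P' -> exists2 x, x \in K & x \in B.
    rewrite !inE => /andP[h KP]; move: h; rewrite KP /= => /subsetPn[x xK xA]; exists x => //.
    have [KW _ _] := cP _ KP; move: (subsetP KW _ xK); rewrite !inE => /andP[_].
    by rewrite (negbTE xA).
  move=> h1 h2; have [x1 x1K x1B] := H _ h1; have [x2 x2K x2B] := H _ h2.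
  move: h1 h2; rewrite !in_setD => /andP[_ K1P] /andP[_ K2P].
  have [K1W _ c1] := cP _ K1P; have [K2W _ _] := cP _ K2P.
  apply/eqP; apply: contraT => nK.
  have dK := trivIsetP tP _ _ K1P K2P; rewrite eq_sym nK in dK; move: (dK isT) => {}dK.
  have x21 : x2 \in K1.
    case: (eqVneq x1 x2) => [<-//|nx]; apply: (c1 x1) => //; first exact: (subsetP K2W).
    by rewrite /r2 nx x1B x2B.
  by rewrite (disjointFr dK x21) in x2K.
have XA : cover P' \subset A by apply/bigcupsP => K /P'P[].
have leX : #|P'| <= #|cover P'|.
  have /eqP <- : trivIset P' by apply: (trivIsetS _ tP); apply/subsetP=> K /P'P[].
  rewrite -sum1_card; apply: leq_sum => K /P'P[/cP[_ oK _] _].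
  by case: #|K| oK.
have NS : nbrs r (cover P') B \subset S.
  apply/subsetP=> y; rewrite inE => /andP[yB /exists_inP[x /bigcupP[K /P'P[KP KA] xK] rxy]].
  apply: contraT => yS; have [_ _ cK] := cP _ KP.
  have yK : y \in K.
    apply: (cK x) => //; first by rewrite !inE yS yB orbT.
    have xA := subsetP KA _ xK.
    rewrite /r2 rxy xA (disjointFl dAB yB) orbT andbT.
    by apply: contraTneq yB => <-; rewrite AB.
  by move: (subsetP KA _ yK); rewrite (disjointFl dAB yB).
have := leq_trans (hallC _ XA) (subset_leq_card NS); lia.
Qed.

End TutteHall.

(** * Cubic graphs without a perfect matching meeting three given edges oddly *)

Ltac setb := apply/setP => ?; rewrite !inE;
  repeat match goal with |- context [?x \in ?A] => case: (x \in A) => //= end;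
  repeat match goal with |- context [?x == ?y] => case: (x == y) => //= end.

(** Here [a] and [p] are the numbers of barrier vertices and odd components, [c] that of the edges
    between them, and [aa], [q] count twice the edges within the barrier and between different
    components. Then q - aa = 3 (p - a). *)
Lemma barrier_count0 a p c q aa : 3 * p = c + q -> 3 * a = aa + c -> a <= p -> 2 <= aa -> q <= 4 ->
  ~~ odd aa -> (q = 2 /\ aa = 2) \/ (q = 4 /\ aa = 4).
Proof. lia. Qed.

(** One component has [k] leaving edges, at least 5, and the others have [s] together. The upper
    bound 3 p + 2 for k + s is attained, so every inequality is an equality. *)
Lemma barrier_count1 a p p1 c q aa k s : k + s = c + q -> 3 * a = aa + c -> a <= p -> p = p1.+1 ->
  3 * p1 <= s -> 2 <= aa -> q <= 4 -> 5 <= k -> [/\ k = 5, q = 4, aa = 2 & s = 3 * p1].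
Proof. by move=> *; split; lia. Qed.

Section CubicGraph.
Variables (T : finType) (r : rel T).
Hypotheses (rs : symmetric r) (ri : irreflexive r).
Hypothesis (r3 : forall x, #|[set y | r x y]| = 3).
Implicit Types (X Y Z A B K : {set T}).

Definition nb x Y := #|[set y in Y | r x y]|.
(** Edges are counted as ordered pairs, so [edg X X] is twice the number of edges within [X]. *)
Definition edg X Y := \sum_(x in X) nb x Y.

Lemma nbE x Y : nb x Y = \sum_(y in Y) r x y.
Proof.
rewrite /nb -sum1_card big_mkcond [RHS]big_mkcond; apply: eq_bigr => y _.
by rewrite inE; case: (y \in Y) => //=; case: (r x y).
Qed.

Lemma edgC X Y : edg X Y = edg Y X.
Proof.
rewrite /edg (eq_bigr _ (fun x _ => nbE x Y)) exchange_big.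
by apply: eq_bigr => y _; rewrite nbE; apply: eq_bigr => x _; rewrite rs.
Qed.

Lemma edgUl X1 X2 Y : [disjoint X1 & X2] -> edg (X1 :|: X2) Y = edg X1 Y + edg X2 Y.
Proof. by move=> d; rewrite /edg (eq_bigl [predU X1 & X2]) ?bigU // => x; rewrite !inE. Qed.

Lemma edgUr X Y1 Y2 : [disjoint Y1 & Y2] -> edg X (Y1 :|: Y2) = edg X Y1 + edg X Y2.
Proof. by move=> d; rewrite edgC edgUl // edgC [edg Y2 X]edgC. Qed.

Lemma edg0l Y : edg set0 Y = 0. Proof. by rewrite /edg big_set0. Qed.
Lemma edg0r Y : edg Y set0 = 0. Proof. by rewrite edgC edg0l. Qed.

Lemma edgIDl A X Y : edg X Y = edg (X :&: A) Y + edg (X :\: A) Y.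
Proof.
rewrite -edgUl ?setID // -setI_eq0; apply/eqP; setb.
Qed.

Lemma edgIDr A X Y : edg X Y = edg X (Y :&: A) + edg X (Y :\: A).
Proof. by rewrite edgC (edgIDl A) ![edg _ X]edgC. Qed.

Lemma edgT X : edg X setT = 3 * #|X|.
Proof.
rewrite /edg (eq_bigr (fun=> 3)) ?sum_nat_const 1?mulnC // => x _.
by rewrite /nb -[RHS](r3 x); congr #|pred_of_set _|; apply/setP=> y; rewrite !inE.
Qed.

Definition epairs X Y : {set T * T} := [set p | [&& p.1 \in X, p.2 \in Y & r p.1 p.2]].

Lemma card_epairs X Y : #|epairs X Y| = edg X Y.
Proof.
rewrite /edg (eq_bigr _ (fun x _ => nbE x Y)) pair_big_dep /= -sum1_card.
rewrite big_mkcond [RHS]big_mkcond; apply: eq_bigr => -[x y] _ /=; rewrite inE /=.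
by case: (x \in X); case: (y \in Y) => //=; case: (r x y).
Qed.

Lemma edg_eq0 X Y : (edg X Y == 0) = [forall x in X, forall y in Y, ~~ r x y].
Proof.
rewrite -card_epairs cards_eq0; apply/eqP/forall_inP => [e0 x xX|h].
  by apply/forall_inP => y yY; apply/negP => rxy; have := in_set0 (x, y); rewrite -e0 inE /= xX yY rxy.
apply/setP=> -[x y]; rewrite !inE /=; case xX: (x \in X) => //=; case yY: (y \in Y) => //=.
by have /forall_inP/(_ _ yY)/negbTE := h _ xX.
Qed.

Lemma edg_eq0P X Y : (forall x y, x \in X -> y \in Y -> r x y -> False) -> edg X Y = 0.
Proof.
move=> h; apply/eqP; rewrite edg_eq0; apply/forall_inP=> x xX; apply/forall_inP=> y yY.
by apply/negP => /(h x y xX yY).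
Qed.

Lemma edg_le1 X Y x0 y0 : (forall x y, x \in X -> y \in Y -> r x y -> x = x0 /\ y = y0) -> edg X Y <= 1.
Proof.
move=> h; rewrite -card_epairs -(cards1 (x0, y0)); apply: subset_leq_card.
by apply/subsetP=> -[x y]; rewrite !inE /= => /and3P[xX yY rxy]; case: (h x y xX yY rxy) => -> ->.
Qed.

Lemma edg_gt0 X Y x y : x \in X -> y \in Y -> r x y -> 0 < edg X Y.
Proof. by move=> xX yY rxy; rewrite -card_epairs card_gt0; apply/set0Pn; exists (x, y); rewrite inE xX yY. Qed.

Lemma edg_even X : ~~ odd (edg X X).
Proof.
have [n] := ubnP #|X|; elim: n X => // n IH X leX.
have [->|[x xX]] := set_0Vmem X; first by rewrite edg0l.
have d1 : [disjoint [set x] & X :\ x] by rewrite -setI_eq0; apply/eqP; setb.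
have e1 : X = [set x] :|: (X :\ x) by rewrite setD1K.
have -> : edg X X = edg ([set x] :|: X :\ x) ([set x] :|: X :\ x) by rewrite -e1.
rewrite edgUl // !edgUr //.
rewrite [edg (X :\ x) [set x]]edgC (_ : edg [set x] [set x] = 0); last first.
  by apply: edg_eq0P => y z /set1P-> /set1P->; rewrite ri.
rewrite add0n addnA addnn oddD odd_double; apply: IH.
by rewrite (cardsD1 x) xX in leX.
Qed.

Definition cut X := edg X (~: X).

Lemma cut_card X : cut X + edg X X = 3 * #|X|.
Proof.
by rewrite -edgT /cut addnC -edgUr ?setUCr // -setI_eq0 setICr.
Qed.

Lemma cut_odd X : odd (cut X) = odd #|X|.
Proof.
have := congr1 odd (cut_card X); rewrite oddD (negbTE (edg_even X)) addbF oddM /= => ->.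
by [].
Qed.

Lemma cut1 x : cut [set x] = 3.
Proof.
have := cut_card [set x]; rewrite cards1 (_ : edg _ _ = 0) ?addn0 //.
by apply: edg_eq0P => y z /set1P-> /set1P->; rewrite ri.
Qed.

Lemma order_even : ~~ odd #|T|.
Proof. by have := edg_even setT; rewrite edgT cardsT oddM. Qed.

Section Obstruction.
Hypothesis cut3 : forall X, X != set0 -> X != setT -> 3 <= cut X.
Hypothesis triv3 : forall X, cut X = 3 -> #|X| <= 1 \/ #|~: X| <= 1.

(* An edge is given by the ordered pair of its ends. *)
Definition onE (a : T * T) x y := ((x == a.1) && (y == a.2)) || ((x == a.2) && (y == a.1)).

Lemma onE_sym a : symmetric (onE a).
Proof. by move=> x y; rewrite /onE orbC; congr orb; rewrite andbC. Qed.

Definition end_of (a : T * T) x := (x == a.1) || (x == a.2).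

Definition matching_e (e g h : T * T) (m : T -> T) :=
  [/\ forall x, m (m x) = x, forall x, r x (m x), m e.1 = e.2, m g.1 != g.2 & m h.1 != h.2].

(* The three shapes of the obstruction to a perfect matching through [e] avoiding [g] and [h]. Here [A] is a Tutte barrier
   of the graph without [e], [g], [h] together with the ends of [e]; counting edges leaves odd components that are
   single vertices, except for at most one, [K] in [local5]. So [A] is a 2-colouring proper up to the listed defects. *)
Definition global1 (e f : T * T) (A : {set T}) :=
  [/\ e.1 \in A, e.2 \in A, f.1 \notin A, f.2 \notin A &
      forall x y, r x y -> ((x \in A) == (y \in A)) = onE e x y || onE f x y].

Definition global2 (e g h k : T * T) (A : {set T}) :=
  [/\ [/\ e.1 \in A & e.2 \in A], [/\ g.1 \notin A & g.2 \notin A], [/\ h.1 \notin A & h.2 \notin A],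
      [/\ k.1 \in A, k.2 \in A, r k.1 k.2 & ~~ onE e k.1 k.2] &
      forall x y, r x y -> ((x \in A) == (y \in A)) = [|| onE e x y, onE g x y, onE h x y | onE k x y]].

Definition local5 (e g h : T * T) (A K : {set T}) :=
  [/\ [/\ cut K = 5, e.1 \notin K & e.2 \notin K],
      [/\ e.1 \in A & e.2 \in A],
      [/\ g.1 \notin A, g.2 \notin A & ~~ ((g.1 \in K) && (g.2 \in K))],
      [/\ h.1 \notin A, h.2 \notin A & ~~ ((h.1 \in K) && (h.2 \in K))] &
      (forall x y, x \notin K -> y \notin K -> r x y ->
         ((x \in A) == (y \in A)) = [|| onE e x y, onE g x y | onE h x y]) /\
      (forall x y, x \notin K -> y \in K -> r x y -> (x \in A) = ~~ (onE g x y || onE h x y))].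

Lemma obstruction e g h : r e.1 e.2 -> r g.1 g.2 -> r h.1 h.2 ->
  uniq [:: e.1; e.2; g.1; g.2; h.1; h.2] ->
  (forall m, ~ matching_e e g h m) ->
  [\/ exists A, global1 e g A, exists A, global1 e h A, exists A k, global2 e g h k A
    | exists A K, local5 e g h A K].
Proof.
move=> re rg rh; rewrite /= !inE !negb_or => /and5P[/and5P[n1 n2 n3 n4 n5] /and4P[n6 n7 n8 n9]
  /and3P[n10 n11 n12] /andP[n13 n14] /andP[n15 _]] nom.
(* The ends of [e] are removed from the vertices, and [g], [h] from the edges: a perfect matching of
   what is left would extend by [e] to a forbidden one. *)
pose W := ~: [set e.1; e.2].
pose r' : rel T := fun x y => [&& r x y, ~~ onE g x y & ~~ onE h x y].
have r's : symmetric r' by move=> x y; rewrite /r' rs !(onE_sym _ x).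
have r'i : irreflexive r' by move=> x; rewrite /r' ri.
have cardW : #|W| + 2 = #|T| by rewrite -(cardsC [set e.1; e.2]) cards2 n1 addnC.
have eW : ~~ odd #|W| by have := order_even; rewrite -cardW addn2 /= negbK.
have npW : ~~ perfect W r'.
  apply/negP => /perfectP[m hm].
  pose m' x := if x == e.1 then e.2 else if x == e.2 then e.1 else m x.
  have Wm x : x != e.1 -> x != e.2 -> [/\ m x != e.1, m x != e.2, m (m x) = x & r' x (m x)].
    move=> x1 x2; have := hm x; rewrite !inE !negb_or x1 x2 => /(_ isT)[/andP[? ?] ? ?]; split=> //.
  case: (nom m'); rewrite /m'; split.
  - move=> x; case: (eqVneq x e.1) => [->|x1]; first by rewrite eq_sym (negbTE n1) eqxx.
    case: (eqVneq x e.2) => [->|x2]; first by rewrite eqxx.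
    by case: (Wm _ x1 x2) => /negbTE-> /negbTE-> -> _.
  - move=> x; case: (eqVneq x e.1) => [->|x1] //.
    case: (eqVneq x e.2) => [->|x2]; first by rewrite rs.
    by case: (Wm _ x1 x2) => _ _ _ /and3P[].
  - by rewrite eqxx.
  - rewrite !(eq_sym g.1) (negbTE n2) (negbTE n6).
    case: (Wm g.1); rewrite 1?eq_sym // => _ _ _ /and3P[_ h1 _].
    by apply: contra h1 => /eqP->; rewrite /onE !eqxx.
  - rewrite !(eq_sym h.1) (negbTE n4) (negbTE n8).
    case: (Wm h.1); rewrite 1?eq_sym // => _ _ _ /and3P[_ _ h1].
    by apply: contra h1 => /eqP->; rewrite /onE !eqxx.
have [S [P [SW cP tP lt covP]]] := tutte_cover r's r'i eW npW.
pose A := [set e.1; e.2] :|: S.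
have eA1 : e.1 \in A by rewrite !inE eqxx.
have eA2 : e.2 \in A by rewrite !inE eqxx orbT.
have AE x : (x \in A) = (x \notin cover P).
  rewrite covP !inE !negb_and !negbK.
  case: (boolP (x \in S)) => [/(subsetP SW)|]; rewrite ?orbT //= !orbF; first by rewrite ?orbT.
have cardA : #|A| = #|S| + 2.
  rewrite cardsU cards2 n1 (_ : _ :&: S = set0) ?cards0 ?subn0 1?addnC //.
  apply/setP=> x; rewrite in_setI in_set0; case xS: (x \in S); rewrite ?andbF //.
  by have := subsetP SW _ xS; rewrite in_setC => /negbTE->.
clearbody A.
have nA K x : K \in P -> x \in K -> x \notin A.
  by move=> KP xK; rewrite AE negbK; apply/bigcupP; exists K.
have inP x : x \notin A -> exists2 K, K \in P & x \in K.
  by rewrite AE negbK => /bigcupP[K KP xK]; exists K.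
have clK K x y : K \in P -> x \in K -> y \notin A -> r x y -> y \notin K -> onE g x y || onE h x y.
  move=> KP xK yA rxy; have [KW _ c] := cP _ KP.
  apply: contraR; rewrite negb_or => /andP[h1 h2]; apply: (c x) => //; last by rewrite /r' rxy h1.
  by rewrite -covP; move: yA; rewrite AE negbK.
(* [Cr] lists, in both directions, the edges between different odd components. These can only be the
   deleted edges [g] and [h], so [Cr] has at most the four elements of [G4]. *)
pose Cr : {set T * T} := [set p | [&& p.1 \notin A, p.2 \notin A, r p.1 p.2 & pblock P p.1 != pblock P p.2]].
pose G4 : {set T * T} := [set p in [:: (g.1, g.2); (g.2, g.1); (h.1, h.2); (h.2, h.1)]].
have pbE K x : K \in P -> x \in K -> pblock P x = K by move=> KP xK; apply: def_pblock.
have inCr x y : x \notin A -> y \notin A -> r x y -> pblock P x != pblock P y -> onE g x y || onE h x y.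
  move=> xA yA rxy; have [K KP xK] := inP _ xA; rewrite (pbE _ _ KP xK) => nb0.
  by apply: (clK K) => //; apply: contraNN nb0 => yK; rewrite (pbE _ _ KP yK).
have CrG : Cr \subset G4.
  apply/subsetP=> -[x y]; rewrite !inE /= => /and4P[xA yA rxy nb0].
  by case/orP: (inCr _ _ xA yA rxy nb0) => /orP[] /andP[/eqP-> /eqP->]; rewrite eqxx ?orbT.
have G4c : #|G4| = 4.
  rewrite /G4 cardsE; apply/eqP; rewrite -[4]/(size [:: (g.1, g.2); (g.2, g.1); (h.1, h.2); (h.2, h.1)]).
  apply/eqP/card_uniqP; rewrite /= !inE !xpair_eqE !negb_or !(eq_sym g.2) !(eq_sym h.2).
  by rewrite (negbTE n10) (negbTE n11) (negbTE n12) (negbTE n15) !(eq_sym h.1) (negbTE n13) !andbF.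
pose E x := nb x (~: pblock P x :\: A).
have QE : #|Cr| = \sum_(x in cover P) E x.
  transitivity (\sum_(x in ~: A) E x); last first.
    by apply: eq_bigl => x; rewrite inE AE negbK.
  rewrite /E (eq_bigr _ (fun x _ => nbE x _)) pair_big_dep /= -sum1_card.
  rewrite big_mkcond [RHS]big_mkcond; apply: eq_bigr => -[x y] _ /=; rewrite !inE /=.
  case xA: (x \in A) => //=; case yA: (y \in A) => //=.
  have [K KP xK] := inP _ (negbT xA); have [K' KP' yK'] := inP _ (negbT yA).
  rewrite (pbE _ _ KP xK) (pbE _ _ KP' yK').
  case: eqVneq => [eK|nK]; first by rewrite eK yK' andbF.
  rewrite (disjointFr (trivIsetP tP _ _ KP' KP _) yK') 1?eq_sym //= andbT.
  by case: (r x y).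
have cutE K : K \in P -> cut K = edg K A + \sum_(x in K) E x.
  move=> KP; rewrite /cut (edgIDr A); congr addn.
    congr edg; apply/setP=> x; rewrite !inE; case xA: (x \in A); rewrite ?andbF // andbT.
    by apply: contraTN xA => xK; apply: (nA K).
  by rewrite /edg; apply: eq_bigr => x xK; rewrite /E (pbE _ _ KP xK).
have sumcut : \sum_(K in P) cut K = edg (cover P) A + #|Cr|.
  rewrite QE (eq_bigr _ cutE) big_split /=; congr addn; by rewrite -big_trivIset.
have AT : 3 * #|A| = edg A A + edg (cover P) A.
  rewrite -edgT (edgIDr A) setTI; congr addn; rewrite edgC; congr edg.
  by apply/setP=> x; rewrite !inE AE negbK andbT.
have AA2 : [set (e.1, e.2); (e.2, e.1)] \subset epairs A A.
  by apply/subsetP=> -[x y]; rewrite !inE /= => /orP[] /eqP[-> ->]; rewrite ?eA1 ?eA2 // rs.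
have c2 : #|[set (e.1, e.2); (e.2, e.1)]| = 2 by rewrite cards2 xpair_eqE (negbTE n1).
have leAA : 2 <= edg A A by rewrite -card_epairs -c2 subset_leq_card.
have oddK K : K \in P -> odd (cut K) /\ 3 <= cut K.
  move=> KP; have [_ oK _] := cP _ KP; rewrite cut_odd oK; split=> //; apply: cut3.
    by apply: contraTneq oK => ->; rewrite cards0.
  by apply: contraTneq eA1 => KT; apply: (nA K) => //; rewrite KT inE.
have leP : 3 * #|P| <= \sum_(K in P) cut K.
  by rewrite mulnC -sum_nat_const; apply: leq_sum => K /oddK[].
have leCr : #|Cr| <= 4 by rewrite -G4c subset_leq_card.
have single K : K \in P -> cut K = 3 -> exists x, K = [set x].
  move=> KP c3; case: (triv3 c3) => le1.
    by apply/cards1P; rewrite eqn_leq le1 card_gt0; apply/eqP => K0; rewrite K0 /cut edg0l in c3.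
  move: le1; rewrite (cardsD1 e.1) (cardsD1 e.2) !inE (eq_sym e.2) n1 /=.
  have -> : e.1 \notin K by apply: contraTN eA1; apply: nA.
  by have -> : e.2 \notin K by apply: contraTN eA2; apply: nA.
(* The excess two of the blocks over [S] makes up for the two ends of [e] in [A]. *)
have leSA : #|A| <= #|P| by rewrite cardA addn2.
have evAA := edg_even A.
have glue (D1 D2 : T -> T -> bool) :
    (forall x y, x \in A -> y \in A -> r x y -> D1 x y) ->
    (forall x y, x \notin A -> y \notin A -> r x y -> D2 x y) ->
    (forall x y, D1 x y -> x \in A /\ y \in A) -> (forall x y, D2 x y -> x \notin A /\ y \notin A) ->
    forall x y, r x y -> ((x \in A) == (y \in A)) = D1 x y || D2 x y.
  move=> h1 h2 h3 h4 x y rxy; case xA: (x \in A); case yA: (y \in A); apply/esym => /=.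
  - by rewrite h1.
  - by apply/negP=> /orP[/h3[]|/h4[]]; rewrite ?xA ?yA.
  - by apply/negP=> /orP[/h3[]|/h4[]]; rewrite ?xA ?yA.
  - by rewrite h2 ?orbT ?xA ?yA.
have onA a x y : a.1 \in A -> a.2 \in A -> onE a x y -> x \in A /\ y \in A.
  by move=> a1 a2 /orP[]/andP[/eqP-> /eqP->].
have onN a x y : a.1 \notin A -> a.2 \notin A -> onE a x y -> x \notin A /\ y \notin A.
  by move=> a1 a2 /orP[]/andP[/eqP-> /eqP->].
have Crs x y : (x, y) \in Cr -> (y, x) \in Cr.
  by rewrite !inE /= => /and4P[-> -> h1 h2]; rewrite rs h1 eq_sym.
have CrN x y : (x, y) \in Cr -> x \notin A /\ y \notin A by rewrite inE => /and4P[].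
have AAe : edg A A = 2 -> forall x y, x \in A -> y \in A -> r x y -> onE e x y.
  move=> c x y xA yA rxy; have /eqP eq : [set (e.1, e.2); (e.2, e.1)] == epairs A A.
    by rewrite eqEcard AA2 card_epairs c c2.
  have : (x, y) \in epairs A A by rewrite inE /= xA yA.
  by rewrite -eq !inE !xpair_eqE.
have Cr4 : #|Cr| = 4 -> Cr = G4.
  by move=> c; apply/eqP; rewrite eqEcard CrG c G4c.
have Cr4N : #|Cr| = 4 -> [/\ g.1 \notin A, g.2 \notin A, h.1 \notin A & h.2 \notin A].
  move=> /Cr4 c; have [g1 g2] : g.1 \notin A /\ g.2 \notin A by apply: CrN; rewrite c !inE eqxx.
  have [h1 h2] : h.1 \notin A /\ h.2 \notin A by apply: CrN; rewrite c !inE eqxx !orbT.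
  by split.
have inG4 x y : (x, y) \in G4 -> onE g x y || onE h x y.
  by rewrite !inE !xpair_eqE /onE orbA.
(* If all components have cut 3, they are single vertices and the count leaves the global shapes.
   Otherwise one component [K] has cut 5 and everything else is tight. *)
have [o3|] := boolP [forall K in P, cut K == 3].
- have sing x y : x \notin A -> y \notin A -> r x y -> (x, y) \in Cr.
    move=> xA yA rxy; rewrite inE /= xA yA rxy /=.
    have [K KP xK] := inP _ xA; have [K' KP' yK'] := inP _ yA.
    rewrite (pbE _ _ KP xK) (pbE _ _ KP' yK'); apply: contraTneq rxy => eK.
    have /eqP/(single _ KP)[z ez] := forall_inP o3 _ KP.
    by move: xK yK'; rewrite -eK ez => /set1P-> /set1P->; rewrite ri.
  have s3 : \sum_(K in P) cut K = 3 * #|P|.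
    by rewrite mulnC -sum_nat_const; apply: eq_bigr => K /(forall_inP o3)/eqP.
  have [q2|q4] : (#|Cr| = 2 /\ edg A A = 2) \/ (#|Cr| = 4 /\ edg A A = 4).
    by apply: (barrier_count0 _ AT leSA) => //; rewrite -s3 sumcut.
  + case: q2 => q2 a2.
    have fin f : (f.1, f.2) \in Cr -> global1 e f A.
      move=> fC; have [f1 f2] := CrN _ _ fC.
      have nf : f.1 != f.2 by move: fC; rewrite inE => /and4P[_ _ h1 _]; apply: contraTneq h1 => /= ->; rewrite ri.
      have /eqP eq : [set (f.1, f.2); (f.2, f.1)] == Cr.
        rewrite eqEcard q2 cards2 xpair_eqE (negbTE nf) andbT.
        by apply/subsetP=> p /set2P[]-> //; apply: Crs.
      split=> //; apply: glue; [exact: AAe| | |].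
      * by move=> x y xA yA rxy; have := sing _ _ xA yA rxy; rewrite -eq !inE !xpair_eqE.
      * by move=> x y; apply: onA.
      * by move=> x y; apply: onN.
    have [[x y] pC] : exists p, p \in Cr by apply/set0Pn; rewrite -card_gt0 q2.
    have := subsetP CrG _ pC; rewrite !inE.
    case/or4P=> /eqP[ex ey]; rewrite ex ey in pC.
    * by apply: Or41; exists A; apply: fin.
    * by apply: Or41; exists A; apply: fin; apply: Crs.
    * by apply: Or42; exists A; apply: fin.
    * by apply: Or42; exists A; apply: fin; apply: Crs.
  + case: q4 => q4 a4; have [g1 g2 h1 h2] := Cr4N q4.
    have [[k1 k2] kA ke] : exists2 k, k \in epairs A A & k \notin [set (e.1, e.2); (e.2, e.1)].
      apply/subsetPn; apply/negP => /subset_leq_card; rewrite card_epairs a4 c2 //.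
    have := kA; rewrite inE /= => /and3P[k1A k2A rk].
    have nke : ~~ onE e k1 k2 by move: ke; rewrite !inE !xpair_eqE.
    have nk : k1 != k2 by apply: contraTneq rk => ->; rewrite ri.
    have /eqP eq : [set (e.1, e.2); (e.2, e.1)] :|: [set (k1, k2); (k2, k1)] == epairs A A.
      rewrite eqEcard subUset AA2 /= card_epairs a4 cardsU c2 cards2 xpair_eqE (negbTE nk) /=.
      rewrite (_ : _ :&: _ = set0) ?cards0 ?andbT.
        by apply/subsetP=> p /set2P[]->; rewrite // inE /= k1A k2A rs.
      apply/setP=> -[x y]; rewrite !inE !xpair_eqE; apply/negP=> /andP[h3 h4].
      case/orP: h4 => /andP[/eqP ex /eqP ey]; move: h3; rewrite ex ey; first by apply/negP.
      by apply/negP; move: nke; rewrite onE_sym.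
    apply: Or43; exists A, (k1, k2); split=> // x y rxy.
    rewrite (glue (fun x y => onE e x y || onE (k1, k2) x y) (fun x y => onE g x y || onE h x y)) //.
    * by case: (onE e x y); case: (onE g x y); case: (onE h x y); case: (onE _ x y).
    * move=> u v uA vA ruv; have : (u, v) \in epairs A A by rewrite inE /= uA vA.
      by rewrite -eq !inE !xpair_eqE.
    * by move=> u v uA vA ruv; apply: inG4; rewrite -Cr4 // sing.
    * by move=> u v /orP[]; apply: onA.
    * by move=> u v /orP[]; apply: onN.
- rewrite negb_forall => /existsP[K]; rewrite negb_imply => /andP[KP nK3].
  have [oK leK] := oddK _ KP.
  have K5 : 5 <= cut K by move: nK3 oK leK; case: (cut K) => [|[|[|[|[|n]]]]].
  have cP1 : #|P| = #|P :\ K|.+1 by rewrite (cardsD1 K) KP.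
  have sD : \sum_(K' in P) cut K' = cut K + \sum_(K' in P :\ K) cut K'.
    by rewrite (bigD1 K) //=; congr addn; apply: eq_bigl => K'; rewrite !inE andbC.
  have leD : 3 * #|P :\ K| <= \sum_(K' in P :\ K) cut K'.
    by rewrite mulnC -sum_nat_const; apply: leq_sum => K'; rewrite !inE => /andP[_ /oddK[]].
  have [cK q4 a2 sD3] : [/\ cut K = 5, #|Cr| = 4, edg A A = 2 & \sum_(K' in P :\ K) cut K' = 3 * #|P :\ K|].
    by apply: (barrier_count1 _ AT leSA cP1) => //; rewrite -sD.
  have [g1 g2 h1 h2] := Cr4N q4.
  have sing K' : K' \in P -> K' != K -> exists x, K' = [set x].
    move=> K'P nK; apply: single => //; have [_ le3] := oddK _ K'P.
    apply/eqP; rewrite eqn_leq le3 andbT leqNgt; apply/negP => lt4.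
    have K'D : K' \in P :\ K by rewrite !inE nK.
    have : 3 * #|P :\ K :\ K'| <= \sum_(L in P :\ K :\ K') cut L.
      by rewrite mulnC -sum_nat_const; apply: leq_sum => L; rewrite !inE => /and3P[_ _ /oddK[]].
    move: sD3; rewrite (bigD1 K') //= (cardsD1 K') K'D.
    rewrite (eq_bigl (mem (P :\ K :\ K'))); last by move=> L; rewrite !inE andbC.
    move=> /= e1 e2; have le1 : 4 + 3 * #|P :\ K :\ K'| <= 3 * (1 + #|P :\ K :\ K'|).
      by rewrite -e1 leq_add.
    by move: le1; rewrite mulnDr leq_add2r.
  have crossK x y : x \notin A -> y \notin A -> r x y -> x \notin K -> (x, y) \in Cr.
    move=> xA yA rxy xK; rewrite inE /= xA yA rxy /=.
    have [L LP xL] := inP _ xA; have [L' LP' yL'] := inP _ yA.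
    rewrite (pbE _ _ LP xL) (pbE _ _ LP' yL'); apply: contraTneq rxy => eL.
    have nLK : L != K by apply: contraNneq xK => <-.
    have [z ez] := sing _ LP nLK.
    by move: xL yL'; rewrite -eL ez => /set1P-> /set1P->; rewrite ri.
  have G4nb x y : (x, y) \in G4 -> pblock P x != pblock P y.
    by rewrite -Cr4 // inE => /and4P[].
  have nbK x y : pblock P x != pblock P y -> ~~ ((x \in K) && (y \in K)).
    by move=> nb0; apply: contra nb0 => /andP[xK yK]; rewrite (pbE _ _ KP xK) (pbE _ _ KP yK).
  apply: Or44; exists A, K; split=> //.
  + split=> //; first by apply: contraTN eA1; apply: nA.
    by apply: contraTN eA2; apply: nA.
  + by split=> //; apply: nbK; apply: G4nb; rewrite !inE eqxx.
  + by split=> //; apply: nbK; apply: G4nb; rewrite !inE eqxx !orbT.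
  split=> [x y xK yK rxy|x y xK yK rxy].
    rewrite -/(onE e x y || (onE g x y || onE h x y)).
    case xA: (x \in A); case yA: (y \in A); apply/esym => /=.
    * by rewrite AAe.
    * apply/negP=> /or3P[/onA[]|/onN[]|/onN[]]; rewrite ?xA ?yA //.
    * apply/negP=> /or3P[/onA[]|/onN[]|/onN[]]; rewrite ?xA ?yA //.
    * by rewrite inG4 ?orbT // -Cr4 // crossK ?xA ?yA.
  have yA := nA _ _ KP yK.
  case: (boolP (x \in A)) => xA; apply/esym.
    by apply/negP=> /orP[/onN[]|/onN[]]; rewrite ?xA.
  by apply/negbTE; rewrite negbK inG4 // -Cr4 // crossK.
Qed.
End Obstruction.
End CubicGraph.

(** Let [K], [L] be the exceptional sets of two of the edges. Then [p], [q] count the edges from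
    [K :\: L] and [L :\: K] to the outside vertices where the two colourings differ, [rr], [t] those
    to outside vertices where they agree, [zx], [zy], [z] those at [K :&: L], and [m1 + m2] those
    between the two differences, [m2] being the part of the third edge. The multiples of 3 are
    degree sums of colour classes. *)
Lemma pair_arith p q rr t zx zy z m1 m2 xb xn w ya yn w' :
  5 = p + rr + (m1 + m2) + zy + z -> 5 = q + t + (m1 + m2) + zx + z ->
  4 <= p + q -> m2 <= 1 ->
  3 * xb = w + p + zx + m1 -> 3 * xn = w + rr + m2 ->
  3 * ya = w' + q + zy + m1 -> 3 * yn = w' + t + m2 ->
  (zx + zy + z = 0 \/ 3 <= zx + zy + z) ->
  (rr + t + z = 0 /\ m2 = 1 \/ [/\ 3 <= rr + t + z, 3 + t + t + z + z <= 5 + (rr + t + z) & 3 + rr + rr + z + z <= 5 + (rr + t + z)]) ->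
  (p + rr + (m1 + m2) + zx = 0 \/ 3 <= p + rr + (m1 + m2) + zx) ->
  (q + t + (m1 + m2) + zy = 0 \/ 3 <= q + t + (m1 + m2) + zy) ->
  [/\ zx + zy + z = 0, rr + t + z = 0 & m2 = 1] \/
  [/\ p = 2, q = 2, rr + t + z = 0, zx = 2 /\ zy = 2 & m1 = 0 /\ m2 = 1].
Proof.
move=> H1 H2 H3 H4 H5 H6 H7 H8 [H9|H9].
- move=> [[H10 H11]|[H10 H12 H13]] H14 H15; [left; split; lia|exfalso; lia].
- move=> [[H10 H11]|[H10 H12 H13]] H14 H15; [right|exfalso; lia].
  split; try lia; split; lia.
Qed.

Ltac dsj := rewrite -setI_eq0; apply/eqP/setP=> ?; rewrite !inE;
  repeat match goal with |- context [?x \in ?A] => case: (x \in A) => //= end.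
Ltac seq_ := apply/setP=> ?; rewrite !inE;
  repeat match goal with |- context [?x \in ?A] => case: (x \in A) => //= end.

(** * Comparing the obstructions that belong to three edges *)

Section T4.
Variables (T : finType) (r : rel T).
Hypotheses (rs : symmetric r) (ri : irreflexive r).
Hypothesis (r3 : forall x, #|[set y | r x y]| = 3).
Hypothesis cut3 : forall X : {set T}, X != set0 -> X != setT -> 3 <= cut r X.
Hypothesis triv3 : forall X : {set T}, cut r X = 3 -> #|X| <= 1 \/ #|~: X| <= 1.
Implicit Types (X Y Z A B C K L U : {set T}).
Local Notation edg := (edg r).
Local Notation cut := (cut r).
Let edgC := edgC rs.
Let edgIDl := edgIDl r.
Let edgIDr := edgIDr rs.

Lemma cut3' X x y : x \in X -> y \notin X -> 3 <= cut X.
Proof.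
move=> xX yX; apply: cut3; first by apply/set0Pn; exists x.
by apply: contraNneq yX => ->.
Qed.

(** The two sides of the bipartite set [K] send equally many edges to each other; the other edges at
    [K :&: C] all go to [Y1], and those at [K :\: C] all to [Y2]. *)
Lemma bip_balance K C Y1 Y2 :
  (forall x y, x \in K -> y \in K -> r x y -> (x \in C) != (y \in C)) ->
  Y1 :|: Y2 = ~: K -> [disjoint Y1 & Y2] ->
  edg (K :\: C) Y1 = 0 -> edg (K :&: C) Y2 = 0 ->
  3 * #|K :&: C| + edg K Y2 = 3 * #|K :\: C| + edg K Y1.
Proof.
move=> bip YE dY e1 e2.
have side S S' : S :|: S' = K -> [disjoint S & S'] -> (forall x y, x \in S -> y \in S -> ~~ r x y) ->
    3 * #|S| = edg S S' + edg S Y1 + edg S Y2.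
  move=> eS dS nS; rewrite -(edgT r3) (_ : setT = S :|: (S' :|: (Y1 :|: Y2))); last first.
    by rewrite YE setUA eS setUCr.
  rewrite !(edgUr rs) //.
  - rewrite (_ : edg S S = 0) ?addnA //; apply: edg_eq0P => // x y xS yS rxy.
    by move: (nS x y xS yS); rewrite rxy.
  - by rewrite YE -setI_eq0 -eS; apply/eqP; apply/setP=> x; rewrite !inE; case: (x \in S'); rewrite ?orbT ?andbF.
  - rewrite YE -setI_eq0 setIUr setU_eq0 setI_eq0 dS /=.
    by apply/eqP; rewrite -eS; apply/setP=> x; rewrite !inE; case: (x \in S).
have cK : K :&: C :|: K :\: C = K by rewrite setID.
have dK : [disjoint K :&: C & K :\: C].
  by rewrite -setI_eq0; apply/eqP; setb.
have s1 : 3 * #|K :&: C| = edg (K :&: C) (K :\: C) + edg (K :&: C) Y1 + edg (K :&: C) Y2.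
  apply: side => // x y; rewrite !inE => /andP[xK xC] /andP[yK yC]; apply/negP => /(bip _ _ xK yK).
  by rewrite xC yC.
have s2 : 3 * #|K :\: C| = edg (K :\: C) (K :&: C) + edg (K :\: C) Y1 + edg (K :\: C) Y2.
  apply: side; rewrite 1?setUC 1?disjoint_sym // => x y; rewrite !inE => /andP[xC xK] /andP[yC yK].
  by apply/negP => /(bip _ _ xK yK); rewrite (negbTE xC) (negbTE yC).
rewrite s1 s2 e1 e2 (edgC (K :\: C)) (edgIDl C K Y1) (edgIDl C K Y2) e1 e2 !addn0 add0n.
by rewrite addnAC.
Qed.

Lemma edg_onE f X Y : [disjoint X & Y] ->
  (forall x y, x \in X -> y \in Y -> r x y -> onE f x y) -> edg X Y <= 1.
Proof.
move=> dXY h; pose x0 := if f.1 \in X then f.1 else f.2; pose y0 := if f.1 \in X then f.2 else f.1.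
apply: (edg_le1 (x0 := x0) (y0 := y0)) => x y xX yY rxy.
case/orP: (h x y xX yY rxy) => /andP[/eqP ex /eqP ey]; subst.
  by rewrite /x0 /y0 xX.
by rewrite /x0 /y0 (disjointFl dXY yY).
Qed.

Lemma edg_onE2 f g X Y : [disjoint X & Y] ->
  (forall x y, x \in X -> y \in Y -> r x y -> onE f x y || onE g x y) -> edg X Y <= 2.
Proof.
move=> dXY h; pose p f := if f.1 \in X then f else (f.2, f.1) : T * T.
rewrite -card_epairs; apply: (@leq_trans #|[set p f; p g]|); last by rewrite cards2; case: eqP.
apply: subset_leq_card; apply/subsetP=> -[x y]; rewrite !inE /= => /and3P[xX yY rxy].
have := h x y xX yY rxy; rewrite /onE /p.
case/orP => /orP[] /andP[/eqP ex /eqP ey]; subst x y; rewrite ?xX ?(disjointFl dXY yY) -?surjective_pairing eqxx ?orbT //.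
Qed.

(* Two global 2-colourings whose defects differ in at most two edges agree up to a swap, since there are no 2-cuts. *)
Lemma global_global A B (D D' : rel T) f g :
  (forall x y, r x y -> ((x \in A) == (y \in A)) = D x y) ->
  (forall x y, r x y -> ((x \in B) == (y \in B)) = D' x y) ->
  (forall x y, r x y -> D x y != D' x y -> onE f x y || onE g x y) ->
  (forall x, (x \in A) = (x \in B)) \/ (forall x, (x \in A) = (x \notin B)).
Proof.
move=> hA hB hD; pose U := [set x | (x \in A) == (x \in B)].
have c2 : cut U <= 2.
  apply: edg_onE2; first by rewrite -setI_eq0 setICr.
  move=> x y; rewrite !inE => xU yU rxy; apply: hD => //; rewrite -hA // -hB //.
  by move: xU yU; do 4 case: (_ \in _).
have [U0|[x xU]] := set_0Vmem U.
  by right=> x; have := in_set0 x; rewrite -U0 inE; do 2 case: (_ \in _).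
left=> y; case: (boolP (y \in U)) => yU; first by apply/eqP; move: yU; rewrite inE.
by have := leq_trans (cut3' xU yU) c2.
Qed.

(** A swap of colours leaves the defects of a 2-colouring in place, so [global_global] forces the
    two defect predicates to agree on every edge. *)
Lemma global_global_differ A B (D D' : rel T) f g x0 y0 :
  (forall x y, r x y -> ((x \in A) == (y \in A)) = D x y) ->
  (forall x y, r x y -> ((x \in B) == (y \in B)) = D' x y) ->
  (forall x y, r x y -> D x y != D' x y -> onE f x y || onE g x y) ->
  r x0 y0 -> D x0 y0 = D' x0 y0.
Proof.
move=> hA hB hD rxy; rewrite -hA // -hB //.
by case: (global_global hA hB hD) => h; rewrite !h; do 2 case: (_ \in _).
Qed.

(* A global 2-colouring and a local one whose defects differ in one edge [f] off [K]: counting the sides of [K] modulo 3. *)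
Lemma global_local A B K (D : rel T) f x0 y0 :
  (forall x y, r x y -> ((x \in A) == (y \in A)) = D x y) ->
  (forall x y, x \notin K -> y \notin K -> r x y -> ((x \in B) == (y \in B)) = D x y (+) onE f x y) ->
  (forall x y, x \notin K -> y \in K -> r x y -> (x \in B) = ~~ (D x y (+) onE f x y)) ->
  (forall x y, x \in K -> y \in K -> r x y -> D x y = onE f x y) ->
  cut K = 5 -> x0 \notin K -> y0 \notin K ->
  (x0 \in A) = (x0 \in B) -> (y0 \in A) != (y0 \in B) -> False.
Proof.
move=> hA hB hKB hK cK x0K y0K x0s y0s.
pose Rp := [set x | (x \notin K) && ((x \in A) == (x \in B))].
pose Rm := [set x | (x \notin K) && ((x \in A) != (x \in B))].
have RE : Rp :|: Rm = ~: K by apply/setP=> x; rewrite !inE; case: (x \in K) => //=; apply: orbN.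
have dR : [disjoint Rp & Rm] by rewrite -setI_eq0; apply/eqP/setP=> x; rewrite !inE; case: (x \in K); case: eqP.
have x0R : x0 \in Rp by rewrite inE x0K x0s eqxx.
have y0R : y0 \in Rm by rewrite inE y0K y0s.
have pm x y : x \in Rp -> y \in Rm -> r x y -> onE f x y.
  rewrite !inE => /andP[xK xs] /andP[yK ys] rxy.
  have := hA _ _ rxy; have := hB _ _ xK yK rxy; move: xs ys.
  by do 4 case: (_ \in _) => //=; case: (D x y) => //=; case: (onE f x y).
have le1 : edg Rp Rm <= 1 by apply: edg_onE pm.
have cRp : cut Rp = edg Rp Rm + edg K Rp.
  rewrite [edg K _]edgC -(edgUr rs); last first.
    by rewrite -setI_eq0; apply/eqP/setP=> x; rewrite !inE; case: (x \in K); rewrite ?andbF.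
  congr edg; apply/setP=> x; rewrite !inE; case: (x \in K) => //=; by rewrite orbF.
have cRm : cut Rm = edg Rp Rm + edg K Rm.
  rewrite [edg K _]edgC [edg Rp _]edgC -(edgUr rs); last first.
    by rewrite -setI_eq0; apply/eqP/setP=> x; rewrite !inE; case: (x \in K); rewrite ?andbF.
  congr edg; apply/setP=> x; rewrite !inE; case: (x \in K) => //=; by rewrite negbK orbF.
have cK' : cut K = edg K Rp + edg K Rm by rewrite -(edgUr rs) // RE.
have gp : 3 <= cut Rp by apply: (@cut3' _ x0 y0) => //; rewrite (disjointFl dR).
have gm : 3 <= cut Rm by apply: (@cut3' _ y0 x0) => //; rewrite (disjointFr dR).
(* The cuts of [Rp] and [Rm] are at least 3; they share the five edges at [K], and each contains the
   at most one edge between [Rp] and [Rm]. So that edge exists and the five split as 2 and 3, which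
   is unbalanced modulo 3. *)
have eR1 : edg Rp Rm = 1 by lia.
have fR x y : onE f x y -> x \notin K.
  have : ~~ (edg Rp Rm == 0) by rewrite eR1.
  rewrite edg_eq0 negb_forall => /existsP[u]; rewrite negb_imply negb_forall => /andP[uR /existsP[v]].
  rewrite negb_imply negbK => /andP[vR ruv].
  have uK : u \notin K by move: uR; rewrite inE => /andP[].
  have vK : v \notin K by move: vR; rewrite inE => /andP[].
  move: uK vK; case/orP: (pm _ _ uR vR ruv) => /andP[/eqP-> /eqP->] f1 f2 /orP[]/andP[/eqP-> _] //.
have fK x y : x \in K -> onE f x y = false.
  by move=> xK; apply/negP => /fR; rewrite xK.
have bip x y : x \in K -> y \in K -> r x y -> (x \in A) != (y \in A).
  by move=> xK yK rxy; rewrite hA // hK // fK.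
have e1 : edg (K :\: A) Rm = 0.
  apply: edg_eq0P => y x; rewrite !inE => /andP[yA yK] /andP[xK xs] ryx; have rxy : r x y by rewrite rs.
  have := hA _ _ rxy; have := hKB _ _ xK yK rxy; rewrite onE_sym fK // (negbTE yA) addbF; move: xs.
  by do 2 case: (_ \in _) => //=; case: (D x y).
have e2 : edg (K :&: A) Rp = 0.
  apply: edg_eq0P => y x; rewrite !inE => /andP[yK yA] /andP[xK xs] ryx; have rxy : r x y by rewrite rs.
  have := hA _ _ rxy; have := hKB _ _ xK yK rxy; rewrite onE_sym fK // yA addbF; move: xs.
  by do 2 case: (_ \in _) => //=; case: (D x y).
have := bip_balance bip (etrans (setUC _ _) RE) _ e1 e2; rewrite disjoint_sym => /(_ dR).
by lia.
Qed.

Definition three_edges (e g h : T * T) :=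
  [/\ r e.1 e.2, r g.1 g.2, r h.1 h.2 & uniq [:: e.1; e.2; g.1; g.2; h.1; h.2]].

(* In the application [r] is the dual graph of a triangulation of the projective plane, and [e], [g], [h] are the dual
   edges of a noncontractible 3-cycle: the complement of a perfect matching meeting it oddly is the cut of a colouring. *)
Definition no_odd (e g h : T * T) :=
  forall m : T -> T, (forall x, m (m x) = x) -> (forall x, r x (m x)) ->
    ~~ odd ((m e.1 == e.2) + (m g.1 == g.2) + (m h.1 == h.2)).

Definition bad (e g h : T * T) := three_edges e g h /\ no_odd e g h.

Lemma bad_rot e g h : bad e g h -> bad g h e.
Proof.
case=> [[re rg rh u] no]; split; first split=> //.
  rewrite (perm_uniq (s2 := [:: e.1; e.2; g.1; g.2; h.1; h.2])) //.
  by rewrite -[X in perm_eq X]/([:: g.1; g.2; h.1; h.2] ++ [:: e.1; e.2]) perm_catC.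
by move=> m m1 m2; have := no m m1 m2; rewrite -addnA addnC.
Qed.

Lemma bad_swap e g h : bad e g h -> bad e h g.
Proof.
case=> [[re rg rh u] no]; split; first split=> //.
  rewrite (perm_uniq (s2 := [:: e.1; e.2; g.1; g.2; h.1; h.2])) // !perm_cons.
  by rewrite -[X in perm_eq X]/([:: h.1; h.2] ++ [:: g.1; g.2]) perm_catC.
by move=> m m1 m2; have := no m m1 m2; rewrite addnAC.
Qed.

Lemma onE_disj e g h x y : three_edges e g h -> onE e x y -> onE g x y = false /\ onE h x y = false.
Proof.
case=> _ _ _; rewrite /= !inE !negb_or => /and5P[/and5P[n1 n2 n3 n4 n5] /and4P[n6 n7 n8 n9] _ _ _].
by rewrite /onE => /orP[] /andP[/eqP-> /eqP->]; rewrite !(negbTE n2, negbTE n3, negbTE n4, negbTE n5, negbTE n6, negbTE n7, negbTE n8, negbTE n9).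
Qed.

Lemma bad_obstruction e g h : bad e g h ->
  [\/ exists A, global1 r e g A, exists A, global1 r e h A, exists A k, global2 r e g h k A
    | exists A K, local5 r e g h A K].
Proof.
case=> [[re rg rh u] no]; apply: obstruction => // m [m1 m2 me mg mh].
by have := no m m1 m2; rewrite me eqxx (negbTE mg) (negbTE mh).
Qed.


Lemma onE_disj3 e g h x y : three_edges e g h ->
  [/\ onE e x y && onE g x y = false, onE e x y && onE h x y = false & onE g x y && onE h x y = false].
Proof.
move=> t3; have t3' : three_edges g h e.
  by have [] : bad g h e \/ True; [right|case|case: t3 => ? ? ? u; split=> //;
     rewrite (perm_uniq (s2 := [:: e.1; e.2; g.1; g.2; h.1; h.2])) //;
     rewrite -[X in perm_eq X]/([:: g.1; g.2; h.1; h.2] ++ [:: e.1; e.2]) perm_catC].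
have h1 := @onE_disj _ _ _ x y t3; have h2 := @onE_disj _ _ _ x y t3'; move: h1 h2.
by case: (onE e x y) => /= h1; case: (onE g x y) => /= h2; split=> //; try case: (h1 isT); try case: (h2 isT) => //.
Qed.

Lemma onE_self (f : T * T) : onE f f.1 f.2. Proof. by rewrite /onE !eqxx. Qed.

Lemma onE_mem (f : T * T) (P : pred T) x y : onE f x y -> P f.1 -> P f.2 -> P x /\ P y.
Proof. by case/orP=> /andP[/eqP-> /eqP->]. Qed.

(** A perfect matching through [h] avoiding [e] and [g] is impossible too, and each of the four
    shapes of its obstruction is incompatible with [A], whose only defects are [e] and [g]. *)
Lemma no_global1 e g h A : bad e g h -> global1 r e g A -> False.
Proof.
move=> be [eA1 eA2 gA1 gA2 hA]; have [t3 _] := be; have [re rg rh _] := t3.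
have D x y := @onE_disj3 e g h x y t3.
have [Dg _ Dg'] := D g.1 g.2; have [De De' _] := D e.1 e.2; have [_ Dh Dh'] := D h.1 h.2.
rewrite !onE_self /= ?andbT in De De' Dg Dg' Dh Dh'.
have := bad_obstruction (bad_rot (bad_rot be)); case.
- case=> A' [_ _ _ _ hA'].
  have := @global_global_differ _ _ _ _ g h g.1 g.2 hA hA' _ rg; rewrite onE_self Dg Dg' orbT => H.
  by have // : true = false; apply: H => x y _; case: (onE g x y); case: (onE h x y); case: (onE e x y).
- case=> A' [_ _ _ _ hA'].
  have := @global_global_differ _ _ _ _ e h e.1 e.2 hA hA' _ re; rewrite onE_self De De' => H.
  by have // : true = false; apply: H => x y _; case: (onE g x y); case: (onE h x y); case: (onE e x y).
- case=> A' [k [_ _ _ _ hA']].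
  have := @global_global_differ _ _ _ _ h k h.1 h.2 hA hA' _ rh; rewrite onE_self Dh Dh' => H.
  by have // : false = true; apply: H => x y _; case: (onE g x y); case: (onE h x y); case: (onE e x y); case: (onE k x y).
- case=> B [K [[cK hK1 hK2] [hB1 hB2] [eB1 eB2 eK] [gB1 gB2 gK] [hin hbd]]].
  have nh x y : y \in K -> onE h x y = false.
    by move=> yK; apply/negP => /(@onE_mem h (fun x => x \notin K))[] //; rewrite yK.
  have [x0 [y0 [x0K y0K x0s y0s]]] : exists x0 y0, [/\ x0 \notin K, y0 \notin K,
      (x0 \in A) = (x0 \in B) & (y0 \in A) != (y0 \in B)].
    have := hA _ _ rh; rewrite Dh Dh' /=; case: (boolP (h.1 \in A)) => h1; case: (boolP (h.2 \in A)) => h2 // _.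
      by exists h.1, h.2; rewrite hB1 hB2 h1 (negbTE h2).
    by exists h.2, h.1; rewrite hB1 hB2 h2 (negbTE h1).
  apply: (global_local (f := h) hA _ _ _ cK x0K y0K x0s y0s).
  + move=> x y xK yK rxy; rewrite hin //; case: (D x y).
    by case: (onE g x y); case: (onE h x y); case: (onE e x y).
  + by move=> x y xK yK rxy; rewrite (hbd x y) // nh // addbF.
  + move=> x y xK yK _; rewrite nh //; apply/negP=> /orP[].
      by case/orP=> /andP[/eqP ex /eqP ey]; rewrite -ex -ey xK yK in eK.
    by case/orP=> /andP[/eqP ex /eqP ey]; rewrite -ex -ey xK yK in gK.
Qed.

(** As for [no_global1], the obstruction for [h] is compared with [A]; now the defects agree up to
    the extra edges [k] and [k']. Two global colourings are told apart by the sides on which [e] and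
    [g] lie. *)
Lemma no_global2 e g h k A : bad e g h -> global2 r e g h k A -> False.
Proof.
move=> be [[eA1 eA2] [gA1 gA2] [hA1 hA2] [kA1 kA2 rk nek] hA]; have [t3 _] := be; have [re rg rh _] := t3.
have D x y := @onE_disj3 e g h x y t3.
have Dk x y : onE k x y -> [/\ onE e x y = false, onE g x y = false & onE h x y = false].
  move=> kxy; split; apply/negP.
  - move=> exy; move: nek; rewrite -[onE e _ _]negbK; apply/negP/negPn.
    move: kxy exy; rewrite /onE; do 2 case/orP=> /andP[/eqP-> /eqP->]; by rewrite ?eqxx ?orbT // andbC.
  - by move/(@onE_mem g (fun x => x \notin A)); case/(@onE_mem k (mem A)): kxy => //= -> _ [] .
  - by move/(@onE_mem h (fun x => x \notin A)); case/(@onE_mem k (mem A)): kxy => //= -> _ [] .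
have := bad_obstruction (bad_rot (bad_rot be)); case.
- by case=> A' /(no_global1 (bad_rot (bad_rot be))).
- by case=> A' /(no_global1 (bad_swap (bad_rot (bad_rot be)))).
- case=> A' [k' [[hA'1 hA'2] [eA'1 eA'2] [gA'1 gA'2] _ hA']].
  have := @global_global _ _ _ _ k k' hA hA'; case.
  + move=> x y _; case: (D x y).
    by case: (onE g x y); case: (onE h x y); case: (onE e x y); case: (onE k x y); case: (onE k' x y).
  + by move=> /(_ e.1); rewrite eA1 (negbTE eA'1).
  + by move=> /(_ g.1); rewrite (negbTE gA1) (negbTE gA'1).
- case=> B [K [[cK hK1 hK2] [hB1 hB2] [eB1 eB2 eK] [gB1 gB2 gK] [hin hbd]]].
  have nh x y : y \in K -> onE h x y = false.
    by move=> yK; apply/negP => /(@onE_mem h (fun x => x \notin K))[] //; rewrite yK.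
  have [x0 [x0K x0A x0B]] : exists x0, [/\ x0 \notin K, x0 \notin A & x0 \notin B].
    by case/nandP: gK => gK; [exists g.1|exists g.2].
  have [f [hf1 hf2 hf3]] : exists f, [/\
      forall x y, x \notin K -> y \notin K -> onE f x y = onE k x y,
      forall x y, x \notin K -> y \in K -> onE f x y = onE k x y
    & forall x y, x \in K -> y \in K -> onE f x y = onE k x y] by exists k.
  apply: (@global_local A B K _ k x0 h.1 hA _ _ _ cK) => //.
  + move=> x y xK yK rxy; rewrite hin //; have := Dk x y; case: (onE k x y) => [[]//-> -> ->|_] //=.
    by case: (onE g x y); case: (onE h x y); case: (onE e x y).
  + move=> x y xK yK rxy; rewrite (hbd x y) // nh //=; have := Dk x y; case: (onE k x y) => [[]//-> -> _|_] //=.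
    by case: (onE g x y); case: (onE e x y).
  + move=> x y xK yK rxy; have ne : onE e x y = false.
      by apply/negP; case/orP=> /andP[/eqP ex /eqP ey]; rewrite -ex -ey xK yK in eK.
    have ng : onE g x y = false.
      by apply/negP; case/orP=> /andP[/eqP ex /eqP ey]; rewrite -ex -ey xK yK in gK.
    by rewrite ne ng nh.
  + by rewrite (negbTE x0A) (negbTE x0B).
  + by rewrite hB1 (negbTE hA1).
Qed.

Lemma bad_local e g h : bad e g h -> exists A K, local5 r e g h A K.
Proof.
move=> be; case: (bad_obstruction be) => //.
- by case=> A /(no_global1 be).
- by case=> A /(no_global1 (bad_swap be)).
- by case=> A [k] /(no_global2 be).
Qed.

Section Pair.
Variables (e g h : T * T) (A B K L : {set T}).
Hypotheses (t3 : three_edges e g h) (lK : local5 r e g h A K) (lL : local5 r g e h B L).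
Let U := ~: (K :|: L).
Let Up := [set x in U | (x \in A) == (x \in B)].
Let Um := [set x in U | (x \in A) != (x \in B)].

Definition joins (f : T * T) X Y :=
  (f.1 \in X) && (f.2 \in Y) || (f.2 \in X) && (f.1 \in Y).

Lemma local_noe x y : y \in K -> onE e x y = false.
Proof.
have [[_ e1 e2] _ _ _ _] := lK => yK; apply/negP => /(@onE_mem e (fun x => x \notin K))[] //.
by rewrite yK.
Qed.

Lemma local_nog x y : y \in L -> onE g x y = false.
Proof.
have [[_ e1 e2] _ _ _ _] := lL => yK; apply/negP => /(@onE_mem g (fun x => x \notin L))[] //.
by rewrite yK.
Qed.

Lemma local_nogh x y : x \in K -> y \in K -> onE g x y = false /\ onE h x y = false.
Proof.
have [_ _ [_ _ gK] [_ _ hK] _] := lK => xK yK.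
by split; apply/negP; case/orP=> /andP[/eqP ex /eqP ey]; rewrite -ex -ey xK yK in gK hK.
Qed.

Lemma local_end (f : T * T) x y : onE f x y -> (x = f.1 /\ y = f.2) \/ (x = f.2 /\ y = f.1).
Proof. by case/orP=> /andP[/eqP-> /eqP->]; [left|right]. Qed.

Lemma local_XUm x u : x \in K :\: L -> u \in Um -> r x u -> x \in B.
Proof.
rewrite !inE negb_or => /andP[xL xK] /andP[/andP[uK uL] nAB]; rewrite rs => rux.
have [_ _ [gA1 gA2 _] [hA1 hA2 _] [_ hbd]] := lK.
have [_ [gB1 gB2] _ [hB1 hB2 _] [hin _]] := lL.
have := hbd _ _ uK xK rux; have := hin _ _ uL xL rux; rewrite local_noe //=.
have nh : onE h u x = false.
  by apply/negP => /local_end[[eu _]|[eu _]]; move: nAB; rewrite eu ?(negbTE hA1) ?(negbTE hA2) ?(negbTE hB1) ?(negbTE hB2).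
rewrite nh !orbF; move: nAB; do 3 case: (_ \in _) => //=; by case: (onE g u x).
Qed.

Lemma local_XUp x u : x \in K :\: L -> u \in Up -> r x u -> x \notin B.
Proof.
rewrite !inE negb_or => /andP[xL xK] /andP[/andP[uK uL] /eqP nAB]; rewrite rs => rux.
have [_ _ [gA1 gA2 _] [hA1 hA2 _] [_ hbd]] := lK.
have [_ [gB1 gB2] _ [hB1 hB2 _] [hin _]] := lL.
have := hbd _ _ uK xK rux; have := hin _ _ uL xL rux; rewrite local_noe // nAB.
have ng : onE g u x = false.
  by apply/negP => /local_end[[eu _]|[eu _]]; move: nAB; rewrite eu ?(negbTE gA1) ?(negbTE gA2) ?gB1 ?gB2.
by rewrite ng /=; do 2 case: (_ \in _) => //=; case: (onE h u x).
Qed.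

Lemma local_XZ x z : x \in K :\: L -> z \in K :&: L -> r x z -> x \in B.
Proof.
rewrite !inE => /andP[xL xK] /andP[zK zL] rxz.
have [_ _ _ _ [_ hbd]] := lL.
rewrite (hbd _ _ xL zL rxz) local_noe //; by case: (local_nogh xK zK) => _ ->.
Qed.

Lemma local_XY x y : x \in K :\: L -> y \in L :\: K -> r x y -> (x \in B) = ~~ onE h x y.
Proof.
rewrite !inE => /andP[xL xK] /andP[yK yL] rxy.
have [_ _ _ _ [_ hbd]] := lL.
by rewrite (hbd _ _ xL yL rxy) onE_sym local_noe.
Qed.

Lemma local_ZU z u : z \in K :&: L -> u \in U -> r z u -> u \in Up.
Proof.
rewrite !inE negb_or => /andP[zK zL] /andP[uK uL]; rewrite rs => ruz; rewrite uK uL /=.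
have [_ _ _ _ [_ hbd]] := lL; have [_ _ _ _ [_ hbd']] := lK.
by rewrite (hbd _ _ uL zL ruz) (hbd' _ _ uK zK ruz) local_noe // local_nog.
Qed.

Lemma local_XX x y : x \in K :\: L -> y \in K :\: L -> r x y -> (x \in B) != (y \in B).
Proof.
rewrite !inE => /andP[xL xK] /andP[yL yK] rxy.
have [_ _ _ _ [hin _]] := lL; rewrite (hin _ _ xL yL rxy) local_noe //.
by case: (local_nogh xK yK) => -> ->.
Qed.

(** On [K :\: L] the colouring [B] is proper, and its two classes have their outside neighbours in
    different places. The witnesses [xb], [xn] are the class sizes, [w] the edges between the
    classes, and [m1] the edges to [L :\: K] other than [h]. *)
Lemma local_side : exists xb xn w m1, [/\
  3 * xb = w + edg (K :\: L) Um + edg (K :\: L) (K :&: L) + m1,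
  3 * xn = w + edg (K :\: L) Up + joins h (K :\: L) (L :\: K) &
  edg (K :\: L) (L :\: K) = m1 + joins h (K :\: L) (L :\: K)].
Proof.
set X := K :\: L; set Y := L :\: K; set Z := K :&: L.
pose XB := X :&: B; pose XN := X :\: B.
have XBX x : x \in XB -> x \in X /\ x \in B by rewrite inE => /andP[].
have XNX x : x \in XN -> x \in X /\ x \notin B by rewrite inE => /andP[].
have TE : [set: T] = XB :|: (XN :|: (Um :|: (Up :|: (Z :|: Y)))) by seq_.
have ex (S : {set T}) : 3 * #|S| = edg S XB + (edg S XN + (edg S Um + (edg S Up + (edg S Z + edg S Y)))).
  rewrite -(edgT r3) TE !(edgUr rs) //; dsj.
have z0 : edg XB XB = 0.
  by apply: edg_eq0P => x y /XBX[xX xB] /XBX[yX yB] /(local_XX xX yX); rewrite xB yB.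
have z1 : edg XN XN = 0.
  by apply: edg_eq0P => x y /XNX[xX xB] /XNX[yX yB] /(local_XX xX yX); rewrite (negbTE xB) (negbTE yB).
have z2 : edg XB Up = 0.
  by apply: edg_eq0P => x y /XBX[xX xB] yU /(local_XUp xX yU); rewrite xB.
have z3 : edg XN Um = 0.
  by apply: edg_eq0P => x y /XNX[xX xB] yU /(local_XUm xX yU); rewrite (negbTE xB).
have z4 : edg XN Z = 0.
  by apply: edg_eq0P => x y /XNX[xX xB] yU /(local_XZ xX yU); rewrite (negbTE xB).
have z5 : edg XN Y = joins h X Y.
  have dXY : [disjoint XN & Y] by dsj.
  have h1 x y : x \in XN -> y \in Y -> r x y -> onE h x y.
    by move=> /XNX[xX xB] yY /(local_XY xX yY); rewrite (negbTE xB) => /esym/negbFE.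
  case: (boolP (joins h X Y)) => [hj|nj] /=.
    apply/eqP; rewrite eqn_leq (edg_onE dXY h1) /=.
    have [_ _ rh _] := t3.
    case/orP: hj => /andP[hx hy].
      apply: (@edg_gt0 _ _ _ _ h.1 h.2) => //; rewrite inE hx andbT.
      by rewrite (local_XY hx hy rh) onE_self.
    apply: (@edg_gt0 _ _ _ _ h.2 h.1) => //; last by rewrite rs.
    by rewrite inE hx andbT (local_XY hx hy) 1?onE_sym ?onE_self // rs.
  apply: edg_eq0P => x y xN yY rxy; case: (XNX _ xN) => xX _.
  by case/negP: nj; case: (local_end (h1 _ _ xN yY rxy)) => -[ex1 ey1]; rewrite /joins -ex1 -ey1 xX yY ?orbT.
have cXB := ex XB; have cXN := ex XN.
rewrite z0 z2 in cXB; rewrite z1 z3 z4 z5 in cXN.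
have e1 : edg X Um = edg XB Um by rewrite (edgIDl B) -/XB -/XN z3 addn0.
have e2 : edg X Up = edg XN Up by rewrite (edgIDl B) -/XB -/XN z2.
have e3 : edg X Z = edg XB Z by rewrite (edgIDl B) -/XB -/XN z4 addn0.
have e4 : edg X Y = edg XB Y + joins h X Y by rewrite (edgIDl B) -/XB -/XN z5.
exists #|XB|, #|XN|, (edg XB XN), (edg XB Y); rewrite e1 e2 e3 e4 cXB cXN (edgC XN XB).
by split; rewrite ?add0n ?addn0 -?addnA.
Qed.

End Pair.

Lemma bad_flip e g h : bad e g h -> bad g e h.
Proof. by move=> /bad_swap /bad_rot /bad_rot. Qed.

(** The complement of [B] on [K] and [A] elsewhere fit together to a colouring with the defects [e]
    and [g] alone, a shape already excluded. *)
Lemma local_disjoint_global e g h A B K L : bad e g h -> local5 r e g h A K -> local5 r g e h B L ->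
  K :&: L = set0 -> (forall x, x \in ~: (K :|: L) -> (x \in A) != (x \in B)) ->
  joins h (K :\: L) (L :\: K) -> False.
Proof.
move=> be lK lL KL0 hU hj; have KL x : x \in K -> x \in L -> False.
  by move=> xK xL; have := in_set0 x; rewrite -KL0 inE xK xL.
have [t3 _] := be.
have [[cK eK1 eK2] [eA1 eA2] [gA1 gA2 gK] [hA1 hA2 hK] [hin hbd]] := lK.
have [[cL gL1 gL2] [gB1 gB2] [eB1 eB2 eL] [hB1 hB2 hL] [gin gbd]] := lL.
pose C := [set x | if x \in K then x \notin B else x \in A].
have hend x y : onE h x y -> ((x \in K) || (y \in K)) && ((x \in L) || (y \in L)).
  by move=> /local_end[][-> ->]; move: hj; rewrite /joins !inE => /orP[]/andP[/andP[_ ->] /andP[_ ->]]; rewrite ?orbT.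
have cross x y : x \notin K -> y \in K -> r x y -> ((x \in A) == (y \notin B)) = onE e x y || onE g x y.
  move=> xK yK rxy; have yL : y \notin L by apply/negP => /(KL _ yK).
  have ne : onE e x y = false by rewrite (local_noe lK).
  have := hbd _ _ xK yK rxy; rewrite ne /=; case: (boolP (x \in L)) => xL.
    have ng : onE g x y = false by rewrite onE_sym (local_nog lL).
    have ryx : r y x by rewrite rs.
    have := gbd _ _ yL xL ryx; rewrite !(onE_sym _ y) ne ng /= => -> ->; by case: (onE h x y).
  have nh : onE h x y = false.
    by apply/negP => /hend; rewrite (negbTE xL) (negbTE yL) andbF.
  have := hU x; rewrite !inE negb_or xK xL => /(_ isT); have := gin _ _ xL yL rxy.
  rewrite ne nh /= !orbF => e1 + e2; rewrite e2; move: e1.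
  by do 2 case: (_ \in B) => //=; case: (onE g x y).
apply: (@no_global1 e g h C be); split.
- by rewrite inE (negbTE eK1).
- by rewrite inE (negbTE eK2).
- by rewrite inE; case: ifP => _ //; rewrite gB1.
- by rewrite inE; case: ifP => _ //; rewrite gB2.
- move=> x y rxy; rewrite !inE; case: (boolP (x \in K)) => xK; case: (boolP (y \in K)) => yK.
  + have xL : x \notin L by apply/negP => /(KL _ xK).
    have yL : y \notin L by apply/negP => /(KL _ yK).
    have := gin _ _ xL yL rxy; case: (local_nogh lK xK yK) => _ ->.
    by rewrite orbF orbC => <-; do 2 case: (_ \in B).
  + by have := cross y x yK xK; rewrite rs !(onE_sym _ y) eq_sym; apply.
  + exact: cross.
  + rewrite hin //; have -> : onE h x y = false.
      by apply/negP => /hend; rewrite (negbTE xK) (negbTE yK).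
    by rewrite orbF.
Qed.

(** The cuts of the cells formed by [K] and [L] are 0 or at least 3, and the class sizes add
    congruences modulo 3. Two solutions remain, one of which is refuted by
    [local_disjoint_global]. *)
Lemma local_pair e g h A B K L : bad e g h -> local5 r e g h A K -> local5 r g e h B L ->
  [/\ edg (K :\: L) (L :\: K) = 1, edg (K :&: L) (~: (K :|: L)) = 0,
      edg (K :\: L) (~: (K :|: L)) = 2 /\ edg (L :\: K) (~: (K :|: L)) = 2,
      edg (K :\: L) (K :&: L) = 2 /\ edg (L :\: K) (K :&: L) = 2 &
      joins h (K :\: L) (L :\: K) /\ forall x, x \in ~: (K :|: L) -> (x \in A) != (x \in B)].
Proof.
move=> be lK lL; have [t3 _] := be; have [t3' _] := bad_flip be.
have [[cK eK1 eK2] [eA1 eA2] [gA1 gA2 gK] [hA1 hA2 hK] [hin _]] := lK.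
have [[cL gL1 gL2] [gB1 gB2] [eB1 eB2 eL] [hB1 hB2 hL] [gin _]] := lL.
have [xb [xn [w [m1 [s1 s2 s3]]]]] := local_side t3 lK lL.
have [yb [yn [w' [m1' [s1' s2' s3']]]]] := local_side t3' lL lK.
have jC : joins h (L :\: K) (K :\: L) = joins h (K :\: L) (L :\: K).
  by rewrite /joins orbC ![(_ \in L :\: K) && _]andbC.
have UC : ~: (L :|: K) = ~: (K :|: L) by rewrite setUC.
rewrite jC UC [L :&: K]setIC in s1' s2' s3'.
set X := K :\: L in s1 s2 s3 s1' s2' s3' jC *; set Y := L :\: K in s1 s2 s3 s1' s2' s3' jC *.
set Z := K :&: L in s1 s2 s3 s1' s2' s3' *; set U := ~: (K :|: L) in UC s1 s2 s3 s1' s2' s3' *.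
set Up := [set x in U | (x \in A) == (x \in B)] in s1 s2 s3.
set Um := [set x in U | (x \in A) != (x \in B)] in s1 s2 s3.
have UpE : [set x in U | (x \in B) == (x \in A)] = Up.
  by apply/setP=> x; rewrite !inE [(x \in B) == _]eq_sym.
have UmE : [set x in U | (x \in B) != (x \in A)] = Um.
  by apply/setP=> x; rewrite !inE [(x \in B) == _]eq_sym.
rewrite UpE UmE in s1' s2' s3'.
have ZUm : edg Z Um = 0.
  apply: edg_eq0P => z u zZ uUm rzu; have uU : u \in U by move: uUm; rewrite inE => /andP[].
  by have := local_ZU lK lL zZ uU rzu; move: uUm; rewrite !inE => /andP[_ /negbTE->]; rewrite andbF.
have UpUm : edg Up Um = 0.
  apply: edg_eq0P => u v; rewrite !inE !negb_or => /andP[/andP[uK uL] us] /andP[/andP[vK vL] vs] ruv.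
  have := hin _ _ uK vK ruv; have := gin _ _ uL vL ruv; rewrite orbCA => <-; move: us vs.
  by do 4 case: (_ \in _).
have EU (S : {set T}) : edg S U = edg S Up + edg S Um.
  rewrite -(edgUr rs); last by dsj.
  by congr edg; apply/setP=> x; rewrite !inE; do 2 case: (_ \in _) => //=; do 2 case: (_ \in _) => //=.
have [cutKE cutLE] : cut K = edg X Y + edg X Up + edg X Um + edg Y Z + edg Z Up /\
                     cut L = edg Y X + edg Y Up + edg Y Um + edg X Z + edg Z Up.
  rewrite /cut [edg Y Z]edgC [edg X Z]edgC; split.
    rewrite {1}(_ : K = X :|: Z); last by seq_.
    rewrite (_ : ~: K = Y :|: U); last by seq_.
    rewrite edgUl ?(edgUr rs) ?EU ?ZUm ?addn0 ?addnA //; dsj.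
  rewrite {1}(_ : L = Y :|: Z); last by seq_.
  rewrite (_ : ~: L = X :|: U); last by seq_.
  rewrite edgUl ?(edgUr rs) ?EU ?ZUm ?addn0 ?addnA //; dsj.
have cutXE : cut X = edg X Up + edg X Um + edg X Y + edg X Z.
  rewrite /cut (_ : ~: X = U :|: (Y :|: Z)); last by seq_.
  rewrite !(edgUr rs) ?EU ?addnA //; dsj.
have cutYE : cut Y = edg Y Up + edg Y Um + edg X Y + edg Y Z.
  rewrite /cut (_ : ~: Y = U :|: (X :|: Z)); last by seq_.
  rewrite !(edgUr rs) ?EU ?addnA //; try dsj.
  by rewrite [edg Y X]edgC.
have cutZE : cut Z = edg X Z + edg Y Z + edg Z Up.
  rewrite /cut (_ : ~: Z = X :|: (Y :|: U)); last by seq_.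
  rewrite !(edgUr rs) ?EU ?ZUm ?addn0; try dsj.
  by rewrite [edg Z X]edgC [edg Z Y]edgC addnA.
have cutUmE : cut Um = edg X Um + edg Y Um.
  rewrite /cut (_ : ~: Um = X :|: (Y :|: (Z :|: Up))); last first.
    by apply/setP=> x; rewrite !inE; do 4 case: (_ \in _).
  rewrite !(edgUr rs); try by dsj.
  by rewrite ![edg Um _]edgC ZUm UpUm !addn0.
have cutUpE : cut Up = edg X Up + edg Y Up + edg Z Up.
  rewrite /cut (_ : ~: Up = X :|: (Y :|: (Z :|: Um))); last first.
    by apply/setP=> x; rewrite !inE; do 4 case: (_ \in _).
  rewrite !(edgUr rs) ?UpUm ?addn0; try dsj.
  by rewrite ![edg Up _]edgC addnA.
(* Joining [Up] to [L] or to [K] gives sets with cuts of at least 3, which limits how the edges at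
   [Up] are distributed. *)
have cutLU : cut (L :|: Up) = edg Y X + edg Y Um + edg X Z + edg X Up.
  rewrite /cut (_ : ~: (L :|: Up) = X :|: Um); last first.
    by apply/setP=> x; rewrite !inE; do 4 case: (_ \in _).
  rewrite (_ : L = Y :|: Z); last by seq_.
  rewrite !edgUl ?(edgUr rs) ?UpUm ?ZUm ?addn0; try dsj.
  by rewrite [edg Z X]edgC [edg Up X]edgC.
have cutKU : cut (K :|: Up) = edg X Y + edg X Um + edg Y Z + edg Y Up.
  rewrite /cut (_ : ~: (K :|: Up) = Y :|: Um); last first.
    by apply/setP=> x; rewrite !inE; do 4 case: (_ \in _).
  rewrite (_ : K = X :|: Z); last by seq_.
  rewrite !edgUl ?(edgUr rs) ?UpUm ?ZUm ?addn0; try dsj.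
  by rewrite [edg Z Y]edgC [edg Up Y]edgC.
(* An end of [e] outside [L] and an end of [g] outside [K] lie where the colourings differ, on
   opposite sides of [A]. So [Um] has two vertices, and its cut is at least 4. *)
have [u0 u0U u0A] : exists2 u, u \in Um & u \in A.
  by case/nandP: eL => eL; [exists e.1|exists e.2]; rewrite // !inE negb_or ?eA1 ?eA2 ?(negbTE eB1) ?(negbTE eB2) ?eK1 ?eK2 eL.
have [v0 v0U v0A] : exists2 u, u \in Um & u \notin A.
  by case/nandP: gK => gK; [exists g.1|exists g.2]; rewrite // !inE negb_or ?gB1 ?gB2 ?(negbTE gA1) ?(negbTE gA2) ?gL1 ?gL2 gK.
have u0N S : S \in [:: X; Y; Z; Up; L :|: Up; K :|: Up] -> u0 \notin S.
  move: u0U; rewrite !inE negb_or => /andP[/andP[/negbTE uK /negbTE uL] /negbTE us].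
  by do ?[case/predU1P=> [->|]]; rewrite ?inE ?uK ?uL ?us //= => /eqP->; rewrite !inE uK uL us.
have alt S : S \in [:: X; Y; Z; Up; L :|: Up; K :|: Up] -> cut S = 0 \/ 3 <= cut S.
  move=> hS; have [->|[x xS]] := set_0Vmem S; first by left; rewrite /cut edg0l.
  by right; apply: (cut3' xS (u0N _ hS)).
have Um4 : 4 <= cut Um.
  have x0N : exists x, x \notin Um.
    have [K0|[x xK]] := set_0Vmem K; first by move: cK; rewrite K0 /cut edg0l.
    by exists x; rewrite !inE xK.
  have ge3 : 3 <= cut Um by case: x0N => x xU; apply: (cut3' u0U xU).
  rewrite ltn_neqAle ge3 andbT eq_sym; apply/eqP => /triv3 [].
    move=> /card_le1_eqP/(_ _ _ u0U v0U) euv; by move: v0A; rewrite euv u0A.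
  move=> le1; have KS : K \subset ~: Um.
    by apply/subsetP=> x xK; rewrite !inE xK.
  have := leq_trans (subset_leq_card KS) le1; rewrite leq_eqVlt ltnS leqn0 => /orP[/cards1P[x Kx]|].
    by move: cK; rewrite Kx (cut1 rs ri r3).
  by rewrite cards_eq0 => /eqP K0; move: cK; rewrite K0 /cut edg0l.
have Up0 : cut Up = 0 -> Up = set0.
  move=> c0; have [//|[x xS]] := set_0Vmem Up.
  by have := cut3' xS (u0N Up _); rewrite c0 !inE eqxx !orbT => /(_ isT).
(* The ends of [h] lie outside both [A] and [B]. If no vertex off [K :|: L] has equal colours, each
   end lies in [K] or in [L], and neither set contains both ends. *)
have Upj : Up = set0 -> joins h X Y.
  move=> U0; have hh x : x \notin A -> x \notin B -> (x \in K) || (x \in L).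
    move=> xA xB; apply: contraT => xKL; have := in_set0 x.
    by rewrite -U0 !inE xKL (negbTE xA) (negbTE xB).
  have := hh _ hA1 hB1; have := hh _ hA2 hB2; move: hK hL; rewrite /joins !inE.
  by do 4 case: (_ \in _).
have := @pair_arith (edg X Um) (edg Y Um) (edg X Up) (edg Y Up) (edg X Z) (edg Y Z) (edg Z Up)
  m1 (joins h X Y) xb xn w yb yn w'.
have em : m1' = m1 by apply/eqP; rewrite -(eqn_add2r (joins h X Y)) -s3 -s3' edgC.
rewrite em in s1' s3'.
rewrite -s3 -cutZE -cutUpE.
case.
- by rewrite -cK cutKE; clear; lia.
- by rewrite -cL cutLE [edg Y X]edgC; clear; lia.
- by rewrite -cutUmE.
- by case: (joins _ _ _).
- by rewrite s1.
- by rewrite s2.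
- by rewrite s1'.
- by rewrite s2'.
- by apply: alt; rewrite !inE eqxx ?orbT.
- have [|c0|c3] := alt Up; first by rewrite !inE eqxx !orbT.
    by left; split=> //; rewrite (Upj (Up0 c0)).
  right; split=> //.
    have hI : L :|: Up \in [:: X; Y; Z; Up; L :|: Up; K :|: Up] by rewrite !inE eqxx ?orbT.
    have [c0|] := alt _ hI.
      have [x xU] : exists x, x \in Up by apply/set0Pn; apply: contraTneq c3 => ->; rewrite /cut edg0l.
      have xS : x \in L :|: Up by rewrite inE xU orbT.
      by have := cut3' xS (u0N _ hI); rewrite c0.
    by rewrite cutLU cutUpE -cL cutLE; clear; lia.
  have hI : K :|: Up \in [:: X; Y; Z; Up; L :|: Up; K :|: Up] by rewrite !inE eqxx ?orbT.
    have [c0|] := alt _ hI.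
      have [x xU] : exists x, x \in Up by apply/set0Pn; apply: contraTneq c3 => ->; rewrite /cut edg0l.
      have xS : x \in K :|: Up by rewrite inE xU orbT.
      by have := cut3' xS (u0N _ hI); rewrite c0.
    by rewrite cutKU cutUpE -cK cutKE; clear; lia.
- by rewrite addnC; have := alt X; rewrite cutXE !inE eqxx => /(_ isT); clear; lia.
- by have := alt Y; rewrite cutYE !inE eqxx orbT => /(_ isT); clear; lia.
- case=> Z0 UP0 j1; exfalso; apply: (local_disjoint_global be lK lL).
  + have [//|[x xS]] := set_0Vmem (K :&: L).
    by have := cut3' xS (u0N Z _); rewrite -/Z Z0 !inE eqxx !orbT => /(_ isT).
  + move=> x xU; apply/negP => hs; have := in_set0 x; by rewrite -(Up0 UP0) inE xU hs.
  + by move: j1; rewrite -/X -/Y; case: (joins h X Y).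
- case=> p2 q2 UP0 [x2 y2] [m0 j1].
  have hj : joins h X Y by move: j1; case: (joins h X Y).
  have e0 : Up = set0 by apply: Up0.
  rewrite !EU e0 !(edg0r rs) ZUm s3 m0 hj p2 q2; split=> //; split=> // x xU.
  by apply/negP => hs; have := in_set0 x; rewrite -e0 inE xU hs.
Qed.

End T4.

(** The unknowns count the edges between the eight cells of the Venn diagram of three sets, and the
    first eighteen equations are [local_pair] for the three pairs of sets. The only solution is that
    of the Petersen graph with three edges contracted. *)
Lemma venn_arith OeOg OeOh OeP OeQ OeR OeT OeO OgOh OgP OgQ OgR OgT OgO OhP OhQ OhR OhT OhO
  PQ PR PT PO QR QT QO RT RO TO :
  OeOg + OeR + (OgQ + QR) = 1 -> OhP + PO + (OhT + TO) = 0 -> OeOh + OeO + (OhQ + QO) = 2 ->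
  OgOh + OgO + (OhR + RO) = 2 -> OeP + OeT + (PQ + QT) = 2 -> OgP + OgT + (PR + RT) = 2 ->
  OeOh + OeR + (OhP + PR) = 1 -> OgQ + QO + (OgT + TO) = 0 -> OeOg + OeO + (OgP + PO) = 2 ->
  OgOh + OhO + (OgR + RO) = 2 -> OeQ + OeT + (PQ + PT) = 2 -> OhQ + OhT + (QR + RT) = 2 ->
  OgOh + OgQ + (OhP + PQ) = 1 -> OeR + RO + (OeT + TO) = 0 -> OeOg + OgO + (OeP + PO) = 2 ->
  OeOh + OhO + (OeQ + QO) = 2 -> OgR + OgT + (PR + PT) = 2 -> OhR + OhT + (QR + QT) = 2 ->
  0 < OeOg -> 0 < OeOh -> 0 < OgOh ->
  (OeO + OgO + OhO + PO + QO + RO + TO = 0 \/ 3 <= OeO + OgO + OhO + PO + QO + RO + TO) ->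
  (OeP + OgP + OhP + PQ + PR + PT + PO = 0 \/ 3 <= OeP + OgP + OhP + PQ + PR + PT + PO) ->
  [/\ [/\ OeOg = 1, OeOh = 1 & OgOh = 1], [/\ OeP = 1, OeQ = 1, OgP = 1 & OgR = 1],
      [/\ OhQ = 1, OhR = 1, PT = 1, QT = 1 & RT = 1],
      [/\ OhP = 0, OgQ = 0, OeR = 0, OeT = 0 & OgT = 0] &
      [/\ [/\ OhT = 0, PQ = 0, PR = 0 & QR = 0] & [/\ OeO = 0, OgO = 0, OhO = 0, PO = 0 & [/\ QO = 0, RO = 0 & TO = 0]]]].
Proof.
move=> H1 H2 H3 H4 H5 H6 H7 H8 H9 H10 H11 H12 H13 H14 H15 H16 H17 H18 G1 G2 G3.
have Z1 : [/\ OhP = 0, PO = 0, OhT = 0 & TO = 0] by split; lia.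
have Z2 : [/\ OgQ = 0, QO = 0 & OgT = 0] by split; lia.
have Z3 : [/\ OeR = 0, RO = 0 & OeT = 0] by split; lia.
case: Z1 Z2 Z3 => ? ? ? ? [? ? ?] [? ? ?]; subst.
have Z4 : [/\ OeOg = 1, OeOh = 1, OgOh = 1 & [/\ QR = 0, PR = 0 & PQ = 0]] by split; [lia|lia|lia|split; lia].
case: Z4 => ? ? ? [? ? ?]; subst.
case=> [Z5|Z5] Z6.
  have [? ? ?] : [/\ OeO = 0, OgO = 0 & OhO = 0] by split; lia.
  subst; do !split=> //; lia.
exfalso; lia.
Qed.

(** * Assembling the three exceptional sets *)

Section Venn.
Variables (T : finType) (r : rel T).
Hypotheses (rs : symmetric r) (ri : irreflexive r).
Hypothesis (r3 : forall x, #|[set y | r x y]| = 3).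
Hypothesis cut3 : forall X : {set T}, X != set0 -> X != setT -> 3 <= cut r X.
Hypothesis triv3 : forall X : {set T}, cut r X = 3 -> #|X| <= 1 \/ #|~: X| <= 1.
Implicit Types (X Y Z A B C K L U W PA PB : {set T}).
Local Notation edg := (edg r).
Local Notation cut := (cut r).
Let edgC := edgC rs.
Let edgIDl := edgIDl r.
Let edgIDr := edgIDr rs.
Let cut3' := cut3' cut3.

(** By Hall's theorem: a deficient [X], together with its neighbours and [PB], would have a cut of
    at most 2, or a cut of 3 with two vertices on each side. *)
Lemma piece_match W C PA PB :
  (forall x y, x \in W -> y \in W -> r x y -> (x \in C) != (y \in C)) ->
  PA \subset W :&: C -> PB \subset W :\: C -> #|PA| = #|PB| -> 0 < #|PB| ->
  edg (W :&: C) (~: W) = 2 -> edg (W :\: C) (~: W) = 2 ->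
  2 * edg (W :&: C :\: PA) (~: W) + 3 * #|PB| <= 5 \/
    2 * edg (W :&: C :\: PA) (~: W) + 3 * #|PB| <= 6 /\ 2 <= #|PB| ->
  perfect (W :\: (PA :|: PB)) r.
Proof.
move=> bip PAW PBW ePP PB0 oA oB hyp.
pose A' := W :&: C :\: PA; pose B' := W :\: C :\: PB.
have zA : edg (W :&: C) (W :&: C) = 0.
  apply: edg_eq0P => x y; rewrite !inE => /andP[xW xC] /andP[yW yC] /(bip _ _ xW yW).
  by rewrite xC yC.
have zB : edg (W :\: C) (W :\: C) = 0.
  apply: edg_eq0P => x y; rewrite !inE => /andP[xC xW] /andP[yC yW] /(bip _ _ xW yW).
  by rewrite (negbTE xC) (negbTE yC).
have bal : #|W :&: C| = #|W :\: C|.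
  have TE : [set: T] = (W :&: C) :|: ((W :\: C) :|: ~: W) by seq_.
  have : 3 * #|W :&: C| = 3 * #|W :\: C|.
    rewrite -!(edgT r3) TE !(edgUr rs); try by dsj.
    by rewrite zA zB oA oB [edg (W :\: C) (W :&: C)]edgC.
  by move/eqP; rewrite eqn_mul2l => /eqP.
have dAB : [disjoint A' & B'] by dsj.
have eAB : #|A'| = #|B'|.
  by rewrite [LHS]cardsD [RHS]cardsD (setIidPr PAW) (setIidPr PBW) bal ePP.
have [a aPA] : exists a, a \in PA by apply/set0Pn; rewrite -card_gt0 ePP.
have [b bPB] : exists b, b \in PB by apply/set0Pn; rewrite -card_gt0.
have PAW' x : x \in PA -> x \in W /\ x \in C by move/(subsetP PAW); rewrite inE => /andP[].
have PBW' x : x \in PB -> x \in W /\ x \notin C by move/(subsetP PBW); rewrite inE => /andP[].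
have [X XA|m [m1 m2]] := @hall T r A' B' rs ri dAB eAB; last first.
  apply/perfectP; exists m => x xW; have : x \in A' \/ x \in B'.
    move: xW; rewrite !inE negb_or => /andP[/andP[-> ->] ->] /=.
    by case: (x \in C); [left|right].
  have inW y : y \in A' \/ y \in B' -> y \in W :\: (PA :|: PB).
    case; rewrite !inE => /and3P[h1 h2 h3]; rewrite ?h1 ?h2 ?h3 /= ?andbT.
      by apply/norP; split=> //; apply/negP => hP; have [_] := PBW' _ hP; rewrite h3.
    by apply/norP; split=> //; apply/negP => hP; have [_] := PAW' _ hP; rewrite (negbTE h2).
  case=> [/m1|/m2] [h1 h2 h3]; split=> //; apply: inW; [by right|by left].
set Y := nbrs r X B'; rewrite leqNgt; apply/negP => ltY.
have XW x : x \in X -> [/\ x \in W, x \in C & x \notin PA].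
  by move/(subsetP XA); rewrite !inE => /andP[-> /andP[-> ->]].
have YW y : y \in Y -> [/\ y \in W, y \notin C & y \notin PB].
  by rewrite inE => /andP[+ _]; rewrite !inE => /and3P[-> -> ->].
have dXY : [disjoint X & Y :|: PB].
  rewrite -setI_eq0; apply/eqP/setP=> x; rewrite in_setI in_setU in_set0; apply/negP=> /andP[/XW[_ xC _]].
  by case/orP=> [/YW[]|/PBW'[]]; rewrite xC.
have dYP : [disjoint Y & PB].
  by rewrite -setI_eq0; apply/eqP/setP=> x; rewrite in_setI in_set0; apply/negP=> /andP[/YW[_ _ /negP]].
pose S := X :|: (Y :|: PB).
have eX : 3 * #|X| = edg X (Y :|: PB) + edg X (~: W).
  rewrite -(edgT r3) (edgIDr (Y :|: PB)) setTI; congr addn.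
  rewrite (edgIDr W) (_ : edg X (_ :&: W) = 0); last first.
    apply: edg_eq0P => x y xX; rewrite in_setI in_setD in_setU negb_or.
    move=> /andP[/andP[/andP[yY yP] _] yW] rxy; case: (XW _ xX) => xW xC _.
    have := bip _ _ xW yW rxy; rewrite xC => yC.
    case/negP: yY; rewrite inE !inE yP yW yC /=; apply/exists_inP; by exists x.
  rewrite add0n; congr edg; apply/setP=> x; rewrite !in_setD in_setT andbT in_setU in_setC.
  case xW: (x \in W) => //=; apply/negP => /orP[/YW[]|/PBW'[]]; by rewrite xW.
have eO : edg X (~: W) <= edg A' (~: W).
  rewrite (edgIDl X A') (setIidPr XA); exact: leq_addr.
have eS : edg S S = 2 * edg X (Y :|: PB).
  rewrite /S edgUl // [edg X (X :|: _)](edgUr rs) // [edg (Y :|: PB) (X :|: _)](edgUr rs) //.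
  rewrite (_ : edg X X = 0); last first.
    by apply/eqP; rewrite -leqn0 -zA -!card_epairs subset_leq_card //; apply/subsetP=> -[x y]; rewrite !inE /= =>
       /and3P[/XW[-> -> _] /XW[-> -> _] ->].
  rewrite (_ : edg (Y :|: PB) (Y :|: PB) = 0).
    by rewrite addn0 add0n (edgC (Y :|: PB)) mul2n addnn.
  have YPW x : x \in Y :|: PB -> x \in W :\: C.
    by rewrite in_setU in_setD => /orP[/YW[-> -> _]|/PBW'[-> ->]].
  apply/eqP; rewrite -leqn0 -zB -!card_epairs subset_leq_card //; apply/subsetP=> -[x y].
  by rewrite inE => /and3P[/= /YPW xW /YPW yW rxy]; rewrite inE /= xW yW rxy.
have cS : #|S| = #|X| + (#|Y| + #|PB|).
  rewrite /S !cardsU (_ : X :&: _ = set0); last by apply/eqP; rewrite setI_eq0.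
  by rewrite (_ : Y :&: _ = set0) ?cards0 ?subn0 //; apply/eqP; rewrite setI_eq0.
have := cut_card rs r3 S; rewrite eS cS.
have bS : b \in S by rewrite !in_setU bPB !orbT.
have aS x : x \in PA -> x \notin S.
  move=> xPA; have [xW xC] := PAW' _ xPA.
  rewrite !in_setU; apply/negP => /or3P[/XW[_ _]|/YW[_]|/PBW'[_]]; by rewrite ?xPA ?xC.
have := cut3' bS (aS _ aPA).
rewrite -/A' in hyp; move=> c3 cE.
have c3' : cut S = 3 /\ 2 <= #|PB|.
  by move: hyp eX eO cE c3 ltY; clear; case=> [h|[h h']]; lia.
case: c3' => c3' PB2; case: (triv3 c3') => le1.
  have : #|PB| <= #|S| by apply: subset_leq_card; apply/subsetP=> x xP; rewrite !in_setU xP !orbT.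
  by move: le1 PB2; clear; lia.
have : #|PA| <= #|~: S| by apply: subset_leq_card; apply/subsetP=> x xP; rewrite in_setC aS.
by rewrite ePP; move: le1 PB2; clear; lia.
Qed.

(* [a1], [a2] (resp. [b1], [b2]) are the ends in [C] (resp. off [C]) of the four edges leaving [W]. *)
Definition piece W C a1 a2 b1 b2 :=
  [/\ forall x y, x \in W -> y \in W -> r x y -> (x \in C) != (y \in C),
      [/\ a1 \in W :&: C, a2 \in W :&: C, b1 \in W :\: C & b2 \in W :\: C],
      edg (W :&: C) (~: W) = 2 /\ edg (W :\: C) (~: W) = 2,
      0 < edg [set a1] (~: W) /\ 0 < edg [set a2] (~: W) &
      #|W| != 2 -> a1 != a2 /\ b1 != b2].

Lemma piece_match2 W C a1 a2 b1 b2 : piece W C a1 a2 b1 b2 -> perfect (W :\: [set a1; b1]) r.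
Proof.
case=> bip [a1W a2W b1W b2W] [oA oB] [pa1 _] _; apply: (piece_match bip) => //.
- by rewrite sub1set.
- by rewrite sub1set.
- by rewrite !cards1.
- by rewrite cards1.
- left; rewrite cards1; have : edg (W :&: C) (~: W) = edg [set a1] (~: W) + edg (W :&: C :\: [set a1]) (~: W).
    by rewrite (edgIDl [set a1]) (setIidPr _) ?sub1set.
  by rewrite oA; move: pa1; clear; lia.
Qed.

Lemma piece_match4 W C a1 a2 b1 b2 : piece W C a1 a2 b1 b2 -> #|W| != 2 ->
  perfect (W :\: ([set a1; a2] :|: [set b1; b2])) r.
Proof.
case=> bip [a1W a2W b1W b2W] [oA oB] [pa1 pa2] h /h[na nb0]; apply: (piece_match bip) => //.
- by rewrite subUset !sub1set a1W.
- by rewrite subUset !sub1set b1W.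
- by rewrite !cards2 na nb0.
- by rewrite cards2.
- right; rewrite cards2 nb0; have : edg (W :&: C) (~: W) = edg [set a1] (~: W) + edg [set a2] (~: W) + edg (W :&: C :\: [set a1; a2]) (~: W).
    rewrite (edgIDl [set a1; a2]) (setIidPr _) ?subUset ?sub1set ?a1W //; congr addn.
    by rewrite edgUl // disjoints1 inE.
  by rewrite oA; move: pa1 pa2; clear; split=> //; lia.
Qed.

(** Taking [a] out of [W] trades two leaving edges for one, and the resulting cut of 3 isolates a
    vertex. *)
Lemma two_ports W a b u v : cut W = 4 -> a \in W -> b \in W -> a != b -> u \notin W -> v \notin W -> u != v ->
  r a u -> r a v -> #|W| = 2.
Proof.
move=> cW aW bW nab uW vW nuv rau rav.
have e1 : cut W = edg [set a] (~: W) + edg (W :\ a) (~: W).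
  by rewrite /cut (edgIDl [set a]) (setIidPr _) ?sub1set.
have e2 : 3 = edg [set a] (~: W) + edg [set a] (W :\ a).
  rewrite -(cut1 rs ri r3 a) /cut -(edgUr rs); last first.
    by rewrite -setI_eq0; apply/eqP/setP=> x; rewrite !inE; case: (x \in W); rewrite ?andbF.
  by congr edg; apply/setP=> x; rewrite !inE; case: (eqVneq x a) => [->|]; rewrite ?aW //=; case: (x \in W).
have e3 : cut (W :\ a) = edg (W :\ a) (~: W) + edg [set a] (W :\ a).
  rewrite [edg [set a] _]edgC -(edgUr rs); last first.
    by rewrite disjoint_sym disjoints1 inE negbK.
  by congr edg; apply/setP=> x; rewrite !inE; case: (eqVneq x a) => [->|]; rewrite ?aW //= ?orbT ?orbF.
have g2 : 2 <= edg [set a] (~: W).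
  rewrite /edg big_set1; apply: (@leq_trans #|[set u; v]|); first by rewrite cards2 nuv.
  by apply: subset_leq_card; apply/subsetP=> x; rewrite !inE => /orP[]/eqP->; rewrite ?uW ?vW ?rau ?rav.
have ge3 : 3 <= cut (W :\ a) by apply: (@cut3' _ b a); rewrite !inE ?eqxx // eq_sym nab bW.
have c3 : cut (W :\ a) = 3 by move: e1 e2 e3 g2 ge3; rewrite cW; clear; lia.
have cWa : #|W| = #|W :\ a|.+1 by rewrite (cardsD1 a) aW.
have ba : b \in W :\ a by rewrite !inE eq_sym nab bW.
case: (triv3 c3) => le1.
  rewrite cWa; congr _.+1; apply/eqP; rewrite eqn_leq le1 card_gt0; by apply/set0Pn; exists b.
have := @subset_leq_card _ [set a; u] (~: (W :\ a)); rewrite cards2.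
have -> : a != u by apply: contraNneq uW => <-.
move=> H; have : 1 < #|~: (W :\ a)|.
  by apply: H; apply/subsetP=> x; rewrite !inE => /orP[]/eqP->; rewrite ?eqxx // (negbTE uW) andbF.
by rewrite ltnNge le1.
Qed.

(** The part of [K1] off the two other sets is 2-coloured by [A2]. Its four ports are an end of [g],
    an end of [h] and the neighbours [x12], [x13] of [z12], [z13]; by [two_ports], ports on the same
    side coincide only if the part has two vertices. *)
Lemma piece_of e g h K1 K2 K3 A2 A3 z12 z13 x12 x13 : bad r e g h ->
  local5 r g h e A2 K2 -> local5 r h e g A3 K3 ->
  e.1 \notin K1 -> e.2 \notin K1 -> joins h (K1 :\: K2) (K2 :\: K1) -> joins g (K1 :\: K3) (K3 :\: K1) ->
  (forall x, x \in ~: (K2 :|: K3) -> (x \in A2) != (x \in A3)) ->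
  z12 \in K1 :&: K2 :\: K3 -> z13 \in K1 :&: K3 :\: K2 ->
  x12 \in K1 :\: K2 :\: K3 -> x13 \in K1 :\: K2 :\: K3 -> r x12 z12 -> r x13 z13 ->
  cut (K1 :\: K2 :\: K3) = 4 ->
  exists a b, [/\ end_of g a, end_of h b & piece (K1 :\: K2 :\: K3) A2 a x12 b x13].
Proof.
move=> be l2 l3 e1 e2 hj gj hU z12Z z13Z x12W x13W rx12 rx13 cW; have [t3 _] := be.
have [[cK2 g1 g2] [gA1 gA2] [hA1 hA2 _] [eA1 eA2 _] [hin2 hbd2]] := l2.
have [[cK3 h1 h2] _ _ _ [hin3 hbd3]] := l3.
set W := K1 :\: K2 :\: K3 in x12W x13W cW *.
have [a [a' [aW a'K [eg rg ga]]]] : exists a a', [/\ a \in W, a' \in K3 :\: K1 :\: K2 & 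
    [/\ end_of g a, r a a' & a \in A2]].
  have [_ rg _ _] := t3.
  case/orP: gj; rewrite !inE => /andP[/andP[h3 h4] /andP[h5 h6]]; [exists g.1, g.2|exists g.2, g.1].
    by rewrite !inE h3 h4 g1 h5 h6 g2 /end_of eqxx rg gA1.
  by rewrite !inE h3 h4 g1 h5 h6 g2 /end_of eqxx orbT rs rg gA2.
have [b [b' [bW b'K [eh rh hb]]]] : exists b b', [/\ b \in W, b' \in K2 :\: K1 :\: K3 & 
    [/\ end_of h b, r b b' & b \notin A2]].
  have [_ _ rh _] := t3.
  case/orP: hj; rewrite !inE => /andP[/andP[h3 h4] /andP[h5 h6]]; [exists h.1, h.2|exists h.2, h.1].
    by rewrite !inE h3 h4 h1 h5 h6 h2 /end_of eqxx rh hA1.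
  by rewrite !inE h3 h4 h1 h5 h6 h2 /end_of eqxx orbT rs rh hA2.
have nz (f : T * T) y z (S : {set T}) : f.1 \notin S -> f.2 \notin S -> z \in S ->
    onE f y z = false /\ onE f z y = false.
  move=> f1 f2 zS; split; apply/negP => H; have [] := @onE_mem _ f (fun x => x \notin S) _ _ H f1 f2; by rewrite zS.
have x12A : x12 \in A2.
  move: z12Z x12W; rewrite !inE => /andP[z3 /andP[z1 z2]] /and3P[x3 x2 x1].
  rewrite (hbd2 x12 z12) //.
  have [_ ->] := nz e z12 x12 K1 e1 e2 x1; rewrite orbF.
  apply/negP=> /local_end ex; case/orP: hj; rewrite !inE => /andP[/andP[h3 h4] /andP[h5 h6]].
    by case: ex => -[ex ez]; move: h5 h3; rewrite -?ez -?ex ?z1 ?z2.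
  by case: ex => -[ex ez]; move: h5 h3; rewrite -?ez -?ex ?z1 ?z2.
have x13A : x13 \notin A2.
  have xU : x13 \in ~: (K2 :|: K3) by move: x13W; rewrite !inE negb_or => /and3P[-> -> _].
  have := hU _ xU; suff -> : x13 \in A3 by case: (_ \in A2).
  move: z13Z x13W; rewrite !inE => /andP[z2 /andP[z1 z3]] /and3P[x3 x2 x1].
  rewrite (hbd3 x13 z13) //.
  have [_ ->] := nz e z13 x13 K1 e1 e2 x1; rewrite /=.
  apply/negP=> /local_end ex; case/orP: gj; rewrite !inE => /andP[/andP[h3 h4] /andP[h5 h6]].
    by case: ex => -[ex ez]; move: h5 h3; rewrite -?ez -?ex ?z1 ?z3.
  by case: ex => -[ex ez]; move: h5 h3; rewrite -?ez -?ex ?z1 ?z3.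
exists a, b; split=> //.
have WE x : x \in W -> [/\ x \in K1, x \notin K2 & x \notin K3] by rewrite !inE => /and3P[-> -> ->].
have bip x y : x \in W -> y \in W -> r x y -> (x \in A2) != (y \in A2).
  move=> /WE[x1 x2 x3] /WE[y1 y2 y3] rxy; have := hin2 _ _ x2 y2 rxy.
  have [_ ->] := nz e y x K1 e1 e2 x1; rewrite orbF.
  have -> : onE h x y = false.
    apply/negP => /local_end ex; case/orP: hj; rewrite !inE => /andP[_ /andP[_ h6]].
      by case: ex => -[ex ez]; move: h6; rewrite -?ez -?ex ?(negbTE x2) ?(negbTE y2).
    by case: ex => -[ex ez]; move: h6; rewrite -?ez -?ex ?(negbTE x2) ?(negbTE y2).
  have -> : onE g x y = false.
    apply/negP => /local_end ex; case/orP: gj; rewrite !inE => /andP[_ /andP[_ h6]].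
      by case: ex => -[ex ez]; move: h6; rewrite -?ez -?ex ?(negbTE x3) ?(negbTE y3).
    by case: ex => -[ex ez]; move: h6; rewrite -?ez -?ex ?(negbTE x3) ?(negbTE y3).
  by move=> /= ->.
have out x : x \in K2 :|: K3 -> x \in ~: W by rewrite !inE => /orP[]->; rewrite ?andbF.
have a'O : a' \in ~: W by apply: out; move: a'K; rewrite !inE => /and3P[_ _ ->]; rewrite orbT.
have b'O : b' \in ~: W by apply: out; move: b'K; rewrite !inE => /and3P[_ _ ->].
have z12O : z12 \in ~: W by apply: out; move: z12Z; rewrite !inE => /and3P[_ _ ->].
have z13O : z13 \in ~: W by apply: out; move: z13Z; rewrite !inE => /and3P[_ _ ->]; rewrite orbT.
have naz : a' != z12 by apply: contraTneq a'K => ->; move: z12Z; rewrite !inE => /and3P[_ -> ->].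
have nbz : b' != z13 by apply: contraTneq b'K => ->; move: z13Z; rewrite !inE => /and3P[_ -> ->]; rewrite andbF.
have two (S : {set T}) x x' u v : x \in S -> x' \in S -> u \in ~: W -> v \in ~: W -> u != v -> r x u -> r x' v ->
    2 <= edg S (~: W).
  move=> xS x'S uO vO nuv ru rv.
  rewrite (edgIDr [set u]) -[2]/(1 + 1); apply: leq_add.
    by apply: (@edg_gt0 _ _ _ _ x u) => //; rewrite in_setI uO set11.
  by apply: (@edg_gt0 _ _ _ _ x' v) => //; rewrite in_setD vO in_set1 eq_sym nuv.
have gA : 2 <= edg (W :&: A2) (~: W).
  by apply: (two _ a x12 a' z12) => //; rewrite in_setI ?aW ?x12W.
have gB : 2 <= edg (W :\: A2) (~: W).
  by apply: (two _ b x13 b' z13) => //; rewrite in_setD ?bW ?x13W ?hb ?x13A.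
have eAB : edg (W :&: A2) (~: W) + edg (W :\: A2) (~: W) = 4 by rewrite -edgIDl.
have ab : a != b by apply: contraNneq hb => <-.
split=> //.
- by split; [rewrite in_setI aW ga|rewrite in_setI x12W x12A|rewrite in_setD bW hb|rewrite in_setD x13W x13A].
- by move: gA gB eAB; clear; lia.
- by split; [apply: (@edg_gt0 _ _ _ _ a a')|apply: (@edg_gt0 _ _ _ _ x12 z12)]; rewrite ?set11.
- move=> n2; split; apply: contraNneq n2 => eab; apply/eqP.
    apply: (@two_ports W a b a' z12) => //; rewrite -?in_setC // ?eab //.
  have ba : b != a by rewrite eq_sym.
  have rbz : r b z13 by rewrite eab.
  by apply: (two_ports cW bW aW ba _ _ nbz rh rbz); rewrite -in_setC.
Qed.

Lemma local5C e g h A K : local5 r e g h A K -> local5 r e h g A K.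
Proof.
case=> h1 h2 h3 h4 [h5 h6]; split=> //; split=> x y xK yK rxy; first by rewrite h5 // [onE g x y || _]orbC.
by rewrite (h6 x y) // orbC.
Qed.

(** Such a matching, completed by the three edges, would contain all three of them, an odd
    number. *)
Lemma bad_imperfect e g h : bad r e g h ->
  ~~ perfect (~: ([set e.1; e.2] :|: [set g.1; g.2] :|: [set h.1; h.2])) r.
Proof.
case=> [[re rg rh]]; rewrite /= !inE !negb_or => /and5P[/and5P[n1 n2 n3 n4 n5] /and4P[n6 n7 n8 n9]
  /and3P[n10 n11 n12] /andP[n13 n14] /andP[n15 _]] no.
apply/negP; set W := ~: _ => pW.
have [m hm] := perfectP _ _ pW.
pose m' x := if x == e.1 then e.2 else if x == e.2 then e.1 else
             if x == g.1 then g.2 else if x == g.2 then g.1 else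
             if x == h.1 then h.2 else if x == h.2 then h.1 else m x.
have inW x : x \in W = [&& x != e.1, x != e.2, x != g.1, x != g.2, x != h.1 & x != h.2].
  by rewrite !inE !negb_or -!andbA.
have m'W x : x \in W -> m' x = m x.
  by rewrite inW /m' => /and5P[/negbTE-> /negbTE-> /negbTE-> /negbTE-> /andP[/negbTE-> /negbTE->]].
have [q1 q2] : m' e.1 = e.2 /\ m' e.2 = e.1 by rewrite /m' !eqxx [e.2 == _]eq_sym (negbTE n1).
have [q3 q4] : m' g.1 = g.2 /\ m' g.2 = g.1.
  by rewrite /m' !eqxx ![g.1 == _]eq_sym ![g.2 == _]eq_sym (negbTE n2) (negbTE n3) (negbTE n6) (negbTE n7) (negbTE n10).
have [q5 q6] : m' h.1 = h.2 /\ m' h.2 = h.1.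
  by rewrite /m' !eqxx ![h.1 == _]eq_sym ![h.2 == _]eq_sym (negbTE n4) (negbTE n5) (negbTE n8) (negbTE n9) (negbTE n11)
     (negbTE n12) (negbTE n13) (negbTE n14) (negbTE n15).
have cases x : x \in W \/ x \in [:: e.1; e.2; g.1; g.2; h.1; h.2].
  by rewrite inW !inE; case: (x == e.1); case: (x == e.2); case: (x == g.1); case: (x == g.2); case: (x == h.1);
     case: (x == h.2); auto.
have H1 x : m' (m' x) = x.
  case: (cases x) => [xW|]; first by case: (hm _ xW) => h1 h2 _; rewrite m'W // m'W.
  by rewrite !inE => /or3P[|| /or4P[]] /eqP->; rewrite ?q1 ?q2 ?q3 ?q4 ?q5 ?q6.
have H2 x : r x (m' x).
  case: (cases x) => [xW|]; first by case: (hm _ xW) => h1 h2 h3; rewrite m'W.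
  by rewrite !inE => /or3P[|| /or4P[]] /eqP->; rewrite ?q1 ?q2 ?q3 ?q4 ?q5 ?q6 // rs.
by have := no m' H1 H2; rewrite q1 q3 q5 !eqxx.
Qed.


Lemma edg_quad A B C K : [disjoint A & B] -> [disjoint C & K] ->
  edg (A :|: B) (C :|: K) = edg A C + edg A K + (edg B C + edg B K).
Proof. by move=> h1 h2; rewrite edgUl // !(edgUr rs). Qed.

Lemma ends_set (f : T * T) a b : end_of f a -> end_of f b -> a != b -> [set f.1; f.2] = [set a; b].
Proof.
by case/orP=> /eqP-> /orP[]/eqP->; rewrite ?eqxx // => _; rewrite setUC.
Qed.

(* If one of the three 4-edge-cut pieces is not a single edge, all four of its ports can be matched outwards, and the
   resulting perfect matching contains [e], [g] and [h]. *)
Lemma three_pieces e g h (O1 O2 O3 C1 C2 C3 : {set T}) ge x12 he x13 hg y1 eg y2 eh w1 gh w2 z12 z13 z23 t : bad r e g h ->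
  [/\ [disjoint O1 & O2], [disjoint O1 & O3] & [disjoint O2 & O3]] ->
  (forall x, [|| x \in O1, x \in O2, x \in O3 | x \in [:: z12; z13; z23; t]]) ->
  (forall z, z \in [:: z12; z13; z23; t] -> [/\ z \notin O1, z \notin O2 & z \notin O3]) ->
  uniq [:: z12; z13; z23; t] -> r x12 z12 -> r x13 z13 -> r t z23 ->
  piece O1 C1 ge x12 he x13 -> piece O2 C2 hg y1 eg y2 -> piece O3 C3 eh w1 gh w2 ->
  [/\ end_of g ge, end_of h he & end_of h hg] -> [/\ end_of e eg, end_of e eh & end_of g gh] -> #|O1| = 2.
Proof.
move=> be [d12 d13 d23] cov zn uz rx12 rx13 rt p1 p2 p3 [n1 n2 n3] [n4 n5 n6].
apply/eqP; apply: contraT => nO1; case/negP: (bad_imperfect be).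
have q1 := piece_match4 p1 nO1; have q2 := piece_match2 p2; have q3 := piece_match2 p3.
have [_ [geO x12O heO x13O] _ _ /(_ nO1)[ngx nhx]] := p1.
have [_ [hgO _ egO _] _ _ _] := p2; have [_ [ehO _ ghO _] _ _ _] := p3.
move: geO x12O heO x13O hgO egO ehO ghO; rewrite !in_setI !in_setD.
move=> /andP[geO geC] /andP[x12O x12C] /andP[heC heO] /andP[x13C x13O] /andP[hgO hgC] /andP[egC egO]
  /andP[ehO ehC] /andP[ghC ghO].
have ndC x y (S : {set T}) : x \in S -> y \notin S -> x != y by move=> xS; apply: contraNneq => <-.
have nd x y (S S' : {set T}) : [disjoint S & S'] -> x \in S -> y \in S' -> x != y.
  by move=> dS xS yS; apply: contraTneq yS => <-; rewrite (disjointFr dS xS).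
rewrite (ends_set n4 n5 (nd _ _ _ _ d23 egO ehO)) (ends_set n1 n6 (nd _ _ _ _ d13 geO ghO)).
rewrite (ends_set n2 n3 (nd _ _ _ _ d12 heO hgO)).
move: uz; rewrite /= !in_cons !in_nil !orbF !negb_or => /and4P[/and3P[u1 u2 u3] /andP[u4 u5] u6 _].
have [zn1 zn2 zn3] := zn z12 (mem_head _ _).
have [zm1 zm2 zm3] : [/\ z13 \notin O1, z13 \notin O2 & z13 \notin O3] by apply: zn; rewrite !inE eqxx ?orbT.
have [zk1 zk2 zk3] : [/\ z23 \notin O1, z23 \notin O2 & z23 \notin O3] by apply: zn; rewrite !inE eqxx ?orbT.
have [zt1 zt2 zt3] : [/\ t \notin O1, t \notin O2 & t \notin O3] by apply: zn; rewrite !inE eqxx ?orbT.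
have s1 := perfect2 rs (ndC _ _ _ x12O zn1) rx12.
have s2 := perfect2 rs (ndC _ _ _ x13O zm1) rx13.
have s3 : perfect [set t; z23] r by apply: perfect2 => //; rewrite eq_sym.
(* The ports [x12] and [x13] are matched outwards to [z12] and [z13]; the two other ports of the
   first piece are left to the edges [g] and [h]. *)
pose S1 := O1 :\: ([set ge; x12] :|: [set he; x13]) :|: [set x12; z12] :|: [set x13; z13].
have xx : x12 != x13 by apply: ndC x12C x13C.
have ps1 : perfect S1 r.
  apply: perfectU => //; last first.
    apply: perfectU => //; rewrite -setI_eq0; apply/eqP/setP=> x; rewrite !inE.
    case: (eqVneq x x12) => [->|_]; first by rewrite orbT.
    by case: (eqVneq x z12) => [->|_]; rewrite ?andbF // (negbTE zn1) andbF.
  rewrite -setI_eq0; apply/eqP/setP=> x; rewrite !inE.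
  case: (eqVneq x x13) => [->|_].
    rewrite !orbT /= [x13 == x12]eq_sym (negbTE xx) /=.
    by rewrite (negbTE (ndC _ _ _ x13O zn1)).
  case: (eqVneq x z13) => [->|_]; rewrite ?andbF // (negbTE zm1) andbF /=.
  by rewrite [z13 == x12]eq_sym (negbTE (ndC _ _ _ x12O zm1)) [z13 == z12]eq_sym (negbTE u1).
pose S2 := O2 :\: [set hg; eg] :|: O3 :\: [set eh; gh] :|: [set t; z23].
have ps2 : perfect S2 r.
  apply: perfectU => //; last first.
    apply: perfectU => //; rewrite -setI_eq0; apply/eqP/setP=> x; rewrite !inE; case xO: (x \in O2); rewrite ?andbF //.
    by rewrite (disjointFr d23 xO) !andbF.
  rewrite -setI_eq0; apply/eqP/setP=> x; rewrite !inE.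
  case: (eqVneq x t) => [->|_]; first by rewrite (negbTE zt2) (negbTE zt3) !andbF.
  by case: (eqVneq x z23) => [->|_]; rewrite ?andbF // (negbTE zk2) (negbTE zk3) !andbF.
rewrite (_ : ~: _ = S1 :|: S2).
  apply: perfectU => //.
  have in1 x : x \in S1 -> (x \in O1) || (x \in [:: z12; z13]).
    rewrite !inE => /orP[/orP[/andP[_ ->]//|/orP[]/eqP->]|/orP[]/eqP->]; by rewrite ?x12O ?x13O ?eqxx ?orbT.
  have in2 x : x \in S2 -> [|| x \in O2, x \in O3 | x \in [:: t; z23]].
    rewrite !inE => /orP[/orP[/andP[_ ->]//|/andP[_ ->]]|/orP[]/eqP->]; by rewrite ?eqxx ?orbT.
  rewrite -setI_eq0; apply/eqP/setP=> x; rewrite in_setI in_set0; apply/negP=> /andP[/in1 i1 /in2 i2].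
  case/orP: i1 => [xO|].
    move: i2; rewrite (disjointFr d12 xO) (disjointFr d13 xO) !inE /= => /orP[]/eqP ex; move: xO; rewrite ex.
      by rewrite (negbTE zt1).
    by rewrite (negbTE zk1).
  rewrite !inE => /orP[]/eqP ex; move: i2; rewrite ex ?(negbTE zn2) ?(negbTE zn3) ?(negbTE zm2) ?(negbTE zm3) !inE.
    by rewrite (negbTE u3) (negbTE u2).
  by rewrite (negbTE u5) (negbTE u4).
apply/setP=> x; rewrite !inE; have := cov x; rewrite !inE; case: (boolP (x \in O1)) => [xO _|nO1'].
  rewrite (disjointFr d12 xO) (disjointFr d13 xO).
  have nz z : z \notin O1 -> (x == z) = false by move=> zO; apply/negbTE; apply: ndC xO zO.
  have no2 z : z \in O2 -> (x == z) = false by move=> zO; apply/negbTE; apply: nd d12 xO zO.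
  have no3 z : z \in O3 -> (x == z) = false by move=> zO; apply/negbTE; apply: nd d13 xO zO.
  rewrite !(nz _ zn1) !(nz _ zm1) !(nz _ zk1) !(nz _ zt1) (no2 _ egO) (no2 _ hgO) (no3 _ ehO) (no3 _ ghO).
  case: (eqVneq x x12) => [->|_].
    by rewrite (negbTE (ndC _ _ _ x12C heC)) eq_sym (negbTE ngx) /= ?orbT.
  case: (eqVneq x x13) => [->|_].
    by rewrite [x13 == he]eq_sym (negbTE nhx) /= [x13 == ge]eq_sym (negbTE (ndC _ _ _ geC x13C)) /= ?orbT.
  by case: (x == ge); case: (x == he).
case: (boolP (x \in O2)) => [xO _|nO2].
  rewrite (disjointFr d23 xO).
  have nz z : z \notin O2 -> (x == z) = false by move=> zO; apply/negbTE; apply: ndC xO zO.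
  have no1 z : z \in O1 -> (x == z) = false by move=> zO; rewrite eq_sym; apply/negbTE; apply: nd d12 zO xO.
  have no3 z : z \in O3 -> (x == z) = false by move=> zO; apply/negbTE; apply: nd d23 xO zO.
  rewrite !(nz _ zn2) !(nz _ zm2) !(nz _ zk2) !(nz _ zt2) (no1 _ geO) (no1 _ heO) (no1 _ x12O) (no1 _ x13O) (no3 _ ehO) (no3 _ ghO).
  by case: (x == hg); case: (x == eg).
case: (boolP (x \in O3)) => [xO _|nO3].
  have nz z : z \notin O3 -> (x == z) = false by move=> zO; apply/negbTE; apply: ndC xO zO.
  have no1 z : z \in O1 -> (x == z) = false by move=> zO; rewrite eq_sym; apply/negbTE; apply: nd d13 zO xO.
  have no2 z : z \in O2 -> (x == z) = false by move=> zO; rewrite eq_sym; apply/negbTE; apply: nd d23 zO xO.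
  rewrite !(nz _ zn3) !(nz _ zm3) !(nz _ zk3) !(nz _ zt3) (no1 _ geO) (no1 _ heO) (no1 _ x12O) (no1 _ x13O) (no2 _ egO) (no2 _ hgO).
  by case: (x == eh); case: (x == gh).
have n1' z : z \in O1 -> (x == z) = false by move=> zO; apply/eqP=> ex; rewrite ex zO in nO1'.
have n2' z : z \in O2 -> (x == z) = false by move=> zO; apply/eqP=> ex; rewrite ex zO in nO2.
have n3' z : z \in O3 -> (x == z) = false by move=> zO; apply/eqP=> ex; rewrite ex zO in nO3.
rewrite (n1' _ geO) (n1' _ heO) (n1' _ x12O) (n1' _ x13O) (n2' _ hgO) (n2' _ egO) (n3' _ ehO) (n3' _ ghO).
by case: (x == z12); case: (x == z13); case: (x == z23); case: (x == t).
Qed.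

(** [local_pair] for the three pairs of exceptional sets feeds [venn_arith]. The cells of cut 3 are
    single vertices, and those of cut 4 have two vertices by [three_pieces]. *)
Lemma petersen e g h : bad r e g h -> #|T| = 10.
Proof.
move=> be; have be' := bad_rot be; have be'' := bad_rot be'.
have [A1 [K1 L1]] := bad_local rs ri r3 cut3 triv3 be.
have [A2 [K2 L2]] := bad_local rs ri r3 cut3 triv3 be'.
have [A3 [K3 L3]] := bad_local rs ri r3 cut3 triv3 be''.
have [a1 a2 [a3 a4] [a5 a6] [j12 U12]] := local_pair rs ri r3 cut3 triv3 be L1 (local5C L2).
have [b1 b2 [b3 b4] [b5 b6] [j13 U13]] := local_pair rs ri r3 cut3 triv3 (bad_swap be) (local5C L1) L3.
have [c1 c2 [c3 c4] [c5 c6] [j23 U23]] := local_pair rs ri r3 cut3 triv3 be' L2 (local5C L3).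
pose Oe := K1 :\: K2 :\: K3; pose Og := K2 :\: K3 :\: K1; pose Oh := K3 :\: K1 :\: K2.
pose P := K1 :&: K2 :\: K3; pose Q := K1 :&: K3 :\: K2; pose R := K2 :&: K3 :\: K1.
pose T3 := K1 :&: K2 :&: K3; pose O := ~: (K1 :|: K2 :|: K3).
(* A tuple of commutation rules, used as one multirule that puts the two cells of every [edg] in a
   fixed order. *)
pose norm := (edgC Og Oe, edgC Oh Oe, edgC Oh Og, edgC P Oe, edgC P Og, edgC P Oh, edgC Q Oe, edgC Q Og, edgC Q Oh, edgC Q P, edgC R Oe, edgC R Og, edgC R Oh, edgC R P, edgC R Q, edgC T3 Oe, edgC T3 Og, edgC T3 Oh, edgC T3 P, edgC T3 Q, edgC T3 R, edgC O Oe, edgC O Og, edgC O Oh, edgC O P, edgC O Q, edgC O R, edgC O T3).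
have [[_ e1 e2] _ _ _ _] := L1; have [[_ g1 g2] _ _ _ _] := L2; have [[_ h1 h2] _ _ _ _] := L3.
have [[re rg rh _] _] := be.
have j0 f X Y X' Y' : r f.1 f.2 -> joins f X Y -> (forall x, x = f.1 \/ x = f.2 -> x \in X -> x \in X') ->
    (forall x, x = f.1 \/ x = f.2 -> x \in Y -> x \in Y') -> 0 < edg X' Y'.
  move=> rf /orP[]/andP[x1 x2] h3 h4.
    by apply: (@edg_gt0 _ _ _ _ f.1 f.2) => //; [apply: h3 => //; left|apply: h4 => //; right].
  by apply: (@edg_gt0 _ _ _ _ f.2 f.1); rewrite 1?rs //; [apply: h3 => //; right|apply: h4 => //; left].
have G1 : 0 < edg Oe Og.
  by apply: (j0 _ _ _ _ _ rh j12) => x [->|->]; rewrite !inE => /andP[-> ->]; rewrite ?h1 ?h2.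
have G2 : 0 < edg Oe Oh.
  by apply: (j0 _ _ _ _ _ rg j13) => x [->|->]; rewrite !inE => /andP[-> ->]; rewrite ?g1 ?g2.
have G3 : 0 < edg Og Oh.
  by apply: (j0 _ _ _ _ _ re j23) => x [->|->]; rewrite !inE => /andP[-> ->]; rewrite ?e1 ?e2.
have X12 : K1 :\: K2 = Oe :|: Q by seq_.
have Y12 : K2 :\: K1 = Og :|: R by seq_.
have Z12 : K1 :&: K2 = P :|: T3 by seq_.
have V12 : ~: (K1 :|: K2) = Oh :|: O by seq_.
have X13 : K1 :\: K3 = Oe :|: P by seq_.
have Y13 : K3 :\: K1 = Oh :|: R by seq_.
have Z13 : K1 :&: K3 = Q :|: T3 by seq_.
have V13 : ~: (K1 :|: K3) = Og :|: O by seq_.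
have X23 : K2 :\: K3 = Og :|: P by seq_.
have Y23 : K3 :\: K2 = Oh :|: Q by seq_.
have Z23 : K2 :&: K3 = R :|: T3 by seq_.
have V23 : ~: (K2 :|: K3) = Oe :|: O by seq_.
move: a1 a2 a3 a4 a5 a6 b1 b2 b3 b4 b5 b6 c1 c2 c3 c4 c5 c6.
rewrite X12 Y12 Z12 V12 X13 Y13 Z13 V13 X23 Y23 Z23 V23.
rewrite !edg_quad; try by dsj.
rewrite !norm => a1 a2 a3 a4 a5 a6 b1 b2 b3 b4 b5 b6 c1 c2 c3 c4 c5 c6.
have cutP : cut P = edg Oe P + edg Og P + edg Oh P + edg P Q + edg P R + edg P T3 + edg P O.
  rewrite /cut (_ : ~: P = Oe :|: (Og :|: (Oh :|: (Q :|: (R :|: (T3 :|: O)))))); last by seq_.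
  rewrite !(edgUr rs) ?addnA; try by dsj.
  by rewrite ?norm.
have cutQ : cut Q = edg Oe Q + edg Og Q + edg Oh Q + edg P Q + edg Q R + edg Q T3 + edg Q O.
  rewrite /cut (_ : ~: Q = Oe :|: (Og :|: (Oh :|: (P :|: (R :|: (T3 :|: O)))))); last by seq_.
  rewrite !(edgUr rs) ?addnA; try by dsj.
  by rewrite ?norm.
have cutR : cut R = edg Oe R + edg Og R + edg Oh R + edg P R + edg Q R + edg R T3 + edg R O.
  rewrite /cut (_ : ~: R = Oe :|: (Og :|: (Oh :|: (P :|: (Q :|: (T3 :|: O)))))); last by seq_.
  rewrite !(edgUr rs) ?addnA; try by dsj.
  by rewrite ?norm.
have cutT3 : cut T3 = edg Oe T3 + edg Og T3 + edg Oh T3 + edg P T3 + edg Q T3 + edg R T3 + edg T3 O.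
  rewrite /cut (_ : ~: T3 = Oe :|: (Og :|: (Oh :|: (P :|: (Q :|: (R :|: O)))))); last by seq_.
  rewrite !(edgUr rs) ?addnA; try by dsj.
  by rewrite ?norm.
have cutO : cut O = edg Oe O + edg Og O + edg Oh O + edg P O + edg Q O + edg R O + edg T3 O.
  rewrite /cut (_ : ~: O = Oe :|: (Og :|: (Oh :|: (P :|: (Q :|: (R :|: T3)))))); last by seq_.
  rewrite !(edgUr rs) ?addnA; try by dsj.
  by rewrite ?norm.
have cutOe : cut Oe = edg Oe Og + edg Oe Oh + edg Oe P + edg Oe Q + edg Oe R + edg Oe T3 + edg Oe O.
  rewrite /cut (_ : ~: Oe = Og :|: (Oh :|: (P :|: (Q :|: (R :|: (T3 :|: O)))))); last by seq_.
  rewrite !(edgUr rs) ?addnA; try by dsj.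
  by rewrite ?norm.
have cutOg : cut Og = edg Oe Og + edg Og Oh + edg Og P + edg Og Q + edg Og R + edg Og T3 + edg Og O.
  rewrite /cut (_ : ~: Og = Oe :|: (Oh :|: (P :|: (Q :|: (R :|: (T3 :|: O)))))); last by seq_.
  rewrite !(edgUr rs) ?addnA; try by dsj.
  by rewrite ?norm.
have cutOh : cut Oh = edg Oe Oh + edg Og Oh + edg Oh P + edg Oh Q + edg Oh R + edg Oh T3 + edg Oh O.
  rewrite /cut (_ : ~: Oh = Oe :|: (Og :|: (P :|: (Q :|: (R :|: (T3 :|: O)))))); last by seq_.
  rewrite !(edgUr rs) ?addnA; try by dsj.
  by rewrite ?norm.
have alt S x : x \in ~: S -> cut S = 0 \/ 3 <= cut S.
  rewrite in_setC => xS; have [->|[z zS]] := set_0Vmem S; first by left; rewrite /cut edg0l.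
  by right; apply: cut3' zS xS.
have [x0 x0e] : exists x, x \in Oe.
  by apply/set0Pn; apply: contraTneq G1 => ->; rewrite edg0l.
have [y0 y0g] : exists x, x \in Og.
  by apply/set0Pn; apply: contraTneq G1 => ->; rewrite (edg0r rs).
have [w0 w0h] : exists x, x \in Oh.
  by apply/set0Pn; apply: contraTneq G2 => ->; rewrite (edg0r rs).
have nO S : S \in [:: P; Q; R; T3; O] -> [/\ x0 \in ~: S, y0 \in ~: S & w0 \in ~: S].
  move: x0e y0g w0h; rewrite !inE => /and3P[x3 x2 x1] /and3P[y1 y3 y2] /and3P[z2 z1 z3].
  by do 4?[case/predU1P=> [->|]]; [..|move/eqP=> ->]; rewrite ?inE ?(negbTE x3) ?(negbTE x2) ?x1 ?(negbTE y1) ?(negbTE y3)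
    ?y2 ?(negbTE z2) ?(negbTE z1) ?z3.
have altO : cut O = 0 \/ 3 <= cut O by apply: (@alt _ x0) => //; case: (nO O) => //; rewrite !inE eqxx ?orbT.
have altP : cut P = 0 \/ 3 <= cut P by apply: (@alt _ x0) => //; case: (nO P) => //; rewrite !inE eqxx ?orbT.
rewrite cutO in altO; rewrite cutP in altP.
have [[v1 v2 v3] [v4 v5 v6 v7] [v8 v9 v10 v11 v12] [v13 v14 v15 v16 v17] [[v18 v19 v20 v21] [v22 v23 v24 v25 [v26 v27 v28]]]]
  := venn_arith a1 a2 a3 a4 a5 a6 b1 b2 b3 b4 b5 b6 c1 c2 c3 c4 c5 c6 G1 G2 G3 altO altP.
rewrite !(v1, v2, v3, v4, v5, v6, v7, v8, v9, v10, v11, v12, v13, v14, v15, v16, v17, v18, v19, v20, v21, v22, v23, v24,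
  v25, v26, v27, v28) in cutO cutP cutQ cutR cutT3 cutOe cutOg cutOh.
have O0 : O = set0.
  have OI : O \in [:: P; Q; R; T3; O] by rewrite !in_cons eqxx !orbT.
  have [//|[z zO]] := set_0Vmem O; have [h3 _ _] := nO O OI; rewrite in_setC in h3.
  by have := cut3' zO h3; rewrite cutO.
have nxy : x0 != y0.
  by apply: contraTneq x0e => ->; move: y0g; rewrite !inE => /and3P[/negbTE-> _ _]; rewrite !andbF.
have single S : S \in [:: P; Q; R; T3; O] -> cut S = 3 -> exists z, S = [set z].
  move=> SI c3'; have [h3 h4 _] := nO S SI; case: (triv3 c3') => le1.
    by apply/cards1P; rewrite eqn_leq le1 card_gt0; apply/eqP => K0; rewrite K0 /cut edg0l in c3'.
  by move: nxy; rewrite (card_le1_eqP le1 _ _ h3 h4) eqxx.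
have [z12 PE] : exists z, P = [set z] by apply: single => //; rewrite !in_cons eqxx ?orbT.
have [z13 QE] : exists z, Q = [set z] by apply: single => //; rewrite !in_cons eqxx ?orbT.
have [z23 RE] : exists z, R = [set z] by apply: single => //; rewrite !in_cons eqxx ?orbT.
have [t TE] : exists z, T3 = [set z] by apply: single => //; rewrite !in_cons eqxx ?orbT.
have port S z : edg S [set z] = 1 -> exists2 x, x \in S & r x z.
  move=> e1'; have : ~~ (edg S [set z] == 0) by rewrite e1'.
  rewrite edg_eq0 negb_forall => /existsP[x]; rewrite negb_imply negb_forall => /andP[xS /existsP[y]].
  by rewrite negb_imply negbK in_set1 => /andP[/eqP-> rxz]; exists x.
have [x12 x12O rx12] := port Oe z12 (etrans (congr1 _ (esym PE)) v4).
have [x13 x13O rx13] := port Oe z13 (etrans (congr1 _ (esym QE)) v5).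
have [y12 y12O ry12] := port Og z12 (etrans (congr1 _ (esym PE)) v6).
have [y23 y23O ry23] := port Og z23 (etrans (congr1 _ (esym RE)) v7).
have [w13 w13O rw13] := port Oh z13 (etrans (congr1 _ (esym QE)) v8).
have [w23 w23O rw23] := port Oh z23 (etrans (congr1 _ (esym RE)) v9).
have [t12 t12T rt12] : exists2 x, x \in [set t] & r z12 x.
  have [x xP rxt] := port P t (etrans (congr1 _ (esym TE)) v10); exists t; rewrite ?set11 //.
  by move: xP; rewrite PE => /set1P <-.
have [t13 t13T rt13] : exists2 x, x \in [set t] & r z13 x.
  have [x xP rxt] := port Q t (etrans (congr1 _ (esym TE)) v11); exists t; rewrite ?set11 //.
  by move: xP; rewrite QE => /set1P <-.
have [t23 t23T rt23] : exists2 x, x \in [set t] & r z23 x.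
  have [x xP rxt] := port R t (etrans (congr1 _ (esym TE)) v12); exists t; rewrite ?set11 //.
  by move: xP; rewrite RE => /set1P <-.
move: t12T t13T t23T => /set1P t12E /set1P t13E /set1P t23E; subst t12 t13 t23.
have jC f X Y : joins f X Y -> joins f Y X by rewrite /joins orbC ![(_ \in X) && _]andbC.
have z12P : z12 \in P by rewrite PE set11.
have z13Q : z13 \in Q by rewrite QE set11.
have z23R : z23 \in R by rewrite RE set11.
have tT : t \in T3 by rewrite TE set11.
have z12P' : z12 \in K2 :&: K1 :\: K3 by rewrite [K2 :&: K1]setIC.
have z13Q' : z13 \in K3 :&: K1 :\: K2 by rewrite [K3 :&: K1]setIC.
have z23R' : z23 \in K3 :&: K2 :\: K1 by rewrite [K3 :&: K2]setIC.
have U31 x : x \in ~: (K3 :|: K1) -> (x \in A3) != (x \in A1).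
  by rewrite setUC eq_sym; apply: U13.
have cOe : cut (K1 :\: K2 :\: K3) = 4 by rewrite -/Oe cutOe.
have cOg : cut (K2 :\: K3 :\: K1) = 4 by rewrite -/Og cutOg.
have cOh : cut (K3 :\: K1 :\: K2) = 4 by rewrite -/Oh cutOh.
have [ge [he [endge endhe pe]]] := piece_of be L2 L3 e1 e2 j12 j13 U23 z12P z13Q x12O x13O rx12 rx13 cOe.
have [hg [eg [endhg endeg pg]]] := piece_of be' L3 L1 g1 g2 j23 (jC _ _ _ j12) U31 z23R z12P' y23O y12O ry23 ry12 cOg.
have [eh [gh [endeh endgh ph]]] := piece_of be'' L1 L2 h1 h2 (jC _ _ _ j13) (jC _ _ _ j23) U12 z13Q' z23R' w13O w23O rw13 rw23 cOh.
rewrite -/Oe in pe; rewrite -/Og in pg; rewrite -/Oh in ph.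
have cov x : [|| x \in Oe, x \in Og, x \in Oh | x \in [:: z12; z13; z23; t]].
  have : x \notin O by rewrite O0 inE.
  have : (x \in P) = (x == z12) by rewrite PE in_set1.
  have : (x \in Q) = (x == z13) by rewrite QE in_set1.
  have : (x \in R) = (x == z23) by rewrite RE in_set1.
  have : (x \in T3) = (x == t) by rewrite TE in_set1.
  rewrite !in_cons in_nil orbF => <- <- <- <-; rewrite !inE.
  by do 3 case: (_ \in _).
have dcell : [/\ [disjoint Oe & Og], [disjoint Oe & Oh] & [disjoint Og & Oh]] by split; dsj.
have zn z : z \in [:: z12; z13; z23; t] -> [/\ z \notin Oe, z \notin Og & z \notin Oh].
  move: z12P z13Q z23R tT; rewrite !in_setD !in_setI => /andP[/negbTE p3 /andP[p1 p2]] /andP[/negbTE q2 /andP[q1 q3]].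
  move=> /andP[/negbTE r1 /andP[r2 r3']] /andP[/andP[t1 t2] t3].
  rewrite !in_cons in_nil orbF => /or4P[] /eqP->; rewrite ?p1 ?p2 ?p3 ?q1 ?q2 ?q3 ?r1 ?r2 ?r3' ?t1 ?t2 ?t3 //.
have uz : uniq [:: z12; z13; z23; t].
  move: z12P z13Q z23R tT; rewrite !in_setD !in_setI => /andP[/negbTE p3 /andP[p1 p2]] /andP[/negbTE q2 /andP[q1 q3]].
  move=> /andP[/negbTE r1 /andP[r2 r3']] /andP[/andP[t1 t2] t3].
  have ne x y (S : {set T}) : x \in S -> (y \in S) = false -> (x == y) = false.
    by move=> xS yS; apply/eqP=> exy; rewrite exy yS in xS.
  rewrite /= !inE (ne _ _ _ p2 q2) (ne _ _ _ p1 r1) [z12 == t]eq_sym (ne _ _ _ t3 p3) (ne _ _ _ q1 r1).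
  by rewrite [z13 == t]eq_sym (ne _ _ _ t2 q2) [z23 == t]eq_sym (ne _ _ _ t1 r1).
have n1 : #|Oe| = 2 by apply: (three_pieces be dcell cov zn uz rx12 rx13 _ pe pg ph); rewrite // rs.
have n2 : #|Og| = 2.
  apply: (@three_pieces _ _ _ Og Oh Oe _ _ _ _ _ _ _ _ _ _ _ _ _ _ _ z23 z12 z13 t be' _ _ _ _ ry23 ry12 _ pg ph pe) => //.
  - by case: dcell => k1 k2 k3; split; rewrite // disjoint_sym.
  - move=> x; have := cov x; rewrite !inE.
    by case: (x \in K1); case: (x \in K2); case: (x \in K3); case: (x == z12); case: (x == z13); case: (x == z23).
  - move=> z zI; have [|k1 k2 k3] := zn z; last by split.
    by move: zI; rewrite !inE; case: (z == z12); case: (z == z13); case: (z == z23).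
  - rewrite (perm_uniq (s2 := [:: z12; z13; z23; t])) //.
    by rewrite -[X in perm_eq X]/([:: z23] ++ [:: z12; z13] ++ [:: t]) perm_catCA.
  - by rewrite rs.
have n3 : #|Oh| = 2.
  apply: (@three_pieces _ _ _ Oh Oe Og _ _ _ _ _ _ _ _ _ _ _ _ _ _ _ z13 z23 z12 t be'' _ _ _ _ rw13 rw23 _ ph pe pg) => //.
  - by case: dcell => k1 k2 k3; split; rewrite // disjoint_sym.
  - move=> x; have := cov x; rewrite !inE.
    by case: (x \in K1); case: (x \in K2); case: (x \in K3); case: (x == z12); case: (x == z13); case: (x == z23).
  - move=> z zI; have [|k1 k2 k3] := zn z; last by split.
    by move: zI; rewrite !inE; case: (z == z12); case: (z == z13); case: (z == z23).
  - rewrite (perm_uniq (s2 := [:: z12; z13; z23; t])) //.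
    by rewrite -[X in perm_eq X]/([:: z13; z23] ++ [:: z12] ++ [:: t]) perm_catCA.
  - by rewrite rs.
have cdj X Y : [disjoint X & Y] -> #|X :|: Y| = #|X| + #|Y|.
  by move=> d; rewrite cardsU (_ : X :&: Y = set0) ?cards0 ?subn0 //; apply/eqP; rewrite setI_eq0.
rewrite -cardsT (_ : setT = Oe :|: (Og :|: (Oh :|: (P :|: (Q :|: (R :|: T3)))))); last first.
  apply/setP=> x; rewrite in_setT; have := in_set0 x; rewrite -O0 !inE.
  by do 3 case: (_ \in _).
by rewrite !cdj; try (by dsj); rewrite n1 n2 n3 PE QE RE TE !cards1.
Qed.

End Venn.

(** * Closed cochains and coboundaries over F2 *)

Definition symd (T : finType) (A B : {set T}) : {set T} := [set x | (x \in A) (+) (x \in B)].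

Section Parity.
Variables (I J : finType).
Implicit Types (A X : {set I}) (B Y : {set J}).

Lemma odd_card A : odd #|A| = \big[addb/false]_(x in A) true.
Proof.
by rewrite -sum1_card (big_morph odd oddD (erefl : odd 0 = false)); apply: eq_bigr.
Qed.

Lemma odd_setI A X : odd #|A :&: X| = \big[addb/false]_(x in A) (x \in X).
Proof.
by rewrite odd_card [RHS]big_mkcond [LHS]big_mkcond; apply: eq_bigr => x _; rewrite inE; case: (x \in A); case: (x \in X).
Qed.

Lemma in_symd A X x : (x \in symd A X) = (x \in A) (+) (x \in X).
Proof. by rewrite inE. Qed.

Lemma odd_symd A X : odd #|symd A X| = odd #|A| (+) odd #|X|.
Proof.
rewrite !odd_card big_mkcond (big_mkcond (mem A)) (big_mkcond (mem X)) -big_split /=; apply: eq_bigr => x _.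
by rewrite inE; case: (x \in A); case: (x \in X).
Qed.

Lemma symd_disj A X : [disjoint A & X] -> symd A X = A :|: X.
Proof.
move=> d; apply/setP=> x; rewrite !inE; case xA: (x \in A) => //=; by rewrite (disjointFr d xA).
Qed.

Lemma symd_id A : symd A A = set0.
Proof. by apply/setP=> x; rewrite !inE addbb. Qed.

Lemma symd_card A X : #|symd A X| + 2 * #|A :&: X| = #|A| + #|X|.
Proof.
rewrite -(cardsID X A) -(cardsID A X) (setIC X A).
have -> : symd A X = (A :\: X) :|: (X :\: A).
  by apply/setP=> x; rewrite !inE; case: (x \in A); case: (x \in X).
rewrite cardsU (_ : _ :&: _ = set0); last first.
  by apply/setP=> x; rewrite !inE; case: (x \in A); case: (x \in X).
rewrite cards0; lia.
Qed.

End Parity.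

(** * Rank arguments over the field with two elements *)

Section F2.
Import GRing.Theory.
Local Open Scope ring_scope.

Lemma F2_odd n : n%:R = (odd n)%:R :> 'F_2.
Proof. by rewrite -{1}(odd_double_half n) natrD -muln2 natrM (_ : 2%:R = 0 :> 'F_2) ?mulr0 ?addr0 //; apply/val_inj. Qed.

Lemma F2_bool (b c : bool) : (b%:R == c%:R :> 'F_2) = (b == c).
Proof. by case: b; case: c. Qed.

Lemma F2_case (x : 'F_2) : x = (x == 1)%:R.
Proof. by case: x => [[|[|n]]] // i; apply/val_inj. Qed.

Section Mx.
Variables (I J : finType).
Implicit Types (A X : {set I}) (B Y : {set J}).

Definition rv A X : 'rV['F_2]_#|A| := \row_(i < #|A|) (enum_val i \in X)%:R.
Definition mxof A B (a : I -> J -> bool) : 'M['F_2]_(#|A|, #|B|) :=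
  \matrix_(i < #|A|, j < #|B|) (a (enum_val i) (enum_val j))%:R.

Lemma rv_surj A (w : 'rV_#|A|) : exists2 X : {set I}, X \subset A & w = rv A X.
Proof.
exists [set x in A | [exists i, (enum_val i == x) && (w 0 i == 1)]].
  by apply/subsetP=> x; rewrite inE => /andP[].
apply/rowP=> i; rewrite !mxE [LHS]F2_case; congr (nat_of_bool _)%:R; apply/idP/idP => [w1|].
  by rewrite inE enum_valP; apply/existsP; exists i; rewrite eqxx.
by rewrite inE => /andP[_ /existsP[j /andP[/eqP/enum_val_inj-> ->]]].
Qed.

Lemma rv_inj A (X Y : {set I}) : rv A X = rv A Y -> {in A, X =i Y}.
Proof.
move=> /rowP h x xA; have := h (enum_rank_in xA x).
by rewrite !mxE enum_rankK_in // => /eqP; rewrite F2_bool => /eqP.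
Qed.

Lemma rv_add A (X Y : {set I}) : rv A X + rv A Y = rv A (symd X Y).
Proof.
by apply/rowP=> i; rewrite !mxE inE; case: (_ \in X); case: (_ \in Y) => //; apply/val_inj.
Qed.

Lemma sum_bool A (P : pred I) : \sum_(i < #|A|) (P (enum_val i : I))%:R = (odd #|[set x in A | P x]|)%:R :> 'F_2.
Proof.
rewrite -(big_enum_val (fun x => (P x)%:R)) /= -F2_odd -sum1_card natr_sum [RHS]big_mkcond [LHS]big_mkcond /=.
by apply: eq_bigr => x _; rewrite inE; case: (x \in A) => //=; case: (P x).
Qed.
End Mx.

Lemma rv_mul (I J : finType) (A X : {set I}) (B : {set J}) a :
  rv A X *m mxof A B a = rv B [set j | odd #|[set i in A | (i \in X) && a i j]|].
Proof.
apply/rowP=> j; rewrite !mxE inE -(sum_bool A (fun x => (x \in X) && a x (enum_val j))).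
by apply: eq_bigr => i _; rewrite !mxE -natrM mulnb.
Qed.

Lemma mxof_tr (I J : finType) (A : {set I}) (B : {set J}) a : (mxof A B a)^T = mxof B A (fun j i => a i j).
Proof. by apply/matrixP=> i j; rewrite !mxE. Qed.

(** The Fredholm alternative over the field with two elements: a right side orthogonal to everything
    that the matrix kills lies in the row space. The columns of the cokernel matrix supply the
    vectors to test. *)
Lemma fredholm (I J : finType) (A : {set I}) (B R : {set J}) a :
  (forall Y : {set J}, Y \subset B -> {in A, forall i, ~~ odd #|[set j in Y | a i j]|} -> ~~ odd #|Y :&: R|) ->
  exists2 X : {set I}, X \subset A & {in B, forall j, odd #|[set i in X | a i j]| = (j \in R)}.
Proof.
move=> H; have : (rv B R <= mxof A B a)%MS.
  rewrite submxE; apply/eqP/rowP=> k; rewrite [RHS]mxE.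
  have [Y YB EY] := rv_surj (col k (cokermx (mxof A B a)))^T.
  have {}H := H Y YB; rewrite mxE.
  have EY' j : (cokermx (mxof A B a)) j k = (enum_val j \in Y)%:R.
    by move/rowP: EY => /(_ j); rewrite !mxE.
  under eq_bigr => j _ do rewrite mxE EY' -natrM mulnb.
  rewrite (sum_bool B (fun x => (x \in R) && (x \in Y))).
  rewrite (_ : [set x in B | _] = Y :&: R); last first.
    by apply/setP=> x; rewrite !inE; case xY: (x \in Y); rewrite ?andbF // (subsetP YB _ xY) andbT.
  rewrite (negbTE (H _)) // => i iA.
  have /matrixP/(_ (enum_rank_in iA i) k) := mulmx_coker (mxof A B a).
  rewrite mxE [RHS]mxE; under eq_bigr => j _ do rewrite mxE enum_rankK_in // EY' -natrM mulnb.
  rewrite (sum_bool B (fun x => a i x && (x \in Y))) => /eqP.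
  rewrite (F2_bool _ false) => /eqP; rewrite (_ : [set x in B | _] = [set j in Y | a i j]) => [->//|].
  by apply/setP=> x; rewrite !inE; case xY: (x \in Y); rewrite ?andbF // (subsetP YB _ xY) andbT.
case/submxP=> w; have [X XA ->] := rv_surj w; rewrite rv_mul => /rv_inj h; exists X => // j jB.
rewrite h // inE; congr (odd #|pred_of_set _|); apply/setP=> i; rewrite !inE.
by case iX: (i \in X); rewrite ?andbF // (subsetP XA _ iX).
Qed.

(* Connectedness, in the form: the kernel of the incidence matrix over F2 consists of the constants. *)
Definition const_kernel (I J : finType) (A : {set I}) (B : {set J}) (a : I -> J -> bool) :=
  forall X : {set I}, X \subset A -> {in B, forall j, ~~ odd #|[set i in X | a i j]|} -> X = set0 \/ X = A.

Lemma const_kernel_rank (I J : finType) (A : {set I}) (B : {set J}) a :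
  const_kernel A B a -> (#|A| <= (\rank (mxof A B a)).+1)%N.
Proof.
move=> H; rewrite -addn1 -leq_subLR -mxrank_ker.
apply: leq_trans (rank_leq_row (rv A A)); apply: mxrankS; apply/row_subP => i.
set w := row i _; have w0 : w *m mxof A B a = 0 by apply/sub_kermxP; exact: row_sub.
have [X XA E] := rv_surj w; rewrite E in w0 *; rewrite rv_mul in w0.
have : X = set0 \/ X = A.
  apply: H => // j jB; move/rowP/(_ (enum_rank_in jB j)): w0; rewrite !mxE enum_rankK_in // inE => /eqP.
  rewrite (F2_bool _ false) => /eqP; rewrite (_ : [set i0 in A | _] = [set i0 in X | a i0 j]) => [->//|].
  by apply/setP=> x; rewrite !inE; case xY: (x \in X); rewrite ?andbF // (subsetP XA _ xY).
case=> ->; last exact: submx_refl.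
by rewrite (_ : rv A set0 = 0) ?sub0mx //; apply/rowP=> k; rewrite !mxE inE.
Qed.

Section H1.
Variables (V E F : finType) (A : {set V}) (B : {set E}) (C : {set F}).
Variables (a0 : V -> E -> bool) (a1 : F -> E -> bool).
Hypotheses (k0 : const_kernel A B a0) (k1 : const_kernel C B a1).
Hypothesis dd : {in A & C, forall v f, ~~ odd #|[set e in B | a0 v e && a1 f e]|}.

Definition isclosed (x : {set E}) := {in C, forall f, ~~ odd #|[set e in B | (e \in x) && a1 f e]|}.
Definition iscob (x : {set E}) := exists2 c : {set V}, c \subset A & {in B, forall e, (e \in x) = odd #|[set v in c | a0 v e]|}.

Let M := mxof A B a0.
Let N := mxof B C (fun e f => a1 f e).

Lemma closed_ker x : isclosed x -> (rv B x <= kermx N)%MS.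
Proof.
move=> cx; apply/sub_kermxP; rewrite rv_mul; apply/rowP=> j; rewrite !mxE inE (negbTE (cx _ _)) //.
exact: enum_valP.
Qed.

Lemma cob_sub x : (rv B x <= M)%MS -> iscob x.
Proof.
case/submxP=> w; have [c cA ->] := rv_surj w; rewrite rv_mul => /rv_inj h; exists c => // e eB.
rewrite h // inE; congr (odd #|pred_of_set _|); apply/setP=> i; rewrite !inE.
by case iX: (i \in c); rewrite ?andbF // (subsetP cA _ iX).
Qed.

Lemma M_ker : (M <= kermx N)%MS.
Proof.
apply/sub_kermxP/matrixP=> i j; rewrite !mxE; under eq_bigr => k _ do rewrite !mxE -natrM mulnb.
by rewrite (sum_bool B (fun x => a0 (enum_val i) x && a1 (enum_val j) x)) (negbTE (dd _ _)) ?enum_valP.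
Qed.

(** Connectedness bounds both ranks from below, and coboundaries are cocycles. Together this bounds
    the dimension of the cohomology by 2 minus the Euler characteristic. *)
Lemma rank_bounds : [/\ #|A| <= (\rank M).+1, \rank M <= \rank (kermx N) & \rank (kermx N) + #|C| <= #|B|.+1]%N.
Proof.
split; first exact: const_kernel_rank; first exact: mxrankS M_ker.
have := const_kernel_rank k1; rewrite -mxof_tr mxrank_tr -/N => h.
by rewrite mxrank_ker; have := rank_leq_row N; move: h; clear; lia.
Qed.

Lemma euler_le2 : (#|A| + #|C| <= #|B| + 2)%N.
Proof. by have [] := rank_bounds; clear; lia. Qed.

Lemma h1_sphere x : (#|A| + #|C| = #|B| + 2)%N -> isclosed x -> iscob x.
Proof.
move=> e cx; apply: cob_sub; apply: submx_trans (closed_ker cx) _.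
have [h1 h2 h3] := rank_bounds; have := mxrank_leqif_sup M_ker; case=> _ <-; apply/eqP.
by move: e h1 h2 h3; clear; lia.
Qed.

(** The quotient of the cocycles by the coboundaries has at most two elements, so two classes that
    are both nontrivial cancel. *)
Lemma h1_proj x y : (#|A| + #|C| = #|B| + 1)%N -> isclosed x -> isclosed y ->
  [\/ iscob x, iscob y | iscob (symd x y)].
Proof.
move=> e cx cy; have [xM|xM] := boolP (rv B x <= M)%MS; first by constructor 1; apply: cob_sub.
have lt : (\rank M < \rank (M + rv B x)%MS)%N by rewrite ltn_neqAle mxrankS ?addsmxSl // andbT;
  apply: contra xM => /eqP h; have [_] := mxrank_leqif_sup (addsmxSl M (rv B x)); rewrite h eqxx => /esym;
  apply: submx_trans; apply: addsmxSr.
have sub : (M + rv B x <= kermx N)%MS by rewrite addsmx_sub M_ker closed_ker.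
have [h1 h2 h3] := rank_bounds.
have : (rv B y <= M + rv B x)%MS.
  apply: submx_trans (closed_ker cy) _; have := mxrank_leqif_sup sub; case=> h4 <-; apply/eqP.
  by move: e h1 h2 h3 lt h4; clear; lia.
case/sub_addsmxP=> -[u w] /= yE; have : w *m rv B x = w 0 0 *: rv B x by rewrite [w in LHS]mx11_scalar mul_scalar_mx.
rewrite [w 0 0]F2_case; case: (w 0 0 == 1) => Ew; rewrite Ew in yE.
  constructor 3; apply: cob_sub; rewrite -rv_add yE scale1r addrCA (_ : rv B x + rv B x = 0) ?addr0 ?submxMl //.
  by apply/rowP=> k; rewrite !mxE; case: (_ \in x); apply/val_inj.
by constructor 2; apply: cob_sub; rewrite yE scale0r addr0 submxMl.
Qed.

End H1.
End F2.

(** * Triangulated surfaces *)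

Module Complex.

Section Definitions.
Variables (V E : finType) (t : E -> {set V}) (Phi : finType) (b : Phi -> {set E}) (F : {set Phi}).
Implicit Types (X Y : {set Phi}) (x y C : {set E}) (c : {set V}) (f g : Phi) (e : E) (v : V).

Definition vt f := \bigcup_(e in b f) t e.
(** The boundary modulo 2 of a set of faces; seen in the dual graph, the edge cut of that set. *)
Definition bdry X := [set e | odd #|[set f in X | e \in b f]|].
Definition Eu := \bigcup_(f in F) b f.
Definition Vu := \bigcup_(f in F) vt f.
Definition star v := [set f in F | v \in vt f].
Definition even_at C v := ~~ odd #|[set e in C | v \in t e]|.

(* [t e] are the ends of the edge [e], [b f] the edges of the face [f]; only the edges and vertices of faces in [F] count.
   Multiple edges are allowed, since quotients and contractions create them, but loops are not. *)
Record surf : Prop := Surf {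
  s_ne : F != set0;
  s_b3 : forall f, f \in F -> #|b f| = 3;
  s_ev : forall f v, f \in F -> even_at (b f) v;
  s_t2 : forall f e, f \in F -> e \in b f -> #|t e| = 2;
  s_e2 : forall f e, f \in F -> e \in b f -> #|[set g in F | e \in b g]| = 2;
  s_con : forall X, X \subset F -> bdry X = set0 -> X = set0 \/ X = F;
  s_link : forall v X, X \subset star v -> X != set0 -> X != star v -> exists2 e, e \in bdry X & v \in t e }.

Definition euler (chi : nat) := #|Vu| + #|F| = #|Eu| + chi.
Definition closed x := forall f, f \in F -> ~~ odd #|b f :&: x|.
Definition cob c := [set e | odd #|t e :&: c|].
Definition mono c f := (vt f \subset c) || [disjoint vt f & c].
(* Equivalent to the existence of a bipartite subgraph with two thirds of the edges: a face has at most two edges in a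
   cut, and exactly two if it is not monochromatic. *)
Definition colourable := exists c, forall f, f \in F -> ~~ mono c f.

Lemma in_bdryE X e : (e \in bdry X) = \big[addb/false]_(f in X) (e \in b f).
Proof.
rewrite inE; transitivity (odd #|X :&: [set f | e \in b f]|).
  by congr (odd #|pred_of_set _|); apply/setP=> f; rewrite !inE.
by rewrite odd_setI; apply: eq_bigr => f _; rewrite inE.
Qed.

Lemma bdry_symd X Y : bdry (symd X Y) = symd (bdry X) (bdry Y).
Proof.
apply/setP=> e; rewrite in_symd !in_bdryE big_mkcond (big_mkcond (mem X)) (big_mkcond (mem Y)) -big_split /=.
by apply: eq_bigr => f _; rewrite inE; case: (f \in X); case: (f \in Y); case: (e \in b f).
Qed.

Lemma odd_bdry X x : odd #|bdry X :&: x| = \big[addb/false]_(f in X) odd #|b f :&: x|.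
Proof.
rewrite setIC odd_setI; under eq_bigr => e _ do rewrite in_bdryE.
by rewrite exchange_big; apply: eq_bigr => f _; rewrite setIC odd_setI.
Qed.

Lemma bdry1 f : bdry [set f] = b f.
Proof. by apply/setP=> e; rewrite in_bdryE big_set1. Qed.

Lemma bdry0 : bdry set0 = set0.
Proof. by apply/setP=> e; rewrite in_bdryE big_set0 inE. Qed.

Lemma bdryU X Y : [disjoint X & Y] -> bdry (X :|: Y) = symd (bdry X) (bdry Y).
Proof. by move=> d; rewrite -symd_disj // bdry_symd. Qed.

Lemma in_vt f v : reflect (exists2 e, e \in b f & v \in t e) (v \in vt f).
Proof. by apply: (iffP bigcupP) => -[e h1 h2]; exists e. Qed.

Lemma even_atE C v : even_at C v = ~~ odd #|C :&: [set e | v \in t e]|.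
Proof. by congr (~~ odd #|pred_of_set _|); apply/setP=> e; rewrite !inE. Qed.

Hypothesis S : surf.

Lemma bdry_even X v : X \subset F -> even_at (bdry X) v.
Proof.
move=> XF; rewrite even_atE odd_bdry big1 // => f fX; apply/negbTE; rewrite -even_atE.
exact: s_ev (subsetP XF _ fX).
Qed.

Lemma odd_cut X : X \subset F -> odd #|bdry X| = odd #|X|.
Proof.
move=> XF; rewrite -[bdry X]setIT odd_bdry odd_card; apply: eq_bigr => f fX.
by rewrite setIT s_b3 // (subsetP XF).
Qed.

Lemma vt_Vu f : f \in F -> vt f \subset Vu.
Proof. by move=> fF; apply: bigcup_sup. Qed.

Lemma t_vt f e : e \in b f -> t e \subset vt f.
Proof. by move=> ef; apply: bigcup_sup. Qed.

Lemma EuP e : reflect (exists2 f, f \in F & e \in b f) (e \in Eu).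
Proof. by apply: (iffP bigcupP) => -[f h1 h2]; exists f. Qed.

Lemma VuP v : reflect (exists2 f, f \in F & v \in vt f) (v \in Vu).
Proof. by apply: (iffP bigcupP) => -[f h1 h2]; exists f. Qed.

Lemma two_faces f e : f \in F -> e \in b f ->
  exists g, [/\ g \in F, g != f, e \in b g & forall h, h \in F -> e \in b h -> h = f \/ h = g].
Proof.
move=> fF ef; have /eqP/cards2P[g1 [g2 [ng E2]]] := s_e2 S fF ef.
have in2 h : (h \in F) && (e \in b h) = (h == g1) || (h == g2).
  by have /setP/(_ h) := E2; rewrite !inE.
have := in2 f; rewrite fF ef => /esym/orP[]/eqP fE; [exists g2|exists g1].
  have := in2 g2; rewrite eqxx orbT => /andP[-> ->]; rewrite fE eq_sym; split=> // h hF eh.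
  by have := in2 h; rewrite hF eh => /esym/orP[]/eqP->; [left|right].
have := in2 g1; rewrite eqxx => /andP[-> ->]; rewrite fE; split=> // h hF eh.
by have := in2 h; rewrite hF eh => /esym/orP[]/eqP->; [right|left].
Qed.

Lemma in_bdry X f g e : X \subset F -> f \in X -> g \in F -> g \notin X -> e \in b f -> e \in b g -> e \in bdry X.
Proof.
move=> XF fX gF gX ef eg; rewrite inE; have [g' [g'F ng eg' U]] := two_faces (subsetP XF _ fX) ef.
have {ng eg'}eg' : g = g' by case: (U g gF eg) => // gf; rewrite gf fX in gX.
rewrite (_ : [set _ in _ | _] = [set f]) ?cards1 //; apply/setP=> h; rewrite !inE.
apply/andP/eqP => [[hX eh]|->//]; case: (U h (subsetP XF _ hX) eh) => // hg.
by rewrite hg -eg' in hX; rewrite hX in gX.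
Qed.

Lemma bdryP X e : X \subset F ->
  reflect (exists f g, [/\ f \in X, g \in F, g \notin X, e \in b f & e \in b g]) (e \in bdry X).
Proof.
move=> XF; apply: (iffP idP) => [|[f [g [h1 h2 h3 h4 h5]]]]; last exact: in_bdry h4 h5.
rewrite inE => od; have /card_gt0P[f] : 0 < #|[set f in X | e \in b f]| by case: #|_| od.
rewrite inE => /andP[fX ef]; have [g [gF ng eg U]] := two_faces (subsetP XF _ fX) ef.
exists f, g; split=> //; apply: contraL od => gX.
rewrite (_ : [set _ in _ | _] = [set f; g]) ?cards2 1?eq_sym ?ng //; apply/setP=> h; rewrite !inE.
apply/andP/orP => [[hX eh]|[]/eqP->//]; by case: (U h (subsetP XF _ hX) eh) => ->; [left|right].
Qed.

Lemma bdryC X : X \subset F -> bdry (F :\: X) = bdry X.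
Proof.
move=> XF; apply/setP=> e; apply/(bdryP _ (subsetDl _ _))/(bdryP _ XF) => -[f [g [h1 h2 h3 h4 h5]]]; exists g, f; split=> //.
- by move: h3; rewrite inE h2 andbT negbK.
- by move: h1; rewrite inE => /andP[].
- by move: h1; rewrite inE => /andP[].
- by rewrite inE h3.
- exact: (subsetP XF).
- by rewrite inE h1.
Qed.

Lemma bdry_Eu X : X \subset F -> bdry X \subset Eu.
Proof. by move=> XF; apply/subsetP=> e /(bdryP _ XF)[f [g [fX gF _ ef eg]]]; apply/EuP; exists g. Qed.

Lemma Eu_t2 e : e \in Eu -> #|t e| = 2.
Proof. by case/EuP=> f fF ef; apply: (s_t2 S fF). Qed.

Lemma b_Eu f : f \in F -> b f \subset Eu.
Proof. by move=> fF; apply/subsetP=> e ef; apply/EuP; exists f. Qed.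

(** A single boundary edge would give its ends odd degree in the boundary; in other words, the dual
    graph has no bridge. *)
Lemma cut_ge2 X : X \subset F -> X != set0 -> X != F -> 2 <= #|bdry X|.
Proof.
move=> XF X0 X1; rewrite ltn_neqAle eq_sym; apply/andP; split.
  apply/negP => /cards1P[e E1]; have : e \in Eu by rewrite (subsetP (bdry_Eu XF)) // E1 set11.
  move/Eu_t2 => t2; have /card_gt0P[v vt] : 0 < #|t e| by rewrite t2.
  have := bdry_even v XF; rewrite /even_at E1 (_ : [set _ in _ | _] = [set e]) ?cards1 //.
  by apply/setP=> x; rewrite !inE; case: eqP => // ->.
rewrite card_gt0; apply/negP => /eqP /(s_con S XF)[] h; by rewrite h eqxx in X0 X1.
Qed.

Lemma cut_ge3 X : X \subset F -> odd #|X| -> X != F -> 3 <= #|bdry X|.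
Proof.
move=> XF oX X1; have X0 : X != set0 by apply: contraTneq oX => ->; rewrite cards0.
have := cut_ge2 XF X0 X1; have := odd_cut XF; rewrite oX; by case: #|_| => [|[|[|]]].
Qed.

End Definitions.
Arguments b_Eu {E Phi b F f}.
Arguments vt_Vu {V E t Phi b F f}.
Arguments t_vt {V E t Phi b f e}.

Section Triangle.
Variables (V E : finType) (t : E -> {set V}).

(** Vertices and edges are listed so that each edge stands opposite to the vertex in the same
    position; a rotation then permutes both lists alike. *)
Definition triangle (C : {set E}) x y z e1 e2 e3 :=
  [/\ C = [set e1; e2; e3], [/\ t e1 = [set y; z], t e2 = [set x; z] & t e3 = [set x; y]],
      [/\ x != y, x != z & y != z] & [/\ e1 != e2, e1 != e3 & e2 != e3]].

Lemma cards3 (C : {set E}) : #|C| = 3 -> exists e1 e2 e3, C = [set e1; e2; e3] /\ [/\ e1 != e2, e1 != e3 & e2 != e3].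
Proof.
move=> c3; have /card_gt0P[e1 e1C] : 0 < #|C| by rewrite c3.
have /cards2P[e2 [e3 [n23 E2]]] : #|C :\ e1| == 2 by move: c3; rewrite (cardsD1 e1) e1C add1n => -[->].
exists e1, e2, e3; rewrite -setUA -E2 setD1K //; split=> //.
have : e2 \in C :\ e1 /\ e3 \in C :\ e1 by rewrite E2 !inE !eqxx orbT.
by rewrite !inE => -[/andP[h1 _] /andP[h2 _]]; rewrite eq_sym h1 eq_sym h2.
Qed.

Lemma cards3I e1 e2 e3 (A : {set E}) : e1 != e2 -> e1 != e3 -> e2 != e3 ->
  #|[set e1; e2; e3] :&: A| = (e1 \in A) + (e2 \in A) + (e3 \in A).
Proof.
move=> m1 m2 m3; transitivity (\sum_(e in e1 |: (e2 |: [set e3])) (e \in A : nat)).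
  rewrite -sum1_card big_mkcond [RHS]big_mkcond; apply: eq_bigr => e _; rewrite !inE orbA.
  by case: (_ || _) => //=; case: (e \in A).
by rewrite !big_setU1 ?big_set1 ?inE ?negb_or ?m1 ?m2 //= addnA.
Qed.

(** Even degrees make the third edge the sum modulo 2 of the other two, which therefore share
    exactly one vertex. *)
Lemma triangleP (C : {set E}) : #|C| = 3 -> (forall e, e \in C -> #|t e| = 2) -> (forall v, even_at t C v) ->
  exists x y z e1 e2 e3, triangle C x y z e1 e2 e3.
Proof.
move=> /cards3[e1 [e2 [e3 [EC [n12 n13 n23]]]]] t2 ev.
have t2' e : e \in [:: e1; e2; e3] -> #|t e| = 2.
  by move=> h; apply: t2; rewrite EC !inE in h *; case/or3P: h => ->; rewrite ?orbT.
have par v : (v \in t e1) (+) (v \in t e2) (+) (v \in t e3) = false.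
  apply/negbTE; have := ev v; rewrite even_atE EC odd_setI -setUA !big_setU1 ?big_set1 ?inE ?negb_or ?n12 ?n13 //=.
  by rewrite addbA.
have t3 : t e3 = symd (t e1) (t e2).
  by apply/setP=> v; rewrite inE; move: (par v); case: (v \in t e1); case: (v \in t e2); case: (v \in t e3).
have c1 : #|t e1 :&: t e2| = 1.
  have := symd_card (t e1) (t e2); rewrite -t3 !t2' ?inE ?eqxx ?orbT //; lia.
have /cards1P[z Ez] : #|t e1 :&: t e2| == 1 by rewrite c1.
have [z1 z2] : z \in t e1 /\ z \in t e2 by apply/andP; rewrite -in_setI Ez set11.
have [y Ey] : exists y, t e1 :\ z = [set y].
  by apply/cards1P; have := t2' e1; rewrite (cardsD1 z) z1 !inE eqxx add1n => /(_ isT)[->].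
have [x Ex] : exists x, t e2 :\ z = [set x].
  by apply/cards1P; have := t2' e2; rewrite (cardsD1 z) z2 !inE eqxx orbT add1n => /(_ isT)[->].
have [nyz yt1] : y != z /\ y \in t e1 by apply/andP; rewrite -in_setD1 Ey set11.
have [nxz xt2] : x != z /\ x \in t e2 by apply/andP; rewrite -in_setD1 Ex set11.
have nxy : x != y.
  apply: contraNneq nxz => xy; have : x \in t e1 :&: t e2 by rewrite inE xt2 {1}xy yt1.
  by rewrite Ez inE.
have T1 : t e1 = [set y; z] by rewrite setUC -Ey setD1K.
have T2 : t e2 = [set x; z] by rewrite setUC -Ex setD1K.
exists x, y, z, e1, e2, e3; split=> //; split=> //.
rewrite t3 T1 T2; apply/setP=> v; rewrite !inE.
case: (eqVneq v z) => [->|]; rewrite ?orbT ?orbF /=; last first.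
  by case: (eqVneq v x) => [->|]; rewrite ?(negbTE nxy) //; case: (v == y).
by rewrite ![z == _]eq_sym (negbTE nxz) (negbTE nyz).
Qed.

Lemma triangle_rot C x y z e1 e2 e3 : triangle C x y z e1 e2 e3 -> triangle C y z x e2 e3 e1.
Proof.
rewrite /triangle => -[-> [-> -> ->] [h1 h2 h3] [h4 h5 h6]]; split.
- by apply/setP=> e; rewrite !inE; case: (e == e1); case: (e == e2); case: (e == e3).
- by split=> //; rewrite setUC.
- by split; rewrite // eq_sym.
- by split; rewrite // eq_sym.
Qed.

End Triangle.

Section Surface.
Variables (V E : finType) (t : E -> {set V}) (Phi : finType) (b : Phi -> {set E}) (F : {set Phi}).
Implicit Types (X Y : {set Phi}) (x y C : {set E}) (c : {set V}) (f g : Phi) (e : E) (v : V).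
Local Notation vt := (vt t b).
Local Notation bdry := (bdry b).
Local Notation Eu := (Eu b F).
Local Notation Vu := (Vu t b F).
Local Notation star := (star t b F).
Local Notation even_at := (even_at t).
Local Notation closed := (closed b F).
Local Notation cob := (cob t).
Local Notation mono := (mono t b).
Hypothesis S : surf t b F.

Lemma face_triangle f : f \in F -> exists (x y z : V) e1 e2 e3, triangle t (b f) x y z e1 e2 e3.
Proof.
move=> fF; apply: triangleP; [exact: (s_b3 S)|move=> e; exact: (s_t2 S)|move=> v; exact: (s_ev S)].
Qed.

Lemma triangle_vt f (x y z : V) e1 e2 e3 : triangle t (b f) x y z e1 e2 e3 -> vt f = [set x; y; z].
Proof.
case=> Eb [t1 t2 t3] _ _; apply/setP=> v; apply/in_vt/idP => [[e]|].
  by rewrite Eb !inE => /orP[/orP[]|] /eqP->; rewrite ?t1 ?t2 ?t3 !inE => /orP[]->; rewrite ?orbT.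
rewrite !inE => /orP[/orP[]|] /eqP->; [exists e2|exists e1|exists e1]; rewrite ?Eb ?t1 ?t2 !inE ?eqxx ?orbT //.
Qed.

Lemma card_vt f : f \in F -> #|vt f| = 3.
Proof.
move=> /face_triangle[x [y [z [e1 [e2 [e3 T]]]]]]; rewrite (triangle_vt T); case: T => _ _ [h1 h2 h3] _.
by rewrite setUC cardsU1 !inE negb_or eq_sym h2 eq_sym h3 cards2 h1.
Qed.

Lemma triangle_cob C (x y z : V) e1 e2 e3 c : triangle t C x y z e1 e2 e3 ->
  #|C :&: cob c| = if ((x \in c) == (y \in c)) && ((y \in c) == (z \in c)) then 0 else 2.
Proof.
case=> -> [t1 t2 t3] [n1 n2 n3] [m1 m2 m3].
have co e u v : t e = [set u; v] -> u != v -> (e \in cob c) = (u \in c) (+) (v \in c).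
  by move=> te nuv; rewrite inE te odd_setI big_setU1 ?big_set1 ?inE.
have := co _ _ _ t1 n3; have := co _ _ _ t2 n2; have := co _ _ _ t3 n1 => k3 k2 k1.
have cE : forall a1 a2 a3 : bool, (e1 \in cob c) = a1 -> (e2 \in cob c) = a2 -> (e3 \in cob c) = a3 ->
   #|[set e1; e2; e3] :&: cob c| = a1 + a2 + a3.
  by move=> a1 a2 a3 h1 h2 h3; rewrite cards3I // h1 h2 h3.
rewrite (cE _ _ _ k1 k2 k3); by case: (x \in c); case: (y \in c); case: (z \in c).
Qed.

Lemma triangle_mono f (x y z : V) e1 e2 e3 c : triangle t (b f) x y z e1 e2 e3 ->
  mono c f = ((x \in c) == (y \in c)) && ((y \in c) == (z \in c)).
Proof.
move=> T; rewrite /mono (triangle_vt T); apply/orP/idP => [[|]|].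
- by rewrite !subUset !sub1set => /andP[/andP[-> ->] ->].
- by rewrite -setI_eq0 => /eqP/setP h; move: (h x) (h y) (h z); rewrite !inE !eqxx ?orbT /= => -> -> ->.
case/andP=> /eqP xy /eqP yz; case xc: (x \in c); [left|right].
  by rewrite !subUset !sub1set -yz -xy xc.
rewrite -setI_eq0; apply/eqP/setP=> v; rewrite !inE; apply/negP=> /andP[/orP[/orP[]|] /eqP->].
- by rewrite xc.
- by rewrite -xy xc.
by rewrite -yz -xy xc.
Qed.

Lemma face_cob f c : f \in F -> #|b f :&: cob c| = if mono c f then 0 else 2.
Proof.
move=> /face_triangle[x [y [z [e1 [e2 [e3 T]]]]]]; by rewrite (triangle_mono c T) (triangle_cob c T).
Qed.

Lemma bkernel : const_kernel F Eu (fun f e => e \in b f).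
Proof.
move=> X XF h; apply: (s_con S XF); apply/setP=> e; rewrite [RHS]inE; apply/negP=> eX.
by have := h e (subsetP (bdry_Eu S XF) _ eX); rewrite inE in eX; rewrite eX.
Qed.

(** A vertex set with zero coboundary is constant on every face, and the faces that it contains form
    a set without boundary. *)
Lemma vkernel : const_kernel Vu Eu (fun v e => v \in t e).
Proof.
move=> c cV h; have nc e : e \in Eu -> e \notin cob c.
  move=> eE; rewrite inE; have := h e eE; congr (~~ odd #|pred_of_set _|).
  by apply/setP=> v; rewrite !inE andbC.
have nm f : f \in F -> mono c f.
  move=> fF; have := face_cob c fF; rewrite (_ : _ :&: _ = set0) ?cards0; first by case: ifP.
  by apply/setP=> e; rewrite !inE; apply/negP=> /andP[/(subsetP (b_Eu fF))/nc]; rewrite inE => /negbTE->.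
pose X := [set f in F | vt f \subset c].
have XF : X \subset F by apply/subsetP=> f; rewrite inE => /andP[].
have [] := s_con S XF.
- apply/setP=> e; rewrite [RHS]inE; apply/negP=> /(bdryP S _ XF)[f [g [fX gF gX ef eg]]].
  move: fX gX; rewrite !inE gF /= => /andP[fF fc]; have := nm _ gF; rewrite /mono => /orP[->//|dg] _.
  have /card_gt0P[v ve] : 0 < #|t e| by rewrite (s_t2 S fF ef).
  have := subsetP fc _ (subsetP (t_vt ef) _ ve); by rewrite (disjointFr dg (subsetP (t_vt eg) _ ve)).
- move=> X0; left; apply/setP=> v; rewrite [RHS]inE; apply/negP=> vc.
  have /VuP[f fF vf] := subsetP cV _ vc; have := nm _ fF; rewrite /mono => /orP[fc|df].
    by have : f \in X; [rewrite inE fF|rewrite X0 inE].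
  by rewrite (disjointFr df vf) in vc.
move=> X1; right; apply/eqP; rewrite eqEsubset cV; apply/subsetP=> v /VuP[f fF vf].
by have : f \in X; [rewrite X1|rewrite inE => /andP[_ /subsetP]; apply].
Qed.

Lemma d1d0 : {in Vu & F, forall v f, ~~ odd #|[set e in Eu | (v \in t e) && (e \in b f)]|}.
Proof.
move=> v f _ fF; have := s_ev S v fF; congr (~~ odd #|pred_of_set _|); apply/setP=> e; rewrite !inE.
by case ef: (e \in b f); rewrite ?andbF // (subsetP (b_Eu fF) _ ef) andbT.
Qed.

Lemma isclosedP x : closed x -> isclosed Eu F (fun f e => e \in b f) x.
Proof.
move=> cx f fF; have := cx f fF; congr (~~ odd #|pred_of_set _|); apply/setP=> e; rewrite !inE.
by case ef: (e \in b f); rewrite ?andbF // (subsetP (b_Eu fF) _ ef) andbT.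
Qed.

Definition iscobd x := exists c, forall e, e \in Eu -> (e \in x) = (e \in cob c).

Lemma iscobP x : iscob Vu Eu (fun v e => v \in t e) x -> iscobd x.
Proof.
case=> c _ h; exists c => e eE; rewrite h // inE; congr (odd #|pred_of_set _|).
by apply/setP=> v; rewrite !inE andbC.
Qed.

Lemma euler_bound : #|Vu| + #|F| <= #|Eu| + 2.
Proof. exact: euler_le2 vkernel bkernel d1d0. Qed.

Lemma sphere_cob x : euler t b F 2 -> closed x -> iscobd x.
Proof. by move=> e /isclosedP cx; apply: iscobP; apply: (h1_sphere vkernel bkernel d1d0). Qed.

Lemma proj_cob x y : euler t b F 1 -> closed x -> closed y -> [\/ iscobd x, iscobd y | iscobd (symd x y)].
Proof.
move=> e /isclosedP cx /isclosedP cy.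
by have [] := h1_proj vkernel bkernel d1d0 e cx cy => /iscobP h; [constructor 1|constructor 2|constructor 3].
Qed.

(** An application of [fredholm] with the faces as unknowns and the edges as equations: cocycles
    detect every cycle that bounds nothing. *)
Lemma bounding C : C \subset Eu -> (forall x, x \subset Eu -> closed x -> ~~ odd #|C :&: x|) ->
  exists2 X : {set Phi}, X \subset F & bdry X = C.
Proof.
move=> CE h; have [|X XF HX] := @fredholm Phi E F Eu C (fun f e => e \in b f).
  move=> x xE cx; rewrite setIC; apply: h => // f fF; have := cx f fF; congr (~~ odd #|pred_of_set _|).
  by apply/setP=> e; rewrite !inE andbC.
exists X => //; apply/setP=> e; have [eE|nE] := boolP (e \in Eu); first by rewrite inE HX.
rewrite (contraNF (subsetP CE e) nE); apply: contraNF nE; exact: subsetP (bdry_Eu S XF) e.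
Qed.

End Surface.

End Complex.
Export Complex.

(** * Matchings of the dual graph *)

Section Cochains.
Variables (V E : finType) (t : E -> {set V}) (Phi : finType) (b : Phi -> {set E}).
Implicit Types (c d : {set V}) (C : {set E}) (f : Phi).

Lemma cob_symd c d : cob t (symd c d) = symd (cob t c) (cob t d).
Proof.
apply/setP=> e; rewrite in_symd !inE -odd_symd; congr (odd #|pred_of_set _|).
by apply/setP=> v; rewrite !inE; case: (v \in t e); rewrite //= ?addbF.
Qed.

Lemma cob_even C c : (forall v, even_at t C v) -> ~~ odd #|C :&: cob t c|.
Proof.
move=> ev; rewrite odd_setI; under eq_bigr => e _ do rewrite inE setIC odd_setI.
rewrite exchange_big big1 // => v _; apply/negbTE; have := ev v; rewrite even_atE odd_setI.
by under eq_bigr => e _ do rewrite inE.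
Qed.

Lemma monoC c f : mono t b (~: c) f = mono t b c f.
Proof. by rewrite /mono disjoints_subset setCK orbC; congr orb; rewrite -disjoints_subset. Qed.

Lemma mono_eq c d f : {in vt t b f, c =i d} -> mono t b c f = mono t b d f.
Proof.
move=> h; rewrite /mono -!setI_eq0; congr orb.
  by apply/subsetP/subsetP => h' v vf; [rewrite -h // h'|rewrite h // h'].
by congr (_ == _); apply/setP=> v; rewrite !inE; case vf: (v \in vt t b f) => //=; rewrite h.
Qed.

End Cochains.

Section Matching.
Variables (V E : finType) (t : E -> {set V}) (Phi : finType) (b : Phi -> {set E}) (F : {set Phi}).
Implicit Types (X Y S W : {set Phi}) (P : {set {set Phi}}) (M Z C : {set E}) (c : {set V}) (f g : Phi) (e : E) (v : V).
Local Notation vt := (vt t b).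
Local Notation bdry := (bdry b).
Local Notation Eu := (Eu b F).
Local Notation closed := (closed b F).
Local Notation cob := (cob t).
Local Notation mono := (mono t b).
Hypothesis S0 : surf t b F.

Definition adjr Z f g := [&& f != g, f \in F, g \in F & [exists e in b f :&: b g, e \notin Z]].

Lemma adjr_sym Z : symmetric (adjr Z).
Proof.
move=> f g; rewrite /adjr eq_sym setIC; by case: (f \in F); case: (g \in F).
Qed.

Lemma adjr_irr Z : irreflexive (adjr Z).
Proof. by move=> f; rewrite /adjr eqxx. Qed.

Lemma adjrP Z f g : reflect (exists e, [/\ f != g, f \in F, g \in F & [/\ e \in b f, e \in b g & e \notin Z]]) (adjr Z f g).
Proof.
apply: (iffP and4P) => [[h1 h2 h3 /exists_inP[e]]|[e [h1 h2 h3 [h4 h5 h6]]]].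
  by rewrite inE => /andP[h4 h5] h6; exists e.
by split=> //; apply/exists_inP; exists e; rewrite // inE h4.
Qed.

Lemma pm_of W Z : W \subset F -> perfect W (adjr Z) ->
  exists M, [/\ M \subset Eu, [disjoint M & Z], (forall f, f \in W -> #|b f :&: M| = 1) &
                (forall f e, f \in F -> e \in b f -> e \in M -> f \in W)].
Proof.
move=> WF /perfectP[m hm]; pose ch f := [pick e in b f :&: b (m f) :\: Z].
pose M := [set e | [exists f in W, ch f == Some e]].
have chP f e : f \in W -> ch f = Some e -> [/\ e \in b f, e \in b (m f), e \notin Z & forall g, g \in F -> e \in b g -> g = f \/ g = m f].
  move=> fW; have [mW _ /adjrP[_ [nfm _ _ _]]] := hm f fW.
  rewrite /ch; case: pickP => // x; rewrite !inE => /and3P[xZ xf xm] [<-]; split=> // g gF xg.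
  have [g' [_ _ _ U]] := two_faces S0 (subsetP WF _ fW) xf.
  case: (U _ gF xg) => [->|gg]; [by left|right; case: (U _ (subsetP WF _ mW) xm) => [mf|->//]].
  by rewrite mf eqxx in nfm.
have chE f : f \in W -> exists e, ch f = Some e.
  move=> fW; have [mW _ /adjrP[e [_ _ _ [ef em eZ]]]] := hm f fW.
  by rewrite /ch; case: pickP => [x|/(_ e)]; [exists x|rewrite !inE ef em eZ].
have chm f : f \in W -> ch (m f) = ch f.
  by move=> fW; have [_ mm _] := hm f fW; rewrite /ch mm setIC.
have inM f e : f \in F -> e \in b f -> e \in M -> f \in W /\ ch f = Some e.
  move=> fF ef; rewrite inE => /exists_inP[g gW /eqP ge]; have [_ _ _ U] := chP _ _ gW ge.
  have [mW _ _] := hm g gW; by case: (U f fF ef) => ->; rewrite ?chm.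
exists M; split.
- apply/subsetP=> e; rewrite inE => /exists_inP[f fW /eqP /(chP _ _ fW)[ef _ _ _]].
  by apply/EuP; exists f => //; apply: (subsetP WF).
- rewrite -setI_eq0; apply/eqP/setP=> e; rewrite !inE; apply/negP=> /andP[/exists_inP[f fW /eqP /(chP _ _ fW)[_ _ + _]]].
  by move/negbTE=> ->.
- move=> f fW; have [e ce] := chE f fW; have [ef _ _ _] := chP _ _ fW ce.
  rewrite (_ : _ :&: _ = [set e]) ?cards1 //; apply/setP=> x; rewrite in_setI in_set1; apply/andP/eqP => [[xf xM]|->].
    by have [_] := inM _ _ (subsetP WF _ fW) xf xM; rewrite ce => -[].
  by split=> //; rewrite inE; apply/exists_inP; exists f; rewrite ?ce.
by move=> f e fF ef /(inM _ _ fF ef)[].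
Qed.

Lemma bdry_leD X Y : [disjoint X & Y] -> #|bdry (X :|: Y)| <= #|bdry X| + #|bdry Y|.
Proof. by move=> d; rewrite bdryU //; have := symd_card (bdry X) (bdry Y); lia. Qed.

Lemma bdry_le3 X : X \subset F -> #|bdry X| <= 3 * #|X|.
Proof.
have [n] := ubnP #|X|; elim: n X => // n IH X lt XF; have [->|[f fX]] := set_0Vmem X.
  by rewrite bdry0 cards0.
rewrite -(setD1K fX); have d : [disjoint [set f] & X :\ f] by rewrite disjoints1 !inE eqxx.
apply: leq_trans (bdry_leD d) _; rewrite bdry1 (s_b3 S0 (subsetP XF _ fX)) cardsU1 !inE eqxx mulnDr muln1 leq_add2l.
by apply: IH; [move: lt; rewrite (cardsD1 f) fX|apply: subset_trans (subsetDl _ _) XF].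
Qed.

Lemma bdry_full : bdry F = set0.
Proof. by rewrite -(setD0 F) (bdryC S0) ?sub0set // bdry0. Qed.

Lemma even_faces : ~~ odd #|F|.
Proof. by rewrite -(odd_cut S0) // bdry_full cards0. Qed.

(** An edge on the boundary of a block leads to another block only if it is in [Z], and is then
    counted twice; otherwise it leaves [W :\: S] and is counted once. *)
Lemma blocks_cut W Z S P : W \subset F -> closed_odd W (adjr Z) S P -> trivIset P -> cover P = W :\: S ->
  \sum_(B in P) #|bdry B| <= #|bdry (W :\: S)| + 2 * #|Z|.
Proof.
move=> WF cl tP cP; have BF B : B \in P -> B \subset F.
  by case/cl=> BW _ _; apply: subset_trans BW (subset_trans (subsetDl _ _) WF).
have UF : W :\: S \subset F by apply: subset_trans (subsetDl _ _) WF.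
rewrite (eq_bigr (fun B => \sum_e (e \in bdry B : nat))); last by move=> B _; rewrite -sum1_card big_mkcond.
rewrite exchange_big /= (_ : #|bdry (W :\: S)| = \sum_e (e \in bdry (W :\: S) : nat)); last by rewrite -sum1_card big_mkcond.
rewrite (_ : 2 * #|Z| = \sum_e 2 * (e \in Z : nat)); last first.
  by rewrite -big_distrr /= -sum1_card [in LHS]big_mkcond.
rewrite -big_split /=; apply: leq_sum => e _; set R := [set B in P | e \in bdry B].
have -> : \sum_(B in P) (e \in bdry B : nat) = #|R|.
  rewrite -sum1_card big_mkcond [RHS]big_mkcond; apply: eq_bigr => B _; rewrite /R [B \in [set _ in _ | _]]inE.
  by case: (B \in P) => //=; case: (e \in _).
have [->|[B0 B0R]] := set_0Vmem R; first by rewrite cards0.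
move: B0R; rewrite inE => /andP[B0P /(bdryP S0 _ (BF _ B0P))[f [g [fB gF gB ef eg]]]].
have fF := subsetP (BF _ B0P) _ fB.
have fg h : h \in F -> e \in b h -> h = f \/ h = g.
  have [g' [_ _ _ U]] := two_faces S0 fF ef; move=> hF eh; case: (U h hF eh) => ->; [by left|right].
  by case: (U g gF eg) => // gf; rewrite gf fB in gB.
have inR B : B \in R -> B \in P /\ (f \in B \/ g \in B).
  rewrite inE => /andP[BP /(bdryP S0 _ (BF _ BP))[h [_ [hB _ _ eh _]]]]; split=> //.
  by case: (fg h (subsetP (BF _ BP) _ hB) eh) => <-; [left|right].
case eZ: (e \in Z) => /=.
  apply: (@leq_trans #|[set pblock P f; pblock P g]|); last by rewrite cards2; case: (_ != _); lia.
  apply: subset_leq_card; apply/subsetP=> B /inR[BP]; rewrite !inE.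
  by case=> h; rewrite -(def_pblock tP BP h) eqxx ?orbT.
have gU : g \notin W :\: S.
  apply/negP => gU; have [_ _ H] := cl _ B0P; case/negP: (gB); apply: (H f g fB gU).
  by apply/adjrP; exists e; split=> //; rewrite ?eZ //; apply: contraNneq gB => <-.
have fU : f \in W :\: S by rewrite -cP; apply/bigcupP; exists B0.
rewrite (in_bdry S0 UF fU gF gU ef eg) /= muln0 addn0.
apply: (@leq_trans #|[set pblock P f]|); last by rewrite cards1.
apply: subset_leq_card; apply/subsetP=> B /inR[BP]; rewrite !inE => -[h|h]; first by rewrite -(def_pblock tP BP h).
by case/negP: gU; rewrite -cP; apply/bigcupP; exists B.
Qed.

Definition is_pm M := M \subset Eu /\ forall f, f \in F -> #|b f :&: M| = 1.

(** With a barrier, the cuts of the blocks would add up to at most 3 #|S| + 4, but each is at least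
    3 and there are at least #|S| + 2 of them. *)
Lemma plesnik Z : #|Z| <= 2 -> exists2 M, is_pm M & [disjoint M & Z].
Proof.
move=> Z2; have [pf|npf] := boolP (perfect F (adjr Z)).
  by have [M [h1 h2 h3 _]] := pm_of (subxx _) pf; exists M.
have [S [P [SF cl tP leP cP]]] := tutte_cover (adjr_sym Z) (adjr_irr Z) even_faces npf.
have := blocks_cut (subxx _) cl tP cP; rewrite (bdryC S0) // => le1.
have : \sum_(B in P) 3 <= \sum_(B in P) #|bdry B|.
  apply: leq_sum => B /cl[BF oB _]; apply: (cut_ge3 S0) => //; first exact: subset_trans BF (subsetDl _ _).
  by apply: contraTneq oB => ->; apply: even_faces.
rewrite sum_nat_const => le2; have := bdry_le3 SF; move: le1 le2 leP Z2; clear; lia.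
Qed.

(** A matching that avoids the two other edges of a face has to use [e]; this is why two avoidable
    edges suffice. *)
Lemma plesnik_in e : e \in Eu -> exists2 M, is_pm M & e \in M.
Proof.
case/EuP=> f fF ef; have [|M pM dM] := @plesnik (b f :\ e).
  by have := s_b3 S0 fF; rewrite (cardsD1 e) ef add1n => -[->].
exists M => //; have [_ /(_ f fF)/eqP/cards1P[x Ex]] := pM.
have : x \in b f :&: M by rewrite Ex set11.
rewrite inE => /andP[xf xM]; have := disjointFr dM xM; rewrite !inE xf andbT => /negbFE/eqP <- //.
Qed.

Lemma pm_closed M : is_pm M -> closed (Eu :\: M).
Proof.
case=> _ h f fF; have : #|b f :&: (Eu :\: M)| + #|b f :&: M| = 3.
  rewrite -(s_b3 S0 fF) -[RHS](cardsID M) addnC; congr (_ + #|pred_of_set _|).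
  by apply/setP=> e; rewrite !inE; case ef: (e \in b f); rewrite ?andbF //= (subsetP (b_Eu fF) _ ef) andbT.
by rewrite h // addn1 => -[->].
Qed.

Lemma pm_colour M c : is_pm M -> (forall e, e \in Eu -> (e \in Eu :\: M) = (e \in cob c)) ->
  forall f, f \in F -> b f :&: cob c = b f :\: M /\ ~~ mono c f.
Proof.
case=> _ hM h f fF; have E0 : b f :&: cob c = b f :\: M.
  apply/setP=> e; rewrite in_setI; case ef: (e \in b f); last by rewrite in_setD ef andbF.
  have eE := subsetP (b_Eu fF) _ ef; by rewrite -h // !in_setD eE ef.
split=> //; have := face_cob S0 c fF; rewrite E0; case: ifP => // _ z.
by have := cardsID M (b f); rewrite z hM // (s_b3 S0 fF).
Qed.

(** The face has exactly one edge with ends of equal colour. On the sphere the complement of a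
    perfect matching through that edge is the cut of a colouring, which agrees with [c0] on [f] up
    to a swap. *)
Lemma extend f c0 : euler t b F 2 -> f \in F -> ~~ mono c0 f ->
  exists2 c, (forall g, g \in F -> ~~ mono c g) & {in vt f, c =i c0}.
Proof.
move=> eu fF nm; have c2 := face_cob S0 c0 fF; rewrite (negbTE nm) in c2.
have /cards1P[e Ee] : #|b f :\: cob c0| == 1.
  by have := cardsID (cob c0) (b f); rewrite c2 (s_b3 S0 fF) => /eqP; rewrite eqn_add2l.
have [ef nec] : e \in b f /\ e \notin cob c0.
  by apply/andP; rewrite andbC -in_setD Ee set11.
have [M pM eM] := plesnik_in (subsetP (b_Eu fF) _ ef).
have [c hc] := sphere_cob S0 eu (pm_closed pM).
have hm := pm_colour pM hc; have [Ef _] := hm f fF.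
have bM : b f :\: M = b f :&: cob c0.
  have [_ /(_ f fF)/eqP/cards1P[x Ex]] := pM.
  have xe : e = x by apply/set1P; rewrite -Ex inE ef.
  apply/setP=> y; have /setP/(_ y) := Ex; have /setP/(_ y) := Ee; rewrite -xe !in_setD !in_setI !in_set1.
  by case: (y \in b f); case: (y \in cob c0); case: (y \in M); case: (y == e).
have : mono (symd c c0) f.
  have := face_cob S0 (symd c c0) fF; rewrite (_ : _ :&: _ = set0) ?cards0; first by case: ifP.
  apply/setP=> y; rewrite in_setI cob_symd in_symd in_set0; have /setP/(_ y) := etrans Ef bM.
  by rewrite !in_setI; case: (y \in b f) => //= ->; rewrite addbb.
case/orP=> [sub|dis]; last first.
  exists c => [g gF|v vf]; first by case: (hm g gF).
  by have := disjointFr dis vf; rewrite in_symd; case: (v \in c); case: (v \in c0).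
exists (~: c) => [g gF|v vf]; first by rewrite monoC; case: (hm g gF).
by have := subsetP sub v vf; rewrite in_symd in_setC; case: (v \in c); case: (v \in c0).
Qed.

(** Some cocycle is odd on the nonbounding cycle [C], whereas cuts are even on it. The complement of
    [M] is no cut, as there is no colouring, so it differs from that cocycle by a cut. *)
Lemma pm_even M C : euler t b F 1 -> ~ colourable t b F -> C \subset Eu -> (forall v, even_at t C v) ->
  (forall X, X \subset F -> bdry X <> C) -> is_pm M -> odd #|C :&: (Eu :\: M)|.
Proof.
move=> eu nc CE ev nb pM; have cy := pm_closed pM; set y := Eu :\: M in cy *.
have [//|ey] := boolP (odd _); exfalso.
have iscob_even x : iscobd t b F x -> ~~ odd #|C :&: x|.
  case=> c hc; rewrite (_ : C :&: x = C :&: cob c) ?cob_even //.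
  by apply/setP=> e; rewrite !in_setI; case eC: (e \in C) => //=; rewrite hc // (subsetP CE).
have [x [xE cx ox]] : exists x : {set E}, [/\ x \subset Eu, closed x & odd #|C :&: x|].
  case: (boolP [exists x : {set E}, [&& x \subset Eu, [forall (f | f \in F), ~~ odd #|b f :&: x|] & odd #|C :&: x|]]).
    by case/existsP=> x /and3P[h1 /forall_inP h2 h3]; exists x.
  rewrite negb_exists => /forallP h; have [|X XF EX] := bounding S0 CE; last by case: (nb X XF).
  move=> x xE cx; have := h x; rewrite xE /= negb_and => /orP[/forall_inP[]|//]; exact: cx.
have [/iscob_even|[c hc]|/iscob_even] := proj_cob S0 eu cx cy.
- by rewrite ox.
- by apply: nc; exists c => f fF; case: (pm_colour pM hc fF).
rewrite (_ : C :&: _ = symd (C :&: x) (C :&: y)); first by rewrite odd_symd ox (negbTE ey).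
by apply/setP=> e; rewrite in_symd !in_setI in_symd; case: (e \in C).
Qed.

End Matching.

(** * Quotients and pieces *)

(* The blocks of a partition [P] of the faces, all with 3-edge boundaries, are the faces of a coarser surface. *)
Section Quotient.
Variables (V E : finType) (t : E -> {set V}) (Phi : finType) (b : Phi -> {set E}) (F : {set Phi}).
Variable P : {set {set Phi}}.
Implicit Types (X Y B : {set Phi}) (Q : {set {set Phi}}) (C : {set E}) (c : {set V}) (f g : Phi) (e : E) (v : V).
Local Notation vt := (vt t b).
Local Notation bdry := (bdry b).
Local Notation star := (star t b F).
Hypothesis S0 : surf t b F.

Definition iV X := [set v in Vu t b F | star v \subset X].
Definition iE X := [set e in Eu b F | [set f in F | e \in b f] \subset X].
(* The interior of [X] has Euler characteristic one, as an open disc has. *)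
Definition disc X := #|iV X| + #|X| = #|iE X| + 1.

Hypotheses (pP : partition P F) (c3 : forall B, B \in P -> #|bdry B| = 3).

Let covP : cover P = F. Proof. by case/and3P: pP => /eqP. Qed.
Let tP : trivIset P. Proof. by case/and3P: pP. Qed.
Let ne B : B \in P -> B != set0.
Proof. by case/and3P: pP => _ _ n0 BP; apply: contraNneq n0 => <-. Qed.
Let BF B : B \in P -> B \subset F.
Proof. by move=> BP; rewrite -covP; apply: bigcup_sup. Qed.
Let uniqB B B' f : B \in P -> B' \in P -> f \in B -> f \in B' -> B = B'.
Proof. by move=> BP BP' fB fB'; rewrite -(def_pblock tP BP fB) -(def_pblock tP BP' fB'). Qed.
Let blk f : f \in F -> exists2 B, B \in P & f \in B.
Proof. by rewrite -covP => /bigcupP[B BP fB]; exists B. Qed.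

Lemma quot_bdry Q : Q \subset P -> Complex.bdry bdry Q = bdry (cover Q).
Proof.
move=> QP; apply/setP=> e; rewrite !in_bdryE big_trivIset ?(trivIsetS QP) //=.
by apply: eq_bigr => B _; rewrite in_bdryE.
Qed.

Lemma cover_sub Q : Q \subset P -> cover Q \subset F.
Proof. by move=> QP; apply/bigcupsP=> B BQ; apply/BF/(subsetP QP). Qed.

Lemma cover_mem Q B f : Q \subset P -> B \in P -> f \in B -> (f \in cover Q) = (B \in Q).
Proof.
move=> QP BP fB; apply/bigcupP/idP => [[B' BQ fB']|BQ]; last by exists B.
by rewrite (uniqB BP (subsetP QP _ BQ) fB fB').
Qed.

Lemma quot_star_bdry B f v : B \in P -> f \in B -> f \in star v -> ~~ (star v \subset B) -> v \in Complex.vt t bdry B.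
Proof.
move=> BP fB fs ns; have sF : star v \subset F by apply/subsetP=> g; rewrite inE => /andP[].
have [|||e eX ve] := s_link S0 (v := v) (X := star v :&: B).
- exact: subsetIl.
- by apply/set0Pn; exists f; rewrite inE fs.
- by apply: contra ns => /eqP/setIidPl.
have XF : star v :&: B \subset F by apply: subset_trans (subsetIl _ _) sF.
have [f' [g' [f'X g'F g'X ef eg]]] := bdryP S0 _ XF eX.
apply/in_vt; exists e => //; move: f'X g'X; rewrite inE => /andP[f's f'B].
have gs : g' \in star v by rewrite inE g'F; apply/in_vt; exists e.
by rewrite in_setI gs /= => gB; apply: (in_bdry S0 (BF BP) f'B g'F gB ef eg).
Qed.

Lemma quot_star B v : B \in P -> v \in Complex.vt t bdry B -> exists f g, [/\ f \in star v, f \in B, g \in star v & g \notin B].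
Proof.
move=> BP /in_vt[e /(bdryP S0 _ (BF BP))[f [g [fB gF gB ef eg]]] ve]; exists f, g; split=> //.
  by rewrite inE (subsetP (BF BP) _ fB); apply/in_vt; exists e.
by rewrite inE gF; apply/in_vt; exists e.
Qed.

(** The boundary of a set of blocks is that of its union, so the connectedness of the surface and of
    its links passes to the quotient. *)
Lemma quot_surf : surf t bdry P.
Proof.
split.
- by apply: contraNneq (s_ne S0) => P0; rewrite -covP P0 /cover big_set0.
- exact: c3.
- by move=> B v BP; apply: (bdry_even S0); apply: BF.
- by move=> B e BP eB; apply: (Eu_t2 S0); apply: (subsetP (bdry_Eu S0 (BF BP))).
- move=> B e BP /(bdryP S0 _ (BF BP))[f [g [fB gF gB ef eg]]].
  have [B' BP' gB'] := blk gF; rewrite (_ : [set _ in _ | _] = [set B; B']).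
    by rewrite cards2 (_ : B != B') //; apply: contraNneq gB => ->.
  have fF := subsetP (BF BP) _ fB.
  have fB' : f \notin B' by apply: contra gB => fB'; rewrite (uniqB BP BP' fB fB').
  apply/setP=> X; rewrite inE in_set2; apply/andP/orP => [[XP]|[]/eqP->]; last 2 first.
  + by split=> //; apply: (in_bdry S0 (BF BP) fB gF gB ef eg).
  + by split=> //; apply: (in_bdry S0 (BF BP') gB' fF fB' eg ef).
  case/(bdryP S0 _ (BF XP))=> [f' [_ [fX _ _ ef' _]]].
  have [g' [_ _ _ U]] := two_faces S0 fF ef; have f'F := subsetP (BF XP) _ fX.
  case: (U _ f'F ef') => E1; first by left; apply/eqP/(uniqB XP BP fX); rewrite E1.
  right; apply/eqP/(uniqB XP BP' fX); case: (U _ gF eg) => E2; last by rewrite E1 -E2.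
  by rewrite E2 fB in gB.
- move=> Q QP; rewrite quot_bdry // => /(s_con S0 (cover_sub QP))[] h; [left|right].
    apply/setP=> B; rewrite inE; apply/negP => BQ; have /set0Pn[f fB] := ne (subsetP QP _ BQ).
    by have := cover_mem QP (subsetP QP _ BQ) fB; rewrite h inE BQ.
  apply/eqP; rewrite eqEsubset QP; apply/subsetP=> B BP; have /set0Pn[f fB] := ne BP.
  by rewrite -(cover_mem QP BP fB) h (subsetP (BF BP)).
move=> v Q Qs Q0 Q1; have QP : Q \subset P by apply: subset_trans Qs _; apply/subsetP=> B; rewrite inE => /andP[].
have QF := cover_sub QP; have sF : star v \subset F by apply/subsetP=> g; rewrite inE => /andP[].
have [B0 [B0s B0Q]] : exists B, B \in Complex.star t bdry P v /\ B \notin Q.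
  have : ~~ (Complex.star t bdry P v \subset Q) by apply: contra Q1 => h; rewrite eqEsubset Qs.
  by case/subsetPn=> B h1 h2; exists B.
have /andP[B0P B0v] : (B0 \in P) && (v \in Complex.vt t bdry B0) by rewrite inE in B0s.
have [g0 [_ [g0s g0B _ _]]] := quot_star B0P B0v.
have [B1 B1Q] := set0Pn _ Q0; have B1P := subsetP QP _ B1Q.
have := subsetP Qs _ B1Q; rewrite inE => /andP[_ /(quot_star B1P)[f0 [_ [f0s f0B _ _]]]].
have [|||e eX ve] := s_link S0 (v := v) (X := star v :&: cover Q).
- exact: subsetIl.
- by apply/set0Pn; exists f0; rewrite in_setI f0s (cover_mem QP B1P f0B).
- apply: contra B0Q => /eqP /setIidPl /subsetP/(_ _ g0s); by rewrite (cover_mem QP B0P g0B).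
have XF : star v :&: cover Q \subset F by apply: subset_trans (subsetIl _ _) sF.
exists e => //; rewrite quot_bdry //; have [f [g [fX gF gX ef eg]]] := bdryP S0 _ XF eX.
move: fX gX; rewrite in_setI => /andP[fs fQ].
have gs : g \in star v by rewrite inE gF; apply/in_vt; exists e.
by rewrite in_setI gs /= => gQ; apply: (in_bdry S0 QF fQ gF gQ ef eg).
Qed.

Lemma quot_Vu v : v \in Vu t b F -> (v \notin Vu t bdry P) = [exists B in P, star v \subset B].
Proof.
case/VuP=> f fF vf; have fs : f \in star v by rewrite inE fF.
have [B BP fB] := blk fF; apply/idP/exists_inP => [vn|[B' BP' sB']].
  exists B => //; apply: contraR vn => ns; apply/VuP; exists B => //; exact: quot_star_bdry fs ns.
apply/negP=> /VuP[B1 BP1 vB1]; have [f1 [g1 [f1s f1B g1s g1B]]] := quot_star BP1 vB1.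
by case/negP: g1B; rewrite -(uniqB BP' BP1 (subsetP sB' _ f1s) f1B); apply: (subsetP sB').
Qed.

Lemma quot_Vu_sub : Vu t bdry P \subset Vu t b F.
Proof.
apply/subsetP=> v /VuP[B BP /(quot_star BP)[f [_ [fs _ _ _]]]]; apply/VuP; exists f; move: fs; rewrite inE; by case/andP.
Qed.

Lemma quot_Eu_sub : Eu bdry P \subset Eu b F.
Proof. by apply/subsetP=> e /EuP[B BP eB]; apply: (subsetP (bdry_Eu S0 (BF BP))). Qed.

Lemma quot_Eu e : e \in Eu b F -> (e \notin Eu bdry P) = [exists B in P, [set f in F | e \in b f] \subset B].
Proof.
case/EuP=> f fF ef; have [B BP fB] := blk fF; apply/idP/exists_inP => [en|[B' BP' sB']].
  exists B => //; apply/subsetP=> g; rewrite inE => /andP[gF eg]; apply: contraR en => gB.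
  by apply/EuP; exists B => //; apply: (in_bdry S0 (BF BP) fB gF gB ef eg).
apply/negP=> /EuP[B1 BP1 /(bdryP S0 _ (BF BP1))[f1 [g1 [f1B g1F g1B ef1 eg1]]]].
have sF f' : f' \in F -> e \in b f' -> f' \in B' by move=> h1 h2; apply: (subsetP sB'); rewrite inE h1.
case/negP: g1B; rewrite -(uniqB BP' BP1 _ f1B); first exact: sF.
by apply: sF => //; apply: (subsetP (BF BP1)).
Qed.

(** The star map is left abstract so that vertices and edges are treated at once: whatever
    disappears in the quotient has its star inside exactly one block. *)
Lemma card_interior (T : finType) (A A' : {set T}) (st : T -> {set Phi}) :
  A' \subset A -> (forall x, x \in A -> st x \subset F /\ st x != set0) ->
  (forall x, x \in A -> (x \notin A') = [exists B in P, st x \subset B]) ->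
  #|A| = #|A'| + \sum_(B in P) #|[set x in A | st x \subset B]|.
Proof.
move=> sA st0 h; rewrite (eq_bigr (fun B : {set Phi} => \sum_(x in A) (st x \subset B : nat))); last first.
  move=> B _; rewrite -sum1_card big_mkcond [RHS]big_mkcond; apply: eq_bigr => x _; rewrite inE.
  by case: (x \in A) => //=; case: (_ \subset _).
rewrite exchange_big /= (eq_bigr (fun x => (x \notin A') : nat)).
  rewrite -(cardsID A' A) (setIidPr sA); congr (_ + _).
  rewrite -sum1_card big_mkcond [RHS]big_mkcond; apply: eq_bigr => x _; rewrite in_setD.
  by case: (x \in A); case: (x \in A').
move=> x xA; rewrite (h x xA); have [/existsP[B /andP[BP sB]]|nB] := boolP [exists B in P, st x \subset B].
  rewrite (bigD1 B) //= sB big1 // => B' /andP[BP' nB]; apply/eqP; rewrite eqb0; apply/negP => sB'.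
  have [_ /set0Pn[f fx]] := st0 x xA; case/eqP: nB; exact: uniqB (subsetP sB' _ fx) (subsetP sB _ fx).
rewrite big1 // => B BP; apply/eqP; rewrite eqb0; apply: contra nB => sB; by apply/exists_inP; exists B.
Qed.

Lemma quot_cardV : #|Vu t b F| = #|Vu t bdry P| + \sum_(B in P) #|iV B|.
Proof.
apply: card_interior quot_Vu_sub _ quot_Vu => v /VuP[f fF vf]; split.
  by apply/subsetP=> g; rewrite inE => /andP[].
by apply/set0Pn; exists f; rewrite inE fF.
Qed.

Lemma quot_cardE : #|Eu b F| = #|Eu bdry P| + \sum_(B in P) #|iE B|.
Proof.
apply: card_interior quot_Eu_sub _ quot_Eu => e /EuP[f fF ef]; split.
  by apply/subsetP=> g; rewrite inE => /andP[].
by apply/set0Pn; exists f; rewrite inE fF.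
Qed.

Lemma quot_euler chi : (forall B, B \in P -> disc B) -> euler t b F chi -> euler t bdry P chi.
Proof.
move=> dP; rewrite /euler quot_cardV quot_cardE (card_partition pP).
have : \sum_(B in P) #|iV B| + \sum_(B in P) #|B| = \sum_(B in P) #|iE B| + #|P|.
  rewrite -sum1_card -!big_split; apply: eq_bigr => B; exact: dP.
move: (\sum_(B in P) #|iV B|) (\sum_(B in P) #|iE B|) (\sum_(B in P) #|B|) => x y z.
move: #|Vu t bdry P| #|Eu bdry P| #|P| => p q n; lia.
Qed.

(** A vertex that disappears in the quotient has its whole star in one block and takes its colour
    from there; on all other vertices the blocks agree with [c0]. *)
Lemma assemble c0 (cB : {set Phi} -> {set V}) : (forall B, B \in P -> {in Complex.vt t bdry B, cB B =i c0}) ->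
  exists c, forall B f, B \in P -> f \in B -> {in vt f, c =i cB B}.
Proof.
move=> h; pose bl v := odflt set0 [pick B in P | star v \subset B].
exists [set v | if v \in Vu t bdry P then v \in c0 else v \in cB (bl v)] => B f BP fB v vf.
have fF := subsetP (BF BP) _ fB; have fs : f \in star v by rewrite inE fF.
have vV : v \in Vu t b F by apply: (subsetP (vt_Vu fF)).
rewrite inE; case: ifPn => vP.
  rewrite h //; apply: quot_star_bdry fs _ => //; apply: contraTN vP => sB.
  by rewrite quot_Vu //; apply/exists_inP; exists B.
rewrite quot_Vu // in vP; case/exists_inP: vP => B' BP' sB'.
rewrite /bl; case: pickP => [B1 /andP[BP1 sB1]|/(_ B')]; last by rewrite BP' sB'.
by rewrite (uniqB BP1 BP (subsetP sB1 _ fs) fB).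
Qed.

(** A set of faces with boundary [C] cannot split a block: the boundaries of the two parts would
    divide the three boundary edges of the block and have at least two edges each. *)
Lemma quot_nonbounding C : C \subset Eu bdry P -> (forall Q, Q \subset P -> Complex.bdry bdry Q <> C) ->
  forall X, X \subset F -> bdry X <> C.
Proof.
move=> CE nb X XF EX.
have full B : B \in P -> X :&: B = set0 \/ X :&: B = B.
  move=> BP; set Y := X :&: B; have YF : Y \subset F by apply: subset_trans (subsetIl _ _) XF.
  have YB : Y \subset B by apply: subsetIr.
  have sub : bdry Y \subset bdry B.
    apply/subsetP=> e /(bdryP S0 _ YF)[f [g [fY gF gY ef eg]]].
    move: fY gY; rewrite !in_setI => /andP[fX fB]; have [gB|gB] := boolP (g \in B); last first.
      by move=> _; apply: (in_bdry S0 (BF BP) fB gF gB ef eg).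
    rewrite andbT => gX; have eC : e \in C by rewrite -EX; apply: (in_bdry S0 XF fX gF gX ef eg).
    have /EuP[B1 BP1 /(bdryP S0 _ (BF BP1))[f1 [g1 [f1B g1F g1B ef1 eg1]]]] := subsetP CE _ eC.
    have fF := subsetP XF _ fX; have [g' [_ _ _ U]] := two_faces S0 fF ef.
    have all1 h : h \in F -> e \in b h -> h \in B.
      move=> hF eh; case: (U h hF eh) => ->//; case: (U g gF eg) => [gf|<-//]; by rewrite gf fX in gX.
    by case/negP: g1B; rewrite -(uniqB BP BP1 (all1 _ _ ef1) f1B) ?all1 // (subsetP (BF BP1)).
  have [->|Y0] := eqVneq Y set0; first by left.
  right; apply/eqP; rewrite eqEsubset YB /= -setD_eq0; apply: contraT => D0.
  have DF : B :\: Y \subset F by apply: subset_trans (subsetDl _ _) (BF BP).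
  have D1 : B :\: Y != F.
    by have [f fY] := set0Pn _ Y0; apply/eqP=> D1; have := subsetP YF _ fY; rewrite -D1 in_setD fY.
  have Y1 : Y != F.
    apply: contraNneq D0 => Y1; rewrite setD_eq0 Y1; exact: BF.
  have eD : bdry (B :\: Y) = bdry B :\: bdry Y.
    have -> : B :\: Y = symd B Y.
      by apply/setP=> f; rewrite in_symd in_setD; case fY: (f \in Y); rewrite ?(subsetP YB _ fY) //= addbF.
    rewrite bdry_symd; apply/setP=> e; rewrite in_symd in_setD; case eY: (e \in bdry Y); rewrite ?(subsetP sub _ eY) //=.
    by rewrite addbF.
  have := cut_ge2 S0 DF D0 D1; have := cut_ge2 S0 YF Y0 Y1; rewrite eD cardsD (setIidPr sub) (c3 BP).
  by clear; lia.
apply: (nb [set B in P | B \subset X]); first by apply/subsetP=> B; rewrite inE => /andP[].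
rewrite quot_bdry; last by apply/subsetP=> B; rewrite inE => /andP[].
rewrite -EX; congr bdry; apply/setP=> f; apply/bigcupP/idP => [[B]|fX].
  by rewrite inE => /andP[_ /subsetP]; apply.
have [B BP fB] := blk (subsetP XF _ fX); exists B => //; rewrite inE BP.
by case: (full B BP) => [/setP/(_ f)|/setIidPr //]; rewrite !inE fX fB.
Qed.

End Quotient.

Section Pieces.
Variables (V E : finType) (t : E -> {set V}) (Phi : finType) (b : Phi -> {set E}) (F : {set Phi}).
Implicit Types (X Y B : {set Phi}) (P Q : {set {set Phi}}) (C : {set E}) (c : {set V}) (f g : Phi) (e : E) (v : V).
Local Notation vt := (vt t b).
Local Notation bdry := (bdry b).
Local Notation star := (star t b F).
Local Notation disc := (disc t b F).
Local Notation iV := (iV t b F).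
Local Notation iE := (iE b F).
Hypothesis S0 : surf t b F.

Lemma vt_bdry1 f : Complex.vt t bdry [set f] = vt f.
Proof. by rewrite /Complex.vt bdry1. Qed.

Lemma mono_bdry1 c f : mono t bdry c [set f] = mono t b c f.
Proof. by rewrite /mono vt_bdry1. Qed.

Lemma vt_bdryC X : X \subset F -> Complex.vt t bdry (F :\: X) = Complex.vt t bdry X.
Proof. by move=> XF; rewrite /Complex.vt (bdryC S0). Qed.

Lemma mono_bdryC c X : X \subset F -> mono t bdry c (F :\: X) = mono t bdry c X.
Proof. by move=> XF; rewrite /mono vt_bdryC. Qed.

Lemma cut3_proper X : X \subset F -> #|bdry X| = 3 -> X != set0 /\ X != F.
Proof.
by move=> XF c3; split; apply: contra_eqN c3 => /eqP->; rewrite ?bdry0 ?(bdry_full S0) cards0.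
Qed.

Lemma setDDF X : X \subset F -> F :\: (F :\: X) = X.
Proof. by move=> XF; rewrite setDDr setDv set0U; apply/setIidPr. Qed.

Lemma edge_star f e : f \in F -> e \in b f -> exists2 g, g != f & g \in [set g in F | e \in b g].
Proof. by move=> fF ef; have [g [gF nfg eg _]] := two_faces S0 fF ef; exists g => //; rewrite inE gF. Qed.

Lemma iV1 f : f \in F -> iV [set f] = set0.
Proof.
move=> fF; apply/setP=> v; rewrite in_set in_set0; apply/negP=> /andP[/VuP[g gF vg] sv].
have : g \in star v by rewrite inE gF.
move/(subsetP sv)/set1P => gf; rewrite gf in vg; have /in_vt[e ef ve] := vg.
have [h nh] := edge_star fF ef; rewrite inE => /andP[hF eh].
have : h \in star v by rewrite inE hF; apply/in_vt; exists e.
by move/(subsetP sv)/set1P => hf; rewrite hf eqxx in nh.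
Qed.

Lemma disc1 f : f \in F -> disc [set f].
Proof.
move=> fF; rewrite /disc cards1 iV1 // cards0.
rewrite (_ : iE _ = set0) ?cards0 //; apply/setP=> e; rewrite in_set in_set0; apply/negP=> /andP[/EuP[g gF eg] se].
have : g \in [set g in F | e \in b g] by rewrite inE gF.
move/(subsetP se)/set1P => gf; rewrite gf in eg; have [h nh] := edge_star fF eg.
by move/(subsetP se)/set1P => hf; rewrite hf eqxx in nh.
Qed.

(* The complement of [X] is collapsed to a single face, and [X] is kept. *)
Definition pc X := (F :\: X) |: [set [set f] | f in X].

Lemma pcP X B : reflect (B = F :\: X \/ exists2 f, f \in X & B = [set f]) (B \in pc X).
Proof.
rewrite in_setU1; apply: (iffP orP) => [[/eqP|/imsetP]|[->|h]]; [by left|by right|by left; rewrite eqxx|right].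
exact/imsetP.
Qed.

Lemma pc_out X : F :\: X \in pc X. Proof. by apply/pcP; left. Qed.
Lemma pc_in X f : f \in X -> [set f] \in pc X. Proof. by move=> fX; apply/pcP; right; exists f. Qed.

Lemma pc_sum X (w : {set Phi} -> nat) : X \subset F -> X != F ->
  \sum_(B in pc X) w B = w (F :\: X) + \sum_(f in X) w [set f].
Proof.
move=> XF XnF; rewrite big_setU1; last first.
  by apply/negP=> /imsetP[f fX /setP/(_ f)]; rewrite !inE eqxx fX.
by congr addn; rewrite big_imset // => f g _ _ /set1_inj.
Qed.

Lemma pc_partition X : X \subset F -> X != F -> partition (pc X) F.
Proof.
move=> XF XnF; apply/and3P; split.
- apply/eqP/setP=> f; apply/bigcupP/idP => [[B /pcP[->|[g gX ->]]]|fF].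
  + by rewrite inE => /andP[].
  + by move/set1P=> ->; apply: (subsetP XF).
  have [fX|fX] := boolP (f \in X); first by exists [set f]; rewrite ?pc_in // set11.
  by exists (F :\: X); rewrite ?pc_out // inE fX.
- apply/trivIsetP=> B B' /pcP[->|[f fX ->]] /pcP[->|[g gX ->]]; rewrite ?eqxx // => n.
  + by rewrite disjoint_sym disjoints1 inE gX.
  + by rewrite disjoints1 inE fX.
  by rewrite disjoints1 inE; apply: contra n => /eqP->.
apply/negP=> /pcP[/esym/eqP|[f _ /setP/(_ f)]]; last by rewrite !inE eqxx.
by rewrite setD_eq0 => FX; rewrite eqEsubset XF FX in XnF.
Qed.

Section OnePiece.
Variable X : {set Phi}.
Hypotheses (XF : X \subset F) (c3 : #|bdry X| = 3).

Let X0 : X != set0. Proof. by case: (cut3_proper XF c3). Qed.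
Let XnF : X != F. Proof. by case: (cut3_proper XF c3). Qed.

Lemma pc_c3 B : B \in pc X -> #|bdry B| = 3.
Proof. by case/pcP=> [->|[f fX ->]]; rewrite ?(bdryC S0) // bdry1 (s_b3 S0) // (subsetP XF). Qed.

Lemma pc_surf : surf t bdry (pc X).
Proof. exact: quot_surf S0 (pc_partition XF XnF) pc_c3. Qed.

Lemma pc_card : #|pc X| = #|X| + 1.
Proof. by rewrite -sum1_card pc_sum // sum_nat_const muln1 addnC. Qed.

Let single0 f : f \in X -> #|iV [set f]| = 0 /\ #|iE [set f]| = 0.
Proof.
move=> fX; have fF := subsetP XF _ fX; have := disc1 fF; rewrite /disc cards1.
by rewrite iV1 // cards0; lia.
Qed.

Lemma pc_cards : #|Vu t b F| = #|Vu t bdry (pc X)| + #|iV (F :\: X)| /\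
  #|Eu b F| = #|Eu bdry (pc X)| + #|iE (F :\: X)|.
Proof.
rewrite (quot_cardV S0 (pc_partition XF XnF)) (quot_cardE S0 (pc_partition XF XnF)) !pc_sum //.
by rewrite !big1 ?addn0 // => f /single0[].
Qed.

Lemma cut_cards : #|Vu t b F| = 3 + #|iV X| + #|iV (F :\: X)| /\
  #|Eu b F| = 3 + #|iE X| + #|iE (F :\: X)|.
Proof.
pose P2 := [set X; F :\: X].
have nX : X != F :\: X.
  by apply/eqP=> /setP h; have [f fX] := set0Pn _ X0; have := h f; rewrite inE fX.
have p2 : partition P2 F.
  apply/and3P; split.
  - by rewrite /cover big_setU1 ?inE //= big_set1; apply/eqP/setP=> f; rewrite !inE; case fX: (f \in X) => //=;
      rewrite (subsetP XF _ fX).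
  - apply/trivIsetP=> B B'; rewrite !inE => /orP[]/eqP-> /orP[]/eqP->; rewrite ?eqxx // => _.
      by rewrite -setI_eq0; apply/eqP/setP=> f; rewrite !inE; case: (f \in X).
    by rewrite -setI_eq0; apply/eqP/setP=> f; rewrite !inE; case: (f \in X); rewrite ?andbF.
  rewrite !inE negb_or eq_sym X0 /= eq_sym setD_eq0; apply: contra XnF => h; by rewrite eqEsubset XF.
have v2 : Vu t bdry P2 = Complex.vt t bdry X.
  by rewrite /Vu big_setU1 ?inE // big_set1 vt_bdryC //= setUid.
have e2 : Eu bdry P2 = bdry X.
  by rewrite /Eu big_setU1 ?inE // big_set1 (bdryC S0) //= setUid.
have c2 B : B \in P2 -> #|bdry B| = 3 by rewrite !inE => /orP[]/eqP->; rewrite ?(bdryC S0).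
rewrite (quot_cardV S0 p2) (quot_cardE S0 p2) v2 e2 c3 !big_setU1 ?inE //= !big_set1.
by rewrite (card_vt (quot_surf S0 p2 c2)) ?inE ?eqxx // !addnA.
Qed.

(** Collapsing the complement gives a closed surface with [#|X| + 1] faces, whose Euler
    characteristic is at most 2. *)
Lemma disc_le : #|iV X| + #|X| <= #|iE X| + 1.
Proof.
have [a1 a2] := pc_cards; have [b1 b2] := cut_cards; have := euler_bound pc_surf; rewrite pc_card.
by move: a1 a2 b1 b2; rewrite [X in X = _ -> _]/=; lia.
Qed.

Lemma pc_euler : disc X -> euler t bdry (pc X) 2.
Proof.
have [a1 a2] := pc_cards; have [b1 b2] := cut_cards; rewrite /euler pc_card /disc.
by move: a1 a2 b1 b2; lia.
Qed.

(** The disc closed up by its outside is a sphere in which the outside is one face, so [extend]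
    applies to that face. *)
Lemma disc_extend c0 : disc X -> ~~ mono t bdry c0 X ->
  exists2 c : {set V}, {in Complex.vt t bdry X, c =i c0} & forall f, f \in X -> ~~ mono t b c f.
Proof.
move=> dX nm; have [] := @extend _ _ _ _ _ _ pc_surf (F :\: X) c0 (pc_euler dX) (pc_out X).
  by rewrite mono_bdryC.
rewrite vt_bdryC // => c h1 h2; exists c => // f fX; rewrite -mono_bdry1; exact/h1/pc_in.
Qed.

End OnePiece.

Lemma cardsDF X : X \subset F -> #|F| = #|X| + #|F :\: X|.
Proof. by move=> XF; rewrite cardsD (setIidPr XF) subnKC // subset_leq_card. Qed.

(** The interiors of the two sides of a 3-cut have characteristics at most 1, with sum 2 here and
    sum 1 in [disc_proj]. *)
Lemma disc_sphere X : X \subset F -> #|bdry X| = 3 -> euler t b F 2 -> disc X.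
Proof.
move=> XF c3; have DF : F :\: X \subset F := subsetDl _ _.
have c3' : #|bdry (F :\: X)| = 3 by rewrite (bdryC S0).
have [b1 b2] := cut_cards XF c3; have := disc_le XF c3; have := disc_le DF c3'.
by rewrite /euler /disc b1 b2 (cardsDF XF); lia.
Qed.

Lemma disc_proj X : X \subset F -> #|bdry X| = 3 -> euler t b F 1 -> disc X \/ disc (F :\: X).
Proof.
move=> XF c3; have DF : F :\: X \subset F := subsetDl _ _.
have c3' : #|bdry (F :\: X)| = 3 by rewrite (bdryC S0).
have [b1 b2] := cut_cards XF c3; have := disc_le XF c3; have := disc_le DF c3'.
by rewrite /euler /disc b1 b2 (cardsDF XF); lia.
Qed.

Definition disc_partition P := partition P F /\ forall B, B \in P -> #|bdry B| = 3 /\ disc B.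

Lemma disc_partition1 : disc_partition [set [set f] | f in F].
Proof.
split; last by move=> B /imsetP[f fF ->]; rewrite bdry1 (s_b3 S0) //; split=> //; apply: disc1.
apply/and3P; split.
- apply/eqP/setP=> f; apply/bigcupP/idP => [[B /imsetP[g gF ->] /set1P->]//|fF].
  by exists [set f]; rewrite ?set11 // imset_f.
- apply/trivIsetP=> B B' /imsetP[f fF ->] /imsetP[g gF ->] n; rewrite disjoints1 inE; apply: contra n => /eqP->//.
by apply/negP=> /imsetP[f _ /setP/(_ f)]; rewrite !inE eqxx.
Qed.

Lemma part_sub P B : partition P F -> B \in P -> B \subset F.
Proof. by case/and3P=> /eqP<- _ _ BP; apply: bigcup_sup. Qed.

(** The requirement [R] is boolean so that [xchoose] can pick a colouring for each block;
    implications make the choice total on sets that are not blocks. *)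
Lemma assemble_ex P c0 (R : {set V} -> Phi -> bool) : (forall (c d : {set V}) f, {in vt f, c =i d} -> R c f = R d f) -> partition P F ->
  (forall B, B \in P -> exists c : {set V}, {in Complex.vt t bdry B, c =i c0} /\ forall f, f \in B -> R c f) ->
  exists c, forall f, f \in F -> R c f.
Proof.
move=> Req pP h.
have {h}h B : exists c : {set V}, [&& [forall (v | v \in Complex.vt t bdry B), (B \in P) ==> ((v \in c) == (v \in c0))] &
    [forall (f | f \in B), (B \in P) ==> R c f]].
  have [BP|nB] := boolP (B \in P); last by exists c0; apply/andP; split; apply/forall_inP.
  by have [c [h1 h2]] := h B BP; exists c; apply/andP; split; apply/forall_inP=> x xB; [rewrite (h1 x xB) eqxx|rewrite h2].
pose cB B := xchoose (h B).
have hB B : B \in P -> {in Complex.vt t bdry B, cB B =i c0} /\ forall f, f \in B -> R (cB B) f.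
  move=> BP; have /andP[/forall_inP h1 /forall_inP h2] := xchooseP (h B); split.
    by move=> v vB; apply/eqP; apply: (implyP (h1 v vB)).
  by move=> f fB; apply: (implyP (h2 f fB)).
have [c hc] := assemble S0 pP (fun B BP => (hB B BP).1).
exists c => f fF; have : f \in cover P by case/and3P: pP => /eqP->.
case/bigcupP=> B BP fB; rewrite (Req _ _ _ (hc B f BP fB)); exact: (hB B BP).2.
Qed.

Lemma quot_colourable P : disc_partition P -> colourable t bdry P -> colourable t b F.
Proof.
case=> pP dP [c0 h0]; apply: (assemble_ex (P := P) (c0 := c0) (R := fun c f => ~~ mono t b c f)) => //.
  by move=> c d f h; rewrite (mono_eq h).
move=> B BP; have [c3 dB] := dP B BP.
by have [c h1 h2] := disc_extend (part_sub pP BP) c3 dB (h0 B BP); exists c.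
Qed.

Lemma merge_partition P Q : partition P F -> Q \subset P -> Q != set0 -> partition (cover Q |: (P :\: Q)) F.
Proof.
move=> pP QP Q0; have /and3P[/eqP cP tP n0] := pP.
have QF : cover Q \subset F by rewrite -cP; apply/bigcupsP=> B BQ; apply: bigcup_sup; apply: (subsetP QP).
have dis B : B \in P -> B \notin Q -> [disjoint cover Q & B].
  move=> BP BQ; rewrite -setI_eq0; apply/eqP/setP=> f; rewrite in_setI in_set0; apply/negP=> /andP[/bigcupP[B' BQ' fB'] fB].
  by case/negP: BQ; rewrite -(def_pblock tP BP fB) (def_pblock tP (subsetP QP _ BQ') fB').
apply/and3P; split.
- apply/eqP/setP=> f; apply/bigcupP/idP => [[B]|].
    rewrite in_setU1 in_setD => /predU1P[->|/andP[_ BP]] fB; first exact: (subsetP QF).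
    by rewrite -cP; apply/bigcupP; exists B.
  rewrite -cP => /bigcupP[B BP fB]; have [BQ|BQ] := boolP (B \in Q).
    by exists (cover Q); rewrite ?setU11 //; apply/bigcupP; exists B.
  by exists B; rewrite // in_setU1 in_setD BQ BP orbT.
- apply/trivIsetP=> B B'; rewrite !in_setU1 !in_setD => /predU1P[->|/andP[nB BP]] /predU1P[->|/andP[nB' BP']]; rewrite ?eqxx //.
  + by move=> _; apply: dis.
  + by move=> _; rewrite disjoint_sym; apply: dis.
  by move=> n; apply: (trivIsetP tP).
rewrite in_setU1 in_setD negb_or (negbTE n0) andbF andbT; have /set0Pn[B BQ] := Q0.
have : B != set0 by apply: contraNneq n0 => <-; apply: (subsetP QP).
case/set0Pn=> f fB; apply/eqP=> /setP/(_ f); rewrite in_set0 => /esym/bigcupP[]; by exists B.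
Qed.

Definition irreducible := forall X, X \subset F -> #|bdry X| = 3 -> #|X| <= 1 \/ #|F :\: X| <= 1.

End Pieces.

(** * Contractions *)

Definition nonbounding3 (V E Phi : finType) (t : E -> {set V}) (b : Phi -> {set E}) (F : {set Phi}) (z1 z2 : V) :=
  exists (C : {set E}) x y z e1 e2 e3, [/\ triangle t C x y z e1 e2 e3, C \subset Eu b F,
    z1 \notin [set x; y; z], z2 \notin [set x; y; z] & forall X : {set Phi}, X \subset F -> bdry b X <> C].

(* The edge [e = uv] is contracted onto [v]; the faces [fp = uvp] and [fq = uvq] disappear, [ap] is identified with [bp]
   and [aq] with [bq]. *)
Section Contract.
Variables (V E : finType) (t : E -> {set V}) (Phi : finType) (b : Phi -> {set E}) (F : {set Phi}).
Implicit Types (X Y : {set Phi}) (C : {set E}) (c : {set V}) (f g : Phi) (w : V).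
Local Notation vt := (vt t b).
Local Notation bdry := (bdry b).
Local Notation star := (star t b F).
Hypothesis S0 : surf t b F.
Variables (u v p q : V) (e ap bp aq bq : E) (fp fq : Phi).
Hypotheses (fpF : fp \in F) (fqF : fq \in F) (nfg : fp != fq).
Hypotheses (bfp : b fp = [set e; ap; bp]) (bfq : b fq = [set e; aq; bq]).
Hypotheses (te : t e = [set u; v]) (tap : t ap = [set u; p]) (tbp : t bp = [set v; p])
  (taq : t aq = [set u; q]) (tbq : t bq = [set v; q]).
Hypothesis nuv : u != v.
Hypothesis une : uniq [:: e; ap; bp; aq; bq].
Hypothesis noloop : forall x, x \in Eu b F -> t x = t e -> x = e.

Let pi w := if w == u then v else w.
Let lam x := if x == ap then bp else if x == aq then bq else x.
Definition ct x := pi @: t x.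
Definition cb f := lam @: b f.
Definition cF := F :\: [set fp; fq].

Let F1F : cF \subset F. Proof. exact: subsetDl. Qed.

Let nes : [/\ e != ap, e != bp, e != aq & e != bq] /\ [/\ ap != bp, ap != aq, ap != bq, bp != aq & bp != bq] /\ aq != bq.
Proof.
by move: une; rewrite /= !inE !negb_or => /and4P[/and4P[-> -> -> ->] /and3P[-> -> ->] /andP[-> ->] /andP[-> _]].
Qed.

Lemma ct_lam x : ct (lam x) = pi @: t x.
Proof.
rewrite /ct /lam; case: eqP => [->|_]; [rewrite tap tbp|case: eqP => [->|//]; rewrite taq tbq];
  by rewrite !imsetU !imset_set1 /pi eqxx (eq_sym v u) (negbTE nuv).
Qed.

Lemma ct_vt f : Complex.vt ct cb f = pi @: vt f.
Proof.
apply/setP=> w; apply/in_vt/imsetP => [[x /imsetP[y yb ->]]|[w' /in_vt[y yb wy] ->]].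
  by rewrite ct_lam => /imsetP[w' wy ->]; exists w' => //; apply/in_vt; exists y.
by exists (lam y); [apply: imset_f|rewrite ct_lam; apply: imset_f].
Qed.

Let pi_u w : (pi w == u) = false.
Proof. by rewrite /pi; case: (eqVneq w u) => [_|/negbTE->//]; rewrite eq_sym (negbTE nuv). Qed.

Let pi_inj w w' : pi w = pi w' -> w = w' \/ (w \in [set u; v] /\ w' \in [set u; v]).
Proof.
rewrite /pi !inE; case: (eqVneq w u) => [->|nw]; case: (eqVneq w' u) => [->|nw'] //=; try by left.
- by move=> <-; right; rewrite eqxx.
- by move=> ->; right; rewrite eqxx.
Qed.

Let face2 f g x h : f \in F -> g \in F -> f != g -> x \in b f -> x \in b g -> h \in F -> x \in b h -> h = f \/ h = g.
Proof.
move=> fF gF nfg' xf xg hF xh; have [g' [_ _ _ U]] := two_faces S0 fF xf.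
case: (U g gF xg) => [gf|->]; first by rewrite gf eqxx in nfg'.
exact: U.
Qed.

Let efp : e \in b fp. Proof. by rewrite bfp !inE eqxx. Qed.
Let efq : e \in b fq. Proof. by rewrite bfq !inE eqxx. Qed.

Let e_face f : f \in F -> (e \in b f) = (f == fp) || (f == fq).
Proof.
move=> fF; apply/idP/orP => [ef|[/eqP->//|/eqP->//]].
by have [->|->] := face2 fpF fqF nfg efp efq fF ef; [left|right].
Qed.

Let inF1 f : (f \in cF) = (f \in F) && (e \notin b f).
Proof.
rewrite !inE; case fF: (f \in F); rewrite ?andbF // andbT e_face //.
Qed.

Let inj_face f : f \in cF -> ~~ ((u \in vt f) && (v \in vt f)).
Proof.
rewrite inF1 => /andP[fF ef]; apply: contra ef => /andP[uf vf].
have [x [y [z [e1 [e2 [e3 T]]]]]] := face_triangle S0 fF.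
have [Eb [t1 t2 t3] _ _] := T; rewrite (triangle_vt T) !inE in uf vf.
have E1 : e1 \in b f /\ e2 \in b f /\ e3 \in b f by rewrite Eb !inE !eqxx !orbT.
have [b1 [b2 b3]] := E1.
have U a : a \in b f -> t a = [set u; v] -> e \in b f.
  by move=> af ta; rewrite -(noloop (subsetP (b_Eu fF) _ af)) // ta.
case/orP: uf => [/orP[]|] /eqP uE; case/orP: vf => [/orP[]|] /eqP vE; move: nuv; rewrite ?uE ?vE ?eqxx // => _;
  [apply: (U e3)|apply: (U e2)|apply: (U e3)|apply: (U e1)|apply: (U e2)|apply: (U e1)]; rewrite // uE vE ?t1 ?t2 ?t3 // setUC //.
Qed.

Let pi_vt f : f \in cF -> {in vt f &, injective pi}.
Proof.
move=> fF w w' wf wf' /pi_inj[//|]; rewrite !inE => -[/orP[]/eqP E1 /orP[]/eqP E2]; rewrite ?E1 ?E2 //.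
  by have := inj_face fF; rewrite -E1 -E2 wf wf'.
by have := inj_face fF; rewrite -E1 -E2 wf wf'.
Qed.

Let lam_inj f : f \in cF -> {in b f &, injective lam}.
Proof.
move=> fF x y xf yf; have [[n1 n2 n3 n4] [[n5 n6 n7 n8 n9] n10]] := nes.
have bad a a' s : a \in b f -> a' \in b f -> t a = [set u; s] -> t a' = [set v; s] -> False.
  move=> h1 h2 h3 h4; case/negP: (inj_face fF); apply/andP; split.
    by apply/in_vt; exists a => //; rewrite h3 !inE eqxx.
  by apply/in_vt; exists a' => //; rewrite h4 !inE eqxx.
rewrite /lam; case: (eqVneq x ap) => [xa|nxa]; case: (eqVneq y ap) => [ya|nya]; rewrite ?xa ?ya //.
- case: (eqVneq y aq) => [ya' /eqP|nya' yE]; first by rewrite (negbTE n9).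
  by case: (bad ap bp p) => //; rewrite -?xa ?yE.
- case: (eqVneq x aq) => [xa' /eqP|nxa' xE]; first by rewrite eq_sym (negbTE n9).
  by case: (bad ap bp p) => //; rewrite -?ya -?xE.
case: (eqVneq x aq) => [xa'|nxa']; case: (eqVneq y aq) => [ya'|nya']; rewrite ?xa' ?ya' //.
- by move=> yE; case: (bad aq bq q) => //; rewrite -?xa' ?yE.
- by move=> xE; case: (bad aq bq q) => //; rewrite -?ya' -?xE.
Qed.

Lemma ct_triangle f x y z e1 e2 e3 : f \in cF -> triangle t (b f) x y z e1 e2 e3 ->
  triangle ct (cb f) (pi x) (pi y) (pi z) (lam e1) (lam e2) (lam e3).
Proof.
move=> fF T; have [Eb [t1 t2 t3] [n1 n2 n3] [m1 m2 m3]] := T.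
have vf w : w \in [set x; y; z] -> w \in vt f by rewrite (triangle_vt T).
have ef a : a \in [set e1; e2; e3] -> a \in b f by rewrite Eb.
split.
- by rewrite /cb Eb !imsetU !imset_set1.
- by rewrite !ct_lam t1 t2 t3 !imsetU !imset_set1.
- by split; rewrite (inj_in_eq (pi_vt fF)) ?vf // !inE eqxx ?orbT.
by split; rewrite (inj_in_eq (lam_inj fF)) ?ef // !inE eqxx ?orbT.
Qed.

Lemma triangle_even (V' E' : finType) (t' : E' -> {set V'}) (C : {set E'}) x y z e1 e2 e3 (w : V') :
  triangle t' C x y z e1 e2 e3 -> even_at t' C w.
Proof.
case=> -> [t1 t2 t3] [n1 n2 n3] [m1 m2 m3]; rewrite even_atE cards3I // !inE t1 t2 t3 !inE.
case: (eqVneq w x) => [->|]; first by rewrite (negbTE n1) (negbTE n2).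
case: (eqVneq w y) => [->|]; first by rewrite (negbTE n3).
by case: (eqVneq w z).
Qed.

Lemma triangle_card (V' E' : finType) (t' : E' -> {set V'}) (C : {set E'}) x y z e1 e2 e3 : triangle t' C x y z e1 e2 e3 -> #|C| = 3.
Proof. by case=> -> _ _ [h1 h2 h3]; have := cards3I setT h1 h2 h3; rewrite setIT !inE. Qed.

(* The face across [ap] (resp. [bp], [aq], [bq]) from the two faces that disappear. *)
Variables (hap hbp haq hbq : Phi).
Hypotheses (hapF : hap \in cF) (hbpF : hbp \in cF) (haqF : haq \in cF) (hbqF : hbq \in cF).
Hypotheses (aph : ap \in b hap) (bph : bp \in b hbp) (aqh : aq \in b haq) (bqh : bq \in b hbq).

Let cond f x h : x \in b f -> f \in F -> e \in b f -> h \in cF -> x \in b h -> forall g, g \in cF -> (x \in b g) = (g == h).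
Proof.
move=> xf fF ef; rewrite inF1 => /andP[hF eh] xh g; rewrite inF1 => /andP[gF eg].
apply/idP/eqP => [xg|->//]; have nfh : f != h by apply: contraNneq eh => <-.
by case: (face2 fF hF nfh xf xh gF xg) => // gf; rewrite gf ef in eg.
Qed.

Let apE g : g \in cF -> (ap \in b g) = (g == hap).
Proof. by apply: (@cond fp) => //; rewrite bfp !inE eqxx ?orbT. Qed.
Let bpE g : g \in cF -> (bp \in b g) = (g == hbp).
Proof. by apply: (@cond fp) => //; rewrite bfp !inE eqxx ?orbT. Qed.
Let aqE g : g \in cF -> (aq \in b g) = (g == haq).
Proof. by apply: (@cond fq) => //; rewrite bfq !inE eqxx ?orbT. Qed.
Let bqE g : g \in cF -> (bq \in b g) = (g == hbq).
Proof. by apply: (@cond fq) => //; rewrite bfq !inE eqxx ?orbT. Qed.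

Let nh a b' s g g' : g \in cF -> a \in b g -> b' \in b g' -> t a = [set u; s] -> t b' = [set v; s] -> g != g'.
Proof.
move=> gF ag bg ta tb; apply/eqP=> gg; subst g'; case/negP: (inj_face gF); apply/andP; split.
  by apply/in_vt; exists a; rewrite // ta !inE eqxx.
by apply/in_vt; exists b'; rewrite // tb !inE eqxx.
Qed.

Let nhp : hap != hbp. Proof. exact: nh hapF aph bph tap tbp. Qed.
Let nhq : haq != hbq. Proof. exact: nh haqF aqh bqh taq tbq. Qed.

Definition special x := x \in [:: e; ap; bp; aq; bq].

Let specialE x : special x = [|| x == e, x == ap, x == bp, x == aq | x == bq].
Proof. by rewrite /special !inE. Qed.

Lemma cb_mem f x : (x \in cb f) = if x == ap then false else if x == aq then false else
  if x == bp then (ap \in b f) || (bp \in b f) else if x == bq then (aq \in b f) || (bq \in b f) else x \in b f.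
Proof.
have [[n1 n2 n3 n4] [[n5 n6 n7 n8 n9] n10]] := nes.
have H y : y \in b f -> lam y = x -> x \in cb f by move=> yf <-; apply: imset_f.
apply/imsetP/idP => [[y yf ->]|].
  rewrite /lam; case: (eqVneq y ap) yf => [->|na]; first by rewrite eq_sym (negbTE n5) (negbTE n8) eqxx => ->.
  case: (eqVneq y aq) => [->|nq].
    by rewrite eq_sym (negbTE n7) eq_sym (negbTE n10) eq_sym (negbTE n9) eqxx => ->.
  rewrite (negbTE na) (negbTE nq); case: (eqVneq y bp) => [->->|_]; first by rewrite orbT.
  by case: (eqVneq y bq) => [->->|_]; first by rewrite orbT.
case: (eqVneq x ap) => // na; case: (eqVneq x aq) => // nq; case: (eqVneq x bp) => [->|nb].
  case/orP=> h; [exists ap|exists bp] => //; rewrite /lam ?eqxx // eq_sym (negbTE n5) (negbTE n8) //.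
case: (eqVneq x bq) => [->|nb'].
  case/orP=> h; [exists aq|exists bq] => //; rewrite /lam ?eqxx //.
    by rewrite eq_sym (negbTE n6).
  by rewrite eq_sym (negbTE n7) eq_sym (negbTE n10).
by move=> xf; exists x => //; rewrite /lam (negbTE na) (negbTE nq).
Qed.

Let special_out x f : ~~ special x -> f \in F -> x \in b f -> f \in cF.
Proof.
move=> nx fF xf; rewrite inF1 fF e_face //; apply: contra nx => /orP[]/eqP fE; move: xf; rewrite fE ?bfp ?bfq /special !inE;
  by case/orP=> [/orP[]|] ->; rewrite ?orbT.
Qed.

Let cb_ns x f : ~~ special x -> (x \in cb f) = (x \in b f).
Proof. by rewrite specialE !negb_or cb_mem => /and5P[_ /negbTE-> /negbTE-> /negbTE-> /negbTE->]. Qed.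

Lemma contract_e2 f x : f \in cF -> x \in cb f -> #|[set g in cF | x \in cb g]| = 2.
Proof.
move=> fF; have [[n1 n2 n3 n4] [[n5 n6 n7 n8 n9] n10]] := nes.
have [|sx] := boolP (special x); last first.
  rewrite cb_ns // => xf; rewrite -(s_e2 S0 (subsetP F1F _ fF) xf); congr #|pred_of_set _|.
  apply/setP=> g; rewrite [LHS]in_set [RHS]in_set cb_ns //; apply/andP/andP => -[h1 h2]; split=> //.
    exact: (subsetP F1F).
  exact: special_out sx h1 h2.
rewrite specialE cb_mem => /or4P[/eqP->|/eqP->|/eqP->|/orP[]/eqP->].
- rewrite (negbTE n1) (negbTE n2) (negbTE n3) (negbTE n4) => ef; by move: fF; rewrite inF1 ef andbF.
- by rewrite eqxx.
- move=> _; rewrite (_ : [set _ in _ | _] = [set hap; hbp]) ?cards2 ?nhp //; apply/setP=> g; rewrite in_set in_set2.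
  have [gF|] := boolP (g \in cF).
    by rewrite cb_mem eq_sym (negbTE n5) (negbTE n8) eqxx apE // bpE.
  by move=> ng /=; apply/esym/negbTE; apply: contra ng => /orP[]/eqP->.
- by rewrite eq_sym (negbTE n6) eqxx.
move=> _; rewrite (_ : [set _ in _ | _] = [set haq; hbq]) ?cards2 ?nhq //; apply/setP=> g; rewrite in_set in_set2.
have [gF|] := boolP (g \in cF).
  by rewrite cb_mem eq_sym (negbTE n7) eq_sym (negbTE n10) eq_sym (negbTE n9) eqxx aqE // bqE.
by move=> ng /=; apply/esym/negbTE; apply: contra ng => /orP[]/eqP->.
Qed.

(** A set of remaining faces is lifted by giving each vanished face to the side of its neighbour
    [hap] or [haq]; the boundary of the lift then avoids [ap] and [aq]. *)
Let lft X := X :|: [set f | (f == fp) && (hap \in X) || (f == fq) && (haq \in X)].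

Let fp1 : fp \notin cF. Proof. by rewrite inF1 efp andbF. Qed.
Let fq1 : fq \notin cF. Proof. by rewrite inF1 efq andbF. Qed.

Let lft_in X f : X \subset cF -> f \in cF -> (f \in lft X) = (f \in X).
Proof.
move=> XF fF; rewrite !inE; case: eqP => [fE|_]; first by case/negP: fp1; rewrite -fE.
by case: eqP => [fE|_]; rewrite ?orbF //; case/negP: fq1; rewrite -fE.
Qed.

Let lft_p X : X \subset cF -> (fp \in lft X) = (hap \in X).
Proof.
move=> XF; rewrite !inE eqxx (negbTE nfg) orbF /=; case fX: (fp \in X) => //; by case/negP: fp1; apply: (subsetP XF).
Qed.

Let lft_q X : X \subset cF -> (fq \in lft X) = (haq \in X).
Proof.
move=> XF; rewrite !inE eqxx eq_sym (negbTE nfg) /=; case fX: (fq \in X) => //; by case/negP: fq1; apply: (subsetP XF).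
Qed.

Let lft_sub X : X \subset cF -> lft X \subset F.
Proof.
move=> XF; rewrite subUset (subset_trans XF F1F); apply/subsetP=> f; rewrite inE.
by case/orP=> /andP[/eqP->].
Qed.

Let bdry_cF X x : X \subset cF -> (x \in Complex.bdry cb X) = odd #|[set f in X | x \in cb f]|.
Proof. by rewrite inE. Qed.

Let bdry_bp X : X \subset cF -> (bp \in Complex.bdry cb X) = (hap \in X) (+) (hbp \in X).
Proof.
have [[n1 n2 n3 n4] [[n5 n6 n7 n8 n9] n10]] := nes => XF.
rewrite bdry_cF // (_ : [set _ in _ | _] = [set hap; hbp] :&: X).
  rewrite odd_setI big_setU1 ?big_set1 ?inE //.
apply/setP=> f; rewrite in_set in_setI in_set2; case fX: (f \in X); rewrite ?andbF //= andbT.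
by rewrite cb_mem eq_sym (negbTE n5) (negbTE n8) eqxx apE ?bpE // (subsetP XF).
Qed.

Let bdry_bq X : X \subset cF -> (bq \in Complex.bdry cb X) = (haq \in X) (+) (hbq \in X).
Proof.
have [[n1 n2 n3 n4] [[n5 n6 n7 n8 n9] n10]] := nes => XF.
rewrite bdry_cF // (_ : [set _ in _ | _] = [set haq; hbq] :&: X).
  rewrite odd_setI big_setU1 ?big_set1 ?inE //.
apply/setP=> f; rewrite in_set in_setI in_set2; case fX: (f \in X); rewrite ?andbF //= andbT.
by rewrite cb_mem eq_sym (negbTE n7) eq_sym (negbTE n10) eq_sym (negbTE n9) eqxx aqE ?bqE // (subsetP XF).
Qed.

Let bdry_ns X x : X \subset cF -> ~~ special x -> (x \in Complex.bdry cb X) = (x \in bdry X).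
Proof.
by move=> XF nx; rewrite !inE; congr (odd #|pred_of_set _|); apply/setP=> f; rewrite !inE cb_ns.
Qed.

Lemma lift_bdry X x : X \subset cF -> x \in bdry (lft X) -> x != e -> lam x \in Complex.bdry cb X.
Proof.
have [[n1 n2 n3 n4] [[n5 n6 n7 n8 n9] n10]] := nes.
move=> XF xX nxe; have LF := lft_sub XF; have [f [g [fL gF gL xf xg]]] := bdryP S0 _ LF xX.
have fF := subsetP LF _ fL.
have two a h : a \in b h -> h \in cF -> forall k, a \in b k -> k \in F -> e \in b k -> x = a ->
    (k \in lft X) != (h \in lft X).
  move=> ah hF k ak kF ek xa; rewrite xa in xf xg; have nkh : k != h by apply: contraTneq ek => ->; move: hF; rewrite inF1 => /andP[].
  have hF' := subsetP F1F _ hF.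
  case: (face2 kF hF' nkh ak ah fF xf) => fE; case: (face2 kF hF' nkh ak ah gF xg) => gE; subst f g.
  - by rewrite fL in gL.
  - by rewrite fL (negbTE gL).
  - by rewrite fL (negbTE gL).
  - by rewrite fL in gL.
have apf : ap \in b fp by rewrite bfp !inE eqxx orbT.
have bpf : bp \in b fp by rewrite bfp !inE eqxx orbT.
have aqf : aq \in b fq by rewrite bfq !inE eqxx orbT.
have bqf : bq \in b fq by rewrite bfq !inE eqxx orbT.
have [|nx] := boolP (special x); last first.
  have := nx; rewrite specialE !negb_or => /and5P[_ na nb na' nb'].
  rewrite /lam (negbTE na) (negbTE na') bdry_ns //.
  have f1 := special_out nx fF xf; have g1 := special_out nx gF xg.
  apply: (in_bdry S0 (subset_trans XF F1F) (f := f) (g := g)) => //; first by rewrite -(lft_in XF).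
  by rewrite -(lft_in XF).
rewrite specialE (negbTE nxe) /= => /or4P[] /eqP xE.
- by have := two _ _ aph hapF _ apf fpF efp xE; rewrite lft_p // lft_in // eqxx.
- have := two _ _ bph hbpF _ bpf fpF efp xE; rewrite lft_p // lft_in // => h.
  by rewrite xE /lam eq_sym (negbTE n5) (negbTE n8) bdry_bp //; case: (_ \in _) h; case: (_ \in _).
- by have := two _ _ aqh haqF _ aqf fqF efq xE; rewrite lft_q // lft_in // eqxx.
have := two _ _ bqh hbqF _ bqf fqF efq xE; rewrite lft_q // lft_in // => h.
by rewrite xE /lam eq_sym (negbTE n7) eq_sym (negbTE n10) bdry_bq //; case: (_ \in _) h; case: (_ \in _).
Qed.

(** The lift has no boundary edge except possibly [e], and a single edge is not a boundary. *)
Lemma contract_con X : X \subset cF -> Complex.bdry cb X = set0 -> X = set0 \/ X = cF.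
Proof.
move=> XF X0; have LF := lft_sub XF.
have L1 : #|bdry (lft X)| <= 1.
  rewrite -(cards1 e); apply: subset_leq_card; apply/subsetP=> x xL; rewrite inE; apply: contraT => nx.
  by have := lift_bdry XF xL nx; rewrite X0 inE.
have [L0|L0] := eqVneq (lft X) set0.
  by left; apply/eqP; rewrite -subset0 -L0 subsetUl.
have [LT|LT] := eqVneq (lft X) F; last by have := cut_ge2 S0 LF L0 LT; rewrite ltnNge L1.
right; apply/eqP; rewrite eqEsubset XF; apply/subsetP=> f fF; rewrite -(lft_in XF fF) LT; exact: (subsetP F1F).
Qed.

Let u_fp : u \in vt fp. Proof. by apply/in_vt; exists e; rewrite // te !inE eqxx. Qed.
Let v_fp : v \in vt fp. Proof. by apply/in_vt; exists e; rewrite // te !inE eqxx orbT. Qed.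

(** Were there no boundary edge at [w], the lift could have only [e] as a boundary edge in the star
    of a preimage of [w], which parity excludes. The stars of [u] and [v] are tied together by the
    face [fp]. *)
Lemma contract_link w X : X \subset Complex.star ct cb cF w -> X != set0 -> X != Complex.star ct cb cF w ->
  exists2 x, x \in Complex.bdry cb X & w \in ct x.
Proof.
move=> Xs X0 X1; apply/exists_inP; apply: contraT; rewrite negb_exists_in => /forall_inP nb.
have s1 f : (f \in Complex.star ct cb cF w) = (f \in cF) && (w \in pi @: vt f) by rewrite inE ct_vt.
have XF : X \subset cF by apply: subset_trans Xs _; apply/subsetP=> f; rewrite s1 => /andP[].
have LF := lft_sub XF.
have dich w' : pi w' = w -> lft X :&: star w' = set0 \/ lft X :&: star w' = star w'.
  move=> pw; set Y := _ :&: _; have [->|Y0] := eqVneq Y set0; first by left.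
  right; apply/eqP; apply: contraT => Y1; have [|e1 e1Y we1] := s_link S0 _ Y0 Y1; first exact: subsetIr.
  have YF : Y \subset F by apply: subset_trans (subsetIl _ _) LF.
  have only x : x \in bdry Y -> w' \in t x -> x = e.
    move=> xY wx; apply/eqP; apply: contraT => nx; have [f [g [fY gF gY xf xg]]] := bdryP S0 _ YF xY.
    have xL : x \in bdry (lft X).
      apply: (in_bdry S0 LF _ gF _ xf xg); first by move: fY; rewrite in_setI => /andP[].
      apply: contra gY => gL; rewrite in_setI gL inE gF; apply/in_vt; by exists x.
    by have := nb _ (lift_bdry XF xL nx); rewrite ct_lam -pw imset_f.
  have := bdry_even S0 w' YF; rewrite /even_at (_ : [set _ in _ | _] = [set e]) ?cards1 //.
  apply/setP=> x; rewrite in_set in_set1; apply/andP/eqP => [[]|->]; first exact: only.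
  by rewrite -(only _ e1Y we1).
have /set0Pn[f0 f0X] := X0; have := subsetP Xs _ f0X; rewrite s1 => /andP[f0F /imsetP[w0 w0f w0E]].
have inL f : f \in X -> f \in lft X by move=> fX; rewrite inE fX.
have ne w' : pi w' = w -> forall f, f \in lft X -> w' \in vt f -> lft X :&: star w' = star w'.
  move=> pw f fL wf; case: (dich w' pw) => // /setP/(_ f).
  by rewrite in_setI fL [f \in star _]inE wf (subsetP LF _ fL) inE.
have all w' : pi w' = w -> lft X :&: star w' = star w'.
  have full0 := ne w0 (esym w0E) f0 (inL _ f0X) w0f.
  move=> pw; have := w0E; rewrite -pw => /esym/pi_inj[<-//|[w0uv w'uv]].
  have fpL : fp \in lft X.
    have : fp \in star w0 by rewrite inE fpF; move: w0uv; rewrite !inE => /orP[]/eqP->.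
    by rewrite -full0 in_setI => /andP[].
  by apply: (ne w' pw fp fpL); move: w'uv; rewrite !inE => /orP[]/eqP->.
case/eqP: X1; apply/eqP; rewrite eqEsubset Xs; apply/subsetP=> f; rewrite s1 => /andP[fF /imsetP[w' wf' pw]].
rewrite -(lft_in XF fF); have : f \in star w' by rewrite inE wf' (subsetP F1F).
by rewrite -(all w' (esym pw)) in_setI => /andP[].
Qed.

Lemma contract_surf : surf ct cb cF.
Proof.
have tri f : f \in cF -> exists x y z e1 e2 e3, triangle ct (cb f) x y z e1 e2 e3.
  move=> fF; have [x [y [z [e1 [e2 [e3 T]]]]]] := face_triangle S0 (subsetP F1F _ fF).
  by exists (pi x), (pi y), (pi z), (lam e1), (lam e2), (lam e3); apply: ct_triangle.
split.
- by apply/set0Pn; exists hap.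
- by move=> f /tri[x [y [z [e1 [e2 [e3 T]]]]]]; apply: triangle_card T.
- by move=> f w /tri[x [y [z [e1 [e2 [e3 T]]]]]]; apply: triangle_even T.
- move=> f x /tri[x0 [y [z [e1 [e2 [e3 [-> [t1 t2 t3] [n1 n2 n3] _]]]]]]].
  by rewrite !inE => /orP[/orP[]|] /eqP->; rewrite ?t1 ?t2 ?t3 cards2 ?n1 ?n2 ?n3.
- exact: contract_e2.
- exact: contract_con.
exact: contract_link.
Qed.

Lemma contract_Eu : Eu cb cF = Eu b F :\: [set e; ap; aq].
Proof.
have [[n1 n2 n3 n4] [[n5 n6 n7 n8 n9] n10]] := nes.
apply/setP=> x; rewrite in_setD; apply/EuP/andP => [[f fF xf]|[]].
  have fF' := subsetP F1F _ fF; move: xf; rewrite cb_mem !inE.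
  case: (eqVneq x ap) => // na; case: (eqVneq x aq) => // na'; rewrite !orbF.
  case: (eqVneq x bp) => [-> _|nb].
    by rewrite eq_sym n2; split=> //; apply/EuP; exists hbp; rewrite ?(subsetP F1F).
  case: (eqVneq x bq) => [-> _|nb'].
    by rewrite eq_sym n4; split=> //; apply/EuP; exists hbq; rewrite ?(subsetP F1F).
  move=> xf; split; last by apply/EuP; exists f.
  by apply: contraTneq xf => ->; move: fF; rewrite inF1 => /andP[].
rewrite !inE !negb_or => /andP[/andP[nxe na] na'] /EuP[f fF xf].
have [sx|sx] := boolP (special x); last first.
  by exists f; rewrite ?(special_out sx) // cb_ns.
move: sx; rewrite specialE (negbTE nxe) (negbTE na) (negbTE na') /= => /orP[]/eqP->.
  by exists hbp => //; rewrite cb_mem eq_sym (negbTE n5) (negbTE n8) eqxx bph orbT.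
by exists hbq => //; rewrite cb_mem eq_sym (negbTE n7) eq_sym (negbTE n10) eq_sym (negbTE n9) eqxx bqh orbT.
Qed.

Lemma contract_Vu : Vu ct cb cF = Vu t b F :\ u.
Proof.
apply/setP=> w; rewrite in_setD1; apply/VuP/andP => [[f fF]|[nwu /VuP[f fF wf]]].
  rewrite ct_vt => /imsetP[w' wf ->]; rewrite pi_u; split=> //; apply/VuP.
  rewrite /pi; case: eqP => _; first by exists fp.
  by exists f => //; apply: (subsetP F1F).
suff [g gF wg] : exists2 g, g \in cF & w \in vt g.
  by exists g => //; rewrite ct_vt; apply/imsetP; exists w => //; rewrite /pi (negbTE nwu).
have [f1|] := boolP (f \in cF); first by exists f.
have inv a h s r : a \in b h -> t a = [set s; r] -> s \in vt h /\ r \in vt h.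
  by move=> ah ta; split; apply/in_vt; exists a; rewrite // ta !inE eqxx ?orbT.
have [h1 h2] := inv _ _ _ _ bph tbp; have [h3 h4] := inv _ _ _ _ bqh tbq.
rewrite inF1 fF /= negbK e_face // => /orP[]/eqP fE; subst f; have /in_vt[x xf wx] := wf; move: xf wx.
  rewrite bfp !inE => /orP[/orP[]|]/eqP->; rewrite ?te ?tap ?tbp !inE ?(negbTE nwu) //=.
  - by move=> /eqP->; exists hbp.
  - by move=> /eqP->; exists hbp.
  by case/orP=> /eqP->; exists hbp.
rewrite bfq !inE => /orP[/orP[]|]/eqP->; rewrite ?te ?taq ?tbq !inE ?(negbTE nwu) //=.
- by move=> /eqP->; exists hbq.
- by move=> /eqP->; exists hbq.
by case/orP=> /eqP->; exists hbq.
Qed.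

Lemma contract_euler chi : euler t b F chi -> euler ct cb cF chi.
Proof.
have [[n1 n2 n3 n4] [[n5 n6 n7 n8 n9] n10]] := nes.
rewrite /euler contract_Eu contract_Vu /cF.
have -> : #|F| = #|F :\: [set fp; fq]| + 2.
  rewrite -(cardsID [set fp; fq] F) addnC (setIidPr _) ?cards2 ?nfg // subUset !sub1set fpF //.
have -> : #|Eu b F| = #|Eu b F :\: [set e; ap; aq]| + 3.
  rewrite -(cardsID [set e; ap; aq] (Eu b F)) addnC (setIidPr _).
    by congr addn; have := cards3I setT n1 n3 n6; rewrite setIT !inE.
  rewrite !subUset !sub1set; apply/andP; split; first apply/andP; first split; apply/EuP.
  - by exists fp.
  - by exists fp; rewrite // bfp !inE eqxx orbT.
  by exists fq; rewrite // bfq !inE eqxx orbT.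
rewrite (cardsD1 u (Vu t b F)) (_ : u \in _); last by apply/VuP; exists fp.
by clear; lia.
Qed.

Lemma contract_mono c f : mono ct cb c f = mono t b (pi @^-1: c) f.
Proof.
rewrite /mono ct_vt -sub_imset_pre; congr orb; rewrite -!setI_eq0.
apply/eqP/eqP => /setP h; apply/setP=> w; rewrite !inE; apply/negP=> /andP[].
  by move=> wf wc; have := h (pi w); rewrite in_setI imset_f // wc inE.
by case/imsetP=> w' wf -> wc; have := h w'; rewrite !inE wf wc.
Qed.

(** A cycle avoiding [v] contains none of the five special edges and is unchanged by the
    contraction. A set of faces bounded by it has each vanished face on the same side as its
    neighbours. *)
Lemma contract_nonbounding C x y z e1 e2 e3 : triangle ct C x y z e1 e2 e3 -> C \subset Eu cb cF ->
  v \notin [set x; y; z] -> (forall X, X \subset cF -> Complex.bdry cb X <> C) ->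
  [/\ triangle t C x y z e1 e2 e3, C \subset Eu b F & forall X, X \subset F -> bdry X <> C].
Proof.
have [[n1 n2 n3 n4] [[n5 n6 n7 n8 n9] n10]] := nes.
move=> T; have [EC [t1 t2 t3] d1 d2] := T => CE nv nb.
have CE' : C \subset Eu b F by apply: subset_trans CE _; rewrite contract_Eu subsetDl.
have nvt a : a \in C -> v \notin ct a.
  rewrite EC !inE => /orP[/orP[]|] /eqP->; rewrite ?t1 ?t2 ?t3; apply: contra nv; rewrite !inE => /orP[]->; rewrite ?orbT //.
have same a : a \in C -> ct a = t a.
  move=> aC; have := nvt a aC; rewrite /ct => na; rewrite -[RHS]imset_id; apply: eq_in_imset => w wa.
  rewrite /pi; case: eqP => // wu; case/imsetP: na; exists w => //; by rewrite /pi wu eqxx.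
have inC a : a \in [:: e1; e2; e3] -> a \in C by rewrite EC !inE orbA.
have ns a : a \in C -> ~~ special a.
  move=> aC; apply/negP; rewrite specialE => sa; have := subsetP CE _ aC; rewrite contract_Eu in_setD !inE.
  have := nvt a aC; rewrite same //; case/or4P: sa => [/eqP->|/eqP->|/eqP->|/orP[]/eqP->];
    by rewrite ?eqxx ?orbT ?te ?tbp ?tbq ?inE ?eqxx ?orbT.
split=> //.
  by split=> //; rewrite -!same ?t1 ?t2 ?t3 // inC // !inE eqxx ?orbT.
move=> X XF EX; apply: (nb (X :&: cF)); first exact: subsetIr.
have side f g a : f \in F -> g \in F -> f != g -> a \in b f -> a \in b g -> special a -> (f \in X) = (g \in X).
  move=> fF gF ng af ag sa; apply/idP/idP => hX; apply: contraT => nX.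
    by have := ns a; rewrite -EX (in_bdry S0 XF hX gF nX af ag) sa => /(_ isT).
  by have := ns a; rewrite -EX (in_bdry S0 XF hX fF nX ag af) sa => /(_ isT).
have XF1 : X :&: cF \subset cF by apply: subsetIr.
have sF h : h \in cF -> fp != h /\ fq != h.
  by move=> hF; split; apply: contraTneq hF => <-.
have pE : (fp \in X) = (hap \in X).
  apply: (side _ _ ap) => //; rewrite ?(subsetP F1F) ?(sF _ hapF).1 // ?bfp /special !inE eqxx ?orbT //.
have pE' : (fp \in X) = (hbp \in X).
  apply: (side _ _ bp) => //; rewrite ?(subsetP F1F) ?(sF _ hbpF).1 // ?bfp /special !inE eqxx ?orbT //.
have qE : (fq \in X) = (haq \in X).
  apply: (side _ _ aq) => //; rewrite ?(subsetP F1F) ?(sF _ haqF).2 // ?bfq /special !inE eqxx ?orbT //.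
have qE' : (fq \in X) = (hbq \in X).
  apply: (side _ _ bq) => //; rewrite ?(subsetP F1F) ?(sF _ hbqF).2 // ?bfq /special !inE eqxx ?orbT //.
apply/setP=> a; have [sa|sa] := boolP (special a).
  rewrite (_ : a \in C = false); last by apply/negP=> /ns; rewrite sa.
  have [aE|aE] := boolP (a \in Eu cb cF); last first.
    by apply/negbTE; apply: contra aE; apply: (subsetP (bdry_Eu contract_surf XF1)).
  rewrite contract_Eu in_setD !inE !negb_or in aE; rewrite specialE in sa.
  case/andP: aE => /andP[/andP[/negbTE h1 /negbTE h2] /negbTE h3] _; move: sa; rewrite h1 h2 h3 /=.
  case/orP=> /eqP->; rewrite ?bdry_bp ?bdry_bq // !in_setI.
    by rewrite hapF hbpF !andbT -pE pE' addbb.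
  by rewrite haqF hbqF !andbT -qE qE' addbb.
rewrite bdry_ns // -EX !inE; congr (odd #|pred_of_set _|); apply/setP=> f.
rewrite 2!in_set; case fX: (f \in X) => //=; last by rewrite in_setI fX.
rewrite in_setI fX /=; case af: (a \in b f); rewrite ?andbF // andbT.
exact: special_out sa (subsetP XF _ fX) af.
Qed.

End Contract.

Lemma set2_inj (T : finType) (x y z w : T) : [set x; y] = [set z; w] -> x = z /\ y = w \/ x = w /\ y = z.
Proof.
move=> /setP h; move: (h x) (h y) (h z) (h w); rewrite !inE !eqxx ?orbT /= => /esym/orP[]/eqP xz.
  case/esym/orP=> /eqP yw; last by left.
  by rewrite xz yw eqxx /= orbb => _ /eqP ->; left.
case/esym/orP=> /eqP yw; first by right.
by rewrite xz yw eqxx /= orbb => /eqP->; right.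
Qed.

Section FaceAt.
Variables (V E : finType) (t : E -> {set V}) (Phi : finType) (b : Phi -> {set E}) (F : {set Phi}).
Hypothesis S0 : surf t b F.

Lemma face_at f e u v : f \in F -> e \in b f -> t e = [set u; v] -> u != v ->
  exists p a a', [/\ b f = [set e; a; a'], t a = [set u; p], t a' = [set v; p], u != p /\ v != p &
    [/\ e != a, e != a', a != a' & vt t b f = [set u; v; p]]].
Proof.
move=> fF ef te nuv; have [x [y [z [e1 [e2 [e3 T]]]]]] := face_triangle S0 fF.
have {T ef}[x' [y' [z' [a2 [a3 T]]]]] : exists x' y' z' a2 a3, triangle t (b f) x' y' z' e a2 a3.
  have [Eb _ _ _] := T; rewrite Eb !inE in ef; case/orP: ef => [/orP[]|]/eqP->; first by exists x, y, z, e2, e3.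
    by exists y, z, x, e3, e1; apply: triangle_rot.
  by exists z, x, y, e1, e2; do 2 apply: triangle_rot.
have VT := triangle_vt T; have [Eb [t1 t2 t3] [n1 n2 n3] [m1 m2 m3]] := T.
rewrite te in t1; case: (set2_inj t1) => -[h1 h2]; subst y' z'.
  exists x', a3, a2; split=> //; first by rewrite Eb setUAC.
  - by rewrite t3 setUC.
  - by rewrite t2 setUC.
  - by rewrite eq_sym n1 eq_sym n2.
  by split; rewrite // 1?eq_sym // VT -setUA setUC.
exists x', a2, a3; split=> //.
- by rewrite t2 setUC.
- by rewrite t3 setUC.
- by rewrite eq_sym n2 eq_sym n1.
split=> //; rewrite VT; apply/setP=> w; rewrite !inE; by case: (w == x'); case: (w == u); case: (w == v).
Qed.

End FaceAt.

Section Forest.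
Variables (V E Phi : finType) (z1 z2 : V).
Local Notation Z := [set z1; z2].

(* [R] is a forest of stars with centres in [Z], such that contracting [R], which maps the vertices by [k], creates no
   loop and every 3-cycle of the contraction avoiding [Z] comes from one before it. *)
Definition forest (t : E -> {set V}) (b : Phi -> {set E}) (F : {set Phi}) (R : {set E}) (k : V -> V) :=
  [/\ forall e, e \in R -> exists u v, [/\ e \in Eu b F, t e = [set u; v], u \notin Z, v \in Z & k u = v /\ k v = v],
      forall e e' u, e \in R -> e' \in R -> u \in t e -> u \in t e' -> u \notin Z -> e = e',
      forall e z, e \in Eu b F -> (forall x, x \in t e -> k x = z) -> e \in R,
      forall f, f \in F -> #|b f :&: R| <= 1 &
      forall e f g s s', e \in R -> f \in F -> g \in F -> f != g -> e \in b f -> e \in b g ->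
        s \in vt t b f -> s \notin t e -> s' \in vt t b g -> s' \notin t e -> k s != k s'].

(** The edges of [R] are contracted one by one; the forest conditions survive because [k] takes the
    same value at both ends of a contracted edge. *)
Lemma forest_contract chi n (t : E -> {set V}) (b : Phi -> {set E}) (F : {set Phi}) (R : {set E}) (k : V -> V) : #|R| = n -> surf t b F -> euler t b F chi -> forest t b F R k ->
  exists (t' : E -> {set V}) (b' : Phi -> {set E}) (F' : {set Phi}), [/\ surf t' b' F', euler t' b' F' chi, F' = [set f in F | b f :&: R == set0],
    colourable t' b' F' -> exists c : {set V}, (forall f, f \in F' -> ~~ mono t b c f) /\ (forall e, e \in R -> e \notin cob t c) &
    nonbounding3 t' b' F' z1 z2 -> nonbounding3 t b F z1 z2].
Proof.
elim: n t b F R k => [|n IH] t b F R k cR S0 eu [hR leaf hk one third].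
  have R0 : R = set0 by apply/eqP; rewrite -cards_eq0 cR.
  exists t, b, F; split=> //.
    by apply/setP=> f; rewrite inE R0 setI0 eqxx andbT.
  by case=> c hc; exists c; split=> // e; rewrite R0 inE.
have [e eR] : exists e, e \in R by apply/set0Pn; rewrite -card_gt0 cR.
have [u [v [eE te uZ vZ [ku kv]]]] := hR e eR.
have nuv : u != v by apply: contraNneq uZ => ->.
have /EuP[fp fpF efp] := eE; have [fq [fqF nqp efq U]] := two_faces S0 fpF efp.
have npq : fp != fq by rewrite eq_sym.
have [p [ap [bp [bfp tap tbp [nup nvp] [ea ebp nab VTp]]]]] := face_at S0 fpF efp te nuv.
have [q [aq [bq [bfq taq tbq [nuq nvq] [ea' ebq nab' VTq]]]]] := face_at S0 fqF efq te nuv.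
(* The third vertices of the two faces at [e] remain distinct even after all contractions; this
   makes the five edges of these faces distinct. *)
have kpq : k p != k q.
  apply: (third e fp fq) => //; rewrite ?VTp ?VTq ?te !inE ?eqxx ?orbT // negb_or.
    by rewrite eq_sym nup eq_sym nvp.
  by rewrite eq_sym nuq eq_sym nvq.
have npq' : p != q by apply: contraNneq kpq => ->.
have nt a a' x y z w : t a = [set x; y] -> t a' = [set z; w] -> [|| (x != z) && (x != w), (y != z) && (y != w) | false] -> a != a'.
  move=> ta ta' h; apply/eqP=> aa; move: ta'; rewrite -aa ta => /set2_inj[] [xz yw]; move: h;
  by rewrite xz yw !eqxx ?andbF.
have a1 : ap != aq by apply: (nt _ _ _ _ _ _ tap taq); rewrite npq' [p == u]eq_sym nup /= ?orbT.
have a2 : ap != bq by apply: (nt _ _ _ _ _ _ tap tbq); rewrite nuv nuq.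
have a3 : bp != aq by apply: (nt _ _ _ _ _ _ tbp taq); rewrite [v == u]eq_sym nuv nvq.
have a4 : bp != bq by apply: (nt _ _ _ _ _ _ tbp tbq); rewrite npq' [p == v]eq_sym nvp /= ?orbT.
have une : uniq [:: e; ap; bp; aq; bq].
  by rewrite /= !inE !negb_or ea ebp ea' ebq nab a1 a2 a3 a4 nab'.
have noloop x : x \in Eu b F -> t x = t e -> x = e.
  move=> xE tx; have xR : x \in R.
    by apply: (hk x v) => // w; rewrite tx te !inE => /orP[]/eqP->.
  by apply: (leaf x e u) => //; rewrite ?tx te !inE eqxx.
have acr x f f' : f \in F -> f' \in F -> f != f' -> e \in b f -> e \in b f' -> x \in b f -> x \notin b f' ->
    exists2 h, h \in cF F fp fq & x \in b h.
  move=> fF fF' nf ef ef' xf xf'; have [h [hF nh xh _]] := two_faces S0 fF xf; exists h => //.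
  rewrite !inE hF andbT; apply/negP=> hE; case: (U f fF ef) => fE; case: (U f' fF' ef') => fE'; subst f f'.
  - by rewrite eqxx in nf.
  - by move: hE; rewrite (negbTE nh) /= => /eqP hE; rewrite -hE xh in xf'.
  - by move: hE; rewrite (negbTE nh) orbF => /eqP hE; rewrite -hE xh in xf'.
  by rewrite eqxx in nf.
have eap : ap == e = false by rewrite eq_sym (negbTE ea).
have ebp' : bp == e = false by rewrite eq_sym (negbTE ebp).
have eaq : aq == e = false by rewrite eq_sym (negbTE ea').
have ebq' : bq == e = false by rewrite eq_sym (negbTE ebq).
have [hap hapF aph] : exists2 h, h \in cF F fp fq & ap \in b h.
  by apply: (acr ap fp fq); rewrite ?bfp ?bfq ?inE ?eqxx ?orbT // eap (negbTE a1) (negbTE a2).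
have [hbp hbpF bph] : exists2 h, h \in cF F fp fq & bp \in b h.
  by apply: (acr bp fp fq); rewrite ?bfp ?bfq ?inE ?eqxx ?orbT // ebp' (negbTE a3) (negbTE a4).
have [haq haqF aqh] : exists2 h, h \in cF F fp fq & aq \in b h.
  by apply: (acr aq fq fp); rewrite ?bfp ?bfq ?inE ?eqxx ?orbT // eaq [aq == ap]eq_sym (negbTE a1) [aq == bp]eq_sym (negbTE a3).
have [hbq hbqF bqh] : exists2 h, h \in cF F fp fq & bq \in b h.
  by apply: (acr bq fq fp); rewrite ?bfp ?bfq ?inE ?eqxx ?orbT // ebq' [bq == ap]eq_sym (negbTE a2) [bq == bp]eq_sym (negbTE a4).
have CS := contract_surf S0 fpF fqF npq bfp bfq te tap tbp taq tbq nuv une noloop hapF hbpF haqF hbqF aph bph aqh bqh.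
have CE := contract_euler S0 fpF fqF npq bfp bfq te tap tbp taq tbq nuv une hbpF hbqF bph bqh eu.
have CEu := contract_Eu S0 fpF fqF npq bfp bfq une hbpF hbqF bph bqh.
have CN := contract_nonbounding S0 fpF fqF npq bfp bfq te tap tbp taq tbq nuv une noloop hapF hbpF haqF hbqF aph bph aqh bqh.
have CV f := ct_vt b tap tbp taq tbq nuv f.
have CM c f := contract_mono b tap tbp taq tbq nuv c f.
set t1 := ct t u v in CS CE CEu CN CV CM; set b1 := cb b ap bp aq bq in CS CE CEu CN CV CM.
set F1 := cF F fp fq in CS CE CEu CN CV CM hapF hbpF haqF hbqF.
pose pi w := if w == u then v else w.
have kpi w : k (pi w) = k w by rewrite /pi; case: eqP => // ->; rewrite ku kv.
have F1F : F1 \subset F by apply: subsetDl.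
have nR x f : f \in F -> e \in b f -> x \in b f -> x != e -> x \notin R.
  move=> fF ef xf xe; apply/negP=> xR; have := one f fF; rewrite leqNgt => /negP; apply.
  apply: (@leq_trans #|[set x; e]|); first by rewrite cards2 xe.
  by apply: subset_leq_card; rewrite subUset !sub1set !inE xf xR ef eR.
have apR : ap \notin R by apply: (nR ap fp) => //; rewrite ?bfp ?inE ?eqxx ?orbT // eap.
have bpR : bp \notin R by apply: (nR bp fp) => //; rewrite ?bfp ?inE ?eqxx ?orbT // ebp'.
have aqR : aq \notin R by apply: (nR aq fq) => //; rewrite ?bfq ?inE ?eqxx ?orbT // eaq.
have bqR : bq \notin R by apply: (nR bq fq) => //; rewrite ?bfq ?inE ?eqxx ?orbT // ebq'.
have b1R x f : x \in R -> (x \in b1 f) = (x \in b f).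
  move=> xR; rewrite /b1 (cb_mem b une).
  have nx y : y \notin R -> x == y = false by move=> yR; apply/negbTE; apply: contraNneq yR => <-.
  by rewrite !nx.
have b1I f : f \in F1 -> b1 f :&: (R :\ e) = b f :&: R.
  move=> fF1; apply/setP=> x; rewrite !in_setI in_setD1; case xR: (x \in R); rewrite ?andbF // !andbT b1R //.
  case: (eqVneq x e) => [->|]; rewrite ?andbF ?andbT //=; apply/esym/negbTE; apply: contraTN fF1 => ef.
  rewrite !inE; case fF: (f \in F); rewrite ?andbF // andbT negbK.
  by case: (U f fF ef) => ->; rewrite eqxx ?orbT.
have t1R x : x \in R -> x != e -> t1 x = t x.
  move=> xR xe; rewrite /t1 /ct -[RHS]imset_id; apply: eq_in_imset => w wx; case: eqP => // wu.
  by case/eqP: xe; apply: (leaf x e u) => //; rewrite -?wu // te inE wu set11.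
have cR1 : #|R :\ e| = n by move: cR; rewrite (cardsD1 e) eR add1n => -[].
have FR : forest t1 b1 F1 (R :\ e) k.
  split.
  - move=> x; rewrite in_setD1 => /andP[xe xR]; have [u' [v' [h1 h2 h3 h4 h5]]] := hR x xR; exists u', v'; split=> //.
      rewrite CEu in_setD h1 andbT !inE !negb_or xe.
      by rewrite (contraNneq _ apR) ?(contraNneq _ aqR) // => <-.
    by rewrite t1R.
  - move=> x x' w; rewrite !in_setD1 => /andP[xe xR] /andP[xe' xR']; rewrite !t1R //; exact: leaf.
  - move=> x z; rewrite CEu in_setD => /andP[nx xE] h; rewrite in_setD1; apply/andP; split.
      by apply: contraNneq nx => ->; rewrite !inE eqxx.
    apply: (hk x z) => // w wx; rewrite -kpi; apply: h; exact: imset_f.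
  - by move=> f fF1; rewrite b1I //; apply: one; apply: (subsetP F1F).
  move=> x f g s s'; rewrite in_setD1 => /andP[xe xR] fF gF nfg; rewrite !b1R // => xf xg.
  rewrite !CV (t1R _ xR xe) => /imsetP[w wf ->] nw /imsetP[w' wg ->] nw'; rewrite !kpi.
  have nox y : (if y == u then v else y) \notin t x -> y \notin t x.
    apply: contra => yx; case: eqP => // yu.
    by case/eqP: xe; apply: (leaf x e u) => //; rewrite -?yu // te inE yu set11.
  by apply: (third x f g) => //; rewrite ?(subsetP F1F) // nox.
have [t' [b' [F' [S' eu' F'E col nb]]]] := IH t1 b1 F1 (R :\ e) k cR1 CS CE FR.
exists t', b', F'; split=> //.
- rewrite F'E; apply/setP=> f; rewrite [LHS]in_set [RHS]in_set; have [fF1|nF1] := boolP (f \in F1).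
    by rewrite b1I // (subsetP F1F).
  case fF: (f \in F) => //=; apply/esym/negbTE; apply/set0Pn; exists e; rewrite inE eR andbT.
  by move: nF1; rewrite !inE fF andbT negbK => /orP[]/eqP->.
- move=> /col[c [h1 h2]]; exists (pi @^-1: c); split.
    move=> f fF'; rewrite -CM; exact: h1.
  move=> x xR; have [->|xe] := eqVneq x e.
    rewrite inE te odd_setI big_setU1 ?big_set1 ?inE //= /pi eqxx eq_sym (negbTE nuv) addbb //.
  have := h2 x; rewrite in_setD1 xe xR => /(_ isT); rewrite !inE t1R //; congr (~~ odd #|pred_of_set _|).
  apply/setP=> w; rewrite !inE; case wx: (w \in t x) => //=; rewrite /pi; case: eqP => // wu.
  by case/eqP: xe; apply: (leaf x e u) => //; rewrite -?wu // te inE wu set11.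
case/nb=> C [x [y [z [e1 [e2 [e3 [T CE' nz1 nz2 nbC]]]]]]].
have nv : v \notin [set x; y; z] by move: vZ; rewrite inE => /orP[]/set1P->.
have [T' CE'' nbC'] := CN _ _ _ _ _ _ _ T CE' nv nbC.
by exists C, x, y, z, e1, e2, e3.
Qed.

End Forest.

(** * Irreducible triangulations of the projective plane *)

Section Helpers.
Variables (V E : finType) (t : E -> {set V}).

Lemma even2 a a' : a != a' -> (forall v, even_at t [set a; a'] v) -> t a = t a'.
Proof.
move=> na ev; apply/setP=> v; have := ev v; rewrite even_atE odd_setI big_setU1 ?big_set1 ?inE //=.
by case: (v \in t a); case: (v \in t a').
Qed.

Lemma mk_triangle x y z e1 e2 e3 : t e1 = [set y; z] -> t e2 = [set x; z] -> t e3 = [set x; y] ->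
  x != y -> x != z -> y != z -> triangle t [set e1; e2; e3] x y z e1 e2 e3.
Proof.
move=> t1 t2 t3 n1 n2 n3; split=> //; split.
- by apply/eqP=> ee; move: t1; rewrite ee t2 => /set2_inj[] [xz yw]; rewrite ?xz ?yw eqxx in n1 n2 n3.
- by apply/eqP=> ee; move: t1; rewrite ee t3 => /set2_inj[] [xz yw]; rewrite ?xz ?yw eqxx in n1 n2 n3.
by apply/eqP=> ee; move: t2; rewrite ee t3 => /set2_inj[] [xz yw]; rewrite ?xz ?yw eqxx in n1 n2 n3.
Qed.

Variables (Phi : finType) (b : Phi -> {set E}) (F : {set Phi}).
Hypothesis S0 : surf t b F.

Lemma face_edge f x y : f \in F -> x \in vt t b f -> y \in vt t b f -> x != y -> exists2 a, a \in b f & t a = [set x; y].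
Proof.
move=> fF; have [x0 [y0 [z0 [e1 [e2 [e3 T]]]]]] := face_triangle S0 fF.
rewrite (triangle_vt T); have [-> [t1 t2 t3] _ _] := T; rewrite !inE.
case/orP=> [/orP[]|] /eqP-> /orP[/orP[]|] /eqP->; rewrite ?eqxx // => _;
  [exists e3|exists e2|exists e3|exists e1|exists e2|exists e1]; rewrite ?inE ?eqxx ?orbT // ?t1 ?t2 ?t3 // setUC //.
Qed.

Lemma face_inj f a a' : f \in F -> a \in b f -> a' \in b f -> t a = t a' -> a = a'.
Proof.
move=> fF af a'f taa; have /eqP/cards2P[u [v [nuv ta]]] := s_t2 S0 fF af.
have [p [x [x' [Eb t1 t2 [n1 n2] _]]]] := face_at S0 fF af ta nuv.
move: a'f; rewrite Eb !inE => /orP[/orP[/eqP->//|]|] /eqP E1; move: taa; rewrite ta E1 ?t1 ?t2 => /set2_inj[] [h1 h2].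
- by rewrite h2 eqxx in n2.
- by rewrite h1 eqxx in n1.
- by rewrite h1 eqxx in nuv.
- by rewrite h1 eqxx in n1.
Qed.

Lemma card_EF : 3 * #|F| = 2 * #|Eu b F|.
Proof.
have -> : 3 * #|F| = \sum_(f in F) \sum_(e in Eu b F) (e \in b f : nat).
  rewrite mulnC -sum_nat_const; apply: eq_bigr => f fF; rewrite -(s_b3 S0 fF) -sum1_card big_mkcond [RHS]big_mkcond.
  apply: eq_bigr => e _; case ef: (e \in b f); last by case: ifP.
  by rewrite (subsetP (b_Eu fF) _ ef).
rewrite exchange_big /= mulnC -sum_nat_const; apply: eq_bigr => e /EuP[f fF ef].
rewrite -(s_e2 S0 fF ef) -sum1_card big_mkcond [RHS]big_mkcond; apply: eq_bigr => g _; rewrite inE.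
by case: (g \in F) => //; case: (e \in b g).
Qed.

End Helpers.

Section Irreducible.
Variables (V E : finType) (t : E -> {set V}) (Phi : finType) (b : Phi -> {set E}) (F : {set Phi}).
Implicit Types (X Y S W : {set Phi}) (M Z C : {set E}) (c : {set V}) (f g : Phi) (e : E) (v : V).
Local Notation vt := (vt t b).
Local Notation bdry := (bdry b).
Local Notation Eu := (Eu b F).
Local Notation Vu := (Vu t b F).
Hypotheses (S0 : surf t b F) (eu : euler t b F 1) (nc : ~ colourable t b F) (irr : irreducible b F).

Lemma faces_vertices : #|F| + 2 = 2 * #|Vu|.
Proof. by have := card_EF S0; move: eu; rewrite /euler; lia. Qed.

Lemma vertices_ge4 : 4 <= #|Vu|.
Proof.
rewrite leqNgt; apply/negP=> lt4; have /set0Pn[f0 f0F] := s_ne S0.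
have E3 f : f \in F -> vt f = Vu.
  by move=> fF; apply/eqP; rewrite eqEcard (vt_Vu fF) (card_vt S0 fF); move: lt4; clear; lia.
have [x [y [z [e1 [e2 [e3 T]]]]]] := face_triangle S0 f0F; have V3 := triangle_vt T; rewrite E3 // in V3.
have [_ _ [n1 n2 n3] _] := T; apply: nc; exists [set x] => f fF; apply/negP; rewrite /mono E3 // V3 => /orP[].
  by move/subsetP/(_ y); rewrite !inE eqxx orbT [y == x]eq_sym (negbTE n1) /= ?orbT => /(_ isT).
by rewrite -setI_eq0 => /eqP/setP/(_ x); rewrite !inE eqxx.
Qed.

Lemma faces_ge6 : 6 <= #|F|.
Proof. by have := faces_vertices; have := vertices_ge4; lia. Qed.

(** Adding the face across one of the two edges turns a 2-cut into a 3-cut with several faces on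
    both sides, against irreducibility. *)
Lemma no_cut2 X e1 e2 : X \subset F -> bdry X = [set e1; e2] -> e1 != e2 -> False.
Proof.
wlog le3 : X / 3 <= #|F :\: X|.
  move=> H XF EX n12; have [le3|lt3] := leqP 3 #|F :\: X|; first exact: (H X).
  apply: (H (F :\: X)); rewrite ?subsetDl // ?(bdryC S0) // setDDF //.
  by have := faces_ge6; rewrite (cardsDF XF); move: lt3; clear; lia.
move=> XF EX n12; have tt : t e1 = t e2 by apply: even2 => // v; rewrite -EX; apply: (bdry_even S0).
have e1X : e1 \in bdry X by rewrite EX !inE eqxx.
have [f [g [fX gF gX ef eg]]] := bdryP S0 _ XF e1X.
have e2g : e2 \notin b g by apply: contra n12 => e2g; apply/eqP; apply: (face_inj S0 gF).
have YF : g |: X \subset F by rewrite subUset sub1set gF.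
have cY : #|bdry (g |: X)| = 3.
  rewrite bdryU ?disjoints1 // bdry1 EX; have := symd_card (b g) [set e1; e2].
  rewrite (s_b3 S0 gF) cards2 n12 (_ : _ :&: _ = [set e1]) ?cards1; first by clear; lia.
  apply/setP=> x; rewrite !inE; apply/andP/idP => [[xg /orP[//|/eqP xe]]|/eqP->]; last by rewrite eqxx.
  by rewrite xe (negbTE e2g) in xg.
have X0 : 0 < #|X| by rewrite card_gt0; apply/set0Pn; exists f.
case: (irr YF cY); first by rewrite cardsU1 gX; move: X0; clear; lia.
have -> : F :\: (g |: X) = (F :\: X) :\ g by apply/setP=> h; rewrite !inE negb_or; case: (h == g) => //=; rewrite andbC.
by have := cardsD1 g (F :\: X); rewrite inE gX gF /=; move: le3; clear; lia.
Qed.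

(** Two parallel edges form a nonbounding cycle. The complement of a perfect matching that avoids
    both contains both, an even number, contrary to [pm_even]. *)
Lemma irr_simple e1 e2 : e1 \in Eu -> e2 \in Eu -> t e1 = t e2 -> e1 = e2.
Proof.
move=> E1 E2 tt; apply/eqP; apply: contraT => n12; exfalso; pose C := [set e1; e2].
have CE : C \subset Eu by rewrite subUset !sub1set E1 E2.
have ev v : even_at t C v.
  by rewrite even_atE odd_setI big_setU1 ?big_set1 ?inE //= tt addbb.
have nb X : X \subset F -> bdry X <> C by move=> XF EX; apply: (no_cut2 XF EX n12).
have [|M pM dM] := @plesnik _ _ _ _ _ _ S0 C; first by rewrite cards2 n12.
have := pm_even S0 eu nc CE ev nb pM; rewrite (_ : C :&: _ = C) ?cards2 ?n12 //.
apply/setIidPl/subsetP=> x xC; rewrite in_setD (subsetP CE) // andbT; apply/negP=> xM.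
by rewrite (disjointFr dM xM) in xC.
Qed.

Lemma share1 f g e e' : f \in F -> g \in F -> f != g -> e \in b f -> e \in b g -> e' \in b f -> e' \in b g -> e = e'.
Proof.
move=> fF gF nfg ef eg ef' eg'; apply/eqP; apply: contraT => ne.
have XF : [set f; g] \subset F by rewrite subUset !sub1set fF gF.
have XnF : [set f; g] != F by apply/eqP=> E1; have := faces_ge6; rewrite -E1 cards2 nfg.
have X0 : [set f; g] != set0 by apply/set0Pn; exists f; rewrite !inE eqxx.
have := cut_ge2 S0 XF X0 XnF; have EB : bdry [set f; g] = symd (b f) (b g).
  by rewrite bdryU ?disjoints1 ?inE // !bdry1.
have := symd_card (b f) (b g); rewrite -EB !(s_b3 S0) // => c1 c2.
have I2 : 2 <= #|b f :&: b g|.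
  apply: (@leq_trans #|[set e; e']|); first by rewrite cards2 ne.
  by apply: subset_leq_card; rewrite subUset !sub1set !inE ef eg ef' eg'.
have /cards2P[a [a' [na EX]]] : #|bdry [set f; g]| == 2 by move: c1 c2 I2; clear; lia.
by case: (no_cut2 XF EX na).
Qed.

Lemma cut_ge3' X : X \subset F -> X != set0 -> X != F -> 3 <= #|bdry X|.
Proof.
move=> XF X0 X1; have := cut_ge2 S0 XF X0 X1; rewrite leq_eqVlt => /orP[|//]; rewrite eq_sym => /cards2P[a [a' [na EX]]].
by case: (no_cut2 XF EX na).
Qed.

Lemma facial3 C x y z e1 e2 e3 : triangle t C x y z e1 e2 e3 -> (exists2 X : {set Phi}, X \subset F & bdry X = C) ->
  exists2 f, f \in F & b f = C.
Proof.
move=> T [X XF EX]; have c3 : #|bdry X| = 3 by rewrite EX (triangle_card T).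
have [X0 X1] := cut3_proper S0 XF c3.
case: (irr XF c3) => le1.
  have /cards1P[f Ef] : #|X| == 1 by rewrite eqn_leq le1 card_gt0.
  by exists f; [apply: (subsetP XF); rewrite Ef set11|rewrite -bdry1 -Ef].
have /cards1P[f Ef] : #|F :\: X| == 1.
  by rewrite eqn_leq le1 card_gt0 setD_eq0; apply: contra X1 => h; rewrite eqEsubset XF.
exists f; last by rewrite -bdry1 -Ef (bdryC S0).
by have : f \in F :\: X; [rewrite Ef set11|rewrite inE => /andP[]].
Qed.

Section Petersen.
Variables (C : {set E}) (x y z : V) (e1 e2 e3 : E).
Hypotheses (T : triangle t C x y z e1 e2 e3) (CE : C \subset Eu) (nb : forall X : {set Phi}, X \subset F -> bdry X <> C).

(** [petersen] speaks of a relation on a whole finite type, hence the subtype of the faces. *)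
Let FT := {f : Phi | f \in F}.
Let r (f g : FT) := (f != g) && [exists e in b (val f), e \in b (val g)].

Let rP (f g : FT) : reflect (f <> g /\ exists2 e, e \in b (val f) & e \in b (val g)) (r f g).
Proof. by apply: (iffP andP) => -[/eqP h1 /exists_inP h2]. Qed.

Let rs : symmetric r.
Proof.
by move=> f g; apply/rP/rP => -[n [e h1 h2]]; (split; [exact/nesym|exists e]).
Qed.

Let ri : irreflexive r. Proof. by move=> f; rewrite /r eqxx. Qed.

Let fval (f : FT) : val f \in F := valP f.

Let other (f : FT) e := odflt f [pick g : FT | (g != f) && (e \in b (val g))].

Let otherP (f : FT) e : e \in b (val f) -> [/\ other f e != f, e \in b (val (other f e)) &
  forall h : FT, e \in b (val h) -> h = f \/ h = other f e].
Proof.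
move=> ef; have [g [gF ng eg U]] := two_faces S0 (fval f) ef; rewrite /other; case: pickP => [h /andP[nh eh]|/(_ (exist _ g gF))].
  split=> // k ek; case: (U (val k) (fval k) ek) => /= kE; first by left; apply: val_inj.
  right; apply: val_inj; rewrite /= kE; case: (U (val h) (fval h) eh) => // hE; by case/eqP: nh; apply: val_inj.
rewrite /= eg andbT => /negbFE/eqP/(congr1 val) /= gE; by rewrite gE eqxx in ng.
Qed.

Let r3 (f : FT) : #|[set g | r f g]| = 3.
Proof.
rewrite -(s_b3 S0 (fval f)) -(card_in_imset (f := other f) (D := b (val f))); last first.
  move=> e e' ef ef' oE; have [n1 g1 _] := otherP ef; have [n2 g2 _] := otherP ef'; rewrite -oE in g2.
  by apply: (share1 (fval f) (fval (other f e))) => //; apply: contra n1 => /eqP h; apply/eqP/val_inj.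
congr #|pred_of_set _|; apply/setP=> g; rewrite inE; apply/rP/imsetP => [[n [e ef eg]]|[e ef ->]].
  by exists e => //; have [_ _ /(_ g eg)[gf|//]] := otherP ef; case: n.
by have [/eqP n eg _] := otherP ef; split; [exact/nesym|exists e].
Qed.

Let vv (X : {set FT}) : {set Phi} := val @: X.

Let vvF (X : {set FT}) : vv X \subset F. Proof. by apply/subsetP=> f /imsetP[g _ ->]; apply: fval. Qed.

Let vvE (X : {set FT}) (f : FT) : (val f \in vv X) = (f \in X).
Proof. by apply/imsetP/idP => [[g gX /val_inj->//]|]; exists f. Qed.

Let vvc (X : {set FT}) : #|vv X| = #|X|. Proof. by rewrite card_imset //; apply: val_inj. Qed.

Let e1E : e1 \in Eu.
Proof. by have [EC _ _ _] := T; apply: (subsetP CE); rewrite EC !inE eqxx. Qed.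

Let cutE (X : {set FT}) : cut r X = #|bdry (vv X)|.
Proof.
rewrite /cut -card_epairs; pose sh (p : FT * FT) := odflt e1 [pick e in b (val p.1) :&: b (val p.2)].
have shP (f g : FT) : r f g -> sh (f, g) \in b (val f) /\ sh (f, g) \in b (val g).
  case/rP=> n [e ef eg]; rewrite /sh; case: pickP => [a|/(_ e)]; rewrite /= in_setI ?ef ?eg // => /andP[]; by [].
rewrite -(card_in_imset (f := sh) (D := epairs r X (~: X))); last first.
  move=> [f g] [f' g']; rewrite !in_set /= => /and3P[fX gX rfg] /and3P[fX' gX' rfg'] shE.
  have [h1 h2] := shP _ _ rfg; have [h3 h4] := shP _ _ rfg'; rewrite -shE in h3 h4.
  have [n _ U] := otherP h1.
  have gE : g = other f (sh (f, g)) by case: (U g h2) => // gf; rewrite gf fX in gX.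
  have fE : f' = f by case: (U f' h3) => // f'E; move: fX'; rewrite f'E -gE (negbTE gX).
  by case: (U g' h4) => g'E; [rewrite g'E fX in gX'|rewrite fE g'E -gE].
congr #|pred_of_set _|; apply/setP=> e; apply/imsetP/idP => [[[f g]]|].
  rewrite in_set /= => /and3P[fX gX rfg] ->; have [h1 h2] := shP _ _ rfg.
  by apply: (in_bdry S0 (vvF X) _ (fval g) _ h1 h2); rewrite vvE // -in_setC.
case/(bdryP S0 _ (vvF X))=> f0 [g0 [f0X g0F g0X ef eg]]; have f0F := subsetP (vvF X) _ f0X.
pose f : FT := exist _ f0 f0F; pose g : FT := exist _ g0 g0F.
have fX : f \in X by rewrite -vvE. have gX : g \notin X by rewrite -vvE.
have nfg : f <> g by move=> fg; rewrite fg (negbTE gX) in fX.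
have rfg : r f g by apply/rP; split=> //; exists e.
exists (f, g); first by rewrite in_set /= fX in_setC gX.
have [h1 h2] := shP _ _ rfg; apply: (share1 (fval f) (fval g)) => //.
by apply/eqP=> /val_inj.
Qed.

Let cut3 (X : {set FT}) : X != set0 -> X != setT -> 3 <= cut r X.
Proof.
move=> X0 X1; rewrite cutE; apply: cut_ge3' => //.
  by apply: contra X0; rewrite -!cards_eq0 vvc.
apply: contra X1 => /eqP h; apply/eqP/setP=> f; by rewrite inE -vvE h fval.
Qed.

Let triv3 (X : {set FT}) : cut r X = 3 -> #|X| <= 1 \/ #|~: X| <= 1.
Proof.
rewrite cutE => c3; case: (irr (vvF X) c3); rewrite ?vvc; [by left|right].
rewrite -vvc (_ : vv (~: X) = F :\: vv X) //; apply/setP=> f; apply/imsetP/idP => [[g gX ->]|].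
  by rewrite in_setD fval andbT vvE -in_setC.
rewrite in_setD => /andP[nf fF]; exists (exist _ f fF) => //; rewrite in_setC -vvE //.
Qed.

Let T' := triangle_rot T.
Let T'' := triangle_rot T'.

Let pair_of e : e \in Eu -> exists p : FT * FT, [/\ e \in b (val p.1), e \in b (val p.2), p.1 != p.2 &
  forall h : FT, e \in b (val h) -> h = p.1 \/ h = p.2].
Proof.
case/EuP=> f fF ef; pose f' : FT := exist _ f fF; have [n eg U] := @otherP f' e ef.
by exists (f', other f' e); split=> //=; rewrite eq_sym.
Qed.

(** Two edges of [C] in a face would by simplicity bring the third with them, and [C] would bound
    that face. *)
Let noface (C' : {set E}) x' y' z' a1 a2 a3 : triangle t C' x' y' z' a1 a2 a3 -> C' = C ->
  forall f, f \in F -> a1 \in b f -> a2 \in b f -> False.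
Proof.
move=> T0 EC f fF f1 f2; have [EC' [t1 t2 t3] [n1 n2 n3] [m1 m2 m3]] := T0.
have xf : x' \in vt f by apply/in_vt; exists a2; rewrite // t2 !inE eqxx.
have yf : y' \in vt f by apply/in_vt; exists a1; rewrite // t1 !inE eqxx.
have [a af ta] := face_edge S0 fF xf yf n1.
have aE : a = a3.
  apply: irr_simple; rewrite ?t3 //; first exact: (subsetP (b_Eu fF)).
  by apply: (subsetP CE); rewrite -EC EC' !inE eqxx orbT.
apply: (nb (X := [set f])); rewrite ?sub1set // bdry1 -EC; apply/esym/eqP.
rewrite eqEcard (s_b3 S0 fF) (triangle_card T0) andbT EC' !subUset !sub1set f1 f2 -aE af //.
Qed.

(** No face contains two edges of [C], so their dual edges are disjoint; by [pm_even] every perfect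
    matching contains an even number of the three. Hence they are [bad] for the dual graph. *)
Lemma ten_faces : #|F| = 10.
Proof.
have [EC [t1 t2 t3] [n1 n2 n3] [m1 m2 m3]] := T.
have inE3 a : a \in [:: e1; e2; e3] -> a \in Eu by move=> ha; apply: (subsetP CE); rewrite EC !inE orbA in ha *.
have e2E : e2 \in Eu by apply: inE3; rewrite !inE eqxx orbT.
have e3E : e3 \in Eu by apply: inE3; rewrite !inE eqxx !orbT.
have [p1 [h11 h12 h13 U1]] := pair_of e1E.
have [p2 [h21 h22 h23 U2]] := pair_of e2E.
have [p3 [h31 h32 h33 U3]] := pair_of e3E.
have C1 : [set e2; e3; e1] = C by rewrite EC setUC setUA.
have C2 : [set e3; e1; e2] = C by rewrite -C1 setUC setUA.
have [EC' _ _ _] := T'; have [EC'' _ _ _] := T''.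
have nn a a' (f g : FT) : (forall h, h \in F -> a \in b h -> a' \in b h -> False) -> a \in b (val f) -> a' \in b (val g) -> f != g.
  by move=> H af ag; apply/eqP=> fg; subst g; apply: (H (val f)) => //; apply: fval.
have N12 := noface T erefl; have N23 := noface T' erefl; have N31 := noface T'' erefl.
have N13 h : h \in F -> e1 \in b h -> e3 \in b h -> False by move=> *; apply: (N31 h).
have B : bad r p1 p2 p3.
  split; last first.
    move=> m mm rm; pose M := [set e | [exists f : FT, (e \in b (val f)) && (e \in b (val (m f)))]].
    have inM (f : FT) e : e \in b (val f) -> (e \in M) = (e \in b (val (m f))).
      move=> ef; rewrite inE; apply/existsP/idP => [[g /andP[eg emg]]|emf]; last by exists f; rewrite ef.
      have [n eo U] := otherP ef; case: (U _ eg) => gE; first by rewrite -gE.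
      case: (U _ emg) => mgE; first by rewrite -mgE mm.
      by have /rP[] := rm g; rewrite gE -{1}mgE -gE.
    have pM : is_pm b F M.
      split; first by apply/subsetP=> e; rewrite inE => /existsP[f /andP[ef _]]; apply: (subsetP (b_Eu (fval f))).
      move=> f fF; pose f' : FT := exist _ f fF; have /rP[n [e ef em]] := rm f'.
      rewrite (_ : _ :&: _ = [set e]) ?cards1 //; apply/setP=> a; rewrite in_setI in_set1; apply/andP/eqP => [[af]|->].
        rewrite (inM f') // => am; apply: (share1 (fval f') (fval (m f'))) => //; by apply/eqP=> /val_inj.
      by rewrite (inM f').
    have ev v : even_at t C v by apply: triangle_even T.
    have := pm_even S0 eu nc CE ev nb pM.
    have eqM e (p : FT * FT) : e \in b (val p.1) -> e \in b (val p.2) -> p.1 != p.2 ->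
        (forall h : FT, e \in b (val h) -> h = p.1 \/ h = p.2) -> (m p.1 == p.2) = (e \in M).
      move=> a1 a2 a3 U; rewrite (inM p.1) //; apply/eqP/idP => [->//|em]; case: (U _ em) => // mE.
      by have /rP[] := rm p.1; rewrite mE.
    rewrite (eqM _ _ h11 h12 h13 U1) (eqM _ _ h21 h22 h23 U2) (eqM _ _ h31 h32 h33 U3).
    rewrite -(cards3I M m1 m2 m3) -EC; have : #|C :&: M| + #|C :&: (Eu :\: M)| = 3.
      rewrite -(triangle_card T) -[RHS](cardsID M); congr (_ + #|pred_of_set _|).
      by apply/setP=> e; rewrite !in_setI !in_setD; case eC: (e \in C); rewrite ?andbF //= (subsetP CE _ eC) andbT.
    move=> h o; have : odd (#|C :&: M| + #|C :&: (Eu :\: M)|) by rewrite h.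
    by rewrite oddD o addbT.
  split.
  - by apply/rP; split; [exact/eqP|exists e1].
  - by apply/rP; split; [exact/eqP|exists e2].
  - by apply/rP; split; [exact/eqP|exists e3].
  have [q1 q2 q3 q4] : [/\ p1.1 != p2.1, p1.1 != p2.2, p1.2 != p2.1 & p1.2 != p2.2] by split; apply: (nn _ _ _ _ N12).
  have [q5 q6 q7 q8] : [/\ p1.1 != p3.1, p1.1 != p3.2, p1.2 != p3.1 & p1.2 != p3.2] by split; apply: (nn _ _ _ _ N13).
  have [r1 r2 r3' r4] : [/\ p2.1 != p3.1, p2.1 != p3.2, p2.2 != p3.1 & p2.2 != p3.2] by split; apply: (nn _ _ _ _ N23).
  by rewrite /= !inE !negb_or h13 h23 h33 q1 q2 q3 q4 q5 q6 q7 q8 r1 r2 r3' r4.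
have := petersen rs ri r3 cut3 triv3 B.
by rewrite card_sig => <-; apply: eq_card => f; rewrite inE.
Qed.

End Petersen.

End Irreducible.

(** * Stars of alternate edges at one or two vertices *)

Section Forests.
Variables (V E : finType) (t : E -> {set V}) (Phi : finType) (b : Phi -> {set E}) (F : {set Phi}).
Implicit Types (X Y S W D : {set Phi}) (M Z C R : {set E}) (c : {set V}) (f g : Phi) (e : E).
Local Notation vt := (vt t b).
Local Notation bdry := (bdry b).
Local Notation Eu := (Eu b F).
Local Notation Vu := (Vu t b F).
Local Notation star := (star t b F).
Hypotheses (S0 : surf t b F) (eu : euler t b F 1) (nc : ~ colourable t b F) (irr : irreducible b F).

Let simple := irr_simple S0 eu nc irr.
Let share1 := share1 S0 eu nc irr.

Section Facial.
Hypothesis fac : forall C x y z e1 e2 e3, triangle t C x y z e1 e2 e3 -> C \subset Eu -> exists2 f, f \in F & b f = C.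

Definition sp v := [set e in Eu | v \in t e].

Lemma sp_other v e : e \in sp v -> exists u, t e = [set u; v] /\ u != v.
Proof.
rewrite inE => /andP[eE ve]; have /eqP/cards2P[x [y [nxy te]]] := Eu_t2 S0 eE.
move: ve; rewrite te !inE => /orP[]/eqP->; [exists y|exists x]; split; rewrite // 1?eq_sym // setUC //.
Qed.

Lemma fac3 x y z e1 e2 e3 : e1 \in Eu -> e2 \in Eu -> e3 \in Eu -> t e1 = [set y; z] -> t e2 = [set x; z] -> t e3 = [set x; y] ->
  x != y -> x != z -> y != z -> exists2 f, f \in F & [/\ e1 \in b f, e2 \in b f, e3 \in b f & vt f = [set x; y; z]].
Proof.
move=> E1 E2 E3 t1 t2 t3 n1 n2 n3; have T := mk_triangle t1 t2 t3 n1 n2 n3.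
have [|f fF Ef] := fac T; first by rewrite !subUset !sub1set E1 E2.
exists f => //; rewrite Ef !inE !eqxx !orbT; split=> //; rewrite -Ef in T; exact: triangle_vt T.
Qed.

Section TwoStars.
Variables (v w : V) (Xv Xw : {set E}).
Let R := Xv :|: Xw.
Definition leaf (X : {set E}) v' u := [exists e in X, t e == [set u; v']].
Let k u := if leaf Xv v u then v else if leaf Xw w u then w else u.
Hypotheses (Xvs : Xv \subset sp v) (Xws : Xw \subset sp w).
Hypotheses (nlw : ~~ leaf Xv v w) (nlv : ~~ leaf Xw w v).
Hypothesis both : forall u, leaf Xv v u -> leaf Xw w u -> v = w.
Hypothesis one : forall f, f \in F -> #|b f :&: R| <= 1.

Let RE e : e \in R -> e \in Eu.
Proof. by rewrite inE => /orP[/(subsetP Xvs)|/(subsetP Xws)]; rewrite inE => /andP[]. Qed.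

Lemma leafP (X : {set E}) v' u : reflect (exists2 e, e \in X & t e = [set u; v']) (leaf X v' u).
Proof. by apply: (iffP exists_inP) => -[e eX /eqP te]; exists e => //; apply/eqP. Qed.

Let nleaf (X : {set E}) v' : X \subset sp v' -> ~~ leaf X v' v'.
Proof.
move=> Xs; apply/leafP=> -[e /(subsetP Xs)]; rewrite inE => /andP[/(Eu_t2 S0) + _] te.
by rewrite te cards2 eqxx.
Qed.

Let kcase a : k a = a \/ exists2 e, e \in R & t e = [set a; k a].
Proof.
rewrite /k; case: leafP => [[e eX te]|_]; first by right; exists e; rewrite // inE eX.
by case: leafP => [[e eX te]|_]; [right; exists e; rewrite // inE eX orbT|left].
Qed.

Let kv : k v = v. Proof. by rewrite /k (negbTE (nleaf Xvs)) (negbTE nlv). Qed.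
Let kw : k w = w. Proof. by rewrite /k (negbTE nlw) (negbTE (nleaf Xws)). Qed.

Let kleaf_v u : leaf Xv v u -> k u = v. Proof. by rewrite /k => ->. Qed.
Let kleaf_w u : leaf Xw w u -> k u = w.
Proof. by move=> lw; rewrite /k lw; case: ifP => // lv; apply: both lv lw. Qed.

Let leaf_out u : leaf Xv v u \/ leaf Xw w u -> u \notin [set v; w].
Proof.
case=> lu; apply/negP; rewrite !inE => /orP[]/eqP uE; move: lu; rewrite uE.
- by rewrite (negbTE (nleaf Xvs)).
- by rewrite (negbTE nlw).
- by rewrite (negbTE nlv).
by rewrite (negbTE (nleaf Xws)).
Qed.

Let two_in_face f e e' : f \in F -> e \in b f -> e' \in b f -> e \in R -> e' \in R -> e = e'.
Proof.
move=> fF ef ef' eR eR'; apply/eqP; apply: contraT => n; have := one fF; rewrite leqNgt => /negP; case.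
apply: (@leq_trans #|[set e; e']|); first by rewrite cards2 n.
by apply: subset_leq_card; rewrite subUset !sub1set !inE ef ef' /= -!in_setU eR eR'.
Qed.

(** Since all 3-cycles are facial, an edge whose ends are both moved to a third vertex would lie in
    a face with two edges of [R]. *)
Lemma forest_of :
  (forall e f g s s', e \in R -> f \in F -> g \in F -> f != g -> e \in b f -> e \in b g ->
        s \in vt f -> s \notin t e -> s' \in vt g -> s' \notin t e -> k s != k s') ->
  forest v w t b F R k.
Proof.
move=> third; split=> //.
- move=> e eR; have eE := RE eR; have : exists u, (t e = [set u; v] /\ leaf Xv v u) \/ (t e = [set u; w] /\ leaf Xw w u).
    move: eR; rewrite inE => /orP[eX|eX].
      have [u [te _]] := sp_other (subsetP Xvs _ eX); exists u; left; split=> //; apply/leafP; by exists e.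
    have [u [te _]] := sp_other (subsetP Xws _ eX); exists u; right; split=> //; apply/leafP; by exists e.
  case=> u [[te lu]|[te lu]]; [exists u, v|exists u, w]; split=> //; rewrite ?inE ?eqxx ?orbT //.
  + by have := @leaf_out u (or_introl lu); rewrite !inE.
  + by rewrite kleaf_v.
  + by have := @leaf_out u (or_intror lu); rewrite !inE.
  by rewrite kleaf_w.
- move=> e e' u eR eR' ue ue'; rewrite !inE negb_or => /andP[nv nw].
  have tu x : x \in R -> u \in t x -> (t x = [set u; v] /\ leaf Xv v u) \/ (t x = [set u; w] /\ leaf Xw w u).
    move=> xR ux; move: xR; rewrite inE => /orP[eX|eX].
      have [u' [te _]] := sp_other (subsetP Xvs _ eX); left; move: ux; rewrite te !inE (negbTE nv) orbF => /eqP uu.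
      by rewrite -uu in te *; split=> //; apply/leafP; exists x.
    have [u' [te _]] := sp_other (subsetP Xws _ eX); right; move: ux; rewrite te !inE (negbTE nw) orbF => /eqP uu.
    by rewrite -uu in te *; split=> //; apply/leafP; exists x.
  apply: simple; rewrite ?RE //; case: (tu e eR ue) => -[-> l1]; case: (tu e' eR' ue') => -[-> l2] //.
    by rewrite (both l1 l2).
  by rewrite (both l2 l1).
move=> e z eE h; have /eqP/cards2P[a [a' [na te]]] := Eu_t2 S0 eE.
have ka : k a = z by apply: h; rewrite te !inE eqxx.
have ka' : k a' = z by apply: h; rewrite te !inE eqxx orbT.
have [az|[e1 e1R te1]] := kcase a; have [az'|[e2 e2R te2]] := kcase a'.
- by move: na; rewrite -az ka -ka' az' eqxx.
- rewrite (_ : e = e2) //; apply: simple => //; first exact: RE.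
  by rewrite te te2 ka' -ka az setUC.
- rewrite (_ : e = e1) //; apply: simple => //; first exact: RE.
  by rewrite te te1 ka -ka' az'.
rewrite ka in te1; rewrite ka' in te2; exfalso.
have nz x (e0 : E) : e0 \in R -> t e0 = [set x; z] -> x != z.
  by move=> /RE/(Eu_t2 S0) + te0; rewrite te0 cards2; case: (x != z).
have [f fF [f1 f2 _ _]] := fac3 (RE e2R) (RE e1R) eE te2 te1 te na (nz _ _ e1R te1) (nz _ _ e2R te2).
have e12 := two_in_face fF f1 f2 e2R e1R; rewrite e12 te1 in te2.
case: (set2_inj te2) => -[h1 h2]; first by rewrite h1 eqxx in na.
by have := nz _ _ e1R te1; rewrite h1 eqxx.
Qed.

End TwoStars.

Lemma sp2 v f : f \in star v -> #|b f :&: sp v| = 2.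
Proof.
rewrite inE => /andP[fF]; have [x [y [z [e1 [e2 [e3 T]]]]]] := face_triangle S0 fF.
have [Eb [t1 t2 t3] [n1 n2 n3] [m1 m2 m3]] := T; rewrite (triangle_vt T).
have inE' a : a \in [set e1; e2; e3] -> a \in Eu by rewrite -Eb; apply: (subsetP (b_Eu fF)).
rewrite Eb (cards3I _ m1 m2 m3) ![_ \in sp v]inE !inE' ?inE ?eqxx ?orbT //= t1 t2 t3 !inE => /orP[/orP[]|]/eqP->.
- by rewrite !eqxx (negbTE n1) (negbTE n2).
- by rewrite !eqxx [y == x]eq_sym (negbTE n1) (negbTE n3) ?orbT.
by rewrite !eqxx [z == x]eq_sym (negbTE n2) [z == y]eq_sym (negbTE n3) ?orbT.
Qed.

(** A linear system whose unknowns are the edges at [v]: as the link is connected, the parity of the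
    whole star is its only obstruction. Complementing a solution keeps all parities, since each face
    has two edges at [v], so [e0] can be left out. *)
Lemma spokes_odd v D e0 : D \subset star v -> ~~ odd #|star v :\: D| -> e0 \in sp v ->
  exists X : {set E}, [/\ X \subset sp v, e0 \notin X & forall f, f \in star v -> odd #|b f :&: X| = (f \notin D)].
Proof.
move=> Ds ev e0v; have sF : star v \subset F by apply/subsetP=> f; rewrite inE => /andP[].
have [|X XE HX] := @fredholm E Phi (sp v) (star v) (~: D) (fun e f => e \in b f).
  move=> Y Ys hY; have [Y0|Y0] := eqVneq Y set0; first by rewrite Y0 set0I cards0.
  have [->|Y1] := eqVneq Y (star v); first by rewrite -setDE.
  have [e eY ve] := s_link S0 Ys Y0 Y1.
  have YF : Y \subset F by apply: subset_trans Ys sF.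
  have es : e \in sp v by rewrite inE ve (subsetP (bdry_Eu S0 YF)).
  by have := hY e es; rewrite inE in eY; rewrite eY.
have HX' f : f \in star v -> odd #|b f :&: X| = (f \notin D).
  move=> fs; rewrite -in_setC -(HX f fs); congr (odd #|pred_of_set _|); apply/setP=> e; rewrite !inE andbC //.
have [e0X|e0X] := boolP (e0 \in X); last by exists X.
exists (sp v :\: X); split; first exact: subsetDl.
  by rewrite inE e0X.
move=> f fs; rewrite -HX' //; have : #|b f :&: X| + #|b f :&: (sp v :\: X)| = 2.
  rewrite -(sp2 fs) -[RHS](cardsID X); congr addn; apply: eq_card => e.
    by rewrite !in_setI; case eX: (e \in X); rewrite ?andbF // (subsetP XE _ eX) !andbT.
  by rewrite !in_setI !in_setD !in_setI; case: (e \in b f); rewrite ?andbF.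
move=> h; have : odd (#|b f :&: X| + #|b f :&: (sp v :\: X)|) = false by rewrite h.
by rewrite oddD; case: (odd _); case: (odd _).
Qed.

(** Of its two edges at [v], a face with an odd number in [X] has exactly one; a face in [D] has an
    even number and misses [e0], hence none. *)
Lemma spokes v D e0 : D \subset star v -> ~~ odd #|star v :\: D| -> e0 \in sp v -> (forall f, f \in D -> e0 \in b f) ->
  exists X : {set E}, [/\ X \subset sp v, e0 \notin X & forall f, f \in star v -> #|b f :&: X| = (f \notin D)].
Proof.
move=> Ds ev e0v De; have [X [Xs e0X oX]] := spokes_odd Ds ev e0v; exists X; split=> // f fs.
have sub : b f :&: X \subset b f :&: sp v by apply: setIS.
have le2 : #|b f :&: X| <= 2 by rewrite -(sp2 fs) subset_leq_card.
have := oX f fs; have [fD|fD] := boolP (f \in D) => /= o; last by move: o le2; case: #|_| => [|[|[|]]].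
have lt2 : #|b f :&: X| < 2.
  rewrite -(sp2 fs); apply: proper_card; apply/properP; split=> //; exists e0; first by rewrite in_setI De.
  by rewrite in_setI (negbTE e0X) andbF.
by move: o lt2; case: #|_| => [|[|]].
Qed.

Lemma out_star v (X : {set E}) f : X \subset sp v -> f \in F -> f \notin star v -> b f :&: X = set0.
Proof.
move=> Xs fF; rewrite inE fF /= => vf; apply/setP=> e; rewrite in_setI in_set0; apply/negP=> /andP[ef /(subsetP Xs)].
by rewrite inE => /andP[_ ve]; case/negP: vf; apply/in_vt; exists e.
Qed.

(** A colouring of the contraction, pulled back, is constant along the edges of [R]. Flipping the
    centres cuts all these edges, so no face containing one of them is monochromatic; the other
    faces do not meet the centres. *)
Lemma forest_finish v w R k : forest v w t b F R k ->
  (forall f, f \in F -> b f :&: R = set0 -> v \notin vt f /\ w \notin vt f) -> (exists2 f, f \in F & b f :&: R != set0) ->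
  (forall (t' : E -> {set V}) (b' : Phi -> {set E}) (F' : {set Phi}), surf t' b' F' -> euler t' b' F' 1 ->
     ~ colourable t' b' F' -> #|F'| < #|F| -> nonbounding3 t' b' F' v w) -> nonbounding3 t b F v w.
Proof.
move=> fo out [f0 f0F f0R] IH; have [hR _ _ _ _] := fo.
have [t' [b' [F' [S' eu' F'E col nb]]]] := forest_contract erefl S0 eu fo.
apply: nb; apply: IH => //; last first.
  rewrite F'E; apply: proper_card; apply/properP; split; first by apply/subsetP=> f; rewrite inE => /andP[].
  by exists f0; rewrite // inE f0F.
case/col=> c [h1 h2]; apply: nc; exists (symd c [set v; w]) => f fF.
have [fR|/set0Pn[e]] := eqVneq (b f :&: R) set0.
  have [nv nw] := out f fF fR; rewrite (@mono_eq _ _ _ _ _ _ c); first by apply: h1; rewrite F'E inE fF fR eqxx.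
  move=> x xf; rewrite in_symd !inE; case: eqP => [xv|_]; first by rewrite -xv xf in nv.
  by case: eqP => [xw|_]; [rewrite -xw xf in nw|rewrite addbF].
rewrite inE => /andP[ef eR]; have [x [y [eE te xZ yZ _]]] := hR e eR.
have nxy : x != y by apply: contraNneq xZ => ->.
have := h2 e eR; rewrite inE te odd_setI big_setU1 ?big_set1 ?inE //= => xy.
have := face_cob S0 (symd c [set v; w]) fF; case: ifP => // _ z.
have : e \in b f :&: cob t (symd c [set v; w]).
  rewrite !inE in xZ yZ; rewrite inE ef inE te odd_setI big_setU1 ?big_set1 ?inE //=.
  by move: xy; rewrite (negbTE xZ) yZ; case: (x \in c); case: (y \in c).
by move/eqP: z; rewrite cards_eq0 => /eqP->; rewrite inE.
Qed.

(** Around a vertex of even degree, every second edge can be chosen; each face at the vertex then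
    contains exactly one of them. *)
Lemma even_star v : v \in Vu -> ~~ odd #|star v| ->
  exists X : {set E}, forest v v t b F (X :|: X) (fun u => if leaf X v u then v else if leaf X v u then v else u) /\
    forall f, f \in F -> #|b f :&: X| = (v \in vt f).
Proof.
move=> /VuP[f0 f0F vf0] ev; have f0s : f0 \in star v by rewrite inE f0F.
have [e0 e0f] : exists e, e \in b f0 :&: sp v by apply/set0Pn; rewrite -card_gt0 sp2.
rewrite inE in e0f; have /andP[_ e0s] := e0f.
have [||X [Xs _ cX]] := @spokes v set0 e0 (sub0set _) _ e0s; first by rewrite setD0.
  by move=> f; rewrite inE.
have cX' f : f \in F -> #|b f :&: X| = (v \in vt f).
  move=> fF; have [vf|vf] := boolP (v \in vt f); first by rewrite cX ?inE // fF.
  by rewrite (out_star Xs fF) ?cards0 // inE fF.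
exists X; split=> //.
have nl : ~~ leaf X v v.
  apply/leafP=> -[e /(subsetP Xs)]; rewrite inE => /andP[/(Eu_t2 S0) + _] te; by rewrite te cards2 eqxx.
have one f : f \in F -> #|b f :&: (X :|: X)| <= 1 by move=> fF; rewrite setUid cX' //; case: (_ \in _).
apply: forest_of => // e f g s s'; rewrite setUid => eX fF gF nfg ef eg sf se s'g s'e.
have [u [te nuv]] := sp_other (subsetP Xs _ eX).
have noleaf h s0 : h \in F -> e \in b h -> s0 \in vt h -> s0 \notin t e -> ~~ leaf X v s0.
  move=> hF eh sh se0; apply/leafP=> -[e2 e2X te2]; have nsv : s0 != v by move: se0; rewrite te !inE negb_or => /andP[].
  have vh : v \in vt h by apply/in_vt; exists e; rewrite // te !inE eqxx orbT.
  have [a ah ta] := face_edge S0 hF sh vh nsv.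
  have aE : a = e2.
    by apply: simple; rewrite ?ta //; [apply: (subsetP (b_Eu hF))|have := subsetP Xs _ e2X; rewrite inE => /andP[]].
  have := one h hF; rewrite setUid leqNgt => /negP; apply; apply: (@leq_trans #|[set e; e2]|).
    by rewrite cards2 (_ : e != e2) //; apply: contraNneq se0 => ->; rewrite te2 !inE eqxx.
  by apply: subset_leq_card; rewrite subUset !sub1set !inE eh eX -aE ah aE e2X.
have n1 := noleaf f s fF ef sf se; have n2 := noleaf g s' gF eg s'g s'e.
rewrite (negbTE n1) (negbTE n2); apply/eqP=> ss; subst s'.
have nsv : s != v by move: se; rewrite te !inE negb_or => /andP[].
have vf : v \in vt f by apply/in_vt; exists e; rewrite // te !inE eqxx orbT.
have vg : v \in vt g by apply/in_vt; exists e; rewrite // te !inE eqxx orbT.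
have [a af ta] := face_edge S0 fF sf vf nsv; have [a' ag ta'] := face_edge S0 gF s'g vg nsv.
have aa : a = a' by apply: simple; rewrite ?ta //; [apply: (subsetP (b_Eu fF))|apply: (subsetP (b_Eu gF))].
have ea : e = a by apply: (share1 fF gF) => //; rewrite aa.
by move: se; rewrite ea ta !inE eqxx.
Qed.

(** * Two adjacent vertices of odd degree *)

Section OddPair.
Variables (v w p q : V) (e0 a1 a1' a2 a2' : E) (f1 f2 : Phi) (Xv Xw : {set E}) (k : V -> V).
Hypotheses (f1F : f1 \in F) (f2F : f2 \in F) (nf : f1 != f2) (te0 : t e0 = [set v; w]) (nvw : v != w).
Hypotheses (bf1 : b f1 = [set e0; a1; a1']) (ta1 : t a1 = [set v; q]) (ta1' : t a1' = [set w; q]).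
Hypotheses (bf2 : b f2 = [set e0; a2; a2']) (ta2 : t a2 = [set v; p]) (ta2' : t a2' = [set w; p]).
Hypotheses (nqv : q != v) (nqw : q != w) (npv : p != v) (npw : p != w).
Hypotheses (Xvs : Xv \subset sp v) (Xws : Xw \subset sp w) (e0v : e0 \notin Xv) (e0w : e0 \notin Xw).
Hypotheses (cXv : forall f, f \in star v -> #|b f :&: Xv| = (f != f1)).
Hypotheses (cXw : forall f, f \in star w -> #|b f :&: Xw| = (f != f2)).

Lemma odd_pair_e0 f : f \in F -> e0 \in b f -> f = f1 \/ f = f2.
Proof.
have e1 : e0 \in b f1 by rewrite bf1 !inE eqxx.
have e2 : e0 \in b f2 by rewrite bf2 !inE eqxx.
have [g [_ _ _ U]] := two_faces S0 f1F e1 => fF ef; case: (U f fF ef) => [->|->]; first by left.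
by case: (U f2 f2F e2) => [h|->]; [case/eqP: nf|right].
Qed.

Lemma odd_pair_f1 e : e \in b f1 -> e \notin Xv.
Proof.
move=> ef; have : f1 \in star v.
  by rewrite inE f1F; apply/in_vt; exists e0; rewrite ?bf1 ?te0 !inE eqxx.
move/cXv; rewrite eqxx => /eqP; rewrite cards_eq0 => /eqP/setP/(_ e).
by rewrite inE ef inE /= => ->.
Qed.

Let e0E : e0 \in Eu. Proof. by apply: (subsetP (b_Eu f1F)); rewrite bf1 !inE eqxx. Qed.

Lemma odd_pair_nleaf : ~~ leaf Xv v w.
Proof.
apply/leafP=> -[e eX te]; case/negP: e0v; rewrite (_ : e0 = e) //; apply: simple; rewrite ?te ?te0 1?setUC //.
by have := subsetP Xvs _ eX; rewrite inE => /andP[].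
Qed.

Let vwface f : f \in F -> v \in vt f -> w \in vt f -> f = f1 \/ f = f2.
Proof.
move=> fF vf wf; have [a af ta] := face_edge S0 fF vf wf nvw; apply: odd_pair_e0 => //.
by rewrite (_ : e0 = a) //; apply: simple; rewrite ?te0 ?ta //; apply: (subsetP (b_Eu fF)).
Qed.

(* A common neighbour of [v] and [w] is the third vertex of a face at [e0]. *)
Lemma odd_pair_tri u e e' : e \in Eu -> e' \in Eu -> t e = [set u; v] -> t e' = [set u; w] ->
  (e = a1 /\ e' = a1' /\ u = q) \/ (e = a2 /\ e' = a2' /\ u = p).
Proof.
move=> eE eE' te te'.
have nu x (a : E) : a \in Eu -> t a = [set u; x] -> u != x.
  by move=> /(Eu_t2 S0) + ta; rewrite ta cards2; case: (u != x).
have [f fF [f0 f1' f2' Vf]] := fac3 e0E eE' eE te0 te' te (nu _ _ eE te) (nu _ _ eE' te') nvw.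
have inE2 a : a \in b f -> a \in Eu by apply: (subsetP (b_Eu fF)).
have ne0 a x : a \in Eu -> t a = [set u; x] -> a != e0.
  move=> aE ta; apply/eqP=> ae; move: ta; rewrite ae te0 => /set2_inj[] [h1 h2].
    by have := nu _ _ eE te; rewrite h1 eqxx.
  by have := nu _ _ eE' te'; rewrite h2 eqxx.
have n1 := ne0 _ _ eE te; have n2 := ne0 _ _ eE' te'.
have fin (a a' : E) r : r != v -> r != w -> t a = [set v; r] -> t a' = [set w; r] ->
    b f = [set e0; a; a'] -> e = a /\ e' = a' /\ u = r.
  move=> rv rw ta ta' Eb; rewrite Eb !inE in f1' f2'; move: f1' f2'; rewrite (negbTE n1) (negbTE n2) /=.
  have uE : e = a -> u = r.
    move=> ea; move: (te); rewrite ea ta => /set2_inj[] [h1 h2] //; by have := nu _ _ eE te; rewrite -h1 eqxx.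
  case/orP=> /eqP e'E /orP[]/eqP eE2.
  - move: (te) (te'); rewrite e'E eE2 => -> /set2_inj[] [h1 h2]; first by have := nvw; rewrite h2 eqxx.
    by have := nu _ _ eE te; rewrite h2 eqxx.
  - move: (te); rewrite eE2 ta' => /set2_inj[] [h1 h2]; first by rewrite h2 eqxx in rv.
    by have := nvw; rewrite h1 eqxx.
  - by split=> //; split=> //; apply: uE.
  - move: (te); rewrite eE2 ta' => /set2_inj[] [h1 h2]; first by rewrite h2 eqxx in rv.
    by have := nvw; rewrite h1 eqxx.
by case: (odd_pair_e0 fF f0) => fE; [left|right]; [apply: (fin _ _ q)|apply: (fin _ _ p)]; rewrite ?fE.
Qed.

Hypotheses (kv : forall u, leaf Xv v u -> k u = v) (kw : forall u, leaf Xw w u -> k u = w).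
Hypothesis (ku : forall u, ~~ leaf Xv v u -> ~~ leaf Xw w u -> k u = u).
Hypothesis (a2'w : a2' \notin Xw).

(** The third vertices of the two faces at a contracted edge are distinct, so their images can only
    meet at [w]: one of them is [w] itself, and the other a leaf of [w], which must be [q]. *)
Lemma odd_pair_third e f g s s' : e \in Xv -> f \in F -> g \in F -> f != g -> e \in b f -> e \in b g ->
  s \in vt f -> s \notin t e -> s' \in vt g -> s' \notin t e -> k s != k s'.
Proof.
move=> eX fF gF nfg ef eg sf se s'g s'e; have eE : e \in Eu by have := subsetP Xvs _ eX; rewrite inE => /andP[].
have [u [te nuv]] := sp_other (subsetP Xvs _ eX).
have vin h : e \in b h -> v \in vt h by move=> eh; apply/in_vt; exists e; rewrite // te !inE eqxx orbT.
have uin h : e \in b h -> u \in vt h by move=> eh; apply/in_vt; exists e; rewrite // te !inE eqxx.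
have nsv x : x \notin t e -> x != v by rewrite te !inE negb_or => /andP[].
have noleaf h x : h \in F -> e \in b h -> x \in vt h -> x \notin t e -> ~~ leaf Xv v x.
  move=> hF eh xh xe; apply/leafP=> -[e2 e2X te2].
  have [a ah ta] := face_edge S0 hF xh (vin h eh) (nsv _ xe).
  have aE : a = e2.
    by apply: simple; rewrite ?ta //; [apply: (subsetP (b_Eu hF))|have := subsetP Xvs _ e2X; rewrite inE => /andP[]].
  have hs : h \in star v by rewrite inE hF vin.
  have : #|b h :&: Xv| <= 1 by rewrite cXv //; case: (_ != _).
  rewrite leqNgt => /negP; apply; apply: (@leq_trans #|[set e; e2]|).
    by rewrite cards2 (_ : e != e2) //; apply: contraNneq xe => ->; rewrite te2 !inE eqxx.
  by apply: subset_leq_card; rewrite subUset !sub1set !inE eh eX -aE ah aE e2X.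
have dich h x : h \in F -> e \in b h -> x \in vt h -> x \notin t e -> k x = x \/ (k x = w /\ x = q).
  move=> hF eh xh xe; have nl := noleaf h x hF eh xh xe.
  have [lw|] := boolP (leaf Xw w x); last by move=> nw; left; apply: ku.
  right; split; first exact: kw.
  have /leafP[e3 e3X te3] := lw; have [a ah ta] := face_edge S0 hF xh (vin h eh) (nsv _ xe).
  have e3E : e3 \in Eu by have := subsetP Xws _ e3X; rewrite inE => /andP[].
  have [[_ [_ ->]]//|[_ [e3a _]]] := odd_pair_tri (subsetP (b_Eu hF) _ ah) e3E ta te3.
  by rewrite e3a (negbTE a2'w) in e3X.
have same x : x \in vt f -> x \in vt g -> x \notin t e -> False.
  move=> xf xg xe; have [a af ta] := face_edge S0 fF xf (vin f ef) (nsv _ xe).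
  have [a' ag ta'] := face_edge S0 gF xg (vin g eg) (nsv _ xe).
  have aa : a = a' by apply: simple; rewrite ?ta //; [apply: (subsetP (b_Eu fF))|apply: (subsetP (b_Eu gF))].
  have ea : e = a by apply: (share1 fF gF) => //; rewrite aa.
  by move: xe; rewrite ea ta !inE eqxx.
(* the remaining possibility: [v] has degree three and its star is a nontrivial 3-cut *)
have deg3 h h' : h \in F -> h' \in F -> h != h' -> e \in b h -> e \in b h' -> w \in vt h -> q \in vt h' -> False.
  move=> hF h'F nh eh eh' wh qh'.
  have hE : h = f2.
    by case: (vwface hF (vin h eh) wh) => // hE; have := odd_pair_f1 (e := e); rewrite -hE eh eX => /(_ isT).
  subst h; have ea2 : e = a2.
    move: eh; rewrite bf2 !inE => /orP[/orP[]|]/eqP ee //; first by have := e0v; rewrite -ee eX.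
    have := subsetP Xvs _ eX; rewrite inE ee ta2' !inE => /andP[_ /orP[]/eqP vE]; first by have := nvw; rewrite vE eqxx.
    by have := npv; rewrite vE eqxx.
  have h'1 : h' != f1 by apply: contraTneq eh' => ->; apply: contraL eX => ef1; exact: odd_pair_f1.
  have [a ah ta] := face_edge S0 h'F qh' (vin h' eh') nqv.
  have aa1 : a = a1.
    apply: simple; first exact: (subsetP (b_Eu h'F)).
      by apply: (subsetP (b_Eu f1F)); rewrite bf1 !inE eqxx orbT.
    by rewrite ta ta1 setUC.
  have na12 : a1 != a2.
    apply/eqP=> aa; have a1f : a1 \in b f1 by rewrite bf1 !inE eqxx orbT.
    by have := odd_pair_f1 a1f; rewrite aa -ea2 eX.
  pose X := [set f1; f2; h'].
  have XF : X \subset F by rewrite !subUset !sub1set f1F f2F.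
  have nh'2 : f2 != h' by [].
  have cX : #|X| = 3.
    by rewrite /X setUC cardsU1 !inE negb_or h'1 eq_sym nh'2 cards2 nf.
  have subX : bdry X \subset (b f1 :|: b f2 :|: b h') :\: [set e0; a1; a2].
    apply/subsetP=> x /(bdryP S0 _ XF)[g1 [g2 [g1X g2F g2X xg1 xg2]]]; rewrite in_setD; apply/andP; split; last first.
      by move: g1X; rewrite !inE => /orP[/orP[]|]/eqP gE; rewrite -gE xg1 ?orbT.
    apply/negP=> xin; case/negP: g2X.
    have two y k1 k2 : k1 \in F -> k2 \in F -> k1 != k2 -> y \in b k1 -> y \in b k2 -> k1 \in X -> k2 \in X -> y \in b g2 -> g2 \in X.
      move=> k1F k2F nk y1 y2 k1X k2X yg; have [k3 [_ _ _ U]] := two_faces S0 k1F y1.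
      case: (U g2 g2F yg) => [->//|->]; case: (U k2 k2F y2) => [kk|<-//]; by rewrite kk eqxx in nk.
    have X1 : f1 \in X by rewrite !inE eqxx.
    have X2 : f2 \in X by rewrite !inE eqxx orbT.
    have X3 : h' \in X by rewrite !inE eqxx !orbT.
    move: xin; rewrite in_setU in_set2 in_set1 => /orP[/orP[]|]/eqP xE; rewrite xE in xg2.
    - by apply: (two e0 f1 f2) => //; rewrite ?bf1 ?bf2 !inE eqxx.
    - by apply: (two a1 f1 h') => //; rewrite 1?eq_sym // -?aa1 // bf1 aa1 !inE eqxx orbT.
    by apply: (two a2 f2 h') => //; rewrite -?ea2 // .
  have cU : #|b f1 :|: b f2 :|: b h'| <= 6.
    have i1 : 1 <= #|b f1 :&: b f2| by rewrite card_gt0; apply/set0Pn; exists e0; rewrite inE bf1 bf2 !inE eqxx.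
    have i2 : 2 <= #|(b f1 :|: b f2) :&: b h'|.
      apply: (@leq_trans #|[set a1; a2]|); first by rewrite cards2 na12.
      by apply: subset_leq_card; rewrite subUset !sub1set !inE bf1 bf2 !inE -aa1 ah -ea2 eh' aa1 ea2 !eqxx !orbT.
    have := cardsU (b f1) (b f2); have := cardsU (b f1 :|: b f2) (b h').
    rewrite (s_b3 S0 f1F) (s_b3 S0 f2F) (s_b3 S0 h'F); move: i1 i2; clear; lia.
  have c3e : #|[set e0; a1; a2]| = 3.
    rewrite setUC cardsU1 cards2 !inE negb_or [a2 == a1]eq_sym na12.
    have -> : a2 != e0 by rewrite -ea2; apply: contraTneq eX => ->.
    have -> // : e0 != a1.
    apply/eqP=> ee; move: ta1; rewrite -ee te0 => /set2_inj[] [h1 h2]; first by have := nqw; rewrite h2 eqxx.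
    by have := nqv; rewrite h1 eqxx.
  have sub3 : [set e0; a1; a2] \subset b f1 :|: b f2 :|: b h'.
    by rewrite !subUset !sub1set !inE bf1 bf2 !inE !eqxx !orbT.
  have := cut_ge3 S0 XF; rewrite cX => /(_ isT) ge3.
  have F6 := faces_ge6 S0 eu nc.
  have XnF : X != F by apply/eqP=> XE; rewrite -XE cX in F6.
  have c3 : #|bdry X| = 3.
    have := subset_leq_card subX; rewrite cardsD (setIidPr sub3) c3e; have := ge3 XnF; move: cU; clear; lia.
  case: (irr XF c3); first by rewrite cX.
  by have := cardsDF XF; rewrite cX; move: F6; clear; lia.
apply/eqP=> kk; have [ks|[ks sq]] := dich f s fF ef sf se; have [ks'|[ks' sq']] := dich g s' gF eg s'g s'e.
- by apply: (same s) => //; rewrite -ks kk ks'.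
- have sw : s = w by rewrite -ks kk ks'.
  by apply: (deg3 f g) => //; rewrite -?sw -?sq'.
- have sw : s' = w by rewrite -ks' -kk ks.
  by apply: (deg3 g f) => //; rewrite 1?eq_sym // -?sw -?sq.
by apply: (same s) => //; rewrite sq -sq'.
Qed.

End OddPair.

End Facial.
End Forests.

Section Irreducible.
Variables (V E : finType) (t : E -> {set V}) (Phi : finType) (b : Phi -> {set E}) (F : {set Phi}).
Local Notation vt := (vt t b).
Local Notation bdry := (bdry b).
Local Notation Eu := (Eu b F).
Local Notation Vu := (Vu t b F).
Local Notation star := (star t b F).
Hypotheses (S0 : surf t b F) (eu : euler t b F 1) (nc : ~ colourable t b F) (irr : irreducible b F).

(** At a vertex of even degree one star suffices. If all degrees are odd, the star at one end of
    [e0] spares the face [f1] and the star at the other end spares [f2], so that together they meet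
    every face at the two ends exactly once. *)
Lemma not_all_facial :
  (forall C x y z e1 e2 e3, triangle t C x y z e1 e2 e3 -> C \subset Eu -> exists2 f, f \in F & b f = C) ->
  (forall v w (t' : E -> {set V}) (b' : Phi -> {set E}) (F' : {set Phi}), surf t' b' F' -> euler t' b' F' 1 ->
     ~ colourable t' b' F' -> #|F'| < #|F| -> nonbounding3 t' b' F' v w) -> False.
Proof.
move=> fac IH; have fin v w : nonbounding3 t b F v w -> False.
  case=> C [x [y [z [e1 [e2 [e3 [T CE _ _ nb]]]]]]]; have [f fF Ef] := fac _ _ _ _ _ _ _ T CE.
  by apply: (nb [set f]); rewrite ?sub1set // bdry1.
have [/exists_inP[v vV ev]|od] := boolP [exists v in Vu, ~~ odd #|star v|].
  have [X [fo cX]] := even_star S0 eu nc irr fac vV ev; apply: (fin v v).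
  apply: (forest_finish S0 eu nc fo _ _ (IH v v)).
    move=> f fF; rewrite setUid => /eqP; rewrite -cards_eq0 cX //.
    by case: (v \in vt f).
  have /VuP[f fF vf] := vV; exists f => //; rewrite setUid -cards_eq0 cX // vf //.
have {}od v : v \in Vu -> odd #|star v|.
  by move=> vV; apply: contraR od => ev; apply/exists_inP; exists v.
have /set0Pn[f1 f1F] := s_ne S0.
have /card_gt0P[e0 e0f1] : 0 < #|b f1| by rewrite (s_b3 S0).
have /eqP/cards2P[v [w [nvw te0]]] := s_t2 S0 f1F e0f1.
have [f2 [f2F nf e0f2 U]] := two_faces S0 f1F e0f1.
have [q [a1 [a1' [bf1 ta1 ta1' [nqv nqw] _]]]] := face_at S0 f1F e0f1 te0 nvw.
have [p [a2 [a2' [bf2 ta2 ta2' [npv npw] _]]]] := face_at S0 f2F e0f2 te0 nvw.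
have inv f x : e0 \in b f -> x \in [set v; w] -> x \in vt f by move=> ef; rewrite -te0 => xe; apply/in_vt; exists e0.
have sp0 x : x \in [set v; w] -> e0 \in sp t b F x.
  by move=> xe; rewrite inE te0 xe (subsetP (b_Eu f1F)).
have v2 : v \in [set v; w] by rewrite !inE eqxx.
have w2 : w \in [set v; w] by rewrite !inE eqxx orbT.
have star0 x f : x \in [set v; w] -> f \in F -> e0 \in b f -> f \in star x.
  by move=> xe fF ef; rewrite inE fF inv.
have evs x f : x \in [set v; w] -> f \in F -> e0 \in b f -> ~~ odd #|star x :\ f|.
  move=> xe fF ef; have := od x (subsetP (vt_Vu f1F) _ (inv _ _ e0f1 xe)).
  by rewrite (cardsD1 f) star0 //= negbK.
have [|x|Xv [Xvs e0v cXv0]] := @spokes _ _ t _ b F S0 v [set f1] e0 _ (evs v f1 v2 f1F e0f1) (sp0 v v2).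
- by rewrite sub1set star0.
- by move/set1P=> ->.
have [|x|Xw [Xws e0w cXw0]] := @spokes _ _ t _ b F S0 w [set f2] e0 _ (evs w f2 w2 f2F e0f2) (sp0 w w2).
- by rewrite sub1set star0.
- by move/set1P=> ->.
have cXv f : f \in star v -> #|b f :&: Xv| = (f != f1) by move=> fs; rewrite cXv0 // inE.
have cXw f : f \in star w -> #|b f :&: Xw| = (f != f2) by move=> fs; rewrite cXw0 // inE.
have te0' : t e0 = [set w; v] by rewrite te0 setUC.
have bf1' : b f1 = [set e0; a1'; a1] by rewrite bf1 setUAC.
have bf2' : b f2 = [set e0; a2'; a2] by rewrite bf2 setUAC.
have nf' : f1 != f2 by rewrite eq_sym.
have nwv : w != v by rewrite eq_sym.
have [nqv' nqw' npv' npw'] : [/\ q != v, q != w, p != v & p != w] by rewrite ![_ == v]eq_sym ![_ == w]eq_sym.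
have n1 e : e \in b f1 -> e \notin Xv := odd_pair_f1 f1F te0 bf1 cXv (e := e).
have n2 e : e \in b f2 -> e \notin Xw := odd_pair_f1 f2F te0' bf2 cXw (e := e).
have a2'w : a2' \notin Xw by apply: n2; rewrite bf2 !inE eqxx orbT.
have a1v : a1 \notin Xv by apply: n1; rewrite bf1 !inE eqxx orbT.
pose k u := if leaf t Xv v u then v else if leaf t Xw w u then w else u.
have nlw : ~~ leaf t Xv v w by apply: (odd_pair_nleaf S0 eu nc irr f1F te0 bf1 Xvs e0v).
have nlv : ~~ leaf t Xw w v by apply: (odd_pair_nleaf S0 eu nc irr f2F te0' bf2 Xws e0w).
have XE (X : {set E}) x e : X \subset sp t b F x -> e \in X -> e \in Eu by move=> Xs /(subsetP Xs); rewrite inE => /andP[].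
have both u : leaf t Xv v u -> leaf t Xw w u -> False.
  move=> /leafP[e eX te] /leafP[e' eX' te'].
  have [[ea _]|[_ [ea _]]] := odd_pair_tri S0 fac f1F f2F nf' te0 nvw bf1 ta1 ta1' bf2 ta2 ta2' nqv' nqw' npv' npw'
    (XE _ _ _ Xvs eX) (XE _ _ _ Xws eX') te te'.
    by rewrite ea (negbTE a1v) in eX.
  by rewrite ea (negbTE a2'w) in eX'.
have kv u : leaf t Xv v u -> k u = v by rewrite /k => ->.
have kw u : leaf t Xw w u -> k u = w by move=> lw; rewrite /k lw; case: ifP => // lv; case: (both u).
have ku u : ~~ leaf t Xv v u -> ~~ leaf t Xw w u -> k u = u by rewrite /k => /negbTE-> /negbTE->.
have third1 := odd_pair_third S0 eu nc irr fac f1F f2F nf' te0 nvw bf1 ta1 ta1' bf2 ta2 ta2' nqv' nqw' npv' npw' Xvs Xws e0v cXv kw ku a2'w.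
have ku' u : ~~ leaf t Xw w u -> ~~ leaf t Xv v u -> k u = u by move=> *; apply: ku.
have third2 := odd_pair_third S0 eu nc irr fac f2F f1F nf te0' nwv bf2' ta2' ta2 bf1' ta1' ta1 npw' npv' nqw' nqv' Xws Xvs e0w cXw kv ku' a1v.
have cv f : f \in F -> #|b f :&: Xv| = (f \in star v) && (f != f1).
  by move=> fF; case: (boolP (f \in star v)) => fs; [rewrite cXv|rewrite (out_star Xvs fF fs) cards0].
have cw f : f \in F -> #|b f :&: Xw| = (f \in star w) && (f != f2).
  by move=> fF; case: (boolP (f \in star w)) => fs; [rewrite cXw|rewrite (out_star Xws fF fs) cards0].
have vwf f : f \in F -> f \in star v -> f \in star w -> f = f1 \/ f = f2.
  move=> fF; rewrite !inE fF => vf wf; have [a af ta] := face_edge S0 fF vf wf nvw; apply: U => //.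
  by rewrite (_ : e0 = a) //; apply: (irr_simple S0 eu nc irr); rewrite ?te0 ?ta //; [apply: (subsetP (b_Eu f1F))|apply: (subsetP (b_Eu fF))].
have cU f : f \in F -> #|b f :&: (Xv :|: Xw)| <= #|b f :&: Xv| + #|b f :&: Xw|.
  by move=> fF; rewrite setIUr cardsU leq_subr.
have one f : f \in F -> #|b f :&: (Xv :|: Xw)| <= 1.
  move=> fF; apply: leq_trans (cU f fF) _; rewrite cv // cw //.
  case: (boolP (f \in star v)) => vs; case: (boolP (f \in star w)) => ws //=; last by case: (_ != _).
  - by case: (vwf f fF vs ws) => ->; rewrite eqxx; case: (_ != _).
  by case: (_ != _).
apply: (fin v w); apply: (forest_finish (k := k) (R := Xv :|: Xw) S0 eu nc _ _ _ (IH v w)).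
- apply: (forest_of S0 eu nc irr fac Xvs Xws nlw nlv) => //; first by move=> u lv lw; case: (both u lv lw).
  move=> e f g s s'; rewrite inE => /orP[eX|eX]; [exact: third1|exact: third2].
- move=> f fF f0; have fz : f \in star v \/ f \in star w -> False.
    have z1 : #|b f :&: Xv| = 0 by apply/eqP; rewrite cards_eq0 -subset0 -f0 setIS ?subsetUl.
    have z2 : #|b f :&: Xw| = 0 by apply/eqP; rewrite cards_eq0 -subset0 -f0 setIS ?subsetUr.
    rewrite cv // in z1; rewrite cw // in z2.
    case=> fs; rewrite fs /= in z1 z2.
      have ff : f = f1 by apply/eqP; move: z1; case: eqP.
      by move: z2; rewrite ff nf' andbT star0.
    have ff : f = f2 by apply/eqP; move: z2; case: eqP.
    by move: z1; rewrite ff nf andbT star0.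
  by split; apply/negP=> vf; apply: fz; [left|right]; rewrite inE fF.
exists f1 => //; apply/set0Pn; have : 0 < #|b f1 :&: Xw| by rewrite cw // star0 //= nf'.
case/card_gt0P=> e; rewrite inE => /andP[ef eX]; exists e; by rewrite !inE ef eX orbT.
Qed.

Section Ten.
Hypothesis F10 : #|F| = 10.

Lemma six_vertices : #|Vu| = 6.
Proof. by have := faces_vertices S0 eu; rewrite F10; lia. Qed.

(** Ten faces have 15 edges, as many as there are pairs of six vertices, and no two edges have the
    same ends. *)
Lemma complete6 x y : x \in Vu -> y \in Vu -> x != y -> exists2 e, e \in Eu & t e = [set x; y].
Proof.
move=> xV yV nxy; pose D := [set A : {set V} | (A \subset Vu) && (#|A| == 2)].
have sub : t @: Eu \subset D.
  apply/subsetP=> A /imsetP[e eE ->]; rewrite inE (Eu_t2 S0 eE) eqxx andbT.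
  by have /EuP[f fF ef] := eE; apply: subset_trans (t_vt ef) (vt_Vu fF).
have cE : #|t @: Eu| = #|D|.
  rewrite card_in_imset; last by move=> e e'; apply: (irr_simple S0 eu nc irr).
  by rewrite cards_draws six_vertices; have := card_EF S0; rewrite F10 (_ : 'C(6, 2) = 15) //; lia.
have : [set x; y] \in t @: Eu.
  have /eqP-> : t @: Eu == D by rewrite eqEcard sub cE leqnn.
  by rewrite inE cards2 nxy andbT subUset !sub1set xV.
by case/imsetP=> e eE ->; exists e.
Qed.

Lemma triangle_mem (C : {set E}) x y z e1 e2 e3 a : triangle t C x y z e1 e2 e3 ->
  (a \in C) = (a == e1) (+) (a == e2) (+) (a == e3).
Proof.
case=> -> _ _ [m1 m2 m3]; rewrite !inE.
case: (eqVneq a e1) => [->|_]; first by rewrite (negbTE m1) (negbTE m2).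
by case: (eqVneq a e2) => [->|_] //; rewrite (negbTE m3).
Qed.

Lemma pick_from (A : {set V}) n : n.+1 <= #|A| -> exists a, a \in A /\ n <= #|A :\ a|.
Proof.
move=> h; have /card_gt0P[a aA] : 0 < #|A| by apply: leq_trans h.
by exists a; split=> //; move: h; rewrite (cardsD1 a A) aA.
Qed.

(** Four vertices other than [z1] and [z2] span four 3-cycles. If all of them were facial, these
    faces would form a set without boundary, but it does not have ten members. *)
Lemma nonbounding_ten z1 z2 : nonbounding3 t b F z1 z2.
Proof.
pose W := Vu :\ z1 :\ z2.
have cW : 4 <= #|W|.
  have := cardsD1 z1 Vu; have := cardsD1 z2 (Vu :\ z1); rewrite six_vertices -/W.
  by case: (_ \in _); case: (_ \in _) => -> //= h; lia.
have [a [aW k1]] := pick_from cW; have [c [cW' k2]] := pick_from k1; have [d [dW k3]] := pick_from k2.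
have [g [gW _]] := pick_from k3; move: cW' dW gW; rewrite !in_setD1.
move=> /andP[nca cW'] /and3P[ndc nda dW] /and4P[ngd ngc nga gW].
have WP x : x \in W -> [/\ x \in Vu, x != z1 & x != z2] by rewrite !in_setD1 => /and3P[-> -> ->].
have [aV a1 a2] := WP a aW; have /and3P[c2' c1' cV] := cW'; have /and3P[d2 d1 dV] := dW; have /and3P[g2 g1 gV] := gW.
have [nac nad nag ncd] : [/\ a != c, a != d, a != g & c != d] by split; rewrite eq_sym.
have [ncg ndg] : c != g /\ d != g by split; rewrite eq_sym.
have [eac acE tac] := complete6 aV cV nac; have [ead adE tad] := complete6 aV dV nad.
have [eag agE tag] := complete6 aV gV nag; have [ecd cdE tcd] := complete6 cV dV ncd.
have [ecg cgE tcg] := complete6 cV gV ncg; have [edg dgE tdg] := complete6 dV gV ndg.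
have T1 := mk_triangle tcd tad tac nac nad ncd.
have T2 := mk_triangle tcg tag tac nac nag ncg.
have T3 := mk_triangle tdg tag tad nad nag ndg.
have T4 := mk_triangle tdg tcg tcd ncd ncg ndg.
have key C x y z e1 e2 e3 : triangle t C x y z e1 e2 e3 -> e1 \in Eu -> e2 \in Eu -> e3 \in Eu ->
    x != z1 /\ x != z2 -> y != z1 /\ y != z2 -> z != z1 /\ z != z2 -> nonbounding3 t b F z1 z2 \/
    exists2 f, f \in F & b f = C.
  move=> T E1 E2 E3 [x1 x2] [y1 y2] [w1 w2]; have CE : C \subset Eu by case: T => -> _ _ _; rewrite !subUset !sub1set E1 E2.
  have [/existsP[X /andP[XF /eqP EX]]|nX] := boolP [exists X : {set Phi}, (X \subset F) && (bdry X == C)].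
    by right; apply: (facial3 S0 irr T); exists X.
  left; exists C, x, y, z, e1, e2, e3; split=> //.
  - by rewrite !inE !negb_or !(eq_sym z1) x1 y1.
  - by rewrite !inE !negb_or !(eq_sym z2) x2 y2.
  by move=> X XF EX; case/negP: nX; apply/existsP; exists X; rewrite XF EX eqxx.
have [//|[h1 h1F E1]] := key _ _ _ _ _ _ _ T1 cdE adE acE (conj a1 a2) (conj c1' c2') (conj d1 d2).
have [//|[h2 h2F E2]] := key _ _ _ _ _ _ _ T2 cgE agE acE (conj a1 a2) (conj c1' c2') (conj g1 g2).
have [//|[h3 h3F E3]] := key _ _ _ _ _ _ _ T3 dgE agE adE (conj a1 a2) (conj d1 d2) (conj g1 g2).
have [//|[h4 h4F E4]] := key _ _ _ _ _ _ _ T4 dgE cgE cdE (conj c1' c2') (conj d1 d2) (conj g1 g2).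
rewrite -E1 in T1; rewrite -E2 in T2; rewrite -E3 in T3; rewrite -E4 in T4.
pose X := symd (symd [set h1] [set h2]) (symd [set h3] [set h4]).
have XF : X \subset F.
  apply/subsetP=> x; rewrite !in_symd !in_set1.
  case: (eqVneq x h1) => [->|_] //; case: (eqVneq x h2) => [->|_] //; case: (eqVneq x h3) => [->|_] //.
  by case: (eqVneq x h4) => [->|_].
have X0 : bdry X = set0.
  apply/setP=> x; rewrite !bdry_symd !bdry1 !in_symd in_set0.
  rewrite (triangle_mem x T1) (triangle_mem x T2) (triangle_mem x T3) (triangle_mem x T4).
  by case: (x == eac); case: (x == ead); case: (x == eag); case: (x == ecd); case: (x == ecg); case: (x == edg).
have nh h h' : vt h != vt h' -> (h == h') = false by move=> n; apply/negbTE; apply: contra n => /eqP->.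
have nE (A B : {set V}) x : x \in A -> x \notin B -> A != B by move=> xA; apply: contraNneq => <-.
have h1X : h1 \in X.
  rewrite !in_symd !in_set1 eqxx !nh //.
  - by rewrite (triangle_vt T1) (triangle_vt T4); apply: (nE _ _ a); rewrite !inE ?eqxx // !negb_or nac nad.
  - by rewrite (triangle_vt T1) (triangle_vt T3); apply: (nE _ _ c); rewrite !inE ?eqxx ?orbT // !negb_or nca ncd.
  by rewrite (triangle_vt T1) (triangle_vt T2); apply: (nE _ _ d); rewrite !inE ?eqxx ?orbT // !negb_or nda ndc.
case: (s_con S0 XF X0) => XE; first by rewrite XE inE in h1X.
have := symd_card (symd [set h1] [set h2]) (symd [set h3] [set h4]); rewrite -/X XE F10.
have := symd_card [set h1] [set h2]; have := symd_card [set h3] [set h4]; rewrite !cards1; clear; lia.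
Qed.

End Ten.
End Irreducible.

(** The number [n] bounds the faces. A nontrivial 3-cut lets a disc be collapsed; without one,
    either some 3-cycle is nonbounding, which leaves ten faces, or all are facial, which the
    induction hypothesis for contractions refutes. *)
Theorem noncolourable_nonbounding n (V E Phi : finType) (t : E -> {set V}) (b : Phi -> {set E}) (F : {set Phi}) :
  #|F| <= n -> surf t b F -> euler t b F 1 -> ~ colourable t b F -> forall z1 z2, nonbounding3 t b F z1 z2.
Proof.
elim: n Phi t b F => [|n IH] Phi t b F leF S0 eu nc z1 z2.
  by move: leF; rewrite leqn0 cards_eq0 => /eqP F0; have := s_ne S0; rewrite F0 eqxx.
have red (X : {set Phi}) : X \subset F -> #|bdry b X| = 3 -> 1 < #|X| -> disc t b F X -> nonbounding3 t b F z1 z2.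
  move=> XF c3 X1 dX; pose Y := F :\: X; have YF : Y \subset F by apply: subsetDl.
  have c3' : #|bdry b Y| = 3 by rewrite (bdryC S0).
  have [Y0 YnF] := cut3_proper S0 YF c3'.
  have pP := pc_partition YF YnF; have cP := pc_c3 S0 YF c3'.
  have dP B : B \in pc F Y -> disc t b F B.
    by case/pcP=> [->|[f fY ->]]; [rewrite setDDF|apply: (disc1 S0); apply: (subsetP YF)].
  have [] := IH _ t (bdry b) (pc F Y) _ (pc_surf S0 YF c3') (quot_euler S0 pP dP eu) _ z1 z2.
  - have := cardsDF XF; rewrite (pc_card S0 YF c3') -/Y; move: leF X1; clear; lia.
  - by move=> col; apply: nc; apply: (quot_colourable S0 (P := pc F Y)) => //; split=> // B BP; split; [apply: cP|apply: dP].
  move=> C [x [y [z [e1 [e2 [e3 [T CE n1 n2 nb]]]]]]]; exists C, x, y, z, e1, e2, e3; split=> //.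
    exact: subset_trans CE (quot_Eu_sub S0 pP).
  exact: (quot_nonbounding S0 pP cP CE nb).
have [/existsP[X /and4P[XF /eqP c3 X1 Y1]]|nir] := boolP [exists X : {set Phi}, [&& X \subset F, #|bdry b X| == 3, 1 < #|X| & 1 < #|F :\: X|]].
  case: (disc_proj S0 XF c3 eu); first exact: red.
  by apply: red; rewrite ?subsetDl // (bdryC S0).
have irr : irreducible b F.
  move=> X XF c3; have [le1|gt1] := leqP #|X| 1; first by left.
  right; rewrite leqNgt; apply: contra nir => gt1'; apply/existsP; exists X; by rewrite XF c3 gt1 gt1'.
have [/existsP[C /and4P[/eqP c3 CE /forallP ev /forall_inP nb]]|nn] := boolP [exists C : {set E},
  [&& #|C| == 3, C \subset Eu b F, [forall v, even_at t C v] & [forall (X : {set Phi} | X \subset F), bdry b X != C]]].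
  have [|x [y [z [e1 [e2 [e3 T]]]]]] := triangleP c3 _ ev.
    by move=> e eC; apply: (Eu_t2 S0); apply: (subsetP CE).
  apply: nonbounding_ten => //; apply: (ten_faces S0 eu nc irr T CE) => X XF; apply/eqP; exact: nb.
case: (not_all_facial S0 eu nc irr) => [C x y z e1 e2 e3 T CE|v w t' b' F' S' eu' nc' lt].
  apply: (facial3 S0 irr T); have [/existsP[X /andP[XF /eqP]]|nX] := boolP [exists X : {set Phi}, (X \subset F) && (bdry b X == C)].
    by exists X.
  case/negP: nn; apply/existsP; exists C; rewrite CE (triangle_card T) eqxx /=; apply/andP; split.
    by apply/forallP=> v; apply: (triangle_even _ T).
  by apply/forall_inP=> X XF; apply: contra nX => EX; apply/existsP; exists X; rewrite XF.
by apply: IH => //; move: lt leF; clear; lia.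
Qed.

(** * From triangulated surfaces to sets of facial triangles *)

Local Open Scope fset_scope.

Section Image.
Variables (T : finType) (K : choiceType) (g : T -> K).
Implicit Types A : {set T}.

Definition fim A : {fset K} := [fset g x | x in A].

Lemma fimP A k : reflect (exists2 x, x \in A & k = g x) (k \in fim A).
Proof. exact: imfsetP. Qed.

Lemma in_fim A x : x \in A -> g x \in fim A.
Proof. by move=> xA; apply/fimP; exists x. Qed.

Lemma card_fim A : {in A &, injective g} -> #|` fim A| = #|A|.
Proof. by move=> inj; rewrite card_in_imfset //= cardE. Qed.

Hypothesis ginj : injective g.

Lemma mem_fim A x : (g x \in fim A) = (x \in A).
Proof. by apply/fimP/idP => [[y yA /ginj->]|xA] //; exists x. Qed.

Lemma fim_sub A B : (fim A `<=` fim B) = (A \subset B).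
Proof.
apply/fsubsetP/subsetP => h x.
  by move=> xA; rewrite -mem_fim; apply: h; rewrite mem_fim.
by case/fimP=> y yA ->; rewrite mem_fim; apply: h.
Qed.

Lemma fim_inj : injective fim.
Proof. by move=> A B e; apply/eqP; rewrite eqEsubset -!fim_sub e !fsubset_refl. Qed.

Lemma fim2 x y : fim [set x; y] = [fset g x; g y].
Proof.
apply/fsetP=> k; rewrite !inE; apply/fimP/orP => [[z]|].
  by rewrite !inE => /orP[]/eqP-> ->; [left|right].
by case=> /eqP->; [exists x|exists y]; rewrite ?inE ?eqxx ?orbT.
Qed.

Lemma fim3 x y z : fim [set x; y; z] = [fset g x; g y; g z].
Proof.
apply/fsetP=> k; rewrite !inE; apply/fimP/orP => [[w]|].
  by rewrite !inE => /orP[/orP[]|]/eqP-> ->; [left|left|right]; rewrite ?eqxx ?orbT.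
by case=> [/orP[]|] /eqP->; [exists x|exists y|exists z]; rewrite ?inE ?eqxx ?orbT.
Qed.

Lemma card_fim_all A : #|` fim A| = #|A|.
Proof. by apply: card_fim => x y _ _; apply: ginj. Qed.

Lemma sub_fim A (B : {fset K}) : B `<=` fim A -> exists2 A' : {set T}, A' \subset A & B = fim A'.
Proof.
move=> h; exists [set x in A | g x \in B]; first by apply/subsetP=> x; rewrite inE => /andP[].
apply/fsetP=> k; apply/idP/fimP => [kB|[x]]; last by rewrite inE => /andP[_ xB] ->.
by have /fimP[x xA kE] := fsubsetP h k kB; exists x; rewrite // inE xA -kE.
Qed.

End Image.

Section TriOf.
Variables (V : finType) (lab : V -> nat).
Hypothesis linj : injective lab.
Variables (E : finType) (t : E -> {set V}) (Phi : finType) (b : Phi -> {set E}) (F : {set Phi}).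
Local Notation vt := (vt t b).
Local Notation Eu := (Eu b F).
Local Notation Vu := (Vu t b F).

Definition tri_of : tri := fim (fun f => fim lab (vt f)) F.
Definition simple := forall e e', e \in Eu -> e' \in Eu -> t e = t e' -> e = e'.

Hypotheses (S0 : surf t b F) (sim : simple) (F3 : 2 < #|F|).

Lemma face_sub e f : e \in Eu -> f \in F -> (t e \subset vt f) = (e \in b f).
Proof.
move=> eE fF; apply/idP/idP => [|ef]; last exact: t_vt.
have /eqP/cards2P[x [y [nxy te]]] := Eu_t2 S0 eE; rewrite te subUset !sub1set => /andP[xf yf].
have [a af ta] := face_edge S0 fF xf yf nxy.
by rewrite (_ : e = a) //; apply: sim; rewrite ?te ?ta //; apply: (subsetP (b_Eu fF)).
Qed.

Lemma vt_b f g : f \in F -> g \in F -> vt f = vt g -> b f = b g.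
Proof.
move=> fF gF h; apply/setP=> e; have [eE|nE] := boolP (e \in Eu); first by rewrite -!face_sub // h.
have nb k : k \in F -> (e \in b k) = false by move=> hF; apply/negbTE; apply: contra nE => /(subsetP (b_Eu hF)).
by rewrite !nb.
Qed.

(** Simplicity gives two faces with the same vertices the same edges, so that they form a closed
    surface by themselves, the degenerate sphere with two faces. *)
Lemma vt_inj : {in F &, injective vt}.
Proof.
move=> f g fF gF h; apply/eqP; apply: contraT => nfg.
have XF : [set f; g] \subset F by rewrite subUset !sub1set fF gF.
have := s_con S0 XF; rewrite bdryU ?disjoints1 ?inE // !bdry1 (vt_b fF gF h) symd_id => /(_ erefl)[] E1.
  by have : f \in set0; [rewrite -E1 !inE eqxx|rewrite inE].
by move: F3; rewrite -E1 cards2 nfg.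
Qed.

Lemma tri_inj : {in F &, injective (fun f => fim lab (vt f))}.
Proof. by move=> f g fF gF /(fim_inj linj); apply: vt_inj. Qed.

Lemma tri_card : #|` tri_of| = #|F|.
Proof. exact: card_fim tri_inj. Qed.

Lemma tri_verts : verts tri_of = fim lab Vu.
Proof.
apply/fsetP=> x; apply/bigfcupP/fimP => [[g /andP[/fimP[f fF ->] _] /fimP[v vf ->]]|[v /VuP[f fF vf] ->]].
  by exists v => //; apply/VuP; exists f.
by exists (fim lab (vt f)); [rewrite andbT; apply/fimP; exists f|apply: in_fim].
Qed.

Lemma tri_edges : edges tri_of = fim (fun e => fim lab (t e)) Eu.
Proof.
apply/fsetP=> x; rewrite !inE /= fpowersetE tri_verts; apply/idP/fimP => [/and3P[_ /eqP x2 /hasP[g /fimP[f fF ->]]]|[e eE ->]].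
  case/(sub_fim) => A Af xE; rewrite xE (card_fim_all linj) in x2.
  have /cards2P[u [v [nuv AE]]] := introT eqP x2; rewrite AE subUset !sub1set in Af; case/andP: Af => uf vf.
  have [a af ta] := face_edge S0 fF uf vf nuv; exists a; first exact: (subsetP (b_Eu fF)).
  by rewrite xE AE ta.
have /EuP[f fF ef] := eE; rewrite (card_fim_all linj) (Eu_t2 S0 eE) eqxx /=; apply/andP; split.
  by rewrite (fim_sub linj); apply: subset_trans (t_vt ef) (vt_Vu fF).
by apply/hasP; exists (fim lab (vt f)); [apply: in_fim|rewrite (fim_sub linj) t_vt].
Qed.

Lemma tri_card_verts : #|` verts tri_of| = #|Vu|.
Proof. by rewrite tri_verts (card_fim_all linj). Qed.

Lemma tri_card_edges : #|` edges tri_of| = #|Eu|.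
Proof. by rewrite tri_edges card_fim // => e e' eE e'E /(fim_inj linj); apply: sim. Qed.

Lemma tri_surface : closed_surface tri_of.
Proof.
split.
- have /set0Pn[f fF] := s_ne S0; apply/fset0Pn; exists (fim lab (vt f)); exact: in_fim.
- by move=> g /fimP[f fF ->]; rewrite (card_fim_all linj) (card_vt S0 fF).
- move=> x; rewrite tri_edges => /fimP[e eE ->]; have /EuP[f fF ef] := eE.
  rewrite -(s_e2 S0 fF ef) -(card_fim (g := fun f => fim lab (vt f)) (A := [set g in F | e \in b g])); last first.
    by move=> g h; rewrite !inE => /andP[gF _] /andP[hF _]; apply: tri_inj.
  congr #|` _|; apply/fsetP=> g; rewrite !inE /=; apply/andP/fimP => [[/fimP[h hF ->]]|[h]].
    by rewrite (fim_sub linj) face_sub // => eh; exists h; rewrite // inE hF.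
  rewrite inE => /andP[hF eh] ->; split; first exact: in_fim.
  by rewrite (fim_sub linj) t_vt.
- move=> n; rewrite tri_verts => /fimP[v vV ->] S Sn0 Snb [y0 [y0v y0S [g0 /fimP[f0 f0F ->] /andP[vf0 y0f0]]]].
  rewrite (mem_fim linj) in vf0; have /fimP[y yf0 yE] := y0f0; subst y0.
  have nyv : y != v by apply: contraNneq y0v => ->.
  case: (boolP [exists f in F, [exists a, exists c, [&& v \in vt f, a \in vt f, c \in vt f, c != v, lab a \in S & lab c \notin S]]]).
    case/exists_inP=> f fF /existsP[a /existsP[c /and5P[vf af cf ncv /andP[aS cS]]]].
    exists (fim lab (vt f)); first exact: in_fim.
    exists (lab a), (lab c); split=> //; last by rewrite (inj_eq linj).
    by rewrite -fim3 (fim_sub linj) !subUset !sub1set vf af cf.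
  rewrite negb_exists_in => /forall_inP no.
  have noP f a c : f \in F -> v \in vt f -> a \in vt f -> c \in vt f -> c != v -> lab a \in S -> lab c \in S.
    move=> fF vf af cf ncv aS; have := no f fF; rewrite negb_exists => /forallP/(_ a); rewrite negb_exists => /forallP/(_ c).
    by rewrite vf af cf ncv aS /= negbK.
  (* [X] consists of the faces at [v] with a vertex labelled in [S]. If no face separates [S] at
     [v], both faces on an edge at [v] belong to [X] together, against [s_link]. *)
  exfalso; pose X := [set f in star t b F v | [exists a in vt f, lab a \in S]].
  have Xs : X \subset star t b F v by apply/subsetP=> f; rewrite inE => /andP[].
  have X0 : X != set0.
    have /fset0Pn[a aS] := Sn0; have [_ [g /fimP[f fF ->] /andP[vf /fimP[a' af aE]]]] := Snb a aS.
    rewrite (mem_fim linj) in vf; apply/set0Pn; exists f; rewrite !inE fF vf /=; apply/exists_inP.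
    by exists a' => //; rewrite -aE.
  have X1 : X != star t b F v.
    apply: contraNneq y0S => XE; have : f0 \in X by rewrite XE inE f0F vf0.
    by rewrite inE => /andP[_ /exists_inP[a af aS]]; apply: (noP f0 a).
  have [e eX ve] := s_link S0 Xs X0 X1.
  have XF : X \subset F by apply: subset_trans Xs _; apply/subsetP=> f; rewrite inE => /andP[].
  have [f [g [fX gF gX ef eg]]] := bdryP S0 _ XF eX.
  have eE : e \in Eu by apply/EuP; exists g.
  have /eqP/cards2P[p [q [npq te]]] := Eu_t2 S0 eE.
  have [w nwv we] : exists2 w, w != v & w \in t e.
    by move: ve; rewrite te !inE => /orP[]/eqP->; [exists q|exists p]; rewrite ?inE ?eqxx ?orbT // eq_sym.
  have inv x h : e \in b h -> x \in t e -> x \in vt h by move=> eh xe; apply/in_vt; exists e.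
  have fF := subsetP XF _ fX; move: fX; rewrite inE => /andP[_ /exists_inP[a af aS]].
  have wS := noP f a w fF (inv _ _ ef ve) af (inv _ _ ef we) nwv aS.
  by case/negP: gX; rewrite !inE gF (inv _ _ eg ve); apply/exists_inP; exists w; rewrite // (inv _ _ eg).
move=> S Sn0 Ssub Sne; pose c := [set v in Vu | lab v \in S].
case: (boolP [exists f in F, [exists a in vt f, exists d in vt f, (lab a \in S) && (lab d \notin S)]]).
  case/exists_inP=> f fF /exists_inP[a af /exists_inP[d df /andP[aS dS]]].
  exists (fim lab (vt f)); first exact: in_fim.
  by exists (lab a), (lab d); split=> //; apply: in_fim.
rewrite negb_exists_in => /forall_inP no; exfalso.
have noP f a d : f \in F -> a \in vt f -> d \in vt f -> lab a \in S -> lab d \in S.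
  move=> fF af df aS; have := no f fF; rewrite negb_exists_in => /forall_inP/(_ a af).
  by rewrite negb_exists_in => /forall_inP/(_ d df); rewrite aS /= negbK.
(* Connectedness in terms of vertices is read off from the kernel of the incidence matrix of
   vertices and edges. *)
have [||c0|c1] := vkernel S0 (X := c).
- by apply/subsetP=> v; rewrite inE => /andP[].
- move=> e eE; have /eqP/cards2P[p [q [npq te]]] := Eu_t2 S0 eE; have /EuP[f fF ef] := eE.
  have [pf qf] : p \in vt f /\ q \in vt f.
    by split; apply: (subsetP (t_vt ef)); rewrite te !inE eqxx ?orbT.
  rewrite (_ : [set i in c | i \in t e] = t e :&: c); last by apply/setP=> i; rewrite !inE andbC.
  rewrite te odd_setI big_setU1 ?big_set1 ?inE //=.
  have [pV qV] : p \in Vu /\ q \in Vu by split; apply: (subsetP (vt_Vu fF)).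
  rewrite pV qV /=; have h1 := noP f p q fF pf qf; have h2 := noP f q p fF qf pf.
  by case ps: (lab p \in S) h1 h2 => h1 h2; case qs: (lab q \in S) h1 h2 => h1 h2 //; [have := h1 isT|have := h2 isT].
- have /fset0Pn[n nS] := Sn0; have := fsubsetP Ssub n nS; rewrite tri_verts => /fimP[v vV nE].
  by have : v \in c; [rewrite inE vV -nE|rewrite c0 inE].
case/eqP: Sne; apply/eqP; rewrite eqEfsubset Ssub tri_verts; apply/fsubsetP=> n /fimP[v vV ->].
by have : v \in c; [rewrite c1|rewrite inE => /andP[]].
Qed.

Lemma tri_plane : euler t b F 2 -> plane_tri tri_of.
Proof. by move=> eu; split; [exact: tri_surface|rewrite tri_card_verts tri_card_edges tri_card]. Qed.

Lemma tri_proj : euler t b F 1 -> proj_tri tri_of.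
Proof. by move=> eu; split; [exact: tri_surface|rewrite tri_card_verts tri_card_edges tri_card]. Qed.

End TriOf.

(** * The complex of a closed surface given by its facial triangles *)

Section ComplexOf.
Variable G : tri.
Hypothesis HG : closed_surface G.
Let V : finType := fset_sub_type (verts G).
Let lab : V -> nat := fun v => val v.

Definition pairs_in (W : finType) (f : {set W}) : {set {set W}} := [set e : {set W} | (e \subset f) && (#|e| == 2)].
Definition faces_of : {set {set V}} := [set f | fim lab f \in G].
Let b : {set V} -> {set {set V}} := @pairs_in V.
Let F := faces_of.

Lemma lab_inj : injective lab. Proof. exact: val_inj. Qed.
Let linj := lab_inj.

Let inF f : (f \in F) = (fim lab f \in G). Proof. by rewrite inE. Qed.

Let face_card f : f \in F -> #|f| = 3.
Proof. by rewrite inF -(card_fim_all linj) => /(let: And5 _ h _ _ _ := HG in h). Qed.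

Lemma pairs3 (W : finType) (x y z : W) : x != y -> x != z -> y != z ->
  triangle id (pairs_in [set x; y; z]) x y z [set y; z] [set x; z] [set x; y].
Proof.
move=> n1 n2 n3; have T := @mk_triangle W {set W} id x y z [set y; z] [set x; z] [set x; y] erefl erefl erefl n1 n2 n3.
suff E : pairs_in [set x; y; z] = [set [set y; z]; [set x; z]; [set x; y]] by rewrite E.
apply/esym/eqP; rewrite eqEcard (triangle_card T) cards_draws; apply/andP; split.
  by rewrite !subUset !sub1set !inE !subUset !sub1set !inE !eqxx !orbT !cards2 n1 n2 n3.
rewrite setUC cardsU1 cards2 n1 !inE negb_or eq_sym n2 eq_sym n3 //.
Qed.

Let face_tri f : f \in F -> exists x y z, f = [set x; y; z] /\ triangle id (b f) x y z [set y; z] [set x; z] [set x; y].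
Proof.
by move/face_card/cards3 => [x [y [z [-> [n1 n2 n3]]]]]; exists x, y, z; split=> //; apply: pairs3.
Qed.

Let vtE f : f \in F -> vt id b f = f.
Proof. by move=> fF; have [x [y [z [fE T]]]] := face_tri fF; rewrite (triangle_vt T) fE. Qed.

Let faceG g : g \in G -> exists2 f, f \in F & g = fim lab f.
Proof.
move=> gG; have gV : g `<=` fim lab [set: V].
  apply/fsubsetP=> n ng; have nV : n \in verts G by apply/bigfcupP; exists g; rewrite ?gG.
  by apply/fimP; exists [` nV]; rewrite ?inE.
by have [f _ gE] := sub_fim gV; exists f; rewrite // inF -gE.
Qed.

Let EuE e : (e \in Eu b F) = (fim lab e \in edges G).
Proof.
rewrite !inE /= fpowersetE (card_fim_all linj); apply/EuP/and3P => [[f fF]|[_ e2 /hasP[g /faceG[f fF ->]]]].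
  rewrite inE => /andP[ef e2]; split=> //.
    by apply/fsubsetP=> n /fimP[v _ ->]; apply: valP.
  by apply/hasP; exists (fim lab f); [rewrite -inF|rewrite (fim_sub linj)].
by rewrite (fim_sub linj) => ef; exists f; rewrite // inE ef.
Qed.

Let star_card e : fim lab e \in edges G -> #|[set g in F | e \in b g]| = 2.
Proof.
move=> eE; have [_ _ /(_ _ eE) c2 _ _] := HG; rewrite -c2.
rewrite -(card_fim (g := fim lab) (A := [set g in F | e \in b g])); last by move=> f g _ _; apply: (fim_inj linj).
congr #|` _|; apply/fsetP=> g; rewrite !inE /=; apply/fimP/andP => [[f]|[gG eg]].
  by rewrite inE => /andP[fF]; rewrite inE => /andP[ef _] ->; rewrite (fim_sub linj) -inF.
have [f fF gE] := faceG gG; exists f => //; rewrite inE fF inE; move: eg; rewrite gE (fim_sub linj) => -> /=.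
have eU : e \in Eu b F by rewrite EuE.
by have /EuP[h _] := eU; rewrite inE => /andP[].
Qed.

Let edge2 f u v : f \in F -> u \in f -> v \in f -> u != v -> [set u; v] \in b f.
Proof. by move=> fF uf vf nuv; rewrite inE subUset !sub1set uf vf cards2 nuv. Qed.

Let two_F f e : f \in F -> e \in b f -> exists g, [/\ g \in F, g != f, e \in b g & forall h, h \in F -> e \in b h -> h = f \/ h = g].
Proof.
move=> fF ef; have eE : fim lab e \in edges G by rewrite -EuE; apply/EuP; exists f.
have /eqP/cards2P[g1 [g2 [ng E2]]] := star_card eE.
have in2 h : (h \in F) && (e \in b h) = (h == g1) || (h == g2) by have /setP/(_ h) := E2; rewrite in_set in_set2.
have := in2 f; rewrite fF ef => /esym/orP[]/eqP fE; [exists g2|exists g1].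
  have := in2 g2; rewrite eqxx orbT => /andP[-> ->]; rewrite fE eq_sym; split=> // h hF eh.
  by have := in2 h; rewrite hF eh => /esym/orP[]/eqP->; [left|right].
have := in2 g1; rewrite eqxx => /andP[-> ->]; rewrite fE; split=> // h hF eh.
by have := in2 h; rewrite hF eh => /esym/orP[]/eqP->; [right|left].
Qed.

Let crossing (X : {set {set V}}) f g e : X \subset F -> f \in X -> g \in F -> g \notin X -> e \in b f -> e \in b g -> e \in bdry b X.
Proof.
move=> XF fX gF gX ef eg; rewrite inE; have [g' [_ _ _ U]] := two_F (subsetP XF _ fX) ef.
have gg : g = g' by case: (U g gF eg) => // gf; rewrite gf fX in gX.
rewrite (_ : [set _ in _ | _] = [set f]) ?cards1 //; apply/setP=> h; rewrite in_set in_set1.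
apply/andP/eqP => [[hX eh]|->//]; case: (U h (subsetP XF _ hX) eh) => // hg.
by rewrite hg -gg (negbTE gX) in hX.
Qed.

Let vertF (v : V) : exists2 f, f \in F & v \in f.
Proof.
have /bigfcupP[g] := valP v; rewrite andbT => /faceG[f fF ->] vf; exists f => //.
by rewrite -(mem_fim linj).
Qed.

Let other_in f v : f \in F -> v \in f -> exists2 a, a \in f & a != v.
Proof.
move=> fF vf; have : 0 < #|f :\ v| by have := face_card fF; rewrite (cardsD1 v) vf; case: #|_|.
by case/card_gt0P=> a; rewrite !inE => /andP[nav af]; exists a.
Qed.

(* If no edge at [v] leaves [X], the link of [v] being connected puts all faces at [v] in [X] as soon as one is. *)
Let link_closed (X : {set {set V}}) v : X \subset F ->
  (forall f g a, f \in X -> g \in F -> v \in f -> a \in f -> v \in g -> a \in g -> a != v -> g \in X) ->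
  forall f g, f \in X -> v \in f -> g \in F -> v \in g -> g \in X.
Proof.
move=> XF cl f0 g0 f0X vf0 g0F vg0; apply: contraT => g0X; exfalso.
pose S : {fset nat} := fim lab [set a | (a != v) && [exists f in X, (v \in f) && (a \in f)]].
have inS a : (lab a \in S) = (a != v) && [exists f in X, (v \in f) && (a \in f)] by rewrite (mem_fim linj) inE.
have [_ _ _ link _] := HG.
have [a0 a0f na0] := other_in (subsetP XF _ f0X) vf0; have [b0 b0g nb0] := other_in g0F vg0.
have [||||g /faceG[f fF ->] [a [c [sub aS cS ncv]]]] := link (lab v) _ S.
- by apply/bigfcupP; exists (fim lab f0); rewrite ?andbT -?inF ?(subsetP XF) // mem_fim.
- by apply/fset0Pn; exists (lab a0); rewrite inS na0; apply/exists_inP; exists f0; rewrite ?vf0.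
- move=> n /fimP[a]; rewrite inE => /andP[nav /exists_inP[f fX /andP[vf af]]] ->; split.
    by rewrite (inj_eq linj).
  by exists (fim lab f); rewrite ?mem_fim ?vf //; rewrite -inF (subsetP XF).
- exists (lab b0); split; rewrite ?(inj_eq linj) //.
    rewrite inS nb0 /=; apply/exists_inP=> -[f fX /andP[vf bf]]; case/negP: g0X.
    exact: (cl f g0 b0).
  by exists (fim lab g0); rewrite ?mem_fim ?vg0 // -inF.
have in3 n : n \in [fset lab v; a; c] -> n \in fim lab f by apply: fsubsetP.
have /fimP[a' af aE] : a \in fim lab f by apply: in3; rewrite !inE eqxx orbT.
have /fimP[c' cf cE] : c \in fim lab f by apply: in3; rewrite !inE eqxx orbT.
have vf : v \in f by rewrite -(mem_fim linj); apply: in3; rewrite !inE eqxx.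
subst a c; move: aS; rewrite inS => /andP[nav /exists_inP[h hX /andP[vh ah]]].
have fX : f \in X by apply: (cl h f a').
case/negP: cS; rewrite inS; apply/andP; split; first by apply: contraNneq ncv => ->.
by apply/exists_inP; exists f; rewrite ?vf.
Qed.

Lemma complex_surf : surf id b F.
Proof.
split.
- by have [/fset0Pn[g gG] _ _ _ _] := HG; have [f fF _] := faceG gG; apply/set0Pn; exists f.
- by move=> f /face_tri[x [y [z [_ T]]]]; apply: triangle_card T.
- by move=> f v /face_tri[x [y [z [_ T]]]]; apply: triangle_even T.
- by move=> f e _; rewrite inE => /andP[_ /eqP].
- by move=> f e fF ef; apply: star_card; rewrite -EuE; apply/EuP; exists f.
- move=> X XF X0; have cl f g u a : f \in X -> g \in F -> u \in f -> a \in f -> u \in g -> a \in g -> a != u -> g \in X.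
    move=> fX gF uf af ug ag nau; apply: contraT => gX.
    have := crossing XF fX gF gX (edge2 (subsetP XF _ fX) af uf nau) (edge2 gF ag ug nau).
    by rewrite X0 inE.
  have [->|Xn0] := eqVneq X set0; [by left|right].
  have /set0Pn[f0 f0X] := Xn0; have f0F := subsetP XF _ f0X.
  have full v : v \in cover X -> forall g, g \in F -> v \in g -> g \in X.
    case/bigcupP=> f fX vf g gF vg; apply: (link_closed XF _ fX vf gF vg) => f' g' a *; exact: (cl f' g' v a).
  have [cT|cT] := eqVneq (cover X) setT.
    apply/eqP; rewrite eqEsubset XF; apply/subsetP=> g gF.
    have /card_gt0P[v vg] : 0 < #|g| by rewrite face_card.
    by apply: (full v); rewrite ?cT.
  exfalso; have [_ _ _ _ con] := HG; pose S := fim lab (cover X).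
  have [|||g /faceG[f fF ->] [a [c [/fimP[a' af ->] /fimP[c' cf ->] aS cS]]]] := con S.
  + have /card_gt0P[v vf] : 0 < #|f0| by rewrite face_card.
    by apply/fset0Pn; exists (lab v); rewrite mem_fim //; apply/bigcupP; exists f0.
  + by apply/fsubsetP=> n /fimP[v _ ->]; apply: valP.
  + apply: contra cT => /eqP SE; rewrite eqEsubset subsetT; apply/subsetP=> v _.
    by rewrite -(mem_fim linj) -/S SE; apply: valP.
  rewrite (mem_fim linj) in aS; rewrite (mem_fim linj) in cS.
  by case/negP: cS; apply/bigcupP; exists f => //; apply: (full a').
move=> v X Xs X0 X1; apply/exists_inP; apply: contraT; rewrite negb_exists_in => /forall_inP no; exfalso.
have XF : X \subset F by apply: subset_trans Xs _; apply/subsetP=> f; rewrite inE => /andP[].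
have sE f : (f \in star id b F v) = (f \in F) && (v \in f).
  by rewrite inE; case fF: (f \in F) => //=; rewrite vtE.
have /set0Pn[f0 f0X] := X0; have := subsetP Xs _ f0X; rewrite sE => /andP[f0F vf0].
case/negP: X1; rewrite eqEsubset Xs; apply/subsetP=> g; rewrite sE => /andP[gF vg].
apply: (link_closed XF _ f0X vf0 gF vg) => f h a fX hF vf af vh ah nav; apply: contraT => hX.
have := no _ (crossing XF fX hF hX (edge2 (subsetP XF _ fX) af vf nav) (edge2 hF ah vh nav)).
by rewrite !inE eqxx orbT.
Qed.

Lemma complex_simple : simple id b F. Proof. by []. Qed.

Lemma complex_tri : tri_of lab id b F = G.
Proof.
apply/fsetP=> g; apply/fimP/idP => [[f fF ->]|/faceG[f fF ->]]; first by rewrite vtE // -inF.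
by exists f; rewrite // vtE.
Qed.

Lemma complex_counts : [/\ #|Vu id b F| = #|` verts G|, #|Eu b F| = #|` edges G| & #|F| = #|` G|].
Proof.
split.
- rewrite -(card_fim_all linj); congr #|` _|; apply/fsetP=> n; apply/fimP/idP => [[v _ ->]|nV]; first exact: valP.
  exists [` nV] => //; have [f fF vf] := vertF [` nV]; apply/VuP; exists f; rewrite ?vtE //.
- rewrite -(card_fim (g := fim lab)); last by move=> e e' _ _; apply: (fim_inj linj).
  congr #|` _|; apply/fsetP=> n; apply/fimP/idP => [[e eE ->]|nE]; first by rewrite -EuE.
  have nV : n `<=` fim lab [set: V].
    apply/fsubsetP=> x xn; move: (nE); rewrite !inE /= fpowersetE => /andP[/fsubsetP/(_ x xn) xV _].
    by apply/fimP; exists [` xV]; rewrite ?inE.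
  by have [e _ nE'] := sub_fim nV; exists e; rewrite // EuE -nE'.
rewrite -(card_fim (g := fim lab)); last by move=> e e' _ _; apply: (fim_inj linj).
congr #|` _|; apply/fsetP=> n; apply/fimP/idP => [[f fF ->]|/faceG[f fF ->]]; first by rewrite -inF.
by exists f.
Qed.


(** If there were only two faces, they would share all their edges and so be the same vertex set. *)
Lemma complex_gt2 : 2 < #|F|.
Proof.
rewrite ltnNge; apply/negP=> le2; have S0 := complex_surf; have /set0Pn[f fF] := s_ne S0.
have /card_gt0P[e ef] : 0 < #|b f| by rewrite (s_b3 S0 fF).
have [g [gF nfg _ _]] := two_faces S0 fF ef.
have FE : F = [set f; g].
  by apply/esym/eqP; rewrite eqEcard subUset !sub1set fF gF cards2 eq_sym nfg le2.
have fg : f \subset g.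
  rewrite -(vtE fF) -(vtE gF); apply/bigcupsP=> e' ef'; have [h [hF nhf eh _]] := two_faces S0 fF ef'.
  apply: bigcup_sup; move: hF; rewrite FE in_set2 (negbTE nhf) => /eqP<- //.
case/eqP: nfg; apply/esym/eqP; by rewrite eqEcard fg !face_card.
Qed.
End ComplexOf.

(** * Quasi-Eulerian triangulations *)

Section Sphere.
Local Close Scope fset_scope.
Variables (V E : finType) (t : E -> {set V}) (Phi : finType) (b : Phi -> {set E}) (F : {set Phi}).
Implicit Types (X Y S W D R : {set Phi}) (M C : {set E}) (c : {set V}) (f g : Phi) (e : E).
Local Notation vt := (vt t b).
Local Notation bdry := (bdry b).
Local Notation Eu := (Eu b F).
Hypotheses (S0 : surf t b F) (eu : euler t b F 2) (sim : simple t b F) (F4 : 4 <= #|F|).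

Lemma simple_cut2 X e1 e2 : X \subset F -> bdry X = [set e1; e2] -> e1 != e2 -> False.
Proof.
move=> XF EX n12; have XE := subsetP (bdry_Eu S0 XF); rewrite EX in XE.
have tt : t e1 = t e2 by apply: even2 => // v; rewrite -EX; apply: (bdry_even S0).
by case/eqP: n12; apply: sim => //; apply: XE; rewrite !inE eqxx ?orbT.
Qed.

Lemma simple_share f g e e' : f \in F -> g \in F -> f != g -> e \in b f -> e \in b g -> e' \in b f -> e' \in b g -> e = e'.
Proof.
move=> fF gF nfg ef eg ef' eg'; apply/eqP; apply: contraT => ne.
have XF : [set f; g] \subset F by rewrite subUset !sub1set fF gF.
have XnF : [set f; g] != F by apply/eqP=> E1; move: F4; rewrite -E1 cards2 nfg.
have X0 : [set f; g] != set0 by apply/set0Pn; exists f; rewrite !inE eqxx.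
have := cut_ge2 S0 XF X0 XnF; have EB : bdry [set f; g] = symd (b f) (b g).
  by rewrite bdryU ?disjoints1 ?inE // !bdry1.
have := symd_card (b f) (b g); rewrite -EB !(s_b3 S0) // => c1 c2.
have I2 : 2 <= #|b f :&: b g|.
  apply: (@leq_trans #|[set e; e']|); first by rewrite cards2 ne.
  by apply: subset_leq_card; rewrite subUset !sub1set !inE ef eg ef' eg'.
have /cards2P[a [a' [na EX]]] : #|bdry [set f; g]| == 2 by move: c1 c2 I2; clear; lia.
by case: (simple_cut2 XF EX na).
Qed.

Lemma simple_cut_ge3 X : X \subset F -> X != set0 -> X != F -> 3 <= #|bdry X|.
Proof.
move=> XF X0 X1; have := cut_ge2 S0 XF X0 X1; rewrite leq_eqVlt => /orP[|//]; rewrite eq_sym => /cards2P[a [a' [na EX]]].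
by case: (simple_cut2 XF EX na).
Qed.

Definition nbhd f := [set g | adjr b F set0 f g].

Lemma nbP f g : reflect (exists e, [/\ f != g, f \in F, g \in F & e \in b f /\ e \in b g]) (g \in nbhd f).
Proof.
rewrite inE; apply: (iffP (adjrP _ _ _ _ _)) => [[e [h1 h2 h3 [h4 h5 _]]]|[e [h1 h2 h3 [h4 h5]]]]; exists e; split=> //.
by split; rewrite ?inE.
Qed.

Lemma nb_F f : nbhd f \subset F. Proof. by apply/subsetP=> g /nbP[e []]. Qed.

Lemma card_nbhd f : f \in F -> #|nbhd f| = 3.
Proof.
move=> fF; pose oth e := odflt f [pick g in F | (g != f) && (e \in b g)].
have othP e : e \in b f -> [/\ oth e \in F, oth e != f, e \in b (oth e) & forall h, h \in F -> e \in b h -> h = f \/ h = oth e].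
  move=> ef; have [g [gF ng eg U]] := two_faces S0 fF ef; rewrite /oth; case: pickP => [h /and3P[hF nh eh]|/(_ g)]; last by rewrite gF ng eg.
  split=> // k kF ek; case: (U k kF ek) => ->; [by left|right]; case: (U h hF eh) => hE //; by rewrite hE eqxx in nh.
rewrite -(s_b3 S0 fF) -(card_in_imset (f := oth) (D := b f)); last first.
  move=> e e' ef ef' oE; have [h1 h2 h3 _] := othP e ef; have [_ _ h4 _] := othP e' ef'; rewrite -oE in h4.
  by apply: (simple_share fF h1) => //; rewrite eq_sym.
apply: eq_card => g; apply/nbP/imsetP => [[e [nfg _ gF [ef eg]]]|[e ef ->]].
  by exists e => //; have [_ _ _ /(_ g gF eg)[gf|//]] := othP e ef; rewrite gf eqxx in nfg.
by have [h1 h2 h3 _] := othP e ef; exists e; split; rewrite // eq_sym.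
Qed.

(** The edges off [M] meet every face in 0 or 2 edges, hence form a cut on the sphere; the faces met
    in 0 edges are those in [D]. *)
Lemma exact_mono M D : M \subset Eu -> (forall g, g \in D -> b g \subset M) ->
  (forall g, g \in F -> g \notin D -> #|b g :&: M| = 1) -> exists c, forall g, g \in F -> mono t b c g = (g \in D).
Proof.
move=> ME hD hM.
have E0 g : g \in F -> #|b g :&: (Eu :\: M)| + #|b g :&: M| = 3.
  move=> gF; rewrite -(s_b3 S0 gF) -[RHS](cardsID M) addnC; congr addn; apply: eq_card => e.
  by rewrite !inE; case ef: (e \in b g); rewrite ?andbF //= (subsetP (b_Eu gF) _ ef) andbT.
have sz g : g \in F -> #|b g :&: (Eu :\: M)| = if g \in D then 0 else 2.
  move=> gF; have := E0 g gF; case: ifPn => gD; last by rewrite (hM g gF gD); lia.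
  by rewrite (setIidPl (hD g gD)) (s_b3 S0 gF); lia.
have [|c hc] := sphere_cob (x := Eu :\: M) S0 eu; first by move=> g gF; rewrite sz //; case: ifP.
exists c => g gF; have := face_cob S0 c gF; rewrite (_ : b g :&: cob t c = b g :&: (Eu :\: M)).
  by rewrite sz //; case: ifP; case: ifP.
by apply/setP=> e; rewrite !in_setI; case ef: (e \in b g) => //=; rewrite -hc // (subsetP (b_Eu gF)).
Qed.

Hypothesis irr : irreducible b F.

Lemma sum_one (I : finType) (A : {set I}) (n : I -> nat) : (forall i, i \in A -> n i <= 1) -> \sum_(i in A) n i = #|A| ->
  forall i, i \in A -> n i = 1.
Proof.
move=> h e i iA; have := h i iA; rewrite leq_eqVlt ltnS leqn0 => /orP[/eqP//|/eqP n0].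
have : \sum_(j in A :\ i) n j <= \sum_(j in A :\ i) 1 by apply: leq_sum => j /setD1P[_]; apply: h.
move: e; rewrite (big_setD1 i) //= n0 add0n => ->; rewrite sum1_card (cardsD1 i A) iA ltnn //.
Qed.

Lemma two_colour f0 : f0 \in F -> ~ (exists c, forall g, g \in F -> mono t b c g = (g == f0)) ->
  exists R, [/\ R \subset F, f0 \in R & forall e, e \in Eu -> #|[set g in R | e \in b g]| = 1].
Proof.
move=> f0F nm; pose N := nbhd f0; pose W := F :\: (f0 |: N).
have NF : N \subset F := nb_F f0.
have f0N : f0 \notin N by apply/negP=> /nbP[e []]; rewrite eqxx.
have N0F : f0 |: N \subset F by rewrite subUset sub1set f0F.
have WF : W \subset F by apply: subsetDl.
have cN : #|f0 |: N| = 4 by rewrite cardsU1 f0N card_nbhd.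
have cW : #|F| = 4 + #|W| by rewrite (cardsDF N0F) cN.
have np : ~~ perfect W (adjr b F set0).
  apply/negP=> /(pm_of S0 WF)[M [ME _ M1 MW]]; apply: nm.
  have [|g|g gF ng|c hc] := @exact_mono (M :|: b f0) [set f0].
  - by rewrite subUset ME b_Eu.
  - by move/set1P=> ->; apply: subsetUr.
  - rewrite in_set1 in ng; have [gN|gN] := boolP (g \in N).
      have /nbP[e [_ _ _ [ef eg]]] := gN.
      rewrite (_ : _ :&: _ = [set e]) ?cards1 //; apply/setP=> a; rewrite in_setI in_setU in_set1; apply/andP/eqP => [[ag]|->].
        case/orP=> [aM|af]; last by apply: (simple_share gF f0F).
        by have := MW g a gF ag aM; rewrite in_setD in_setU1 gN orbT.
      by rewrite eg ef orbT.
    have gW : g \in W by rewrite in_setD in_setU1 negb_or ng gN.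
    rewrite -(M1 g gW); apply: eq_card => a; rewrite !in_setI in_setU; case ag: (a \in b g) => //=.
    case af: (a \in b f0); rewrite ?orbF // orbT; case/negP: gN; apply/nbP; exists a; by rewrite eq_sym.
  by exists c => g /hc ->; rewrite inE.
have evW : ~~ odd #|W| by have := even_faces S0; rewrite cW oddD.
have [S [P [SW cl tP leP cP]]] := tutte_cover (adjr_sym b F set0) (adjr_irr b F set0) evW np.
have := blocks_cut S0 WF cl tP cP; rewrite cards0 muln0 addn0 => le1.
have WS : W :\: S = F :\: ((f0 |: N) :|: S) by rewrite setDDl.
have dNS : [disjoint f0 |: N & S].
  rewrite -setI_eq0; apply/eqP/setP=> g; rewrite in_setI in_set0; apply/negP=> /andP[gN /(subsetP SW)].
  by rewrite in_setD gN.
have SF : S \subset F := subset_trans SW WF.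
have NSF : (f0 |: N) :|: S \subset F by rewrite subUset N0F SF.
(* The three neighbours of [f0] have at most nine edges, three of which are those of [f0]. *)
have le6 : #|bdry (f0 |: N)| <= 6.
  have acr e : e \in b f0 -> exists2 g, g \in N & e \in b g.
    move=> ef; have [g [gF ng eg _]] := two_faces S0 f0F ef; exists g => //; apply/nbP; exists e; by rewrite eq_sym.
  pose U := \bigcup_(g in N) b g.
  have cU : #|U| <= 9.
    have : #|U| <= \sum_(g in N) #|b g|.
      rewrite /U; elim/big_rec2: _ => [|g n A gN le]; first by rewrite cards0.
      by apply: leq_trans (leq_add (leqnn _) le); rewrite cardsU leq_subr.
    by rewrite (eq_bigr (fun=> 3)) ?sum_nat_const ?card_nbhd // => g /(subsetP NF)/(s_b3 S0).
  have fU : b f0 \subset U by apply/subsetP=> e /acr[g gN eg]; apply/bigcupP; exists g.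
  apply: (@leq_trans #|U :\: b f0|); last by rewrite cardsD (setIidPr fU) (s_b3 S0 f0F); move: cU; clear; lia.
  apply: subset_leq_card; apply/subsetP=> e /(bdryP S0 _ N0F)[g [h [gN hF hN eg eh]]]; rewrite in_setD.
  have ef0 : e \notin b f0.
    apply: contra hN => ef; rewrite in_setU1; case: eqVneq => //= nh; apply/nbP; exists e; by rewrite eq_sym.
  rewrite ef0; move: gN; rewrite in_setU1 => /predU1P[gf|gN]; first by rewrite gf (negbTE ef0) in eg.
  by apply/bigcupP; exists g.
have le2 : #|bdry (W :\: S)| <= 6 + 3 * #|S|.
  rewrite WS (bdryC S0) //; apply: leq_trans (bdry_leD b dNS) _; apply: leq_add => //; exact: (bdry_le3 S0 SF).
have ge3 B : B \in P -> 3 <= #|bdry B|.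
  case/cl=> BW oB _; apply: (cut_ge3 S0) => //; first by apply: subset_trans BW (subset_trans (subsetDl _ _) WF).
  by apply: contraTneq oB => ->; apply: (even_faces S0).
have sum3 : \sum_(B in P) #|bdry B| = \sum_(B in P) (#|bdry B| - 3) + 3 * #|P|.
  by rewrite mulnC -sum_nat_const -big_split; apply: eq_bigr => B /ge3 h; rewrite /= subnK.
have [z0 cPS] : \sum_(B in P) (#|bdry B| - 3) = 0 /\ #|P| = #|S| + 2.
  by move: le1 le2 leP; rewrite sum3; clear; lia.
have single B : B \in P -> #|B| = 1.
  move=> BP; have [BW oB _] := cl B BP; have BW' : B \subset W := subset_trans BW (subsetDl _ _).
  have c3 : #|bdry B| = 3.
    have := ge3 B BP; move/eqP: z0; rewrite sum_nat_eq0 => /forall_inP/(_ B BP); clear; lia.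
  case: (irr (subset_trans BW' WF) c3) => le; first by move: oB le; case: #|B| => [|[|]].
  have := subset_leq_card BW'; have := cardsDF (subset_trans BW' WF); move: cW le; clear; lia.
have indep g h : g \in W :\: S -> h \in W :\: S -> g != h -> forall e, e \in b g -> e \in b h -> False.
  move=> gW hW ngh e eg eh; have : g \in cover P by rewrite cP.
  case/bigcupP=> B BP gB; have [_ _ /(_ g h gB hW)] := cl B BP; have /eqP/cards1P[x Bx] := single B BP.
  have toF k : k \in W :\: S -> k \in F by rewrite in_setD => /andP[_ /(subsetP WF)].
  have -> : adjr b F set0 g h by apply/adjrP; exists e; split; rewrite ?toF // inE.
  by move=> /(_ isT); move: gB; rewrite Bx !inE => /eqP gx /eqP hx; rewrite gx hx eqxx in ngh.
pose R := f0 |: (W :\: S).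
have RF : R \subset F by rewrite subUset sub1set f0F (subset_trans (subsetDl _ _) WF).
have f0W : f0 \notin W :\: S by rewrite !in_setD in_setU1 eqxx /= andbF.
have cR : 2 * #|R| = #|F|.
  have c1 : #|W :\: S| = #|P|.
    have -> : #|W :\: S| = \sum_(B in P) #|B| by rewrite -cP; apply/esym/eqP; exact: tP.
    by rewrite (eq_bigr (fun=> 1)) ?sum1_card.
  have c2 : #|W| = #|S| + #|W :\: S| by rewrite -(cardsID S W) (setIidPr SW).
  by rewrite cardsU1 f0W; move: c1 c2 cW cPS; clear; lia.
have le1R e : e \in Eu -> #|[set g in R | e \in b g]| <= 1.
  move=> eE; rewrite leqNgt; apply/negP=> /card_gt1P[g [h [+ + ngh]]]; rewrite [g \in _]in_set [h \in _]in_set => /andP[gR eg] /andP[hR eh].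
  have f0x k : k \in W :\: S -> e \in b k -> e \in b f0 -> False.
    move=> kW ek ef; have : k \in N.
      apply/nbP; exists e; split=> //; first by apply: contraNneq f0W => ->.
      by move: kW; rewrite in_setD => /andP[_ /(subsetP WF)].
    by move: kW; rewrite !in_setD in_setU1 => /and3P[_ /norP[_ /negbTE->]].
  move: gR hR; rewrite !in_setU1 => /predU1P[gf|gW] /predU1P[hf|hW].
  - by rewrite gf hf eqxx in ngh.
  - by apply: (f0x h) => //; rewrite -gf.
  - by apply: (f0x g) => //; rewrite -hf.
  exact: (indep g h gW hW ngh e).
exists R; split=> //; first exact: setU11.
(* [R] has half of the faces, so its faces have as many edges, counted with repetition, as there are
   edges; as none is repeated, none is missed. *)
apply: sum_one le1R _; transitivity (\sum_(e in Eu) \sum_(g in R) (e \in b g : nat)).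
  apply: eq_bigr => e _; rewrite -sum1_card big_mkcond [RHS]big_mkcond; apply: eq_bigr => g _; rewrite in_set.
  by case: (g \in R) => //=; case: (_ \in _).
rewrite exchange_big /= (eq_bigr (fun=> 3)); first by rewrite sum_nat_const; have := card_EF S0; move: cR; clear; lia.
move=> g /(subsetP RF) gF; rewrite -(s_b3 S0 gF) -sum1_card big_mkcond [RHS]big_mkcond; apply: eq_bigr => e _.
by case eg: (e \in b g); [rewrite (subsetP (b_Eu gF) _ eg)|case: ifP].
Qed.

Section TwoMono.
Variables (R : {set Phi}) (f0 b0 : Phi).
Hypotheses (RF : R \subset F) (f0R : f0 \in R) (hR : forall e, e \in Eu -> #|[set g in R | e \in b g]| = 1).
Hypotheses (b0F : b0 \in F) (b0R : b0 \notin R).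

Let Bl := F :\: R.
Let BF : Bl \subset F. Proof. exact: subsetDl. Qed.

Let hB e : e \in Eu -> #|[set g in Bl | e \in b g]| = 1.
Proof.
move=> eE; have /EuP[f fF ef] := eE; have := s_e2 S0 fF ef; rewrite -(cardsID R) => h.
have e1 : #|[set g in F | e \in b g] :&: R| = 1.
  rewrite -(hR eE); apply: eq_card => g; rewrite in_setI !in_set; case gR: (g \in R); rewrite ?andbF //= (subsetP RF _ gR) andbT //.
move: h; rewrite e1 => -[h]; rewrite -h; apply: eq_card => g; rewrite in_setD !in_set; by case: (g \in R).
Qed.

Let mono_side (D : {set Phi}) : D \subset F -> (forall e, e \in Eu -> #|[set g in D | e \in b g]| = 1) ->
  (forall g h e, g \in D -> h \in D -> e \in b g -> e \in b h -> g = h) /\ (forall e, e \in Eu -> exists2 g, g \in D & e \in b g).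
Proof.
move=> DF h; split=> [g g' e gD g'D eg eg'|e eE].
  have /eqP/cards1P[x Ex] : #|[set g in D | e \in b g]| = 1 by apply: h; apply/EuP; exists g => //; apply: (subsetP DF).
  have : g \in [set x] by rewrite -Ex inE gD.
  have : g' \in [set x] by rewrite -Ex inE g'D.
  by move=> /set1P-> /set1P->.
have /eqP/cards1P[x Ex] := h e eE; have : x \in [set x] by rewrite set11.
by rewrite -Ex inE => /andP[]; exists x.
Qed.

Let Runiq := (mono_side RF hR).1.
Let Rex := (mono_side RF hR).2.
Let Buniq := (mono_side BF hB).1.
Let Bex := (mono_side BF hB).2.

Let bdry_side (D X : {set Phi}) : D \subset F -> (forall g h e, g \in D -> h \in D -> e \in b g -> e \in b h -> g = h) ->
  X \subset D -> (forall e, e \in bdry X <-> exists2 g, g \in X & e \in b g) /\ #|bdry X| = 3 * #|X|.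
Proof.
move=> DF un; have [n] := ubnP #|X|; elim: n X => // n IH X lt XD; have [->|[g gX]] := set_0Vmem X.
  by split=> [e|]; rewrite bdry0 ?cards0 // in_set0; split=> // -[g]; rewrite inE.
have [|h1 h2] := IH (X :\ g) _ (subset_trans (subsetDl _ _) XD); first by move: lt; rewrite (cardsD1 g) gX.
have d : [disjoint [set g] & X :\ g] by rewrite disjoints1 !inE eqxx.
have db : [disjoint b g & bdry (X :\ g)].
  rewrite -setI_eq0; apply/eqP/setP=> e; rewrite in_setI in_set0; apply/negP=> /andP[eg /h1[h]].
  rewrite !inE => /andP[nh hX] eh; case/eqP: nh; exact: (un h g e (subsetP XD _ hX) (subsetP XD _ gX)).
have EX : bdry X = b g :|: bdry (X :\ g) by rewrite -{1}(setD1K gX) bdryU // bdry1 symd_disj.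
split=> [e|].
  rewrite EX in_setU; split=> [/orP[eg|/h1[h hX eh]]|[h hX eh]]; first by exists g.
    by exists h => //; move: hX; rewrite inE => /andP[].
  apply/orP; by have [<-|nh] := eqVneq h g; [left|right; apply/h1; exists h => //; rewrite !inE nh].
rewrite EX cardsU (_ : _ :&: _ = set0) ?cards0 ?subn0; last by apply/eqP; rewrite setI_eq0.
by rewrite (s_b3 S0 (subsetP DF _ (subsetP XD _ gX))) h2 (cardsD1 g X) gX; lia.
Qed.

Let nb_other f g : g \in nbhd f -> (f \in R) != (g \in R).
Proof.
case/nbP=> e [nfg fF gF [ef eg]]; case fR: (f \in R); case gR: (g \in R) => //.
  by rewrite (Runiq fR gR ef eg) eqxx in nfg.
by rewrite (Buniq _ _ ef eg) ?eqxx // in_setD ?fR ?gR in nfg *.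
Qed.

Let card_eq : #|R| = #|Bl|.
Proof.
have full (D : {set Phi}) : D \subset F -> (forall g h e, g \in D -> h \in D -> e \in b g -> e \in b h -> g = h) ->
    (forall e, e \in Eu -> exists2 g, g \in D & e \in b g) -> 3 * #|D| = #|Eu|.
  move=> DF un ex; have [h1 <-] := bdry_side DF un (subxx D); apply: eq_card => e; apply/idP/idP.
    exact: (subsetP (bdry_Eu S0 DF)).
  by move/ex=> h; apply/h1.
by have := full R RF Runiq Rex; have := full Bl BF Buniq Bex; lia.
Qed.

Let a := (b0 \in nbhd f0).
Let f0F : f0 \in F. Proof. exact: (subsetP RF). Qed.
Let b0B : b0 \in Bl. Proof. by rewrite in_setD b0R. Qed.
Let ab : (f0 \in nbhd b0) = a. Proof. by rewrite /a !inE adjr_sym. Qed.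

Let Ar := R :\: (f0 |: nbhd b0).
Let Ab := Bl :\: (b0 |: nbhd f0).

Let nbf0B : nbhd f0 \subset Bl.
Proof.
by apply/subsetP=> g gN; rewrite in_setD (subsetP (nb_F f0)) // andbT; have := nb_other gN; rewrite f0R; case: (g \in R).
Qed.
Let nbb0R : nbhd b0 \subset R.
Proof. by apply/subsetP=> g gN; have := nb_other gN; rewrite (negbTE b0R); case: (g \in R). Qed.

Let card_side (D N : {set Phi}) x : x \in D -> N \subset D -> #|N| = 3 -> #|D :\: (x |: N)| = #|D| - (4 - (x \in N)).
Proof.
move=> xD ND c3; have sub : x |: N \subset D by rewrite subUset sub1set xD.
by rewrite cardsD (setIidPr sub) cardsU1 c3; case: (x \in N).
Qed.

Let card_A : #|Ar| = #|Ab|.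
Proof.
rewrite (card_side f0R nbb0R (card_nbhd b0F)) (card_side b0B nbf0B (card_nbhd f0F)) card_eq ab /a //.
Qed.

Let disA : [disjoint Ar & Ab].
Proof.
rewrite -setI_eq0; apply/eqP/setP=> g; rewrite in_setI in_set0; apply/negP=> /andP[].
by rewrite in_setD => /andP[_ gR]; rewrite !in_setD gR andbF.
Qed.

(** A deficient [X] with [f0], and their blue neighbours other than [b0], would have at most 3
    boundary edges, fewer if [f0] and [b0] are adjacent. Irreducibility then leaves [b0] alone
    outside, but its three neighbours would all have to be [f0]. *)
Let hall_cond (X : {set Phi}) : X \subset Ar -> #|X| <= #|nbrs (adjr b F set0) X Ab|.
Proof.
move=> XA; set Y := nbrs _ X Ab; rewrite leqNgt; apply/negP=> ltY.
have XR : X \subset R by apply: subset_trans XA (subsetDl _ _).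
have Xn g : g \in X -> g != f0 /\ g \notin nbhd b0.
  by move/(subsetP XA); rewrite in_setD in_setU1 negb_or => /andP[/andP[]].
pose R1 := f0 |: X; pose B1 := Y :|: (nbhd f0 :\ b0).
have R1R : R1 \subset R by rewrite subUset sub1set f0R.
have YA : Y \subset Ab by apply/subsetP=> g; rewrite inE => /andP[].
have YB : Y \subset Bl by apply: subset_trans YA (subsetDl _ _).
have B1B : B1 \subset Bl by rewrite subUset YB (subset_trans (subsetDl _ _) nbf0B).
have [m1 s1] := bdry_side RF Runiq R1R; have [m2 s2] := bdry_side BF Buniq B1B.
have cR1 : #|R1| = #|X|.+1 by rewrite cardsU1 (_ : f0 \notin X) //; apply/negP=> /Xn[]; rewrite eqxx.
have cB1 : #|B1| + a = #|Y| + 3.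
  rewrite cardsU (_ : Y :&: _ = set0) ?cards0 ?subn0; last first.
    apply/setP=> g; rewrite in_setI in_set0 in_setD1; apply/negP=> /and3P[/(subsetP YA) gA _ gN].
    by move: gA; rewrite in_setD in_setU1 gN orbT.
  by have := cardsD1 b0 (nbhd f0); rewrite (card_nbhd f0F) -/a; clear; lia.
have dis : [disjoint R1 & B1].
  rewrite -setI_eq0; apply/eqP/setP=> g; rewrite in_setI in_set0; apply/negP=> /andP[/(subsetP R1R) gR /(subsetP B1B)].
  by rewrite in_setD gR.
have diff : bdry R1 :\: bdry B1 \subset b f0 :&: b b0.
  apply/subsetP=> e; rewrite in_setD => /andP[nB /m1[g gR1 eg]].
  have gF := subsetP RF _ (subsetP R1R _ gR1).
  have [h hBl eh] := Bex (subsetP (b_Eu gF) _ eg); have hF := subsetP BF _ hBl.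
  have ngh : g != h by apply: contraTneq hBl => <-; rewrite in_setD (subsetP R1R).
  have hB1 : h \notin B1 by apply: contra nB => hB1; apply/m2; exists h.
  have gh : g \in nbhd h by apply/nbP; exists e; rewrite eq_sym.
  have hg : h \in nbhd g by apply/nbP; exists e.
  move: gR1; rewrite in_setU1 => /predU1P[gf|gX].
    subst g; have : h == b0 by apply: contraR hB1 => nh; rewrite in_setU in_setD1 nh hg orbT.
    by move/eqP=> <-; rewrite in_setI eg.
  have [_ gn] := Xn g gX; have nhb : h != b0 by apply: contraNneq gn => <-.
  case/negP: hB1; rewrite in_setU; have [hN|hN] := boolP (h \in nbhd f0); first by rewrite in_setD1 nhb hN orbT.
  apply/orP; left; rewrite inE in_setD in_setU1 negb_or nhb hN hBl /=; apply/exists_inP; exists g => //.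
  by move: hg; rewrite inE.
have cI : #|b f0 :&: b b0| <= a.
  have [[e e0]|e0] : (exists e, e \in b f0 :&: b b0) \/ b f0 :&: b b0 = set0.
    by have [->|[e ?]] := set_0Vmem (b f0 :&: b b0); [right|left; exists e].
  - have nfb : f0 != b0 by apply: contraNneq b0R => <-.
    move: e0; rewrite in_setI => /andP[ef eb]; have -> : a by apply/nbP; exists e.
    apply: (@leq_trans #|[set e]|); last (by rewrite cards1); apply: subset_leq_card; apply/subsetP=> x; rewrite in_setI inE => /andP[xf xb].
    by apply/eqP; apply: (simple_share f0F b0F).
  by rewrite e0 cards0.
pose K := R1 :|: B1.
have KF : K \subset F by rewrite subUset (subset_trans R1R RF) (subset_trans B1B BF).
have b0K : b0 \notin K.
  rewrite in_setU negb_or; apply/andP; split; first by apply: contra b0R; apply: (subsetP R1R).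
  rewrite in_setU in_setD1 eqxx orbF; apply/negP=> /(subsetP YA); by rewrite in_setD in_setU1 eqxx.
have f0K : f0 \in K by rewrite !in_setU in_set1 eqxx.
have K0 : K != set0 by apply/set0Pn; exists f0.
have KnF : K != F by apply: contraNneq b0K => ->.
have := simple_cut_ge3 KF K0 KnF; have cK : #|bdry K| + 2 * #|bdry R1 :&: bdry B1| = 3 * #|R1| + 3 * #|B1|.
  by rewrite bdryU // symd_card s1 s2.
have cD : #|bdry R1 :&: bdry B1| + a >= 3 * #|R1|.
  rewrite -s1 -[leqLHS](cardsID (bdry B1)) leq_add2l; apply: leq_trans cI; exact: subset_leq_card.
move=> ge3; have [a0 c3] : (a : nat) = 0 /\ #|bdry K| = 3.
  by move: ge3 cK cD ltY cR1 cB1; case: (a); clear; lia.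
case: (irr KF c3) => le.
  have : 2 <= #|K| by apply: leq_trans (subset_leq_card (subsetUr _ _)); move: cB1; rewrite a0; clear; lia.
  by move: le; clear; lia.
have FK : F :\: K \subset [set b0].
  have [x Ex] : exists x, F :\: K = [set x].
    by apply/cards1P; rewrite eqn_leq le card_gt0; apply/set0Pn; exists b0; rewrite in_setD b0K.
  have : b0 \in F :\: K by rewrite in_setD b0K.
  by rewrite Ex => /set1P->.
have : nbhd b0 \subset [set f0].
  apply/subsetP=> g gN; have gR := subsetP nbb0R _ gN; have gF := subsetP RF _ gR.
  have gK : g \in K.
    apply: contraT => gK; have : g \in [set b0] by apply: (subsetP FK); rewrite in_setD gK.
    by move/set1P=> gb; rewrite gb (negbTE b0R) in gR.
  move: gK; rewrite in_setU => /orP[|/(subsetP B1B)]; last by rewrite in_setD gR.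
  rewrite in_setU1 => /predU1P[->|/Xn[_]]; [exact: set11|by rewrite gN].
by move/subset_leq_card; rewrite (card_nbhd b0F) cards1.
Qed.

(** The neighbours of [f0] and [b0] get their edge from [b f0] and [b b0]; the remaining red and
    blue faces are matched by Hall's theorem. *)
Lemma two_mono : exists c, forall g, g \in F -> mono t b c g = (g \in [set f0; b0]).
Proof.
have [m [m1 m2]] := hall (adjr_sym b F set0) (adjr_irr b F set0) disA card_A hall_cond.
have WF : Ar :|: Ab \subset F.
  by rewrite subUset (subset_trans (subsetDl _ _) RF) (subset_trans (subsetDl _ _) BF).
have pf : perfect (Ar :|: Ab) (adjr b F set0).
  apply/perfectP; exists m => x; rewrite in_setU => /orP[/m1|/m2] [h1 h2 h3]; by rewrite in_setU h1 ?orbT.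
have [M [ME _ M1 MW]] := pm_of S0 WF pf.
apply: (exact_mono (M := M :|: b f0 :|: b b0)).
- by rewrite !subUset ME !b_Eu.
- by move=> g; rewrite in_set2 => /orP[]/eqP->; rewrite ?subsetUr // -setUA setUCA subsetUl.
move=> g gF; rewrite in_set2 negb_or => /andP[ngf ngb].
have memE e : (e \in b g :&: (M :|: b f0 :|: b b0)) = (e \in b g) && [|| e \in M, e \in b f0 | e \in b b0].
  by rewrite in_setI !in_setU -orbA.
have nbE f e : f \in F -> g != f -> e \in b g -> e \in b f -> g \in nbhd f.
  by move=> fF nf eg ef; apply/nbP; exists e; rewrite eq_sym.
have one f (x : {set E}) : f \in F -> g \in nbhd f -> (forall e, e \in b g -> (e \in x) = (e \in b f)) -> #|b g :&: x| = 1.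
  move=> fF /nbP[e [nfg _ _ [ef eg]]] h; rewrite (_ : _ :&: _ = [set e]) ?cards1 //.
  apply/setP=> e'; rewrite in_setI in_set1; apply/andP/eqP => [[eg' ex]|->]; last by rewrite h.
  by rewrite h // in ex; apply: (simple_share gF fF) => //; rewrite eq_sym.
have [gW|gW] := boolP (g \in Ar :|: Ab).
  rewrite -(M1 g gW); apply: eq_card => e; rewrite memE in_setI; case eg: (e \in b g) => //=.
  have nn : ~~ (g \in nbhd f0) /\ ~~ (g \in nbhd b0).
    move: gW; rewrite in_setU !in_setD !in_setU1 !negb_or => /orP[/andP[/andP[_ h1] gR]|/andP[/andP[_ h1] /andP[gR _]]]; split=> //.
      by apply/negP=> /(subsetP nbf0B); rewrite in_setD gR.
    by apply/negP=> /(subsetP nbb0R); rewrite (negbTE gR).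
  case: nn => n1 n2; have -> : e \in b f0 = false by apply: contraNF n1 => ef; apply: nbE ef.
  have -> : e \in b b0 = false by apply: contraNF n2 => ef; apply: nbE ef.
  by rewrite !orbF.
have nM e : e \in b g -> e \in M = false by move=> eg; apply: contraNF gW; apply: MW.
case gR: (g \in R).
  have gN : g \in nbhd b0.
    by apply: contraNT gW => gN; rewrite in_setU in_setD in_setU1 negb_or ngf gN gR.
  apply: (one b0) => // e eg; rewrite !in_setU nM //=; case ef: (e \in b f0) => //=.
  by rewrite (Runiq gR f0R eg ef) eqxx in ngf.
have gB : g \in Bl by rewrite in_setD gR.
have gN : g \in nbhd f0.
  by apply: contraNT gW => gN; rewrite in_setU [g \in Ab]in_setD in_setU1 negb_or ngb gN gB orbT.
apply: (one f0) => // e eg; rewrite !in_setU nM //=; case eb: (e \in b b0); rewrite ?orbF // orbT.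
by rewrite (Buniq gB b0B eg eb) eqxx in ngb.
Qed.

End TwoMono.
End Sphere.

(** * Pasting the blocks back into the quotient *)

Section Paste.
Variables (V : finType) (lab : V -> nat).
Hypothesis linj : injective lab.
Variables (E : finType) (t : E -> {set V}) (Phi : finType) (b : Phi -> {set E}) (F : {set Phi}).
Variable P : {set {set Phi}}.
Local Notation bdry := (bdry b).
Local Notation vt := (vt t b).
Local Notation vtq := (Complex.vt t bdry).
Local Notation star := (star t b F).
Hypotheses (S0 : surf t b F) (sim : simple t b F) (pP : partition P F).
Hypotheses (c3 : forall B, B \in P -> #|bdry B| = 3) (P3 : 2 < #|P|).

Let SQ := quot_surf S0 pP c3.
Let BF B : B \in P -> B \subset F. Proof. exact: part_sub pP. Qed.

Lemma quot_simple : simple t bdry P.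
Proof. by move=> e e' eE e'E; apply: sim; apply: (subsetP (quot_Eu_sub S0 pP)). Qed.

Lemma pc_simple (X : {set Phi}) : X \subset F -> #|bdry X| = 3 -> simple t bdry (pc F X).
Proof.
move=> XF cX e e' eE e'E; have [_ XnF] := cut3_proper S0 XF cX.
by apply: sim; apply: (subsetP (quot_Eu_sub S0 (pc_partition XF XnF))).
Qed.

(** The piece of a block keeps the labels of its vertices, and its outside becomes the face along
    which it is pasted; so all embeddings in [paste_into] can be the identity. *)
Definition block_pieces : pieces := fun g =>
  if [pick B in P | (1 < #|B|) && (fim lab (vtq B) == g)] is Some B then Some (tri_of lab t bdry (pc F B), g) else None.

Lemma block_piecesP g T g' : block_pieces g = Some (T, g') ->
  g' = g /\ exists B, [/\ B \in P, 1 < #|B|, g = fim lab (vtq B) & T = tri_of lab t bdry (pc F B)].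
Proof.
by rewrite /block_pieces; case: pickP => // B /and3P[BP B1 /eqP gE] [<- <-]; split=> //; exists B.
Qed.

Lemma block_pieces_some B : B \in P -> 1 < #|B| -> block_pieces (fim lab (vtq B)) = Some (tri_of lab t bdry (pc F B), fim lab (vtq B)).
Proof.
move=> BP B1; rewrite /block_pieces; case: pickP => [B' /and3P[BP' _ /eqP/(fim_inj linj) h]|/(_ B)]; last by rewrite BP B1 eqxx.
by rewrite (vt_inj SQ quot_simple P3 BP' BP h).
Qed.

Lemma block_pieces_none B : B \in P -> #|B| <= 1 -> block_pieces (fim lab (vtq B)) = None.
Proof.
move=> BP B1; rewrite /block_pieces; case: pickP => // B' /and3P[BP' B1' /eqP/(fim_inj linj) h].
by rewrite (vt_inj SQ quot_simple P3 BP' BP h) ltnNge B1 in B1'.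
Qed.

Let piece_vertex B v : B \in P -> v \in Vu t bdry (pc F B) -> v \in vtq B \/ exists2 f, f \in B & v \in vt f.
Proof.
move=> BP /VuP[C /pcP[->|[f fB ->]]]; first by rewrite (vt_bdryC S0 (BF BP)); left.
by rewrite vt_bdry1; right; exists f.
Qed.

Let interior_or B f v : B \in P -> f \in B -> v \in vt f -> (exists2 g, g \in star v & g \notin B) -> v \in vtq B.
Proof.
move=> BP fB vf [g gs gB]; apply: (quot_star_bdry S0 pP BP fB); first by rewrite inE (subsetP (BF BP)).
by apply: contra gB => /subsetP; apply.
Qed.

Let other_block B B' f : B \in P -> B' \in P -> f \in B -> f \in B' -> B = B'.
Proof.
by have /and3P[_ tP _] := pP; move=> BP BP' fB fB'; rewrite -(def_pblock tP BP fB) -(def_pblock tP BP' fB').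
Qed.

(** A vertex common to a block and to another block or the quotient has a face of its star outside
    the block, and therefore lies on the boundary of the block. *)
Lemma paste_quot : paste_into (tri_of lab t bdry P) block_pieces (tri_of lab t b F) id.
Proof.
have idE (A : {fset nat}) : id @` A = A.
  by apply/fsetP=> x; apply/imfsetP/idP => [[y yA ->//]|xA]; exists x.
split=> //; exists (fun _ => id); split.
- by move=> g _ T g' /block_piecesP[-> _]; split.
- move=> g _ T g' /block_piecesP[-> [B [BP B1 gE ->]]] x v; rewrite tri_verts => /fimP[w wV ->].
  rewrite tri_verts => /fimP[w' w'V ->] /linj ww; subst w'; rewrite gE in_fim //.
  case: (piece_vertex BP wV) => // -[f fB wf]; apply: (interior_or BP fB wf).
  have wVu : w \in Vu t b F := subsetP (quot_Vu_sub S0 pP) _ w'V.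
  have := quot_Vu S0 pP wVu; rewrite w'V => /esym/negbT/exists_inPn/(_ B BP)/subsetPn[k ks kB]; by exists k.
- move=> g1 g2 _ _ ng T1 g1' T2 g2' /block_piecesP[-> [B1 [BP1 _ gE1 ->]]] /block_piecesP[_ [B2 [BP2 _ gE2 ->]]] x y.
  rewrite tri_verts => /fimP[w wV ->]; rewrite tri_verts => /fimP[w' w'V ->] /linj ww; subst w'.
  rewrite gE1 in_fim //; case: (piece_vertex BP1 wV) => // -[f fB wf]; apply: (interior_or BP1 fB wf).
  have nB : B1 <> B2 by move=> BB; rewrite gE1 gE2 BB eqxx in ng.
  have [g gs gB2] : exists2 g, g \in star w & g \in B2.
    case: (piece_vertex BP2 w'V) => [wB|[g gB wg]]; last by exists g; rewrite // inE (subsetP (BF BP2)).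
    by have [g [_ [gs gB _ _]]] := quot_star S0 pP BP2 wB; exists g.
  by exists g => //; apply/negP=> gB1; apply: nB; apply: other_block gB1 gB2.
move=> h; split=> [/fimP[f fF ->]|].
  have : f \in cover P by case/and3P: pP => /eqP->.
  case/bigcupP=> B BP fB; have [B1|B1] := leqP #|B| 1.
    have BE : B = [set f] by apply/esym/eqP; rewrite eqEcard sub1set fB cards1.
    left; exists (fim lab (vtq B)); first exact: in_fim.
    by split; [exact: block_pieces_none|rewrite idE BE vt_bdry1].
  right; exists (fim lab (vtq B)), (tri_of lab t bdry (pc F B)), (fim lab (vtq B)), (fim lab (vt f)); split.
  - exact: in_fim.
  - exact: block_pieces_some.
  - by apply/fimP; exists [set f]; rewrite ?pc_in // vt_bdry1.
  - apply/eqP=> /(fim_inj linj); rewrite -(vt_bdry1 t b) -(vt_bdryC S0 (BF BP)) => vE.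
    have cB := c3 BP; have /setP/(_ f) : [set f] = F :\: B.
      apply: (vt_inj (pc_surf S0 (BF BP) cB) (pc_simple (BF BP) cB) _ _ _ vE); rewrite ?pc_in ?pc_out //.
      by rewrite (pc_card S0 (BF BP) cB) addn1.
    by rewrite !inE eqxx fB.
  by rewrite idE.
case=> [[g /fimP[B BP ->]] [pN ->]|[g [T [g' [h0 [gQ pS h0T nh ->]]]]]].
  have B1 : #|B| <= 1 by rewrite leqNgt; apply/negP=> B1; rewrite block_pieces_some in pN.
  have /set0Pn[f fB] : B != set0 by case/and3P: pP => _ _ n0; apply: contraNneq n0 => <-.
  have BE : B = [set f] by apply/esym/eqP; rewrite eqEcard sub1set fB cards1.
  by rewrite idE BE vt_bdry1; apply/fimP; exists f; rewrite // (subsetP (BF BP)).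
have [gE [B [BP B1 gE2 TE]]] := block_piecesP pS; rewrite idE; subst g' T.
have /fimP[C /pcP[CE|[f fB CE]] h0E] := h0T; subst C.
  by move: nh; rewrite h0E gE2 (vt_bdryC S0 (BF BP)) eqxx.
by rewrite h0E vt_bdry1; apply/fimP; exists f; rewrite // (subsetP (BF BP)).
Qed.

End Paste.

Section Eulerian.
Variables (V : finType) (lab : V -> nat).
Hypothesis linj : injective lab.
Variables (E : finType) (t : E -> {set V}) (Phi : finType) (b : Phi -> {set E}) (F : {set Phi}).
Local Notation bdry := (bdry b).
Local Notation vt := (vt t b).
Local Notation Eu := (Eu b F).
Local Notation T := (tri_of lab t b F).
Hypotheses (S0 : surf t b F) (sim : simple t b F) (F3 : 2 < #|F|).

Let mem_face f : f \in F -> forall X : {set Phi}, X \subset F -> (fim lab (vt f) \in fim (fun g => fim lab (vt g)) X) = (f \in X).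
Proof.
move=> fF X XF; apply/fimP/idP => [[g gX h]|fX]; last by exists f.
by rewrite (tri_inj linj S0 sim F3 fF (subsetP XF _ gX) h).
Qed.

(** The separating set of faces would have exactly the three edges as boundary. By irreducibility
    one side is a single face, which has no vertex off the 3-cycle. *)
Lemma irreducible_separating3 x y z : irreducible b F -> ~ separating3 T x y z.
Proof.
move=> irr [[xyE nxy] [yzE nyz] [zxE nzx] [f' [g' [fT gT [u uf un] [w wg wn] [S [fS gS hS]]]]]].
have /fimP[f fF fE] := fT; have /fimP[g gF gE] := gT; subst f' g'.
move: xyE yzE zxE; rewrite tri_edges // => /fimP[e3 E3 h3] /fimP[e1 E1 h1] /fimP[e2 E2 h2].
have ends (e : E) m n : [fset m; n] = fim lab (t e) -> m != n -> exists x y : V, [/\ m = lab x, n = lab y & t e = [set x; y]].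
  move=> h nmn; have mE : m \in fim lab (t e) by rewrite -h !inE eqxx.
  have nE : n \in fim lab (t e) by rewrite -h !inE eqxx orbT.
  have /fimP[x' xe xE] := mE; have /fimP[y' ye yE] := nE; exists x', y'; split=> //.
  by apply: (fim_inj linj); rewrite -h fim2 xE yE.
have [x1 [y1 [xE yE t3]]] := ends _ _ _ h3 nxy; have [y2 [z1 [yE' zE t1]]] := ends _ _ _ h1 nyz.
have [z2 [x2 [zE' xE' t2]]] := ends _ _ _ h2 nzx.
have yy : y2 = y1 by apply: linj; rewrite -yE -yE'.
have zz : z2 = z1 by apply: linj; rewrite -zE -zE'.
have xx : x2 = x1 by apply: linj; rewrite -xE -xE'.
subst y2 z2 x2; rewrite xE yE zE !(inj_eq linj) in nxy nyz nzx.
have TR := mk_triangle t1 (etrans t2 (setUC _ _)) t3 nxy (_ : x1 != z1) nyz; rewrite eq_sym in TR; have {}TR := TR nzx.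
pose X := [set h in F | fim lab (vt h) \in S].
have XF : X \subset F by apply/subsetP=> h; rewrite inE => /andP[].
have fX : f \in X by rewrite inE fF.
have gX : g \notin X by rewrite inE gF.
have sub : bdry X \subset [set e1; e2; e3].
  apply/subsetP=> e /(bdryP S0 _ XF)[h [k [hX kF kX eh ek]]]; have eE : e \in Eu by apply/EuP; exists k.
  apply: contraT => ne; case/negP: kX; rewrite inE kF; move: hX; rewrite inE => /andP[hF hS'].
  apply: (hS _ _ hS' _ (fim lab (t e))); rewrite ?(fim_sub linj) ?t_vt //.
  - exact: in_fim.
  - by rewrite tri_edges //; exact: in_fim.
  have ne' a : a \in [set e1; e2; e3] -> fim lab (t e) != fim lab (t a).
    move=> aC; apply/eqP=> /(fim_inj linj) tt; case/negP: ne; rewrite (_ : e = a) //; apply: sim => //.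
    by move: aC; rewrite !inE => /orP[/orP[]|]/eqP->.
  rewrite h1 h2 h3 !inE !negb_or !ne' ?inE ?eqxx ?orbT //.
have X0 : X != set0 by apply/set0Pn; exists f.
have X1 : X != F by apply: contraNneq gX => ->.
have C3 := triangle_card TR.
have ge3 := simple_cut_ge3 S0 sim XF X0 X1.
have EX : bdry X = [set e1; e2; e3] by apply/eqP; rewrite eqEcard sub C3.
have fin h n : h \in F -> b h = [set e1; e2; e3] -> n \in fim lab (vt h) -> n \notin [fset x; y; z] -> False.
  move=> hF Eh; rewrite -Eh in TR; rewrite (triangle_vt TR) fim3 -xE -yE -zE => ->; by [].
case: (irr X XF); rewrite ?EX //.
  move=> le; have XE : [set f] = X by apply/eqP; rewrite eqEcard sub1set fX cards1.
  by apply: (fin f u fF) => //; rewrite -EX -XE bdry1.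
move=> le; have XE : [set g] = F :\: X by apply/eqP; rewrite eqEcard sub1set in_setD gX gF cards1.
by apply: (fin g w gF) => //; rewrite -EX -(bdryC S0 XF) -XE bdry1.
Qed.

Variable R : {set Phi}.
Hypotheses (RF : R \subset F) (hR : forall e, e \in Eu -> #|[set g in R | e \in b g]| = 1).

(** The set of all edges is the boundary of the red faces, and boundaries have even degrees. *)
Lemma two_colour_eulerian : eulerian T.
Proof.
have ER : bdry R = Eu.
  apply/setP=> e; apply/idP/idP => [|eE]; first exact: (subsetP (bdry_Eu S0 RF)).
  by rewrite inE hR.
move=> n; rewrite tri_verts => /fimP[v vV ->]; have := bdry_even S0 v RF; rewrite ER; congr (~~ odd _).
rewrite /degree tri_edges // -(card_fim (g := fun e => fim lab (t e)) (A := [set e in Eu | v \in t e])); last first.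
  by move=> e e'; rewrite !inE => /andP[eE _] /andP[e'E _] /(fim_inj linj); apply: sim.
congr #|` _|; apply/fsetP=> m; rewrite !inE /=; apply/fimP/andP => [[e]|[/fimP[e eE ->]]].
  by rewrite inE => /andP[eE ve] ->; split; exact: in_fim.
by rewrite (mem_fim linj) => ve; exists e; rewrite // inE eE.
Qed.

Lemma two_colour_proper f0 : f0 \in R -> proper_face_colouring T (fim (fun g => fim lab (vt g)) R) (fim lab (vt f0)).
Proof.
move=> f0R; split.
- by apply/fsubsetP=> m /fimP[g gR ->]; apply: in_fim; apply: (subsetP RF).
- exact: in_fim.
move=> m1 m2 /fimP[f fF ->] /fimP[g gF ->] nfg c2; rewrite !mem_face //.
have nfg' : f != g by apply: contraNneq nfg => ->.
have II : fim lab (vt f) `&` fim lab (vt g) = fim lab (vt f :&: vt g).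
  apply/fsetP=> m; rewrite in_fsetI; apply/andP/fimP => [[/fimP[x xf ->]]|[x]].
    by rewrite (mem_fim linj) => xg; exists x; rewrite // inE xf.
  by rewrite inE => /andP[xf xg] ->; rewrite !in_fim.
rewrite II (card_fim_all linj) in c2; have /eqP/cards2P[x [y [nxy Exy]]] := c2.
have : x \in vt f :&: vt g /\ y \in vt f :&: vt g by rewrite Exy !inE !eqxx orbT.
rewrite !inE => -[/andP[xf xg] /andP[yf yg]].
have [a af ta] := face_edge S0 fF xf yf nxy; have [a' ag ta'] := face_edge S0 gF xg yg nxy.
have aE : a \in Eu by apply: (subsetP (b_Eu fF)).
have aa : a = a' by apply: sim; rewrite ?ta //; apply: (subsetP (b_Eu gF)).
rewrite -aa in ag; have /eqP/cards1P[r Er] := hR aE.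
have rP h : (h \in R) && (a \in b h) = (h == r) by have /setP/(_ h) := Er; rewrite !inE.
have := rP f; have := rP g; rewrite af ag !andbT => -> ->; case: (eqVneq f r) => [fr|nf]; case: (eqVneq g r) => [gr|ng] //.
  by rewrite fr gr eqxx in nfg'.
have /andP[rR ar] : (r \in R) && (a \in b r) by rewrite rP.
have [g' [_ _ _ U]] := two_faces S0 fF af; case: (U r (subsetP RF _ rR) ar) => rE; first by rewrite rE eqxx in nf.
by case: (U g gF ag) => gE; [rewrite gE eqxx in nfg'|rewrite gE -rE eqxx in ng].
Qed.

End Eulerian.

Lemma qe_class_mono n m T f : n <= m -> qe_class n T f -> qe_class m T f.
Proof.
elim: n m T f => [|n IH] [|m] T f //= le [E [f0 [red [p [iE [h1 h2 h3 h4 h5]]]]]].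
exists E, f0, red, p, iE; split=> // g gE P g' pg; have := h4 g gE P g' pg; case: ifP => // _.
exact: IH.
Qed.

(** Meant for the nested classes [qe_class]: one index serves all blue blocks at once. *)
Lemma uniform_bound (I : finType) (Q : I -> nat -> Prop) :
  (forall i n m, n <= m -> Q i n -> Q i m) -> (forall i, exists n, Q i n) -> exists n, forall i, Q i n.
Proof.
move=> mono ex; have [n h] : exists n, forall i, i \in enum I -> Q i n.
  elim: (enum I) => [|i s [n h]]; first by exists 0.
  have [m hm] := ex i; exists (n + m)%N => j; rewrite inE => /predU1P[->|js].
    by apply: mono hm; apply: leq_addl.
  by apply: mono (h j js); apply: leq_addr.
by exists n => i; apply: h; rewrite mem_enum.
Qed.

Section Minimal.
Variables (V E : finType) (t : E -> {set V}) (Phi : finType) (b : Phi -> {set E}) (F : {set Phi}).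
Local Notation bdry := (bdry b).
Hypothesis S0 : surf t b F.

Lemma card_singles : #|[set [set f] | f in F]| = #|F|.
Proof. by rewrite card_in_imset // => f g _ _ /set1_inj. Qed.

Lemma merge_card (P Q : {set {set Phi}}) : partition P F -> Q \subset P -> Q != set0 -> 1 < #|Q| ->
  #|cover Q |: (P :\: Q)| = (#|P :\: Q|).+1.
Proof.
move=> pP QP Q0 Q1; rewrite cardsU1 (_ : cover Q \notin P :\: Q) //; apply/negP; rewrite in_setD => /andP[cQ cP].
have /and3P[_ tP n0] := pP; have /set0Pn[B BQ] := Q0; have BP := subsetP QP _ BQ.
have /set0Pn[f fB] : B != set0 by apply: contraNneq n0 => <-.
have fc : f \in cover Q by apply/bigcupP; exists B.
by case/negP: cQ; rewrite -(def_pblock tP cP fc) (def_pblock tP BP fB).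
Qed.

(** In a partition with fewest blocks, no side of a 3-cut of the quotient that leaves out [[set f]]
    can be merged further. At least four blocks are kept to stay clear of the degenerate quotient;
    parity ensures that merging respects this bound. *)
Lemma minimal_partition (f : Phi) : f \in F -> 4 <= #|F| ->
  exists P : {set {set Phi}}, [/\ partition P F, [set f] \in P, forall B, B \in P -> #|bdry B| = 3, 4 <= #|P| & irreducible bdry P].
Proof.
move=> fF F4; pose valid (P : {set {set Phi}}) := [&& partition P F, [set f] \in P, [forall B in P, #|bdry B| == 3] & 4 <= #|P|].
have v0 : valid [set [set g] | g in F].
  have [p1 d1] := disc_partition1 S0; rewrite /valid p1 card_singles F4 andbT imset_f //=.
  by apply/forall_inP=> B /d1[/eqP].
case: (arg_minnP (fun P : {set {set Phi}} => #|P|) v0) => P /and4P[pP fP /forall_inP c3' P4] minP.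
have c3 B : B \in P -> #|bdry B| = 3 by move/c3'/eqP.
exists P; split=> //; have SQ := quot_surf S0 pP c3.
have main (Q : {set {set Phi}}) : Q \subset P -> #|Complex.bdry bdry Q| = 3 -> [set f] \notin Q -> 1 < #|Q| -> 1 < #|P :\: Q| -> False.
  move=> QP cQ fQ Q1 D1; have Q0 : Q != set0 by rewrite -card_gt0; apply: ltnW.
  have oQ : odd #|Q| by rewrite -(odd_cut SQ QP) cQ.
  have eP := even_faces SQ; have cP := cardsDF QP.
  have oD : odd #|P :\: Q| by move: eP; rewrite cP oddD oQ; case: (odd _).
  have D3 : 3 <= #|P :\: Q| by move: oD D1; case: #|_| => [|[|[|]]].
  have vm : valid (cover Q |: (P :\: Q)).
    rewrite /valid merge_partition // merge_card // ltnS D3 andbT in_setU1 in_setD fQ fP orbT /=.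
    apply/forall_inP=> B; rewrite in_setU1 in_setD => /predU1P[->|/andP[_ /c3->]//].
    by rewrite -(quot_bdry b pP QP) cQ.
  have := minP _ vm.
  rewrite merge_card // cP; move: Q1; clear; lia.
move=> Q QP cQ; have [le1|gt1] := leqP #|Q| 1; first by left.
right; rewrite leqNgt; apply/negP=> gt1'; have [fQ|fQ] := boolP ([set f] \in Q); last exact: (main Q).
apply: (main (P :\: Q)); rewrite ?subsetDl ?(bdryC SQ) ?in_setD ?fQ //.
by rewrite setDDF.
Qed.

End Minimal.

Section QuasiEulerian.
Variables (V E : finType) (lab : V -> nat) (t : E -> {set V}).
Hypothesis linj : injective lab.

(** No colouring of the quotient has [[set f]] alone monochromatic, so the quotient is Eulerian. In
    a blue block, a colouring of the piece with only the outer face monochromatic would combine with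
    one from [two_mono]; hence the induction applies to the piece. *)
Theorem exact_mono_quasi_eulerian n (Phi : finType) (b : Phi -> {set E}) (F : {set Phi}) f :
  #|F| <= n -> 4 <= #|F| -> surf t b F -> euler t b F 2 -> simple t b F -> f \in F ->
  ~ (exists c, forall g, g \in F -> mono t b c g = (g == f)) ->
  exists k, qe_class k (tri_of lab t b F) (fim lab (vt t b f)).
Proof.
elim: n Phi b F f => [|n IH] Phi b F f leF F4 S0 eu sim fF nm.
  by move: (leq_trans F4 leF).
have [P [pP fP c3 P4 irr]] := minimal_partition S0 fF F4.
have P3 : 2 < #|P| by apply: leq_trans P4.
have PF B : B \in P -> B \subset F := part_sub pP.
have dP B : B \in P -> disc t b F B by move=> BP; apply: disc_sphere => //; [apply: PF|apply: c3].
have SQ := quot_surf S0 pP c3; have euQ := quot_euler S0 pP dP eu; have simQ := quot_simple S0 sim pP.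
have fB B : B \in P -> f \in B -> B = [set f].
  have /and3P[_ tP _] := pP; move=> BP fB; by rewrite -(def_pblock tP BP fB) (def_pblock tP fP (set11 f)).
have Rcong (c d : {set V}) g : {in vt t b g, c =i d} -> (mono t b c g == (g == f)) = (mono t b d g == (g == f)).
  by move=> h; rewrite (mono_eq h).
(* A colouring of the quotient is continued into each block: by [disc_extend] where it is not
   monochromatic, by a given colouring where it is. *)
have extend_to c0 : mono t (bdry b) c0 [set f] ->
    (forall B, B \in P -> B != [set f] -> ~~ mono t (bdry b) c0 B \/
      exists c : {set V}, {in vt t (bdry b) B, c =i c0} /\ forall g, g \in B -> ~~ mono t b c g) -> False.
  move=> h0 hB; apply: nm.
  have [|c hc] := assemble_ex (c0 := c0) (R := fun c g => mono t b c g == (g == f)) S0 Rcong pP; last first.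
    by exists c => g gF; apply/eqP/hc.
  move=> B BP; have [BE|nB] := eqVneq B [set f].
    by exists c0; split=> // g; rewrite BE => /set1P->; rewrite eqxx -mono_bdry1 h0.
  have gf g : g \in B -> (g == f) = false.
    by move=> gB; apply: contraNF nB => /eqP gf; rewrite -gf in gB *; apply/eqP; rewrite gf; apply: fB; rewrite // -gf.
  case: (hB B BP nB) => [nmB|[c [h1 h2]]].
    have [c h1 h2] := disc_extend S0 (PF B BP) (c3 B BP) (dP B BP) nmB; exists c; split=> // g gB.
    by rewrite gf // (negbTE (h2 g gB)).
  by exists c; split=> // g gB; rewrite gf // (negbTE (h2 g gB)).
have nmQ : ~ (exists c, forall B, B \in P -> mono t (bdry b) c B = (B == [set f])).
  by case=> c hc; apply: (extend_to c); rewrite ?hc // => B BP nB; left; rewrite hc.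
have [R [RP fR hR]] := two_colour SQ euQ simQ P4 irr fP nmQ.
have pcS B BP := pc_surf S0 (PF B BP) (c3 B BP).
have pcE B BP := pc_euler S0 (PF B BP) (c3 B BP) (dP B BP).
have pcC B BP := pc_card S0 (PF B BP) (c3 B BP).
have pcsim B BP := pc_simple S0 sim (PF B BP) (c3 B BP).
have odd3 B : B \in P -> 1 < #|B| -> 3 <= #|B|.
  by move=> BP; have := odd_cut S0 (PF B BP); rewrite (c3 B BP); case: #|B| => [|[|[|]]].
have cov B : B \in P -> (#|B| + 3 <= #|F|)%N.
  move=> BP; rewrite (card_partition pP) (big_setD1 B BP) /= leq_add2l.
  have : \sum_(B' in P :\ B) 1 <= \sum_(B' in P :\ B) #|B'|.
    apply: leq_sum => B' /setD1P[_ BP']; rewrite card_gt0; have /and3P[_ _ n0] := pP; by apply: contraNneq n0 => <-.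
  by rewrite sum1_card => h; apply: leq_trans h; move: P4; rewrite (cardsD1 B P) BP.
have blue B : exists k, B \in P -> B \notin R -> 1 < #|B| -> qe_class k (tri_of lab t (bdry b) (pc F B)) (fim lab (vt t (bdry b) B)).
  have [/and3P[BP BR B1]|no] := boolP [&& B \in P, B \notin R & 1 < #|B|]; last first.
    by exists 0 => BP BR B1; rewrite BP BR B1 in no.
  have [||c|k hk] := IH _ (bdry b) (pc F B) (F :\: B) _ _ (pcS B BP) (pcE B BP) (pcsim B BP) (pc_out F B).
  - by rewrite pcC //; have := cov B BP; move: leF; clear; lia.
  - by rewrite pcC //; have := odd3 B BP B1; clear; lia.
  - case: c => c hc; have [c0 hc0] := two_mono SQ euQ simQ P4 irr RP fR hR BP BR.
    have nfB : B != [set f] by apply: contraNneq BR => ->.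
    apply: (extend_to c0); first by rewrite hc0 // in_set2 eqxx.
    move=> B' BP' nB'; have [BB|nBB] := eqVneq B' B; last by left; rewrite hc0 // in_set2 negb_or nB' nBB.
    right; subst B'; have mB : mono t (bdry b) c B by rewrite -(mono_bdryC S0 c (PF B BP)) hc ?eqxx ?pc_out.
    have nmg g : g \in B -> ~~ mono t b c g.
      move=> gB; rewrite -mono_bdry1 hc ?pc_in //; apply/eqP=> /setP/(_ g); by rewrite !inE eqxx gB.
    have mB0 : mono t (bdry b) c0 B by rewrite hc0 // in_set2 eqxx orbT.
    (* Both colourings are constant on the boundary of [B], so they agree there after a swap of
       colours if necessary. *)
    have cases (d : {set V}) : mono t (bdry b) d B -> (forall v, v \in vt t (bdry b) B -> v \in d) \/ (forall v, v \in vt t (bdry b) B -> v \notin d).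
      by case/orP=> [/subsetP h|dd]; [left|right=> v vB; rewrite (disjointFr dd vB)].
    have [[h|h] [h0|h0]] := (cases _ mB, cases _ mB0).
    - by exists c; split=> // v vB; rewrite h ?h0.
    - exists (~: c); split=> [v vB|g gB]; last by rewrite monoC nmg.
      by rewrite in_setC h // (negbTE (h0 v vB)).
    - exists (~: c); split=> [v vB|g gB]; last by rewrite monoC nmg.
      by rewrite in_setC (negbTE (h v vB)) h0.
    by exists c; split=> // v vB; rewrite (negbTE (h v vB)) (negbTE (h0 v vB)).
  by exists k => _ _ _; rewrite -(vt_bdryC S0 (PF B BP)).
have [|k hk] := uniform_bound _ blue.
  by move=> B n1 n2 le h h1 h2 h3; apply: qe_class_mono le (h h1 h2 h3).
exists k.+1; pose lq := fun B => fim lab (vt t (bdry b) B).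
exists (tri_of lab t (bdry b) P), (lq [set f]), (fim lq R), (block_pieces lab t b F P), id; split.
- split; first exact: (tri_plane linj SQ simQ P3 euQ).
  exact: (two_colour_eulerian linj SQ simQ RP hR).
- move=> x y z; exact: (irreducible_separating3 linj SQ simQ irr).
- split; first exact: in_fim.
  exact: (two_colour_proper linj SQ simQ P3 RP hR fR).
- move=> g gE T g' /block_piecesP[-> [B [BP B1 gB ->]]].
  have memR : (g \in fim lq R) = (B \in R).
    rewrite gB; apply/fimP/idP => [[B' BR' h]|BR]; last by exists B.
    by rewrite (tri_inj linj SQ simQ P3 BP (subsetP RP _ BR') h).
  rewrite memR gB; case: ifPn => BR; last exact: hk.
  split.
  + apply/eqP=> /(fim_inj linj)/(vt_inj SQ simQ P3 BP fP) BE; by rewrite BE cards1 in B1.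
  + apply: (tri_plane linj (pcS B BP) (pcsim B BP) _ (pcE B BP)).
    by rewrite pcC //; have := odd3 B BP B1; clear; lia.
  by rewrite -(vt_bdryC S0 (PF B BP)); apply/fimP; exists (F :\: B); rewrite ?pc_out.
split.
- exact: (paste_quot linj S0 sim pP c3 P3).
- by apply: (tri_plane linj S0 sim _ eu); apply: leq_trans F4.
rewrite /lq vt_bdry1; apply/fsetP=> x; apply/idP/imfsetP => [xf|[y yf ->//]]; by exists x.
Qed.

End QuasiEulerian.

(** * The decomposition of a triangulation of the projective plane *)

Section Counting.
Local Close Scope fset_scope.
Variables (V E : finType) (t : E -> {set V}) (Phi : finType) (b : Phi -> {set E}) (F : {set Phi}).
Local Notation Eu := (Eu b F).
Local Notation Vu := (Vu t b F).
Hypothesis S0 : surf t b F.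

Lemma incidence_count k (R : {set Phi}) (M : {set E}) : (forall e, e \in M -> #|[set g in R | e \in b g]| = k) ->
  \sum_(f in R) #|b f :&: M| = k * #|M|.
Proof.
move=> h; rewrite mulnC -sum_nat_const -(eq_bigr _ h).
transitivity (\sum_(f in R) \sum_(e in M) (e \in b f)).
  by apply: eq_bigr => f _; rewrite -sum1_card big_mkcond [RHS]big_mkcond; apply: eq_bigr => e _; rewrite in_setI; do 2!case: (_ \in _).
rewrite exchange_big; apply: eq_bigr => e _.
by rewrite -sum1_card big_mkcond [RHS]big_mkcond; apply: eq_bigr => f _; rewrite inE; do 2!case: (_ \in _).
Qed.

Lemma nonmono_count k (R : {set Phi}) c : R \subset F -> (forall e, e \in Eu -> #|[set g in R | e \in b g]| = k) ->
  2 * #|[set f in R | ~~ mono t b c f]| = k * #|Eu :&: cob t c|.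
Proof.
move=> RF h; rewrite -(@incidence_count k R); last by move=> e /setIP[/h].
rewrite mulnC -sum_nat_const big_mkcond [RHS]big_mkcond; apply: eq_bigr => f _; rewrite inE.
case fR: (f \in R) => //=; have fF := subsetP RF _ fR.
by rewrite setIA (setIidPl (b_Eu fF)) (face_cob S0) //; case: (mono _ _ _ _).
Qed.

Lemma cob_count c : #|Eu :&: cob t c| = #|[set f in F | ~~ mono t b c f]|.
Proof.
have h : 2 * #|[set f in F | ~~ mono t b c f]| = 2 * #|Eu :&: cob t c|.
  apply: nonmono_count => // e /EuP[f fF ef]; exact: (s_e2 S0 fF ef).
by move: h; lia.
Qed.

(** Each class contains every edge once. So the two classes have equally many faces and equally many
    cut edges, two for each face that is not monochromatic. *)
Lemma mono_balance (R : {set Phi}) c : R \subset F -> (forall e, e \in Eu -> #|[set g in R | e \in b g]| = 1) ->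
  #|[set f in R | mono t b c f]| = #|[set f in F :\: R | mono t b c f]|.
Proof.
move=> RF hR; have hB e : e \in Eu -> #|[set g in F :\: R | e \in b g]| = 1.
  move=> eE; have [f fF ef] := EuP _ _ _ eE; have := s_e2 S0 fF ef.
  rewrite -(cardsID R) (_ : _ :&: R = [set g in R | e \in b g]); last first.
    by apply/setP=> g; rewrite !inE; case gR: (g \in R); rewrite ?andbF //= (subsetP RF) // andbT.
  rewrite hR // (_ : _ :\: R = [set g in F :\: R | e \in b g]); last by apply/setP=> g; rewrite !inE andbA.
  by move=> [].
have n1 := nonmono_count c RF hR; have n2 := nonmono_count c (subsetDl F R) hB.
have card3 (W : {set Phi}) : W \subset F -> (forall e, e \in Eu -> #|[set g in W | e \in b g]| = 1) -> 3 * #|W| = #|Eu|.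
  move=> WF /incidence_count; rewrite mul1n => <-; rewrite mulnC -sum_nat_const; apply: eq_bigr => f fW.
  by rewrite (setIidPl (b_Eu (subsetP WF _ fW))) (s_b3 S0) // (subsetP WF).
have c1 := card3 R RF hR; have c2 := card3 _ (subsetDl F R) hB.
have split_mono (W : {set Phi}) : #|W| = #|[set f in W | mono t b c f]| + #|[set f in W | ~~ mono t b c f]|.
  rewrite -(cardsID [set f | mono t b c f]); congr (_ + _); apply: eq_card => f; rewrite !inE //.
  by rewrite andbC.
have := split_mono R; have := split_mono (F :\: R); move: n1 n2 c1 c2; clear; lia.
Qed.

Lemma complete_cob c : {in Eu &, injective t} -> (forall x y, x \in Vu -> y \in Vu -> x != y -> exists2 e, e \in Eu & t e = [set x; y]) ->
  #|Eu :&: cob t c| = #|Vu :&: c| * #|Vu :\: c|.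
Proof.
move=> tinj com; rewrite -cardsX -(card_in_imset (f := t)); last by move=> e e' /setIP[h _] /setIP[h' _]; apply: tinj.
rewrite -(card_in_imset (f := fun p : V * V => [set p.1; p.2])); last first.
  move=> [x y] [x' y']; rewrite !inE /= => /andP[/andP[_ xc] /andP[yc _]] /andP[/andP[_ xc'] /andP[yc' _]] h.
  have : x \in [set x'; y'] by rewrite -h !inE eqxx.
  have : y \in [set x'; y'] by rewrite -h !inE eqxx orbT.
  rewrite !inE => /orP[/eqP yE|/eqP->]; first by rewrite yE xc' in yc.
  by case/orP=> [/eqP->|/eqP xE] //; rewrite -xE xc in yc'.
apply: eq_card => A; apply/imsetP/imsetP => [[e /setIP[eE ec] ->]|[[x y]]].
  have /cards2P[x [y [nxy te]]] : #|t e| == 2 by rewrite (Eu_t2 S0).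
  have tV v : v \in t e -> v \in Vu.
    by have /EuP[f fF ef] := eE; move=> ve; apply: (subsetP (vt_Vu fF)); apply: (subsetP (t_vt ef)).
  have xV : x \in Vu by apply: tV; rewrite te !inE eqxx.
  have yV : y \in Vu by apply: tV; rewrite te !inE eqxx orbT.
  move: ec; rewrite inE te odd_setI big_setU1 ?big_set1 ?inE //=.
  case xc: (x \in c); case yc: (y \in c) => //= _.
    by exists (x, y); rewrite // !inE xV yV xc yc.
  by exists (y, x); rewrite // ?inE ?xV ?yV ?xc ?yc //= setUC.
rewrite !inE /= => /andP[/andP[xV xc] /andP[yc yV]] ->.
have nxy : x != y by apply: contraNneq yc => <-.
have [e eE te] := com x y xV yV nxy; exists e => //; rewrite !inE eE te odd_setI big_setU1 ?big_set1 ?inE //=.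
by rewrite xc (negbTE yc).
Qed.

(** One side of a nontrivial 3-cut of the quotient is a disc by [disc_proj]; merging that side
    lowers the number of blocks. *)
Lemma irreducible_partition n (P : {set {set Phi}}) : #|P| <= n -> euler t b F 1 -> disc_partition t b F P ->
  exists2 Q : {set {set Phi}}, disc_partition t b F Q & irreducible (bdry b) Q.
Proof.
move=> le eu; elim: n P le => [|n IH] P le [pP dP].
  by exists P => // X XP; left; apply: leq_trans (subset_leq_card XP) (leqW le).
have [/forallP h|] := boolP [forall X : {set {set Phi}}, [|| ~~ (X \subset P), #|bdry (bdry b) X| != 3, #|X| <= 1 | #|P :\: X| <= 1]].
  by exists P => // X XP c3; have := h X; rewrite XP c3 eqxx /= => /orP[] hX; [left|right].
rewrite negb_forall => /existsP[X]; rewrite !negb_or !negbK -!ltnNge => /and4P[XP /eqP c3 X1 D1].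
have merge (Y : {set {set Phi}}) : Y \subset P -> 1 < #|Y| -> #|bdry b (cover Y)| = 3 -> disc t b F (cover Y) ->
    exists2 Q : {set {set Phi}}, disc_partition t b F Q & irreducible (bdry b) Q.
  move=> YP Y1 cY dY; have Y0 : Y != set0 by rewrite -card_gt0 ltnW.
  apply: (IH (cover Y |: (P :\: Y))).
    by rewrite (merge_card pP) //; have := cardsDF YP; move: le Y1; clear; lia.
  split; first exact: merge_partition.
  by move=> B; rewrite in_setU1 in_setD => /predU1P[->|/andP[_ /dP]].
have cP : cover P = F by case/and3P: pP => /eqP.
have cc : cover (P :\: X) = F :\: cover X.
  have /and3P[_ tP _] := pP; rewrite -cP; apply/setP=> f; rewrite in_setD; apply/bigcupP/andP.
    case=> B; rewrite in_setD => /andP[nB BP] fB; split; last by apply/bigcupP; exists B.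
    apply/bigcupP=> -[B' BX fB']; case/negP: nB.
    by rewrite -(def_pblock tP BP fB) (def_pblock tP (subsetP XP _ BX) fB').
  by case=> nX /bigcupP[B BP fB]; exists B => //; rewrite in_setD BP andbT; apply: contra nX => BX; apply/bigcupP; exists B.
have cXF : cover X \subset F by rewrite -cP; apply/bigcupsP=> B BX; apply: bigcup_sup; apply: (subsetP XP).
have c3X : #|bdry b (cover X)| = 3 by rewrite -(quot_bdry b pP XP).
case: (disc_proj S0 cXF c3X eu) => d; first exact: (merge X).
by apply: (merge (P :\: X)); rewrite ?subsetDl // cc ?(bdryC S0).
Qed.

End Counting.

Section Complete.
Local Close Scope fset_scope.
Variables (V E : finType) (t : E -> {set V}) (Phi : finType) (b : Phi -> {set E}) (F : {set Phi}).
Local Notation Eu := (Eu b F).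
Local Notation Vu := (Vu t b F).
Hypotheses (S0 : surf t b F) (sim : simple t b F) (F10 : #|F| = 10) (V6 : #|Vu| = 6).
Hypothesis com : forall x y, x \in Vu -> y \in Vu -> x != y -> exists2 e, e \in Eu & t e = [set x; y].

Lemma complete_nonmono c : #|[set f in F | ~~ mono t b c f]| = #|Vu :&: c| * #|Vu :\: c|.
Proof. by rewrite -cob_count // complete_cob. Qed.

(** The product x (6 - x) takes only the values 0, 5, 8 and 9. *)
Lemma complete_not_colourable : ~ colourable t b F.
Proof.
case=> c h; have := complete_nonmono c; have -> : [set f in F | ~~ mono t b c f] = F.
  by apply/setP=> f; rewrite inE; apply: andb_idr; apply: h.
have := cardsID c Vu; rewrite V6 F10; move: #|_| #|_|; clear => x y xy h.
have : x <= 6 by lia.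
by move: x h xy => [|[|[|[|[|[|[|x]]]]]]] //; lia.
Qed.

(** The vertices of [f] against the other three cut nine edges, which is also the number of faces
    that are not monochromatic; the tenth is [f]. *)
Lemma complete_one_mono f : f \in F -> forall g, g \in F -> mono t b (vt t b f) g = (g == f).
Proof.
move=> fF; have mf : mono t b (vt t b f) f by rewrite /mono subxx.
have fV : vt t b f \subset Vu := vt_Vu fF; have c3 := card_vt S0 fF.
have n9 := complete_nonmono (vt t b f); have := cardsID (vt t b f) Vu; rewrite (setIidPr fV) V6 c3 => cD.
have {cD}cD : #|Vu :\: vt t b f| = 3 by move: cD; lia.
rewrite (setIidPr fV) c3 cD in n9.
have n1 : #|[set g in F | mono t b (vt t b f) g]| = 1.
  have := cardsID [set g | mono t b (vt t b f) g] F; rewrite F10.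
  rewrite (_ : F :\: _ = [set g in F | ~~ mono t b (vt t b f) g]) ?n9; last by apply/setP=> g; rewrite !inE andbC.
  rewrite (_ : F :&: _ = [set g in F | mono t b (vt t b f) g]); last by apply/setP=> g; rewrite !inE.
  by lia.
have /cards1P[f' E1] : #|[set g in F | mono t b (vt t b f) g]| == 1 by rewrite n1.
move=> g gF; have := E1 => /setP/(_ f); rewrite !inE fF mf => /esym/eqP ff.
rewrite ff -{1}ff.
by have := E1 => /setP/(_ g); rewrite !inE gF.
Qed.

End Complete.

Lemma card_fimI (T : finType) (K : choiceType) (g : T -> K) (A B : {set T}) : injective g ->
  #|` fim g A `&` fim g B| = #|A :&: B|.
Proof.
move=> gi; rewrite -(card_fim_all gi); congr #|` _|; apply/fsetP=> k; rewrite inE; apply/andP/fimP => [[]|[x]].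
  move=> /fimP[x xA ->]; rewrite (mem_fim gi) => xB; exists x => //; by rewrite in_setI xA.
by rewrite in_setI => /andP[xA xB] ->; rewrite !(mem_fim gi).
Qed.

(** * From the absence of a colouring to the decomposition *)

Section Forward.
Variables (V E : finType) (lab : V -> nat).
Hypothesis linj : injective lab.
Variables (t : E -> {set V}) (Phi : finType) (b : Phi -> {set E}) (F : {set Phi}).
Hypotheses (S0 : surf t b F) (sim : simple t b F) (F3 : 2 < #|F|).
Local Notation Eu := (Eu b F).
Local Notation G := (tri_of lab t b F).

Lemma colourable_bipartite : colourable t b F ->
  exists H, bipartite_subgraph G H /\ (3 * #|` H| = 2 * #|` edges G|)%N.
Proof.
case=> c hc; have linjE : {in Eu &, injective (fun e => fim lab (t e))}.
  by move=> e e' eE eE' /(fim_inj linj); apply: sim.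
exists (fim (fun e => fim lab (t e)) (Eu :&: cob t c)); split; last first.
  rewrite (tri_card_edges linj S0 sim) card_fim; last by move=> e e' /setIP[h _] /setIP[h' _]; apply: linjE.
  rewrite (cob_count S0) -(card_EF S0); congr (3 * _)%N; apply: eq_card => f; rewrite inE.
  by apply: andb_idr; apply: hc.
split.
  rewrite (tri_edges linj S0); apply/fsubsetP=> k /fimP[e /setIP[eE _] ->].
  by apply/fimP; exists e.
exists (fim lab c) => k /fimP[e /setIP[eE ec] ->]; rewrite (card_fimI _ _ linj).
have := subset_leq_card (subsetIl (t e) c); rewrite (Eu_t2 S0 eE); move: ec; rewrite inE.
by case: #|_| => [|[|[|]]].
Qed.

Hypotheses (eu : euler t b F 1) (nc : ~ colourable t b F).

Theorem noncolourable_decomposition : exists (T : tri) (p : pieces) (iT : nat -> nat),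
    [/\ proj_tri T, #|` verts T| = 6,
        (forall x y, x \in verts T -> y \in verts T -> x != y -> adj T x y),
        (forall g, g \in T -> forall P g', p g = Some (P, g') -> quasi_eulerian P g')
      & paste_into T p G iT].
Proof.
have [P dP irr] := irreducible_partition S0 (leqnn _) eu (disc_partition1 S0).
have [pP hP] := dP; have c3 B : B \in P -> #|bdry b B| = 3 by case/hP.
have dB B : B \in P -> disc t b F B by case/hP.
have SQ := quot_surf S0 pP c3; have euQ := quot_euler S0 pP dB eu; have simQ := quot_simple S0 sim pP.
have ncQ : ~ colourable t (bdry b) P by move/(quot_colourable S0 dP).
have P10 : #|P| = 10.
  (* Any vertex may stand for both vertices to be avoided; only the existence of a nonbounding
     3-cycle matters here. *)
  have /card_gt0P[v _] := leq_trans (isT : 0 < 4) (vertices_ge4 SQ ncQ).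
  have [C [x [y [z [e1 [e2 [e3 [T CE _ _ nb]]]]]]]] := noncolourable_nonbounding (leqnn _) SQ euQ ncQ v v.
  exact: (ten_faces SQ euQ ncQ irr T CE nb).
have V6 := six_vertices SQ euQ P10; have com := complete6 SQ euQ ncQ irr P10.
have P3 : 2 < #|P| by rewrite P10.
exists (tri_of lab t (bdry b) P), (block_pieces lab t b F P), id; split.
- exact: (tri_proj linj SQ simQ P3 euQ).
- by rewrite (tri_card_verts linj).
- rewrite tri_verts => x' y' /fimP[x xV ->] /fimP[y yV ->] n; split=> //.
  have nxy : x != y by apply: contraNneq n => ->.
  have [e eE te] := com x y xV yV nxy; rewrite (tri_edges linj SQ); apply/fimP; exists e => //.
  by rewrite te fim2.
- move=> g gE T g' /block_piecesP[-> [B [BP B1 gB ->]]].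
  have BF := part_sub pP BP; have SB := pc_surf S0 BF (c3 B BP); have simB := pc_simple S0 sim BF (c3 B BP).
  have eB := pc_euler S0 BF (c3 B BP) (dB B BP).
  have c4 : 3 < #|pc F B|.
    by rewrite (pc_card S0 BF (c3 B BP)); have := odd_cut S0 BF; rewrite (c3 B BP); move: B1; case: #|_| => [|[|[|]]] //; lia.
  have lB : g = fim lab (vt t (bdry b) (F :\: B)) by rewrite (vt_bdryC S0 BF).
  split.
  + exact: (tri_plane linj SB simB (ltnW c4) eB).
  + by rewrite lB; apply: in_fim; apply: pc_out.
  rewrite lB; apply: (exact_mono_quasi_eulerian linj (leqnn _) c4 SB eB simB (pc_out F B)).
  case=> c hc; apply: nc; pose R (c : {set V}) g := ~~ mono t b c g.
  have Rcong (d d' : {set V}) f : {in vt t b f, d =i d'} -> R d f = R d' f by move=> h; rewrite /R (mono_eq h).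
  (* Separating the three boundary vertices of [B] from the rest makes [B] the only monochromatic
     face of the quotient; there [c], up to a swap, is filled in. *)
  pose c0 := vt t (bdry b) B; have one := complete_one_mono SQ simQ P10 V6 com BP.
  have [|d hd] := assemble_ex (c0 := c0) S0 Rcong pP; last by exists d.
  move=> B' BP'; have [BB|nB] := eqVneq B' B; last first.
    have nm : ~~ mono t (bdry b) c0 B' by rewrite one.
    by have [d h1 h2] := disc_extend S0 (part_sub pP BP') (c3 _ BP') (dB _ BP') nm; exists d.
  have nmg f : f \in B -> R c f.
    move=> fB; rewrite /R -mono_bdry1 hc ?pc_in //; apply/eqP=> /setP/(_ f); by rewrite !inE eqxx fB.
  have mB : mono t (bdry b) c B by rewrite -(mono_bdryC S0 c BF) hc ?eqxx ?pc_out.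
  rewrite BB; case/orP: mB => [/subsetP h|dd].
    by exists c; split=> // v vB; rewrite h.
  exists (~: c); split=> [v vB|f fB]; last by rewrite /R monoC; apply: nmg.
  by rewrite in_setC (disjointFr dd vB) vB.
exact: (paste_quot linj S0 sim pP c3 P3).
Qed.

End Forward.

(** * Monochromatic faces of pasted triangulations *)

Definition fmono (A f : {fset nat}) := all (mem A) f || all (predC (mem A)) f.

(** The restriction to [W] keeps the preimage finite, as [i] is a map on all labels. *)
Definition fpreim (i : nat -> nat) (W A : {fset nat}) := [fset v in W | i v \in A].

Lemma fmono_image i W A (f : {fset nat}) : f `<=` W -> fmono A (i @` f) = fmono (fpreim i W A) f.
Proof.
move=> /fsubsetP fW; have im v : v \in f -> i v \in i @` f by move=> vf; apply: in_imfset.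
have pre v : v \in f -> (v \in fpreim i W A) = (i v \in A) by move=> vf; rewrite !inE /= fW.
congr (_ || _); apply/allP/allP => [h v vf|h k /imfsetP[v vf ->]] /=.
- by rewrite pre //; apply: (h (i v) (im v vf)).
- by rewrite -pre //; apply: h.
- by rewrite pre //; apply: (h (i v) (im v vf)).
by rewrite -pre //; apply: h.
Qed.

Lemma face_verts (T : tri) f : f \in T -> f `<=` verts T.
Proof. by move=> fT; apply/fsubsetP=> v vf; apply/bigfcupP; exists f; rewrite ?fT. Qed.

Lemma mono_fmono (V E Phi : finType) (lab : V -> nat) (t : E -> {set V}) (b : Phi -> {set E}) (A : {fset nat}) f :
  fmono A (fim lab (vt t b f)) = mono t b [set v | lab v \in A] f.
Proof.
congr (_ || _).
  apply/allP/subsetP => [h v vf|h k /fimP[v vf ->]]; first by rewrite inE; apply: h; apply: in_fim.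
  by have := h v vf; rewrite inE.
apply/allP/pred0P => [h v /=|h k /fimP[v vf ->]].
  by case vf: (v \in vt t b f) => //=; rewrite inE; apply/negbTE; apply: (h (lab v)); apply: in_fim.
by have /= := h v; rewrite vf inE /= => /negbT.
Qed.

Section OneSurface.
Variable G : tri.
Hypothesis HG : closed_surface G.
Let V : finType := fset_sub_type (verts G).
Let lab : V -> nat := fun v => val v.
Let linj : injective lab := @lab_inj G.
Local Notation b := (@pairs_in V).
Local Notation F := (faces_of G).
Let S0 : surf id b F := complex_surf HG.
Let sim : simple id b F := @complex_simple G.

(** [H] lies in the cut given by [A], which has as many edges as there are faces that are not
    monochromatic; the size of [H] makes this number all of the faces. *)
Lemma bipartite_nonmono H : bipartite_subgraph G H -> (3 * #|` H| = 2 * #|` edges G|)%N ->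
  exists A, forall f, f \in G -> ~~ fmono A f.
Proof.
case=> HE [A hA] cH; exists A => f fG; have GE := complex_tri HG.
pose c := [set v : V | lab v \in A]; have [_ cE _] := complex_counts HG.
have sub : H `<=` fim (fun e : {set V} => fim lab e) (Eu b F :&: cob id c).
  apply/fsubsetP=> k kH; have := fsubsetP HE k kH; rewrite -{1}GE (tri_edges linj S0) => /fimP[e eE kE].
  apply/fimP; exists e => //; rewrite in_setI eE inE; have := hA k kH; rewrite kE.
  suff -> : fim lab e `&` A = fim lab (e :&: c) by rewrite (card_fim_all linj) => ->.
  apply/fsetP=> n; rewrite inE; apply/andP/fimP => [[/fimP[v ve ->] nA]|[v /setIP[ve]]].
    by exists v; rewrite // !inE ve.
  by rewrite inE => vA ->; rewrite in_fim.
have le : #|` H| <= #|[set f in F | ~~ mono id b c f]|.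
  by rewrite -(cob_count S0) -(card_fim_all (fim_inj linj)); apply: fsubset_leq_card.
have all_nm : [set f in F | ~~ mono id b c f] = F.
  apply/eqP; rewrite eqEcard; apply/andP; split; first by apply/subsetP=> g; rewrite inE => /andP[].
  have h1 : (3 * #|F| = 2 * #|` edges G|)%N by rewrite -cE; apply: card_EF S0.
  by rewrite -(leq_pmul2l (isT : 0 < 3)) h1 -cH leq_mul2l.
move: fG; rewrite -GE => /fimP[g gF ->]; rewrite mono_fmono -/c.
by have : g \in [set f in F | ~~ mono id b c f]; [rewrite all_nm|rewrite inE => /andP[]].
Qed.

Lemma red_blue_mono (red : {fset {fset nat}}) f0 A : proper_face_colouring G red f0 -> fmono A f0 ->
  exists2 g, g \in G & (g \notin red) && fmono A g.
Proof.
case=> redG f0r hr mf0; have GE := complex_tri HG; pose c := [set v : V | lab v \in A].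
have Gface f : f \in F -> fim lab (vt id b f) \in G by move=> fF; have := in_fim (fun f => fim lab (vt id b f)) fF; rewrite -[fim _ F]/(tri_of lab id b F) GE.
pose R := [set f in F | fim lab (vt id b f) \in red].
have inR h : (h \in R) = (h \in F) && (fim lab (vt id b h) \in red) by rewrite [LHS]in_set.
have RF : R \subset F by apply/subsetP=> f; rewrite inR => /andP[].
have hR e : e \in Eu b F -> #|[set g in R | e \in b g]| = 1.
  case/EuP=> f fF ef; have [g [gF ngf eg U]] := two_faces S0 fF ef.
  have F2 := complex_gt2 HG.
  (* A proper face colouring is stated for faces sharing two vertices. Faces with a common edge
     share exactly two, since three would make them equal. *)
  have : (fim lab (vt id b f) \in red) != (fim lab (vt id b g) \in red).
    apply: hr; rewrite ?Gface //.
      by apply: contra ngf => /eqP/(tri_inj linj S0 sim F2 fF gF)->.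
    rewrite (card_fimI _ _ linj); have cf := card_vt S0 fF; have cg := card_vt S0 gF.
    have e2 : 2 <= #|vt id b f :&: vt id b g|.
      rewrite -(Eu_t2 S0 (subsetP (b_Eu fF) _ ef)); apply: subset_leq_card; rewrite subsetI.
      by rewrite (t_vt (t := id) ef) (t_vt (t := id) eg).
    apply/eqP; rewrite eqn_leq e2 andbT leqNgt; apply/negP=> I3.
    have If : vt id b f :&: vt id b g = vt id b f by apply/eqP; rewrite eqEcard subsetIl cf.
    case/eqP: ngf; apply: (vt_inj S0 sim F2 gF fF); apply/esym/eqP; by rewrite eqEcard cf cg leqnn andbT -If subsetIr.
  move=> hfg; apply/eqP/cards1P; exists (if f \in R then f else g); apply/setP=> h; rewrite in_set1 [LHS]in_set !inR fF /=.
  have [->|nhf] := eqVneq h f.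
    by rewrite fF ef andbT; case: ifP => //; rewrite ?eqxx // => _; rewrite eq_sym (negbTE ngf).
  have [->|nhg] := eqVneq h g.
    rewrite gF eg andbT /=; move: hfg; do 2!case: (_ \in red) => //=; by rewrite ?eqxx // (negbTE ngf).
  apply/andP/idP => [[/andP[hF _] eh]|].
    by case: (U h hF eh) => hE; rewrite hE eqxx in nhf nhg.
  by case: ifP => _; rewrite ?(negbTE nhf) ?(negbTE nhg).
have := mono_balance S0 c RF hR; have [f fF fE] : exists2 f, f \in F & f0 = fim lab (vt id b f).
  by have := fsubsetP redG f0 f0r; rewrite -{1}GE => /fimP.
have : 0 < #|[set f in R | mono id b c f]|.
  by apply/card_gt0P; exists f; rewrite [_ \in _]in_set inR; move: mf0 f0r; rewrite fE mono_fmono fF => -> ->.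
move=> + eq; rewrite eq => /card_gt0P[g]; rewrite [_ \in _]in_set in_setD -andbA => /and3P[ngR gF mg].
exists (fim lab (vt id b g)); first exact: Gface.
rewrite mono_fmono mg andbT; apply: contra ngR => gr; by rewrite inR gF.
Qed.
End OneSurface.

Lemma qe_class_plane n T f : qe_class n T f -> plane_tri T.
Proof. by case: n => //= n [E [f0 [red [p [iE [_ _ _ _ []]]]]]]. Qed.

Lemma qe_class_face n T f : qe_class n T f -> f \in T.
Proof.
case: n => //= n [E [f0 [red [p [iE [_ _ [f0E [_ f0r _]] hp [[_ [i [_ _ _ h4]]] _ ->]]]]]]].
apply/h4; left; exists f0 => //; split=> //; case pf: (p f0) => [[P g']|] //.
by have := hp f0 f0E P g' pf; rewrite f0r => -[/eqP].
Qed.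

(** The monochromatic face [f0] is red, so some blue face of [E] is monochromatic as well. It either
    survives the pasting or holds a piece that by induction has another monochromatic face. *)
Lemma qe_class_mono_face n T f A : qe_class n T f -> fmono A f ->
  exists2 h, h \in T & (h != f) && fmono A h.
Proof.
elim: n T f A => //= n IH T f A [E [f0 [red [p [iE [[[SE _] _] _ [f0E hr] hp [pst _ ->]]]]]]] mf.
have [iEinj [i [h1 h2 _ h4]]] := pst; have EV g : g \in E -> g `<=` verts E by exact: face_verts.
move: mf; rewrite (fmono_image iE A (EV f0 f0E)) => mf.
have [g gE /andP[gr mg]] := red_blue_mono SE hr mf.
rewrite -(fmono_image iE A (EV g gE)) in mg.
have nf0 : g != f0 by apply: contraNneq gr => ->; case: hr.
have [_ c3 _ _ _] := SE.
case pg: (p g) => [[P g']|].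
  have := hp g gE P g' pg; rewrite (negbTE gr) => qP.
  have [iinj gg] := h1 g gE P g' pg; have [[_ cP _ _ _] _] := qe_class_plane qP.
  have g'P := face_verts (qe_class_face qP).
  have [h hP /andP[nh mh]] := IH P g' (fpreim (i g) (verts P) A) qP (etrans (esym (fmono_image _ _ g'P)) (etrans (congr1 _ gg) mg)).
  exists (i g @` h); first by apply/h4; right; exists g, P, g', h.
  rewrite (fmono_image _ _ (face_verts hP)) mh andbT; apply: contra nh => /eqP hE.
  (* The face found in the piece is not the outer face of the whole: otherwise all its vertices
     would lie on [g'], and it would be [g']. *)
  have sub : h `<=` g'.
    apply/fsubsetP=> x xh; have : i g x \in iE @` f0 by rewrite -hE in_imfset.
    case/imfsetP=> v vf0 /= xv; apply: (h2 g gE P g' pg x v _ _ xv).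
      exact: (fsubsetP (face_verts hP)).
    exact: (fsubsetP (EV f0 f0E)).
  by rewrite eqEfcard sub (cP h hP) (cP g' (qe_class_face qP)).
exists (iE @` g); first by apply/h4; left; exists g.
rewrite mg andbT; apply: contra nf0 => /eqP E1; rewrite eqEfcard (c3 g gE) (c3 f0 f0E) leqnn andbT.
apply/fsubsetP=> x xg; have : iE x \in iE @` f0 by rewrite -E1 in_imfset.
case/imfsetP=> v vf0 /= xv; rewrite (iEinj x v _ _ xv) //.
  exact: (fsubsetP (EV g gE)).
exact: (fsubsetP (EV f0 f0E)).
Qed.

(** Some face of the complete graph is monochromatic. If a piece is pasted into it, that piece has a
    further monochromatic face, and this one is a face of [G]. *)
Lemma pasted_K6_mono (T G : tri) p iT A : proj_tri T -> #|` verts T| = 6 ->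
  (forall x y, x \in verts T -> y \in verts T -> x != y -> adj T x y) ->
  (forall g, g \in T -> forall P g', p g = Some (P, g') -> quasi_eulerian P g') ->
  paste_into T p G iT -> exists2 f, f \in G & fmono A f.
Proof.
move=> [ST euT] T6 com hp [_ [i [h1 _ _ h4]]]; have TE := complex_tri ST.
set V : finType := fset_sub_type (verts T) in TE; set lab : V -> nat := fun v => val v in TE.
have S0 := complex_surf ST; have linj : injective lab := @lab_inj T.
have [cV cE cF] := complex_counts ST; rewrite T6 in cV.
have F10 : #|faces_of T| = 10.
  have h3 : (3 * #|faces_of T| = 2 * #|` edges T|)%N by rewrite -cE; apply: card_EF S0.
  have h6 : (6 + #|faces_of T| = #|` edges T| + 1)%N by rewrite -T6 cF.
  by move: h3 h6; move: #|faces_of T| #|` edges T|; clear; lia.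
have comT (x y : V) : x \in Vu id (@pairs_in V) (faces_of T) -> y \in Vu id (@pairs_in V) (faces_of T) -> x != y ->
    exists2 e : {set V}, e \in Eu (@pairs_in V) (faces_of T) & id e = [set x; y].
  move=> _ _ nxy; have [h _] := com (lab x) (lab y) (valP x) (valP y) nxy.
  move: h; rewrite -{1}TE (tri_edges linj S0) => /fimP[e eE]; rewrite -(fim2 lab) => /(fim_inj linj) ee.
  by exists e.
pose A' := fpreim iT (verts T) A.
have [/existsP[f /andP[fF mf]]|/existsPn no] := boolP [exists f in faces_of T, mono id (@pairs_in V) [set v | lab v \in A'] f]; last first.
  case: (complete_not_colourable S0 (@complex_simple T) F10 cV comT).
  by exists [set v | lab v \in A'] => f fF; have := no f; rewrite fF.
rewrite -mono_fmono in mf; set g := fim lab _ in mf.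
have gT : g \in T by have := in_fim (fun f => fim lab (vt id (@pairs_in V) f)) fF; rewrite -[fim _ (faces_of T)]/(tri_of lab id (@pairs_in V) (faces_of T)) TE.
rewrite -(fmono_image iT A (face_verts gT)) in mf.
case pg: (p g) => [[P g']|]; last by exists (iT @` g) => //; apply/h4; left; exists g.
have [_ _ [n qP]] := hp g gT P g' pg; have [iinj gg] := h1 g gT P g' pg.
rewrite -gg (fmono_image _ _ (face_verts (qe_class_face qP))) in mf.
have [h hP /andP[nh mh]] := qe_class_mono_face qP mf.
exists (i g @` h); last by rewrite (fmono_image _ _ (face_verts hP)).
by apply/h4; right; exists g, P, g', h.
Qed.

Theorem theorem1p7 (G : tri) (HG : proj_tri G) :
  ~ (exists H, bipartite_subgraph G H /\ (3 * #|` H| = 2 * #|` edges G|)%N)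
  <->
  exists (T : tri) (p : pieces) (iT : nat -> nat),
    [/\ proj_tri T, #|` verts T| = 6,
        (forall x y, x \in verts T -> y \in verts T -> x != y -> adj T x y),
        (forall g, g \in T -> forall P g', p g = Some (P, g') -> quasi_eulerian P g')
      & paste_into T p G iT].
Proof.
have [SG euG] := HG; split; last first.
  case=> T [p [iT [hT T6 com hp pst]]] [H [bH cH]].
  have [A hA] := bipartite_nonmono SG bH cH; have [f fG mf] := pasted_K6_mono A hT T6 com hp pst.
  by have := hA f fG; rewrite mf.
move=> nH; have GE := complex_tri SG; have S0 := complex_surf SG.
have [cV cE cF] := complex_counts SG.
have linj := @lab_inj G; have sim := @complex_simple G; have F2 := complex_gt2 SG.
have := noncolourable_decomposition linj S0 sim F2; rewrite GE; apply.
  by rewrite /euler cV cE cF.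
by move/(colourable_bipartite linj S0 sim); rewrite GE.
Qed.
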